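(* Assume that $\Gamma_\mu$ is proximal and strongly irreducible, that $\mu$ admits a finite exponential moment, and that the first Lyapunov exponent $\lambda_\mu$ is zero. Then, for any continuous compactly supported function $h$ on $\mathbb P(\mathbb V)\times\mathbb R$, the following limits exist: $$\lim_{t\to\infty}\frac1t\int_{\mathbb P(\mathbb V)\times\mathbb R}h(x',t'-t)\,\rho(dx',dt')=\int_{\mathbb P(\mathbb V)\times\mathbb R}h(x',t')\,\nu(dx')\,dt',$$ $$\lim_{t\to\infty}\frac1t\int_{\mathbb P(\mathbb V)\times\mathbb R}h(x',t'-t)\,\check\rho(dx',dt')=\int_{\mathbb P(\mathbb V)\times\mathbb R}h(x',t')\,\nu(dx')\,dt'.$$ As a consequence, the marginal densities $W(t)=\frac{\rho(\mathbb P(\mathbb V),dt)}{dt}$ and $\check W(t)=\frac{\check\rho(\mathbb P(\mathbb V),dt)}{dt}$ satisfy $$\lim_{t\to\infty}\frac{W(t)}t=\lim_{t\to\infty}\frac{\check W(t)}t=1.$$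
   Context: $\mathbb V$ is a finite-dimensional real vector space with a Euclidean norm $\|\cdot\|$, $\mathbb G=\mathrm{GL}(\mathbb V)$ acts on the projective space $\mathbb P(\mathbb V)$ by $g(\mathbb Rv)=\mathbb R(gv)$, and $\|g\|$ denotes the operator norm. $\mu$ is a Borel probability measure on $\mathbb G$, and $\Gamma_\mu$ is the closed subsemigroup of $\mathbb G$ spanned by the support of $\mu$. $\Gamma_\mu$ is proximal if it contains an element $g$ whose characteristic polynomial has a unique root of maximal modulus, this root being simple. $\Gamma_\mu$ is strongly irreducible if no finite union of proper non-zero subspaces of $\mathbb V$ is $\Gamma_\mu$-invariant. $\mu$ admits a finite exponential moment if $\int_{\mathbb G}\max\{\|g\|,\|g^{-1}\|\}^\alpha\mu(dg)<\infty$ for some constant $\alpha>0$. $\nu$ denotes the unique $\mu$-stationary Borel probability measure on $\mathbb P(\mathbb V)$. For $g\in\mathbb G$ and $x=\mathbb Rv\in\mathbb P(\mathbb V)$, $\sigma(g,x)=\log\frac{\|gv\|}{\|v\|}$. $g_1,g_2,\dots$ are i.i.d. random elements of $\mathbb G$ with law $\mu$. The first Lyapunov exponent $\lambda_\mu$ is the real number such that for every $x\in\mathbb P(\mathbb V)$, almost surely, $\frac1n\sigma(g_n\cdots g_1,x)\to\lambda_\mu$. For $x\in\mathbb P(\mathbb V)$ and $t\in\mathbb R$: $\tau_{x,t}=\min\{k\ge1:\ t+\sigma(g_k\cdots g_1,x)<0\}$ and $\check\tau_{x,t}=\min\{k\ge1:\ t-\sigma(g_k\cdots g_1,x)<0\}$,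 with $\min\emptyset=\infty$. $\mathbb E(X;B)=\mathbb E(X\mathbf 1_B)$. Definition of $\rho,\check\rho$ (target harmonic measures): they are the Radon measures on $\mathbb P(\mathbb V)\times\mathbb R$ characterized by the following: for every continuous compactly supported $h$ on $\mathbb P(\mathbb V)\times\mathbb R$ and every $x\in\mathbb P(\mathbb V)$ (uniformly in $x$), $\int h\,d\rho=\lim_{n\to\infty}\int_0^\infty t\,\mathbb E\big(h(g_n\cdots g_1x,t+\sigma(g_n\cdots g_1,x));\tau_{x,t}>n-1\big)dt$ and $\int h\,d\check\rho=\lim_{n\to\infty}\int_0^\infty t\,\mathbb E\big(h(g_n\cdots g_1x,t-\sigma(g_n\cdots g_1,x));\check\tau_{x,t}>n-1\big)dt$. The existence of these limits and measures under the stated hypotheses is taken as given. The marginals of $\rho$ and $\check\rho$ on $\mathbb R$ are absolutely continuous with respect to Lebesgue measure with non-decreasing densities (also taken as given); $W$ and $\check W$ denote these non-decreasing densities. *)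

(* Defs.v *)
From HB Require Import structures.
From mathcomp Require Import all_boot all_order all_algebra.
From mathcomp Require Import all_classical all_reals all_analysis.
From mathcomp Require Import finmap complex.
Set Implicit Arguments.
Unset Strict Implicit.
Unset Printing Implicit Defensive.

Import Order.TTheory GRing.Theory Num.Theory.
Import numFieldNormedType.Exports.

Local Open Scope classical_set_scope.
Local Open Scope ring_scope.
Local Open Scope quotient_scope.
Local Open Scope complex_scope.

(* V is modelled by the column vectors 'cV[R]_d.+1, whose dimension d.+1 is an
   arbitrary positive integer (P(V) is empty in dimension 0), with an arbitrary
   inner product dot : {dot 'cV[R]_d.+1 for idfun}. *)

Section GeneralLinearGroup.
Context {R : realType} {d : nat}.

(* As a set_type, it carries the topology induced by 'M[R]_d.+1. *)
Definition GL : Type := set_type [set A : 'M[R]_d.+1 | A \in unitmx].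

HB.instance Definition _ := Topological.on GL.

Lemma GL_unit (g : GL) : val g \in unitmx.
Proof. by case: g => A /= /set_mem. Qed.

Definition toGL (A : 'M[R]_d.+1) (uA : A \in unitmx) : GL :=
  exist _ A (mem_set uA).

Definition GL_one : GL := toGL (unitmx1 R d.+1).

Lemma GL_mul_subproof (g h : GL) : val g *m val h \in unitmx.
Proof. by rewrite unitmx_mul !GL_unit. Qed.

Definition GL_mul (g h : GL) : GL := toGL (GL_mul_subproof g h).

Lemma GL_inv_subproof (g : GL) : invmx (val g) \in unitmx.
Proof. by rewrite unitmx_inv GL_unit. Qed.

Definition GL_inv (g : GL) : GL := toGL (GL_inv_subproof g).

Lemma GL_mulA : associative GL_mul.
Proof. by move=> f g h; apply: val_inj; rewrite /= mulmxA. Qed.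

Lemma GL_mul1 : left_id GL_one GL_mul.
Proof. by move=> g; apply: val_inj; rewrite /= mul1mx. Qed.

Lemma GL_mulV : left_inverse GL_one GL_inv GL_mul.
Proof. by move=> g; apply: val_inj; rewrite /= mulVmx// GL_unit. Qed.

Lemma GL_mulr1 : right_id GL_one GL_mul.
Proof. by move=> g; apply: val_inj; rewrite /= mulmx1. Qed.

Lemma GL_mulrV : right_inverse GL_one GL_inv GL_mul.
Proof. by move=> g; apply: val_inj; rewrite /= mulmxV// GL_unit. Qed.

HB.instance Definition _ := isGroup.Build GL GL_mulA GL_mul1 GL_mulr1
  GL_mulV GL_mulrV.
HB.instance Definition _ := isPointed.Build GL GL_one.
HB.instance Definition _ :=
  Measurable.copy GL (g_sigma_algebraType (@open GL)).

End GeneralLinearGroup.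
Arguments GL : clear implicits.

Section ProjectiveSpace.
Context {R : realType} {d : nat}.

Definition nzvec : Type := set_type [set v : 'cV[R]_d.+1 | v != 0].

HB.instance Definition _ := Topological.on nzvec.

Lemma nzvec_neq0 (v : nzvec) : val v != 0.
Proof. by case: v => v /= /set_mem. Qed.

Definition tonzvec (v : 'cV[R]_d.+1) (v0 : v != 0) : nzvec :=
  exist _ v (mem_set v0).

Definition colinear (u v : nzvec) : bool :=
  `[< exists2 c : R, c != 0 & val u = c *: val v >].

Lemma colinear_refl : reflexive colinear.
Proof. by move=> u; apply/asboolP; exists 1; rewrite ?oner_neq0// scale1r. Qed.

Lemma colinear_sym : symmetric colinear.
Proof.
have H u v : colinear u v -> colinear v u.
  move=> /asboolP[c c0 uv]; apply/asboolP; exists c^-1; first by rewrite invr_eq0.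
  by rewrite uv scalerA mulVf// scale1r.
by move=> u v; apply/idP/idP; exact: H.
Qed.

Lemma colinear_trans : transitive colinear.
Proof.
move=> v u w /asboolP[a a0 uv] /asboolP[b b0 vw]; apply/asboolP.
by exists (a * b); rewrite ?mulf_neq0// uv vw scalerA.
Qed.

Canonical colinear_equiv :=
  EquivRel colinear colinear_refl colinear_sym colinear_trans.

Definition PV : Type := quotient_topology {eq_quot colinear_equiv}.

HB.instance Definition _ := Topological.on PV.
HB.instance Definition _ := Quotient.on PV.

Lemma const_mx1_neq0 : const_mx 1 != 0 :> 'cV[R]_d.+1.
Proof.
by apply/eqP => /matrixP/(_ ord0 ord0)/eqP; rewrite !mxE oner_eq0.
Qed.

HB.instance Definition _ := isPointed.Build PV (\pi_PV (tonzvec const_mx1_neq0)).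
HB.instance Definition _ :=
  Measurable.copy PV (g_sigma_algebraType (@open PV)).

Lemma GL_act_subproof (g : GL R d) (v : nzvec) : val g *m val v != 0.
Proof.
apply: contra (nzvec_neq0 v) => /eqP gv0.
by rewrite -(mul1mx (val v)) -(mulVmx (GL_unit g)) -mulmxA gv0 mulmx0.
Qed.

Definition GL_act (g : GL R d) (x : PV) : PV :=
  \pi_PV (tonzvec (GL_act_subproof g (repr x))).

Lemma GL_act_pi g (v : nzvec) :
  GL_act g (\pi_PV v) = \pi_PV (tonzvec (GL_act_subproof g v)).
Proof.
apply/eqmodP/asboolP => /=.
have /eqmodP/asboolP[c c0 vE] : \pi_PV (repr (\pi_PV v)) = \pi_PV v.
  by rewrite reprK.
by exists c => //; rewrite vE scalemxAr.
Qed.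

End ProjectiveSpace.
Arguments PV : clear implicits.


Section Cocycle.
Context {R : realType} {d : nat} (dot : {dot 'cV[R]_d.+1 for idfun}).

Definition enorm (v : 'cV[R]_d.+1) : R := Num.sqrt (dot v v).

Definition opnorm (A : 'M[R]_d.+1) : R :=
  sup [set enorm (A *m v) | v in [set v | enorm v <= 1]].

Definition sigma (g : GL R d) (x : PV R d) : R :=
  let v := val (repr x) in ln (enorm (val g *m v) / enorm v).

Lemma enormZ (c : R) (v : 'cV[R]_d.+1) : enorm (c *: v) = `|c| * enorm v.
Proof.
rewrite /enorm linearZl_LR linearZr_LR /= mulrA -expr2.
by rewrite sqrtrM ?sqr_ge0// sqrtr_sqr.
Qed.

Lemma sigma_pi g (v : nzvec) :
  sigma g (\pi_(PV R d) v) = ln (enorm (val g *m val v) / enorm (val v)).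
Proof.
have /eqmodP/asboolP[c c0] : \pi_(PV R d) (repr (\pi_(PV R d) v)) = \pi_(PV R d) v.
  by rewrite reprK.
rewrite /sigma => ->; rewrite -scalemxAr !enormZ invfM mulrACA.
by rewrite mulfV ?mul1r// normr_eq0.
Qed.

End Cocycle.

Section Semigroup.
Context {R : realType} {d : nat}.

Definition supp (mu : probability (GL R d) R) : set (GL R d) :=
  [set g | forall U, open U -> U g -> (0 < mu U)%E].

Definition Gamma (mu : probability (GL R d) R) : set (GL R d) :=
  smallest [set S : set (GL R d) |
    closed S /\ forall g h, S g -> S h -> S (g * h)%g] (supp mu).

(* Moduli of complex numbers are compared in R[i], where `|z| is real. *)
Definition proximal (S : set (GL R d)) : Prop :=
  exists2 g, S g &
    let p : {poly R[i]} := map_poly (real_complex R) (char_poly (val g)) in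
    exists z : R[i], [/\ root p z, mup z p = 1%N &
      forall w, root p w -> w != z -> `|w| < `|z|].

(* The finite unions range over nonempty families: the empty union is set0,
   which is always invariant. *)
Definition strongly_irreducible (S : set (GL R d)) : Prop :=
  forall Us : seq {vspace 'cV[R]_d.+1}, Us != [::] ->
    (forall U, U \in Us -> U != 0%VS /\ U != fullv) ->
    ~ (forall g v, S g -> (exists2 U, U \in Us & v \in U) ->
         exists2 U, U \in Us & val g *m v \in U).

Definition finite_exponential_moment (dot : {dot 'cV[R]_d.+1 for idfun})
    (mu : probability (GL R d) R) : Prop :=
  exists2 a : R, 0 < a &
    (\int[mu]_g ((Num.max (opnorm dot (val g)) (opnorm dot (val g^-1%g)))
                   `^ a)%:E < +oo)%E.

Definition stationary (mu : probability (GL R d) R)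
    (nu : probability (PV R d) R) : Prop :=
  forall B, measurable B -> nu B = (\int[mu]_g nu (GL_act g @^-1` B))%E.

Definition unique_stationary (mu : probability (GL R d) R)
    (nu : probability (PV R d) R) : Prop :=
  stationary mu nu /\
  forall nu' : probability (PV R d) R, stationary mu nu' ->
    forall B, measurable B -> nu' B = nu B.

End Semigroup.

Section RandomWalk.
Context {R : realType} {d : nat} {disp : measure_display}
  {Omega : measurableType disp} (P : probability Omega R)
  (g : nat -> {mfun Omega >-> GL R d}).

(* g k stands for g_{k+1}, so that g_n ... g_1 is gprod n. *)
Definition iid (mu : probability (GL R d) R) : Prop :=
  (forall k B, measurable B -> P (g k @^-1` B) = mu B) /\
  (forall (I : {fset nat}) (B : nat -> set (GL R d)),
     (forall k, measurable (B k)) ->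
     P (\bigcap_(k in [set` I]) g k @^-1` B k) =
     (\prod_(k <- I) P (g k @^-1` B k))%E).

Fixpoint gprod (n : nat) (w : Omega) : GL R d :=
  if n is k.+1 then (g k w * gprod k w)%g else 1%g.

Definition lyapunov_exponent (dot : {dot 'cV[R]_d.+1 for idfun}) (lam : R) :
    Prop :=
  forall x, {ae P, forall w,
    (n%:R^-1 * sigma dot (gprod n w) x) @[n --> \oo] --> lam}.

Definition expectation_on (X : Omega -> R) (B : set Omega) : R :=
  fine 'E_P[fun w => X w * \1_B w].

(* The definitions below are used with the cocycles s = sigma and s = - sigma,
   which yield tau, rho and their checked counterparts. *)
Variable s : GL R d -> PV R d -> R.

Definition tau (x : PV R d) (t : R) (w : Omega) : \bar R :=
  ereal_inf [set k%:R%:E | k in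
    [set k : nat | (1 <= k)%N /\ t + s (gprod k w) x < 0]].

Definition compactly_supported (T : topologicalType) (h : T -> R) : Prop :=
  compact (closure [set z | h z != 0]).

(* On P(V) * R, which is locally compact and second countable, the product
   sigma-algebra is the Borel one, and the Radon measures are the Borel measures
   that are finite on compact sets. *)
Definition is_target_harmonic_measure
    (rho : {measure set (PV R d * R) -> \bar R}) : Prop :=
  (forall K, compact K -> (rho K < +oo)%E) /\
  (forall h : PV R d * R -> R, continuous h -> compactly_supported h ->
     forall eps : R, 0 < eps -> \forall n \near \oo, forall x,
       `| \int[lebesgue_measure]_(t in `[0%R, +oo[)
            (t * expectation_on
                   (fun w => h (GL_act (gprod n w) x, t + s (gprod n w) x))
                   [set w | ((n%:R - 1)%:E < tau x t w)%E])
          - \int[rho]_z h z | < eps).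

End RandomWalk.

Definition nondecreasing_marginal_density (R : realType) (d : nat)
    (rho : {measure set (PV R d * R) -> \bar R}) (W : R -> R) : Prop :=
  {homo W : t u / t <= u} /\
  forall B : set R, measurable B ->
    rho (setT `*` B) = (\int[lebesgue_measure]_(t in B) (W t)%:E)%E.

(* Main.v *)
(* Write H(x, m) for the integral of h(x, .) over [m, +oo). Integrating the
   killed walk over its starting level gives, by duality, the queue with Lindley
   recursion m |-> s + max(m, 0), so the masses defining rho are integrals of H
   along the queue. Proximality and strong irreducibility give a metric on P(V)
   contracted on average, for which sigma is Lipschitz; the zero exponent centers
   sigma. Comparing convex functions of the queue with those of the centered walk
   shows that the masses of h shifted by T are T * int H(x, -C) dnu + O(sqrt T),
   uniformly in n. A general h is squeezed between Lipschitz ones, and W is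
   handled by monotonicity. *)
Require Import Defs.
From HB Require Import structures.
From mathcomp Require Import all_boot all_order all_algebra.
From mathcomp Require Import finmap complex.
From mathcomp Require Import all_classical all_reals all_analysis.
From mathcomp Require Import measurable_realfun probability_measure.
From mathcomp Require Import ring lra zify.
Set Implicit Arguments.
Unset Strict Implicit.
Unset Printing Implicit Defensive.
Import Order.TTheory GRing.Theory Num.Theory.
Import numFieldNormedType.Exports.
Local Open Scope classical_set_scope.
Local Open Scope ring_scope.


(** At a fixed height, [rho] is a limit in the time [n], while the estimate is wanted at large
    heights [T]: every error must be bounded independently of [n], along some sequence of times. The
    mean over [nu] of the integrated queue changes at time [n] by minus the correlation between an
    increment and the queue started at 0, up to a multiple of the decrease of [mean_base n], the
    mean of that queue. Decorrelation turns the correlations into the same decreases, weighted by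
    logarithmic windows, so what is needed is a decay of [mean_base n]. If the variance is positive,
    a Huber function, quadratic up to a radius of order [T] and linear beyond, bounds it by a
    multiple of [T / sqrt n]; the geometric mean of this bound and of a constant produces [sqrt T].
    Contraction on average is proved without comparing Lyapunov exponents: the expected record of
    the logarithm of an angle grows sublinearly, while each block of steps puts a fixed amount
    between this record and the expected logarithm, which must therefore become negative. *)

Notation mble := (measurable_fun setT).
Notation mble2 f := (measurable_fun setT (fun z => f z.1 z.2)).
Notation mf_pair := measurable_fun_pair.
Notation mfM := measurable_funM.
Notation mfB := measurable_funB.
Notation mfD := measurable_funD.
Notation mfX := measurable_funX.
Notation mf_EFin := measurable_EFinP.
Notation mf_fst := measurable_fst.
Notation mf_snd := measurable_snd.

Lemma mf_comp {d1 d2 d3} {T1 : measurableType d1} {T2 : measurableType d2}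
    {T3 : measurableType d3} {f : T2 -> T3} {g : T1 -> T2} :
  mble f -> mble g -> mble (f \o g).
Proof. exact: measurableT_comp. Qed.

Lemma mf_app2 {d d1 d2 d'} {T : measurableType d} {T1 : measurableType d1}
    {T2 : measurableType d2} {U : measurableType d'} (F : T1 -> T2 -> U) (f : T -> T1)
    (g : T -> T2) : mble2 F -> mble f -> mble g -> mble (fun y => F (f y) (g y)).
Proof. by move=> mF mf mg; exact: (measurableT_comp mF (mf_pair mf mg)). Qed.

Lemma le_of_eq {disp} {T : porderType disp} (x y : T) : x = y -> (x <= y)%O.
Proof. by move=> ->. Qed.

Lemma norm_bounds {R : realType} (x M : R) : 0 <= x <= M -> `|x| <= M.
Proof. by case/andP => x0 xM; rewrite ger0_norm. Qed.

(** * Elementary inequalities: double sums, Huber functions, geometric blocks of times *)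

Section RealSums.
Context {R : realType}.

Lemma geometric_sum_le (r : R) n : 0 <= r -> r < 1 ->
  \sum_(k < n) r ^+ k <= (1 - r)^-1.
Proof.
move=> r0 r1; have h : 0 < 1 - r by rewrite subr_gt0.
rewrite -[leRHS]mul1r ler_pdivlMr// mulrC.
elim: n => [|n ih]; first by rewrite big_ord0 mulr0.
have e m : (1 - r) * \sum_(k < m) r ^+ k = 1 - r ^+ m.
  elim: m => [|m ihm]; first by rewrite big_ord0 mulr0 expr0 subrr.
  by rewrite big_ord_recr/= mulrDr ihm exprS; ring.
by rewrite e gerBl exprn_ge0.
Qed.

(** Unrolling the recursion writes [a i k] as [a (i + k) 0] minus the terms of [b] on an
    antidiagonal, and the square on the right contains all these antidiagonals. It serves with
    [a i k] and [b i k] the correlations of the [i]-th iterates of [base k] and [loss k]. *)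
Lemma double_sum_le (a b : nat -> nat -> R) n i :
  (forall i k, a i k.+1 = a i.+1 k - b i k) ->
  `|\sum_(k < n) a i k| <= \sum_(k < n) `|a (i + k)%N 0| +
    \sum_(j < n) \sum_(l < n) `|b (i + l)%N j|.
Proof.
move=> ab; elim: n i => [|n ih] i; first by rewrite !big_ord0 normr0 addr0.
rewrite big_ord_recl/=; under eq_bigr do rewrite /bump/= add1n ab.
rewrite sumrB; apply: le_trans (ler_normD _ _) _.
rewrite [X in _ <= X + _]big_ord_recl/= addn0 -addrA lerD2l.
apply: le_trans (ler_normB _ _) _.
apply: le_trans (lerD (ih i.+1) (ler_norm_sum _ _ _)) _.
rewrite -addrA; apply: lerD.
  by apply: ler_sum => k _; rewrite /bump/= add1n addSnnS.
apply: (@le_trans _ _ (\sum_(j < n) \sum_(l < n.+1) `|b (i + l)%N j|)).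
  rewrite -big_split/=; apply: ler_sum => j _; rewrite big_ord_recl/= addn0 addrC lerD2l.
  by apply: ler_sum => l _; rewrite /bump/= add1n addSnnS.
by rewrite [leRHS]big_ord_recr/= lerDl; apply: sumr_ge0.
Qed.

(** The first [w] terms are bounded by [e], the later ones by their geometric majorant. *)
Lemma truncated_sum_le (b : nat -> R) (M e r : R) (w n : nat) :
  0 <= r -> r < 1 -> 0 <= e -> 0 <= M ->
  (forall i, `|b i| <= M * r ^+ i) -> (forall i, `|b i| <= e) ->
  \sum_(i < n) `|b i| <= e *+ w + M * r ^+ w / (1 - r).
Proof.
move=> r0 r1 e0 M0 bM be.
apply: (@le_trans _ _ (\sum_(i < w + n) `|b i|)).
  by rewrite addnC big_split_ord/= lerDl; apply: sumr_ge0.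
rewrite big_split_ord/=; apply: lerD.
  apply: (@le_trans _ _ (\sum_(i < w) e)); first exact: ler_sum.
  by rewrite sumr_const card_ord.
apply: (@le_trans _ _ (M * r ^+ w * \sum_(i < n) r ^+ i)).
  by rewrite mulr_sumr; apply: ler_sum => i _; rewrite -mulrA -exprD.
by rewrite ler_wpM2l ?geometric_sum_le// mulr_ge0// exprn_ge0.
Qed.

Lemma ler_norm_between (x y c e : R) :
  x - c <= y -> y <= x - c + e -> `|y - x + c| <= e.
Proof. by move=> h1 h2; rewrite ger0_norm; lra. Qed.

Lemma ler_norm_telescope (x y z u v e f : R) :
  `|y - x + u| <= e -> `|z - y + v| <= f -> `|z - x + (u + v)| <= e + f.
Proof.
move=> h1 h2; rewrite (_ : _ + (_ + _) = (y - x + u) + (z - y + v)); last by ring.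
by apply: le_trans (ler_normD _ _) (lerD h1 h2).
Qed.

Lemma ler_norm_cancel (x y e f : R) :
  `|x + y| <= e -> `|y| <= f -> `|x| <= e + f.
Proof.
move=> h1 h2; rewrite -[x](addrK y).
by apply: le_trans (ler_normB _ _) (lerD h1 h2).
Qed.


(** Equal to [z ^ 2] on [[0, rho]], to 0 below, and to the tangent at [rho] above: convex,
    non-decreasing, strictly convex only on a window of length [rho] and of linear growth. *)
Definition huber (rho z : R) := Num.max z 0 ^+ 2 - Num.max (z - rho) 0 ^+ 2.

Lemma huber_ge0 rho z : 0 <= rho -> 0 <= huber rho z.
Proof.
by move=> ?; rewrite /huber; case: (leP z 0) => ?; case: (leP (z - rho) 0) => ?; nra.
Qed.

Lemma huber_mono rho z z' : 0 <= rho -> z <= z' -> huber rho z <= huber rho z'.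
Proof.
by move=> ? ?; rewrite /huber; case: (leP z 0) => ?; case: (leP (z - rho) 0) => ?;
  case: (leP z' 0) => ?; case: (leP (z' - rho) 0) => ?; nra.
Qed.

Lemma huber_le rho z : 0 <= rho -> huber rho z <= 2 * rho * Num.max z 0.
Proof.
by move=> ?; rewrite /huber; case: (leP z 0) => ?; case: (leP (z - rho) 0) => ?; nra.
Qed.

(** The arithmetic-geometric inequality [2 z <= lam z ^ 2 + 1 / lam]; the free parameter is adapted
    to the number of steps in [iter_huber_le]. *)
Lemma huber_le_quad rho z lam : 0 <= rho -> 0 < lam ->
  huber rho z <= rho * (lam * z ^+ 2 + lam^-1).
Proof.
move=> r0 l0; apply: le_trans (huber_le z r0) _.
rewrite (mulrC 2) -mulrA ler_wpM2l//.
have li : 0 < lam^-1 by rewrite invr_gt0.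
have e : lam * lam^-1 = 1 by rewrite mulfV// gt_eqF.
have e2 : lam * z ^+ 2 + lam^-1 - 2 * z = lam * (z - lam^-1) ^+ 2.
  by field; rewrite gt_eqF.
have : 0 <= lam * (z - lam^-1) ^+ 2 by rewrite mulr_ge0 ?sqr_ge0// ltW.
rewrite -e2; case: (leP z 0) => ? ?; last by lra.
by rewrite mulr0 addr_ge0// ?(ltW li)// mulr_ge0 ?sqr_ge0// ltW.
Qed.

Lemma huber_line rho w z : 0 <= w -> w <= rho ->
  w ^+ 2 + 2 * w * (z - w) <= huber rho z.
Proof.
move=> w0 wr; rewrite /huber; case: (leP z 0) => z0; case: (leP (z - rho) 0) => zr.
- have := mulr_ge0 w0 w0; have : 0 <= w * - z by rewrite mulr_ge0// oppr_ge0.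
  by nra.
- by lra.
- by have := sqr_ge0 (z - w); nra.
- have : 0 <= (rho - w) * (z - rho) by rewrite mulr_ge0 ?subr_ge0// ltW//; lra.
  have : 0 <= (rho - w) * (z - w) by rewrite mulr_ge0 ?subr_ge0//; lra.
  by nra.
Qed.

Lemma huber_tangent rho z0 : 0 <= rho -> exists p, forall z,
  huber rho z0 + p * (z - z0) <= huber rho z.
Proof.
(* The slope is that of [z ^ 2] at the point [z0] clamped to [[0, rho]]. *)
move=> r0; pose w := Num.min (Num.max z0 0) rho.
have w0 : 0 <= w by rewrite /w le_min r0 le_max lexx orbT.
have wr : w <= rho by rewrite /w ge_min lexx orbT.
exists (2 * w) => z; apply: le_trans (huber_line z w0 wr).
rewrite /huber /w; case: (leP z0 0) => h1; case: (leP (z0 - rho) 0) => h2;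
  rewrite /Num.min ?[0 < rho]lt_neqAle; case: ifP => h3; try nra.
Qed.

(** Within distance [B] of [z0] the function is [z ^ 2] and exceeds its tangent by the whole square;
    farther away the quartic term exceeds the square, and convexity is enough. The lower bound is a
    polynomial in [z - z0], so its mean along a martingale involves only moments of order two and
    four. *)
Lemma huber_tangent_quad rho B z0 : 0 < B -> B <= z0 -> z0 <= rho - B -> forall z,
  huber rho z0 + 2 * z0 * (z - z0) + ((z - z0) ^+ 2 - (z - z0) ^+ 4 / B ^+ 2)
  <= huber rho z.
Proof.
move=> B0 Bz zB z.
set y := z - z0.
have B20 : 0 < B ^+ 2 by rewrite exprn_gt0.
have z00 : 0 <= z0 by lra.
have zr : z0 <= rho by lra.
have h0 : huber rho z0 = z0 ^+ 2.
  by rewrite /huber; case: (leP z0 0) => ?; case: (leP (z0 - rho) 0) => ?; nra.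
have [yB|By] := leP (y ^+ 2) (B ^+ 2).
  have yB1 : `|y| <= B.
    by rewrite -(ger0_norm (ltW B0)) -ler_sqr ?nnegrE// !real_normK// num_real.
  move: yB1; rewrite ler_norml => /andP[y1 y2].
  have q0 : 0 <= y ^+ 4 / B ^+ 2 by rewrite divr_ge0 ?exprn_even_ge0// ltW.
  have hz : huber rho z = z ^+ 2.
    by rewrite /huber; case: (leP z 0) => ?; case: (leP (z - rho) 0) => ?;
      rewrite /y in y1 y2; nra.
  rewrite h0 hz (_ : z ^+ 2 = z0 ^+ 2 + 2 * z0 * y + y ^+ 2); last by rewrite /y; ring.
  by rewrite lerD2l gerBl.
have : y ^+ 2 <= y ^+ 4 / B ^+ 2.
  rewrite ler_pdivlMr// (_ : y ^+ 4 = y ^+ 2 * y ^+ 2); last by ring.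
  by rewrite ler_wpM2l ?sqr_ge0// ltW.
move=> h; apply: le_trans (huber_line z z00 zr); rewrite h0 -/y; lra.
Qed.

Lemma pow4_add_le (y x : R) : (y + x) ^+ 4 <= 8 * (y ^+ 4 + x ^+ 4).
Proof.
have h (u v : R) : (u + v) ^+ 2 <= 2 * (u ^+ 2 + v ^+ 2) by have := sqr_ge0 (u - v); nra.
rewrite (_ : (y + x) ^+ 4 = ((y + x) ^+ 2) ^+ 2); last by ring.
apply: (@le_trans _ _ ((2 * (y ^+ 2 + x ^+ 2)) ^+ 2)).
  by rewrite ler_sqr ?nnegrE ?sqr_ge0// mulr_ge0// addr_ge0 ?sqr_ge0.
have := h (y ^+ 2) (x ^+ 2); rewrite -!exprM !exprMn; nra.
Qed.

Lemma sqr_le_1addsqr (x : R) : x <= 1 + x ^+ 2.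
Proof. by have := sqr_ge0 (x - 1); have := sqr_ge0 x; nra. Qed.

(** The algebra of one step of [walk_lower]: [y] is the deviation so far and [x1] the increment;
    [pow4_add_le] is the origin of the factor 8. *)
Lemma quartic_drift (A p e b y c c4 x4 x1 v : R) :
  0 <= e -> 0 < b -> 0 <= c4 -> x1 ^+ 4 <= x4 ->
  A + p * y + e * (y ^+ 2 - (8 * c4 * (y ^+ 4 + x4) + c) / b)
    + (p + 2 * e * y) * x1 + e * (x1 ^+ 2) + e * v <=
  A + p * (y + x1) + e * ((y + x1) ^+ 2 + v - (c4 * (y + x1) ^+ 4 + c) / b).
Proof.
move=> e0 b0 c40 hx; rewrite -subr_ge0.
have -> : A + p * (y + x1) + e * ((y + x1) ^+ 2 + v - (c4 * (y + x1) ^+ 4 + c) / b) -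
  (A + p * y + e * (y ^+ 2 - (8 * c4 * (y ^+ 4 + x4) + c) / b)
    + (p + 2 * e * y) * x1 + e * (x1 ^+ 2) + e * v) =
  e * (c4 / b) * (8 * (y ^+ 4 + x4) - (y + x1) ^+ 4) by field; rewrite gt_eqF.
rewrite !mulr_ge0 ?invr_ge0 ?(ltW b0)// subr_ge0.
by apply: le_trans (pow4_add_le _ _) _; rewrite ler_wpM2l// lerD2l.
Qed.

(** The sum of the whole series is 22, and its remainder has a closed form. *)
Lemma sum_polyexp_le L : \sum_(l < L) (l%:R + 2) ^+ 2 * 2^-1 ^+ l <= 22 :> R.
Proof.
have h n : \sum_(l < n) (l%:R + 2) ^+ 2 * 2^-1 ^+ l =
    22 - (2 * n%:R ^+ 2 + 12 * n%:R + 22) * 2^-1 ^+ n :> R.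
  elim: n => [|n ih]; first by rewrite big_ord0 expr0; ring.
  rewrite big_ord_recr/= ih (exprS 2^-1 n) -natr1; by set q := _ ^+ n; field.
rewrite h gerBl mulr_ge0 ?exprn_ge0// !addr_ge0 ?mulr_ge0// ?ler0n//.
Qed.

(** The ratio 16 is dictated by the decay of [mean_base]: a bound in the inverse square root of time
    gains a factor 4 per block, and its geometric mean with a constant gains a factor 2. *)
Definition block n0 L := (n0 * (16 ^ L - 1))%N.
(** Constant, equal to [b (l + 1)], on the [l]-th block. When the [b]-th power of a ratio is at most
    [1 / 32], its power by the window is at most [32 ^- (l + 1)], and [2 ^- l] remains after
    multiplication by the length [15 n0 16 ^ l] of the block. *)
Definition window n0 b j := (b * (trunc_log 16 (j %/ n0).+1).+1)%N.

Lemma window_block n0 b l j : (0 < n0)%N -> (block n0 l <= j < block n0 l.+1)%N ->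
  window n0 b j = (b * l.+1)%N.
Proof.
move=> n00 /andP[]; rewrite /block /window => h1 h2.
rewrite (@trunc_log_eq 16 l)//; apply/andP; split.
  have : (16 ^ l - 1 <= j %/ n0)%N by rewrite leq_divRL// mulnC.
  by lia.
have : (j %/ n0 < 16 ^ l.+1 - 1)%N by rewrite ltn_divLR// mulnC.
by lia.
Qed.

Lemma block_step n0 l : block n0 l.+1 = (block n0 l + n0 * (15 * 16 ^ l))%N.
Proof.
rewrite /block -mulnDr; congr (_ * _)%N; have := expn_gt0 16 l; rewrite expnS; lia.
Qed.

Lemma window_lt b l : (b * l.+1 < b.+1 * (l + 2))%N.
Proof. by nia. Qed.

(* Along the blocks [n0 (16 ^ l - 1), n0 (16 ^ (l + 1) - 1)) the window is
   constant, so the differences of [f] telescope, while the exponential factors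
   beat the length of the block. *)
Lemma block_sum_le (f tl : nat -> R) (n0 b : nat) (c1 K Ct M q1 q2 : R) L :
  (0 < n0)%N -> 0 <= c1 -> 0 <= K -> 0 <= Ct -> 0 <= M -> 0 <= q1 -> 0 <= q2 ->
  q1 ^+ b <= 32^-1 -> q2 ^+ b <= 32^-1 -> (forall n, tl n <= Ct * q1 ^+ n) ->
  (forall n, 0 <= f n) -> (forall l, f (block n0 l) <= c1 * 2^-1 ^+ l) ->
  \sum_(j < block n0 L)
    (((window n0 b j)%:R * (f j - f j.+1) + K * tl (window n0 b j)) *+ (window n0 b j).+1
      + M * q2 ^+ window n0 b j) <=
  (c1 + n0%:R * (K * Ct + M)) * (b.+1)%:R ^+ 2 * 22.
Proof.
move=> n00 c10 K0 Ct0 M0 q10 q20 q1b q2b tlq f0 fb.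
set A := c1 + _; have A0 : 0 <= A by rewrite !(addr_ge0, mulr_ge0).
apply: (@le_trans _ _ (\sum_(l < L) A * (b.+1)%:R ^+ 2 * ((l%:R + 2) ^+ 2 * 2^-1 ^+ l)));
  last by rewrite -mulr_sumr ler_wpM2l ?sum_polyexp_le// mulr_ge0// sqr_ge0.
elim: L => [|l ih]; first by rewrite /block expn0 subnn muln0 !big_ord0.
rewrite [leRHS]big_ord_recr/= block_step big_split_ord/=; apply: lerD => //.
set w := (b * l.+1)%N; set p := (n0 * (15 * 16 ^ l))%N.
have eqw (j : 'I_p) : window n0 b (block n0 l + j) = w.
  by apply: window_block => //; rewrite leq_addr/= block_step ltn_add2l.
have tele m : \sum_(j < m) (f (block n0 l + j)%N - f (block n0 l + j).+1) =
    f (block n0 l) - f (block n0 l + m)%N.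
  elim: m => [|m ihm]; first by rewrite big_ord0 addn0 subrr.
  by rewrite big_ord_recr/= ihm addnS; ring.
under eq_bigr => j _ do rewrite eqw mulrnDl -addrA -mulrnAl.
rewrite big_split/= -mulr_sumr tele sumr_const card_ord.
have wn : (w.+1 <= b.+1 * (l + 2))%N := window_lt b l.
have w2 : w%:R *+ w.+1 <= (b.+1)%:R ^+ 2 * (l%:R + 2) ^+ 2 :> R.
  rewrite -[w%:R *+ _]mulr_natr -exprMn -[2]/(2%:R) -natrD -!natrM -natrX ler_nat.
  by rewrite expnS expn1 leq_mul// ltnW.
have w1 : w.+1%:R <= (b.+1)%:R ^+ 2 * (l%:R + 2) ^+ 2 :> R.
  rewrite -exprMn -[2]/(2%:R) -natrD -!natrM -natrX ler_nat.
  by apply: leq_trans wn _; rewrite expnS expn1 leq_pmull// muln_gt0 addn2.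
have w0 : 1 <= (b.+1)%:R ^+ 2 * (l%:R + 2) ^+ 2 :> R.
  by apply: le_trans w1; rewrite ler1n.
set Z := (b.+1)%:R ^+ 2 * (l%:R + 2) ^+ 2 in w2 w1 w0 *.
have Z0 : 0 <= Z by apply: le_trans w0.
have h0 : 0 <= 2^-1 ^+ l :> R by rewrite exprn_ge0.
have qw (q : R) : 0 <= q -> q ^+ b <= 32^-1 -> q ^+ w * p%:R <= n0%:R * 2^-1 ^+ l.
  move=> q0 qb; have qw : q ^+ w <= 32^-1 ^+ l.+1.
    by rewrite /w exprM lerXn2r ?nnegrE// ?exprn_ge0.
  rewrite /p natrM mulrCA ler_wpM2l//.
  apply: (@le_trans _ _ (32^-1 ^+ l.+1 * (15 * 16 ^ l)%:R)); first by rewrite ler_wpM2r.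
  rewrite natrM natrX exprS (_ : 2^-1 = 32^-1 * 16 :> R); last by field.
  rewrite exprMn; have : 0 <= 32^-1 ^+ l * 16 ^+ l :> R by rewrite mulr_ge0// exprn_ge0.
  move: (32^-1 ^+ l) (16 ^+ l) => u v; lra.
have e1 : w%:R *+ w.+1 * (f (block n0 l) - f (block n0 l + p)%N) <= Z * (c1 * 2^-1 ^+ l).
  apply: (@le_trans _ _ (w%:R *+ w.+1 * (c1 * 2^-1 ^+ l))).
    by rewrite ler_wpM2l ?mulrn_wge0//; apply: le_trans (fb l); rewrite gerBl.
  by rewrite ler_wpM2r// mulr_ge0.
have e2 : (K * tl w *+ w.+1 + M * q2 ^+ w) *+ p <= Z * (n0%:R * (K * Ct + M)) * 2^-1 ^+ l.
  rewrite -[(K * tl w *+ w.+1 + _) *+ p]mulr_natr -[K * tl w *+ w.+1]mulr_natr.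
  have := qw _ q10 q1b; have := qw _ q20 q2b.
  set a1 := q1 ^+ w; set a2 := q2 ^+ w => k2 k1.
  have a10 : 0 <= a1 * p%:R by rewrite mulr_ge0// exprn_ge0.
  apply: (@le_trans _ _ (K * Ct * w.+1%:R * (a1 * p%:R) + M * (a2 * p%:R))).
    rewrite mulrDl -[M * a2 * _]mulrA lerD2r (_ : K * Ct * _ * _ = K * (Ct * a1) * w.+1%:R * p%:R);
      last by ring.
    apply: ler_wpM2r => //; apply: ler_wpM2r => //; apply: ler_wpM2l => //; exact: tlq.
  rewrite (_ : Z * _ * _ = K * Ct * Z * (n0%:R * 2^-1 ^+ l) + M * (Z * (n0%:R * 2^-1 ^+ l)));
    last by ring.
  apply: lerD.
    by apply: ler_pM => //; rewrite ?mulr_ge0// ler_wpM2l// mulr_ge0.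
  by rewrite ler_wpM2l//; apply: le_trans k2 _; rewrite ler_peMl// mulr_ge0.
rewrite (_ : A * _ * _ = Z * (c1 * 2^-1 ^+ l) + Z * (n0%:R * (K * Ct + M)) * 2^-1 ^+ l); last first.
  by rewrite /A /Z; ring.
exact: lerD.
Qed.

Lemma level_window (T C th u l B : R) : 0 <= u -> u <= T + C -> u + B <= l ->
  l <= u + (th + B) -> 0 <= B -> B <= l /\ l <= T + C + th + B *+ 2 - B.
Proof. by move=> u0 uT h1 h2 B0; split; lra. Qed.

Lemma norm_le_quad (y e : R) : 0 < e -> `|y| <= e + e^-1 * `|y| ^+ 2.
Proof.
move=> e0; rewrite -(ler_pM2l e0) mulrDr mulrA mulfV ?gt_eqF// mul1r.
by have := sqr_ge0 (`|y| - e); have := sqr_ge0 (`|y|); have := sqr_ge0 e; nra.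
Qed.

Lemma max0_step (l x A : R) : Num.max (l + x - A) 0 <= Num.max (l - A) 0 + `|x|.
Proof.
have := ler_norm x; have := normr_ge0 x.
by case: (leP (l + x - A) 0) => ?; case: (leP (l - A) 0) => ?; lra.
Qed.

Lemma common_power_small (p q : R) : 0 <= p -> p < 1 -> 0 <= q -> q < 1 ->
  exists b, p ^+ b <= 32^-1 /\ q ^+ b <= 32^-1.
Proof.
have h (x : R) : 0 <= x -> x < 1 -> \forall b \near \oo, x ^+ b <= 32^-1.
  move=> x0 x1; have x1' : `|x| < 1 by rewrite ger0_norm.
  have /cvgrPdist_le/(_ 32^-1) := cvg_expr x1'; rewrite invr_gt0 ltr0n => /(_ isT).
  by apply: filterS => b; rewrite sub0r normrN ger0_norm// exprn_ge0.
move=> p0 p1 q0 q1.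
by have [b _ hb] := filterI (h p p0 p1) (h q q0 q1); exists b; exact: (hb b (leqnn _)).
Qed.

Lemma sqrt_affine_le (al be T : R) : 0 <= al -> 0 <= be -> 0 <= T ->
  Num.sqrt (al + be * T) <= Num.sqrt (al + be) * (1 + Num.sqrt T).
Proof.
move=> a0 b0 T0; have s0 := sqrtr_ge0 T.
rewrite -[1 + _]ger0_norm ?addr_ge0// -sqrtr_sqr -sqrtrM ?addr_ge0//.
rewrite ler_wsqrtr// -{1}(sqr_sqrtr T0); set t := Num.sqrt T in s0 *.
have := mulr_ge0 a0 s0; have := mulr_ge0 b0 s0; have := mulr_ge0 a0 (sqr_ge0 t); nra.
Qed.

Lemma ler_norm_trans (x y z e f : R) : `|x - y| <= e -> `|y - z| <= f -> `|x - z| <= e + f.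
Proof.
move=> h1 h2; rewrite (_ : x - z = (x - y) + (y - z)); last by ring.
by apply: le_trans (ler_normD _ _) (lerD h1 h2).
Qed.

Lemma leq_block n0 L : (0 < n0)%N -> (L <= block n0 L)%N.
Proof.
move=> n00; apply: (@leq_trans (16 ^ L - 1)); last by rewrite leq_pmull.
by rewrite leq_subRL ?expn_gt0// add1n ltn_expl.
Qed.

Lemma sqr_pred_pow4 l : ((4 ^ l - 1) ^ 2 <= 16 ^ l - 1)%N.
Proof.
have -> : (16 = 4 ^ 2)%N by [].
have h : (0 < 4 ^ l)%N by rewrite expn_gt0.
by rewrite -expnM mulnC expnM; move: (4 ^ l)%N h => q h; rewrite !expnS !expn0; nia.
Qed.

End RealSums.

(** * Calculus of real integrals against a probability measure *)

Section ProbabilityIntegral.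
Context {d} {T : measurableType d} {R : realType} (P : probability T R).
Implicit Types f g : T -> R.

Definition L1 f := P.-integrable setT (EFin \o f).

Lemma L1_measurable f : L1 f -> mble f.
Proof. by move=> /integrableP[/mf_EFin]. Qed.

Lemma L1_le f g : mble f -> L1 g -> (forall x, `|f x| <= g x) ->
  L1 f.
Proof.
move=> mf ig fg; apply: (le_integrable _ _ _ ig) => //; first exact/mf_EFin.
by move=> x _ /=; rewrite lee_fin (le_trans (fg x))// ler_norm.
Qed.

Lemma L1_cst (c : R) : L1 (fun=> c).
Proof. exact: finite_measure_integrable_cst. Qed.

Lemma L1_bounded f (M : R) : mble f -> (forall x, `|f x| <= M) ->
  L1 f.
Proof. by move=> mf fM; apply: (L1_le mf (L1_cst M)). Qed.

Lemma L1D f g : L1 f -> L1 g -> L1 (fun x => f x + g x).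
Proof. by move=> lf lg; apply: (integrableD _ lf lg). Qed.

Lemma L1N f : L1 f -> L1 (fun x => - f x).
Proof. by move=> lf; apply: (integrableN lf). Qed.

Lemma L1B f g : L1 f -> L1 g -> L1 (fun x => f x - g x).
Proof. by move=> lf lg; apply: L1D => //; exact: L1N. Qed.

Lemma L1Z (c : R) f : L1 f -> L1 (fun x => c * f x).
Proof. by move=> lf; apply: (integrableZl _ c lf). Qed.

Lemma L1_norm f : L1 f -> L1 (fun x => `|f x|).
Proof. by move=> lf; apply: (integrable_norm lf). Qed.

Lemma L1_sum n (f : nat -> T -> R) : (forall i, (i < n)%N -> L1 (f i)) ->
  L1 (fun x => \sum_(i < n) f i x).
Proof.
elim: n => [_|n ih lf].
  by under [X in L1 X]funext do rewrite big_ord0; exact: L1_cst.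
under [X in L1 X]funext do rewrite big_ord_recr/=.
by apply: L1D; [apply: ih => i ?; apply: lf; exact: ltnW|exact: lf].
Qed.

Lemma RintD f g : L1 f -> L1 g ->
  \int[P]_x (f x + g x) = \int[P]_x f x + \int[P]_x g x.
Proof. by move=> lf lg; rewrite RintegralD. Qed.

Lemma RintB f g : L1 f -> L1 g ->
  \int[P]_x (f x - g x) = \int[P]_x f x - \int[P]_x g x.
Proof. by move=> lf lg; rewrite RintegralB. Qed.

Lemma RintZ (c : R) f : L1 f -> \int[P]_x (c * f x) = c * \int[P]_x f x.
Proof. by move=> lf; rewrite RintegralZl. Qed.

Lemma Rint_cst (c : R) : \int[P]_x c = c.
Proof.
rewrite Rintegral_cst//.
by rewrite -[RHS]mulr1; congr (_ * _); rewrite -[RHS]/(fine 1%E);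
  congr fine; exact: probability_setT.
Qed.

Lemma Rint_le f g : L1 f -> L1 g -> (forall x, f x <= g x) ->
  \int[P]_x f x <= \int[P]_x g x.
Proof. by move=> lf lg fg; apply: le_Rintegral. Qed.

Lemma Rint_ge0 f : (forall x, 0 <= f x) -> 0 <= \int[P]_x f x.
Proof. by move=> f0; apply: Rintegral_ge0. Qed.

Lemma Rint_norm f : L1 f -> `|\int[P]_x f x| <= \int[P]_x `|f x|.
Proof. by move=> lf; apply: le_normr_Rintegral. Qed.

Lemma Rint_lec f (c : R) : L1 f -> (forall x, f x <= c) -> \int[P]_x f x <= c.
Proof.
by move=> lf fc; rewrite -[leRHS]Rint_cst; apply: Rint_le => //; exact: L1_cst.
Qed.

Lemma Rint_gec f (c : R) : L1 f -> (forall x, c <= f x) -> c <= \int[P]_x f x.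
Proof.
by move=> lf fc; rewrite -[leLHS]Rint_cst; apply: Rint_le => //; exact: L1_cst.
Qed.

Lemma Rint_sum n (f : nat -> T -> R) : (forall i, (i < n)%N -> L1 (f i)) ->
  \int[P]_x (\sum_(i < n) f i x) = \sum_(i < n) \int[P]_x f i x.
Proof.
elim: n => [_|n ih lf].
  by rewrite big_ord0; under eq_Rintegral do rewrite big_ord0; rewrite Rint_cst.
rewrite big_ord_recr -ih/=; last by move=> i ?; apply: lf; exact: ltnW.
under eq_Rintegral do rewrite big_ord_recr/=.
by rewrite RintD//; [apply: L1_sum => i ?; apply: lf; exact: ltnW|exact: lf].
Qed.

Lemma eq_Rint f g : f =1 g -> \int[P]_x f x = \int[P]_x g x.
Proof. by move=> fg; apply: eq_Rintegral => x _. Qed.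

Lemma EFin_Rint f : L1 f -> (\int[P]_x f x)%:E = (\int[P]_x (f x)%:E)%E.
Proof. by move=> lf; rewrite fineK//; exact: integrable_fin_num. Qed.

Lemma L1_fin f : mble f -> (forall x, 0 <= f x) ->
  (\int[P]_x (f x)%:E < +oo)%E -> L1 f.
Proof.
move=> mf f0 lt; apply/integrableP; split; first exact/mf_EFin.
by under eq_integral do rewrite /= ger0_norm//.
Qed.

End ProbabilityIntegral.
Arguments L1_bounded {d T R P f} M.
Arguments L1_le {d T R P f g}.
Arguments eq_Rint {d T R P f g}.

(** Positive and negative parts are transported separately, so both sides are [fine] of the same
    extended real, whether or not [f] is integrable. *)
Lemma Rint_pushforward {d d'} {T : measurableType d} {T' : measurableType d'}
    {R : realType} (P : probability T R) (Q : probability T' R) (phi : T -> T')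
    (f : T' -> R) :
    mble phi -> mble f ->
    (forall B, measurable B -> Q B = P (phi @^-1` B)) ->
  \int[Q]_y f y = \int[P]_x f (phi x) /\ (L1 P (f \o phi) -> L1 Q f).
Proof.
move=> mphi mf QE.
have pe (h : T' -> \bar R) : mble h -> (forall y, 0 <= h y)%E ->
    (\int[Q]_y h y = \int[P]_x h (phi x))%E.
  move=> mh h0; rewrite (eq_measure_integral (pushforward P phi)); last first.
    by move=> B mB _; exact: QE.
  by rewrite ge0_integral_pushforward// preimage_setT.
split; last first.
  move=> /integrableP[_ lt]; apply/integrableP; split; first exact/mf_EFin.
  rewrite pe//; apply: mf_comp => //; exact/mf_EFin.
rewrite /Rintegral; congr fine; rewrite [LHS]integralE [RHS]integralE.
have mf' : mble (EFin \o f) by exact/mf_EFin.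
rewrite (pe _ (measurable_funepos mf'))// (pe _ (measurable_funeneg mf'))//.
by rewrite funepos.unlock funeneg.unlock.
Qed.

(** * Fubini's theorem for real integrals over a product of probability spaces *)

Section ProductIntegral.
Context {d1 d2} {T1 : measurableType d1} {T2 : measurableType d2} {R : realType}.
Variables (P1 : probability T1 R) (P2 : probability T2 R).
Implicit Types f : T1 * T2 -> R.

Definition prodP : probability (T1 * T2)%type R := (P1 \x P2)%E.

Lemma mf_Rint1 f : mble f ->
  mble (fun y => \int[P1]_x f (x, y)).
Proof.
move=> mf; rewrite /Rintegral; apply: mf_comp => //.
have mf' : mble (EFin \o f) by exact/mf_EFin.
under [X in measurable_fun _ X]funext => y do rewrite integralE.
apply: emeasurable_funB.
- have h := measurable_fun_fubini_tonelli_G (m1 := P1) (EFin \o f)^\+%E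
    (measurable_funepos mf') (funepos_ge0 _).
  by rewrite funepos.unlock in h *; exact: h.
- have h := measurable_fun_fubini_tonelli_G (m1 := P1) (EFin \o f)^\-%E
    (measurable_funeneg mf') (funeneg_ge0 _).
  by rewrite funeneg.unlock in h *; exact: h.
Qed.

Lemma mf_Rint2 f : mble f ->
  mble (fun x => \int[P2]_y f (x, y)).
Proof.
move=> mf; rewrite /Rintegral; apply: mf_comp => //.
have mf' : mble (EFin \o f) by exact/mf_EFin.
under [X in measurable_fun _ X]funext => y do rewrite integralE.
apply: emeasurable_funB.
- have h := measurable_fun_fubini_tonelli_F (m2 := P2) (EFin \o f)^\+%E
    (measurable_funepos mf') (funepos_ge0 _).
  by rewrite funepos.unlock in h *; exact: h.
- have h := measurable_fun_fubini_tonelli_F (m2 := P2) (EFin \o f)^\-%E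
    (measurable_funeneg mf') (funeneg_ge0 _).
  by rewrite funeneg.unlock in h *; exact: h.
Qed.

(* The slice integrals are genuine reals as soon as every slice is dominated;
   [fine] would otherwise hide infinite values. *)
Lemma Rint_prod21 f : L1 prodP f -> (forall y, L1 P1 (fun x => f (x, y))) ->
  \int[prodP]_z f z = \int[P2]_y \int[P1]_x f (x, y).
Proof.
move=> lf ls; rewrite /Rintegral; congr fine.
rewrite -[LHS](@integral21_prod_meas1 _ _ _ _ _ P1 P2 _ lf).
by apply: eq_integral => y _; rewrite /fubini_G/= EFin_Rint.
Qed.

Lemma Rint_prod12 f : L1 prodP f -> (forall x, L1 P2 (fun y => f (x, y))) ->
  \int[prodP]_z f z = \int[P1]_x \int[P2]_y f (x, y).
Proof.
move=> lf ls; rewrite /Rintegral; congr fine.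
rewrite -[LHS](@integral12_prod_meas1 _ _ _ _ _ P1 P2 _ lf).
by apply: eq_integral => y _; rewrite /fubini_F/= EFin_Rint.
Qed.

Lemma L1_fst (g : T1 -> R) : L1 P1 g -> L1 prodP (fun z => g z.1).
Proof.
move=> lg.
have mg : mble g by exact: L1_measurable lg.
have mg1 : mble (fun z : T1 * T2 => g z.1).
  exact: (mf_comp mg mf_fst).
apply/(@integrable12ltyP _ _ _ _ _ P1 P2); first exact/mf_EFin.
under eq_integral => x _.
  rewrite (_ : (fun=> _) = cst `|g x|%:E)// integral_cst//.
  rewrite [X in (_ * X)%E](_ : _ = 1)%E ?mule1; last exact: probability_setT.
  over.
by have /integrableP[] := lg.
Qed.

Lemma mf_pair1 f x : mble f ->
  mble (fun y => f (x, y)).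
Proof. by move=> mf; apply: mf_comp => //; exact: pair1_measurable. Qed.

Lemma mf_pair2 f y : mble f ->
  mble (fun x => f (x, y)).
Proof. by move=> mf; apply: mf_comp => //; exact: pair2_measurable. Qed.

End ProductIntegral.
Arguments mf_Rint1 {d1 d2 T1 T2 R P1 f}.
Arguments mf_Rint2 {d1 d2 T1 T2 R P2 f}.
Arguments L1_fst {d1 d2 T1 T2 R P1} P2 {g}.

(** * Tail integrals of a non-increasing function that is constant on the negative half-line *)

Section LebesgueTail.
Context {R : realType}.
Notation leb := (@lebesgue_measure R).

Lemma ge0_integral_translate (u : R) (f : R -> \bar R) :
  mble f -> (forall x, 0 <= f x)%E ->
  (\int[leb]_x f (x + u)%R = \int[leb]_x f x)%E.
Proof.
move=> mf f0.
pose phi (x : measurableTypeR R) : measurableTypeR R := x + u.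
have mphi : mble phi by exact: mfD.
transitivity (\int[pushforward leb phi]_x f x)%E.
  by rewrite ge0_integral_pushforward// preimage_setT.
apply: eq_measure_integral => A mA _; apply: esym; apply: lebesgue_measure_unique => //.
move=> _ [[a b]] /= ab <-.
rewrite /pushforward (_ : _ @^-1` _ = `]a - u, b - u]%classic); last first.
  by apply/seteqP; split => x /=; rewrite !in_itv/= ltrBlDr lerBrDr.
rewrite !lebesgue_measure_itv/= !lte_fin ltrD2r.
by case: ifPn => // _; rewrite -!EFinB; congr EFin; ring.
Qed.

Variable g : R -> R.
Hypotheses (mg : mble g) (g_ge0 : forall x, 0 <= g x).
Hypotheses (g_noninc : forall x y, x <= y -> g y <= g x).
Hypotheses (g_const : forall x, x <= 0 -> g x = g 0).

Definition tail (u : R) : \bar R := (\int[leb]_(m in `[0%R, +oo[) (g (u + m)%R)%:E)%E.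

Let mf_tail u : mble (fun m : R => (g (u + m))%:E).
Proof.
by apply/mf_EFin; apply: mf_comp => //; exact: mfD.
Qed.

Lemma tailE u : tail u = (\int[leb]_(m in `[u, +oo[) (g m)%:E)%E.
Proof.
rewrite /tail integral_mkcond [RHS]integral_mkcond.
rewrite -[RHS](ge0_integral_translate u).
- apply: eq_integral => x _; rewrite !patchE.
  by rewrite !mem_setE !in_itv/= !andbT lerDr addrC.
- apply/(measurable_restrictT _ _).1 => //; apply: measurable_funTS.
  exact/mf_EFin.
- by move=> x; rewrite patchE; case: ifPn => // _; rewrite lee_fin.
Qed.

Let tail_split (a b : R) : a <= b ->
  (tail a = \int[leb]_(m in `[a, b[) (g m)%:E + tail b)%E.
Proof.
move=> ab; rewrite !tailE -ge0_integral_setU//.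
- congr integral; apply/seteqP; split => x /=; rewrite !in_itv/= ?andbT.
    by case: (leP b x) => bx ax; [right|left]; rewrite ?andbT// ax.
  by case => [/andP[]//|bx]; exact: le_trans bx.
- by apply: measurable_funTS; exact/mf_EFin.
- by move=> x _; rewrite lee_fin.
- rewrite disj_set2E; apply/eqP/seteqP; split => x//= [].
  by rewrite !in_itv/= andbT => /andP[_ xb] bx; move: (lt_le_trans xb bx); rewrite ltxx.
Qed.

Let int_co (a b : R) (lo hi : R) : a <= b ->
  (forall x, a <= x < b -> lo <= g x <= hi) -> 0 <= lo ->
  (((b - a) * lo)%:E <= \int[leb]_(m in `[a, b[) (g m)%:E <= ((b - a) * hi)%:E)%E.
Proof.
move=> ab lohi lo0.
have lE : leb `[a, b[ = (b - a)%:E.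
  rewrite lebesgue_measure_itv/= lte_fin; case: ltP => // ba.
  by rewrite (le_anti (introT andP (conj ab ba))) subrr.
have cE (c : R) : (((b - a) * c)%:E = \int[leb]_(m in `[a, b[) c%:E)%E.
  by rewrite integral_cst//= lE mulrC EFinM.
rewrite !cE; apply/andP; split; apply: ge0_le_integral => //=;
  try (by apply: measurable_funTS; exact/mf_EFin);
  try (by move=> x; rewrite in_itv/= => /lohi/andP[? ?]; rewrite lee_fin).
Qed.

Hypothesis tail_fin : (tail 0 < +oo)%E.

Lemma tail_lty u : (tail u < +oo)%E.
Proof.
have [u0|u0] := leP u 0.
  rewrite (tail_split u0) lte_add_pinfty//.
  have /andP[_ h] : (((0 - u) * 0)%:E <= \int[leb]_(m in `[u, 0%R[) (g m)%:E
      <= ((0 - u) * g 0)%:E)%E.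
    by apply: int_co => // x /andP[_ /ltW x0]; rewrite g_ge0 g_const//=.
  by apply: le_lt_trans h _; rewrite ltry.
move: tail_fin; rewrite (tail_split (ltW u0)); apply: le_lt_trans.
by rewrite leeDr//; apply: integral_ge0 => x _; rewrite lee_fin.
Qed.

Let tail_ge0 u : (0 <= tail u)%E.
Proof. by apply: integral_ge0 => x _; rewrite lee_fin. Qed.

Let tail_num u : tail u \is a fin_num.
Proof. by rewrite ge0_fin_numE// tail_lty. Qed.

(** [tail] is convex with derivative [- g], hence above its tangent at 0. *)
Lemma fine_tail_ge u : fine (tail 0) - u * g 0 <= fine (tail u).
Proof.
have [u0|/ltW u0] := leP u 0.
  have /andP[h _] : (((0 - u) * g 0)%:E <= \int[leb]_(m in `[u, 0%R[) (g m)%:E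
      <= ((0 - u) * g 0)%:E)%E.
    by apply: int_co => // x /andP[_ /ltW x0]; rewrite g_const//= !lexx.
  rewrite -lee_fin EFinB !fineK// (tail_split u0) addeC.
  by apply: leeD => //; rewrite -EFinN; move: h; rewrite sub0r mulNr.
have /andP[_ h] : (((u - 0) * 0)%:E <= \int[leb]_(m in `[0%R, u[) (g m)%:E
    <= ((u - 0) * g 0)%:E)%E.
  by apply: int_co => // x /andP[x0 _]; rewrite g_ge0 g_noninc//=.
rewrite lerBlDl -lee_fin EFinD !fineK// (tail_split u0) leeD2r//.
by move: h; rewrite subr0.
Qed.

(** The tangent at 0 is exceeded by at most [u] times the variation of the slope on [[0, u]], and
    not at all for [u <= 0] since [g] is constant there. Averaged over an increment, this variation
    is what [loss] measures. *)
Lemma fine_tail_le u : fine (tail u) <=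
  fine (tail 0) - u * g 0 + Num.max u 0 * (g 0 - g (Num.max u 0)).
Proof.
have [u0|/ltW u0] := leP u 0.
  rewrite mul0r addr0.
  have /andP[_ h] : (((0 - u) * g 0)%:E <= \int[leb]_(m in `[u, 0%R[) (g m)%:E
      <= ((0 - u) * g 0)%:E)%E.
    by apply: int_co => // x /andP[_ /ltW x0]; rewrite g_const//= !lexx.
  rewrite -lee_fin EFinB !fineK// (tail_split u0) addeC.
  by apply: leeD => //; rewrite -EFinN; move: h; rewrite sub0r mulNr.
have /andP[h _] : (((u - 0) * g u)%:E <= \int[leb]_(m in `[0%R, u[) (g m)%:E
    <= ((u - 0) * g 0)%:E)%E.
  by apply: int_co => // x /andP[x0 /ltW xu]; rewrite !g_noninc.
rewrite [leRHS](_ : _ = fine (tail 0) - u * g u); last by ring.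
rewrite lerBrDl -lee_fin EFinD !fineK// (tail_split u0) leeD2r//.
by move: h; rewrite subr0.
Qed.

End LebesgueTail.

(** * Cocycles over a Markov chain that contracts on average: decorrelation *)

Section CocycleChain.
Context {R : realType} {dG dX : measure_display}.
Context {G : measurableType dG} {X : measurableType dX}.
Variables (mu : probability G R) (nu : probability X R).
Variables (act : G -> X -> X) (s : G -> X -> R) (D : X -> X -> R).
Variables (ell Lam : G -> R) (r : R).
Hypotheses (mact : mble2 act)
  (ms : mble2 s)
  (nu_act : forall B, measurable B ->
  nu B = (\int[mu]_a nu (act a @^-1` B))%E)
  (mD : forall x y, mble (fun a => D (act a x) (act a y)))
  (D_ge0 : forall x y, 0 <= D x y)
  (D_le1 : forall x y, D x y <= 1)
  (D_contr : forall x y, \int[mu]_a D (act a x) (act a y) <= r * D x y)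
  (D_Lam : forall a x y, D (act a x) (act a y) <= Lam a * D x y)
  (r_ge0 : 0 <= r)
  (r_lt1 : r < 1)
  (s_ell : forall a x, `|s a x| <= ell a)
  (s_Lam : forall a x y, `|s a x - s a y| <= Lam a * D x y)
  (L1ell : L1 mu ell)
  (L1Lam : L1 mu Lam)
  (Lam_ge0 : forall a, 0 <= Lam a).

Notation kappa := (prodP mu nu).

Lemma integral_stationary (f : X -> R) : mble f ->
  \int[nu]_x f x = \int[kappa]_z f (act z.1 z.2).
Proof.
move=> mf; apply: (Rint_pushforward (phi := fun z => act z.1 z.2) _ mf _).1 => //.
move=> B mB; rewrite nu_act//; apply: eq_integral => a _; congr (nu _).
by apply/seteqP; split => x /=; rewrite /xsection/= in_setE.
Qed.

Definition markov (f : X -> R) (x : X) : R := \int[mu]_a f (act a x).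

Lemma mf_act1 (f : X -> R) x : mble f ->
  mble (fun a => f (act a x)).
Proof.
move=> mf; apply: (mf_pair2 (f := fun z => f (act z.1 z.2))).
exact: mf_comp.
Qed.

Lemma mf_act2 (f : X -> R) : mble f ->
  mble (fun z : G * X => f (act z.1 z.2)).
Proof. by move=> mf; apply: mf_comp. Qed.

Lemma mf_markov (f : X -> R) : mble f ->
  mble (markov f).
Proof.
move=> mf; apply: (mf_Rint1 (f := fun z => f (act z.1 z.2))).
exact: mf_act2.
Qed.

Lemma mf_iter n (f : X -> R) : mble f ->
  mble (iter n markov f).
Proof. by move=> mf; elim: n => //= n; exact: mf_markov. Qed.

Lemma L1_act (f : X -> R) (M : R) x : mble f -> (forall y, `|f y| <= M) ->
  L1 mu (fun a => f (act a x)).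
Proof. by move=> mf fM; apply: (L1_bounded M) => //; exact: mf_act1. Qed.

Lemma markov_ge0 (f : X -> R) x : (forall y, 0 <= f y) -> 0 <= markov f x.
Proof. by move=> f0; apply: Rint_ge0. Qed.

Lemma iter_markov_ge0 n (f : X -> R) x : (forall y, 0 <= f y) ->
  0 <= iter n markov f x.
Proof. by move=> f0; elim: n x => //= n ih x; exact: markov_ge0. Qed.

Lemma markov_bounded (f : X -> R) (M : R) x : mble f ->
  (forall y, `|f y| <= M) -> `|markov f x| <= M.
Proof.
move=> mf fM; have lf := L1_act x mf fM.
by apply: le_trans (Rint_norm lf) _; apply: Rint_lec => //; exact: L1_norm.
Qed.

Lemma iter_bounded n (f : X -> R) (M : R) x : mble f ->
  (forall y, `|f y| <= M) -> `|iter n markov f x| <= M.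
Proof.
move=> mf fM; elim: n x => //= n ih x; apply: markov_bounded => //.
exact: mf_iter.
Qed.

Lemma markovB (f g : X -> R) (M N : R) x : mble f ->
  mble g -> (forall y, `|f y| <= M) -> (forall y, `|g y| <= N) ->
  markov (fun y => f y - g y) x = markov f x - markov g x.
Proof.
by move=> mf mg fM gN; rewrite /markov RintB//;
  [exact: L1_act mf fM|exact: L1_act mg gN].
Qed.

Lemma L1_D x y : L1 mu (fun a => D (act a x) (act a y)).
Proof.
by apply: (L1_bounded 1) => // a; rewrite ger0_norm.
Qed.

Definition lipD (K : R) (f : X -> R) := forall x y, `|f x - f y| <= K * D x y.

Lemma lipD_markov (K : R) (f : X -> R) (M : R) : mble f ->
  (forall y, `|f y| <= M) -> 0 <= K -> lipD K f -> lipD (K * r) (markov f).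
Proof.
move=> mf fM K0 fK x y; rewrite /markov -RintB; [|exact: L1_act mf fM..].
have lf : L1 mu (fun a => f (act a x) - f (act a y)).
  by apply: L1B; exact: L1_act mf fM.
apply: le_trans (Rint_norm lf) _.
apply: (@le_trans _ _ (\int[mu]_a (K * D (act a x) (act a y)))).
  by apply: Rint_le => [||a]; [exact: L1_norm|apply: L1Z; exact: L1_D|exact: fK].
by rewrite RintZ ?(L1_D x y)// -mulrA ler_wpM2l.
Qed.

Lemma lipD_iter_markov n (K : R) (f : X -> R) (M : R) : mble f ->
  (forall y, `|f y| <= M) -> 0 <= K -> lipD K f -> lipD (K * r ^+ n) (iter n markov f).
Proof.
move=> mf fM K0 fK; elim: n => [|n ih]; first by rewrite expr0 mulr1.
rewrite exprS (mulrC r) mulrA; apply: (lipD_markov (M := M)) => //.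
- exact: mf_iter.
- by move=> y; exact: iter_bounded.
- by rewrite mulr_ge0// exprn_ge0.
Qed.

Lemma integral_markov (f : X -> R) (M : R) : mble f ->
  (forall y, `|f y| <= M) -> \int[nu]_x markov f x = \int[nu]_x f x.
Proof.
move=> mf fM; rewrite [RHS]integral_stationary// Rint_prod21//.
- by apply: (L1_bounded M) => //; exact: mf_act2.
- by move=> y; exact: L1_act mf fM.
Qed.

Lemma integral_iter_markov n (f : X -> R) (M : R) : mble f ->
  (forall y, `|f y| <= M) -> \int[nu]_x iter n markov f x = \int[nu]_x f x.
Proof.
move=> mf fM; elim: n => //= n <-; apply: (integral_markov (M := M)).
  exact: mf_iter.
by move=> y; exact: iter_bounded.
Qed.

Lemma lipD_mean (K : R) (f : X -> R) (M : R) x : mble f ->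
  (forall y, `|f y| <= M) -> 0 <= K -> lipD K f -> `|f x - \int[nu]_y f y| <= K.
Proof.
move=> mf fM K0 fK; have lf : L1 nu f := L1_bounded _ mf fM.
rewrite -{1}(Rint_cst nu (f x)) -RintB//; last exact: L1_cst.
have lfx : L1 nu (fun y => f x - f y) by apply: L1B => //; exact: L1_cst.
apply: le_trans (Rint_norm lfx) _; apply: Rint_lec; first exact: L1_norm.
by move=> y; apply: le_trans (fK x y) _; rewrite ler_piMr.
Qed.

Lemma ell_pos a : 0 <= ell a.
Proof. by apply: le_trans (normr_ge0 _) (s_ell a point). Qed.

Lemma mf_s1 x : mble (s ^~ x).
Proof. exact: (mf_pair2 (f := fun z => s z.1 z.2)). Qed.

Lemma L1_s x : L1 mu (s ^~ x).
Proof. by apply: (L1_le (g := ell)) => //; exact: mf_s1. Qed.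

Lemma L1_ell_kappa : L1 kappa (fun z => ell z.1).
Proof. exact: L1_fst. Qed.

Lemma L1_sM (f : X -> R) (M : R) : mble f -> (forall y, `|f y| <= M) ->
  L1 kappa (fun z => s z.1 z.2 * f (act z.1 z.2)).
Proof.
move=> mf fM; apply: (L1_le (g := fun z => M * ell z.1)).
- by apply: mfM => //; exact: mf_act2.
- exact/L1Z/L1_ell_kappa.
- by move=> z; rewrite normrM mulrC ler_pM.
Qed.

Definition mean_ell := \int[mu]_a ell a.
Definition mean_Lam := \int[mu]_a Lam a.

Lemma mean_ell_ge0 : 0 <= mean_ell. Proof. exact/Rint_ge0/ell_pos. Qed.
Lemma mean_Lam_ge0 : 0 <= mean_Lam. Proof. exact/Rint_ge0. Qed.

Lemma integral_ell_kappa : \int[kappa]_z ell z.1 = mean_ell.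
Proof.
rewrite Rint_prod21//; [|exact: L1_ell_kappa].
by rewrite -/mean_ell Rint_cst.
Qed.

Hypothesis centered : \int[kappa]_z s z.1 z.2 = 0.

(** In the stationary regime, the covariance of an increment with a function of the position to
    which it leads; by [centered] it ignores constants. *)
Definition corr (f : X -> R) := \int[kappa]_z (s z.1 z.2 * f (act z.1 z.2)).

Lemma L1_s_kappa : L1 kappa (fun z => s z.1 z.2).
Proof. by apply: (L1_le (g := fun z => ell z.1)) => //; exact: L1_ell_kappa. Qed.

Lemma corr_le (f : X -> R) (M c e : R) : mble f ->
  (forall y, `|f y| <= M) -> (forall y, `|f y - c| <= e) ->
  `|corr f| <= mean_ell * e.
Proof.
move=> mf fM fe.
have lsf := L1_sM mf fM.
have lfc : L1 kappa (fun z => s z.1 z.2 * (f (act z.1 z.2) - c)).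
  apply: (L1_sM (f := fun y => f y - c) (M := e)) => //.
  exact: mfB.
have -> : corr f = \int[kappa]_z (s z.1 z.2 * (f (act z.1 z.2) - c)).
  rewrite (eq_Rint (g := fun z => s z.1 z.2 * f (act z.1 z.2) - c * s z.1 z.2)).
    by rewrite RintB// ?RintZ ?centered ?mulr0 ?subr0//; [exact: L1_s_kappa|
      apply: L1Z; exact: L1_s_kappa].
  by move=> z; ring.
apply: le_trans (Rint_norm lfc) _.
rewrite -integral_ell_kappa mulrC -RintZ; last exact: L1_ell_kappa.
apply: Rint_le => [||z]; [exact: L1_norm|apply: L1Z; exact: L1_ell_kappa|].
by rewrite normrM mulrC ler_pM.
Qed.

Lemma corr_iter_markov n (K : R) (f : X -> R) (M : R) : mble f ->
  (forall y, `|f y| <= M) -> 0 <= K -> lipD K f ->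
  `|corr (iter n markov f)| <= mean_ell * (K * r ^+ n).
Proof.
move=> mf fM K0 fK.
apply: (corr_le (M := M) (c := \int[nu]_y iter n markov f y)).
- exact: mf_iter.
- by move=> y; exact: iter_bounded.
- move=> y; apply: (lipD_mean (M := M)).
  + exact: mf_iter.
  + by move=> ?; exact: iter_bounded.
  + by rewrite mulr_ge0// exprn_ge0.
  + exact: lipD_iter_markov mf fM K0 fK.
Qed.

Definition tail_ell (A : R) := \int[mu]_a Num.max (ell a - A) 0.

Lemma L1_tail_ell A : L1 mu (fun a => Num.max (ell a - A) 0).
Proof.
apply: (L1_le (g := fun a => ell a + `|A|)).
- apply: measurable_maxr => //; apply: mfB => //.
  exact: L1_measurable L1ell.
- by apply: L1D => //; exact: L1_cst.
- move=> a; have := ell_pos a; have := ler_norm A; have := ler_norm (- A).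
  rewrite normrN => ? ? ?; case: (leP (ell a - A) 0) => h; first by rewrite normr0; lra.
by rewrite gtr0_norm//; lra.
Qed.

Lemma integral_tail_ell_kappa A :
  \int[kappa]_z Num.max (ell z.1 - A) 0 = tail_ell A.
Proof.
have l := L1_fst nu (L1_tail_ell A).
rewrite Rint_prod21//=; first by rewrite -/(tail_ell A) Rint_cst.
by move=> _; exact: L1_tail_ell.
Qed.

(** Increments up to [A] cost [A] times the mean of [f], and the excess of larger ones is charged to
    [tail_ell A]. This bound is kept by all iterates of a function and serves for the first ones,
    [corr_iter_markov] for the later ones. *)
Lemma corr_nonneg (f : X -> R) (M A : R) : mble f ->
  (forall y, 0 <= f y <= M) -> 0 <= A ->
  `|corr f| <= A * \int[nu]_x f x + M * tail_ell A.
Proof.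
move=> mf fM A0.
have M0 : 0 <= M by have /andP[] := fM point; exact: le_trans.
have fM' y : `|f y| <= M by exact: norm_bounds (fM y).
have lsf := L1_sM mf fM'.
have lfa : L1 kappa (fun z => f (act z.1 z.2)).
  by apply: (L1_bounded M) => //; exact: mf_act2.
have lt := L1_fst nu (L1_tail_ell A).
apply: le_trans (Rint_norm lsf) _.
rewrite integral_stationary// -integral_tail_ell_kappa -!RintZ//.
rewrite -RintD; [|exact: L1Z..].
apply: Rint_le => [||z]; [exact: L1_norm|by apply: L1D; exact: L1Z|].
have /andP[f0 f1] := fM (act z.1 z.2).
rewrite normrM [ `|f _|]ger0_norm//.
have := s_ell z.1 z.2; set e := ell _; set u := `|_|; set v := f _ => ue.
have : u <= A + Num.max (e - A) 0 by case: (leP (e - A) 0) => ?; lra.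
move=> /(ler_wpM2r f0) h; apply: le_trans h _; rewrite mulrDl lerD2l mulrC.
by apply: ler_wpM2r => //; rewrite le_max lexx orbT.
Qed.


(** * The queue and the recursion for its integrated mass *)

Variables (H : X -> R -> R) (K C : R).
Hypotheses (mH : mble2 H)
  (H_ge0 : forall x (m : R), 0 <= H x m)
  (H_leK : forall x (m : R), H x m <= K)
  (H_noninc : forall x (m m' : R), m <= m' -> H x m' <= H x m)
  (H_lip : forall x (m m' : R), `|H x m - H x m'| <= K * `|m - m'|)
  (H_lipD : forall x y m, `|H x m - H y m| <= K * D x y)
  (H_out : forall x (m : R), C <= m -> H x m = 0)
  (H_in : forall x (m : R), m <= - C -> H x m = H x (- C))
  (C_ge0 : 0 <= C).

Let K_ge0 : 0 <= K. Proof. exact: le_trans (H_ge0 point 0) (H_leK _ _). Qed.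

(* The queue (Lindley) recursion m |-> s + max(m, 0) is the dual of the walk
   killed below 0: integrating over the starting level t of the killed walk
   turns its transition operator into this one. *)
Fixpoint queue (T : R) (n : nat) (x : X) (m : R) : R :=
  if n is k.+1 then \int[mu]_a queue T k (act a x) (s a x + Num.max m 0)
  else H x (m - T).

Section FixedLevel.
Variable T : R.
Hypothesis T_ge : C <= T.
Notation G_ := (queue T).

Lemma mf_step (f : X -> R -> R) :
  mble2 f ->
  mble (fun w : G * (X * R) =>
    f (act w.1 w.2.1) (s w.1 w.2.1 + Num.max w.2.2 0)).
Proof.
move=> mf.
have m21 : mble (fun w : G * (X * R) => w.2.1).
  by apply: mf_comp => //; exact: mf_fst.
have m22 : mble (fun w : G * (X * R) => w.2.2).
  by apply: mf_comp => //; exact: mf_snd.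
have m1 := mf_pair (f := fun w : G * (X * R) => w.1) mf_fst m21.
have m2 := mf_comp mact m1.
have m3 : mble (fun w : G * (X * R) =>
    s w.1 w.2.1 + Num.max w.2.2 0).
  apply: mfD; first exact: (mf_comp ms m1).
  exact: measurable_maxr.
exact: (mf_comp mf (mf_pair m2 m3)).
Qed.

Lemma mf_queue n : mble2 (G_ n).
Proof.
elim: n => [|n ih] /=.
  have m1 : mble (fun z : X * R => z.2 - T).
    exact: mfB.
  exact: (mf_comp mH
    (mf_pair (f := fun w : X * R => w.1) mf_fst m1)).
apply: (mf_Rint1 (f := fun w : G * (X * R) =>
  G_ n (act w.1 w.2.1) (s w.1 w.2.1 + Num.max w.2.2 0))).
exact: mf_step ih.
Qed.

Lemma mf_queue_step n x (m : R) :
  mble (fun a => G_ n (act a x) (s a x + Num.max m 0)).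
Proof.
apply: (mf_pair2 (f := fun w : G * (X * R) =>
  G_ n (act w.1 w.2.1) (s w.1 w.2.1 + Num.max w.2.2 0)) (x, m)).
by apply: (mf_step (f := G_ n)); exact: mf_queue.
Qed.

Lemma mf_queue1 n (m : R) : mble (fun x => G_ n x m).
Proof. exact: (mf_pair2 m (mf_queue n)). Qed.

Lemma mf_queue2 n x : mble (fun m => G_ n x m).
Proof. exact: (mf_pair1 x (mf_queue n)). Qed.

Lemma queue_ge0 n x (m : R) : 0 <= G_ n x m.
Proof. by elim: n x m => [|n ih] x m //=; apply: Rint_ge0. Qed.

Lemma L1_queue_of n x (m : R) : (forall y u, G_ n y u <= K) ->
  L1 mu (fun a => G_ n (act a x) (s a x + Num.max m 0)).
Proof.
move=> leK; apply: (L1_bounded K); first exact: mf_queue_step.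
by move=> a; rewrite ger0_norm ?queue_ge0.
Qed.

Lemma queue_leK n x (m : R) : G_ n x m <= K.
Proof.
elim: n x m => [|n ih] x m //=.
by apply: Rint_lec => //; exact: L1_queue_of.
Qed.

Lemma queue_norm n x (m : R) : `|G_ n x m| <= K.
Proof. by rewrite ger0_norm ?queue_ge0 ?queue_leK. Qed.

Lemma L1_queue n x (m : R) : L1 mu (fun a => G_ n (act a x) (s a x + Num.max m 0)).
Proof. by apply: L1_queue_of; exact: queue_leK. Qed.

Lemma queue_noninc n x (m m' : R) : m <= m' -> G_ n x m' <= G_ n x m.
Proof.
elim: n x m m' => [|n ih] x m m' mm' /=; first by apply: H_noninc; rewrite lerD2r.
apply: Rint_le => [||a]; [exact: L1_queue..|].
by apply: ih; rewrite lerD2l ge_max !le_max mm' lexx /= orbT.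
Qed.

Lemma max0_lip (u v : R) : `|Num.max u 0 - Num.max v 0| <= `|u - v|.
Proof.
by case: (leP u 0) => ?; case: (leP v 0) => ?; rewrite ?subr0 ?sub0r ?subrr//;
  rewrite ?normr0// ler_norml; have := ler_norm (u - v); have := ler_norm (v - u);
  rewrite (distrC v u) => ? ?; apply/andP; split; lra.
Qed.

Lemma queue_lip n x (m m' : R) : `|G_ n x m - G_ n x m'| <= K * `|m - m'|.
Proof.
elim: n x m m' => [|n ih] x m m' /=.
  by apply: le_trans (H_lip _ _ _) _; rewrite (_ : m - T - (m' - T) = m - m')//; ring.
rewrite -RintB; [|exact: L1_queue..].
have l : L1 mu (fun a => G_ n (act a x) (s a x + Num.max m 0)
    - G_ n (act a x) (s a x + Num.max m' 0)) by apply: L1B; exact: L1_queue.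
apply: le_trans (Rint_norm l) _; apply: Rint_lec => [|a]; first exact: L1_norm.
apply: le_trans (ih _ _ _) _; rewrite ler_wpM2l//.
by rewrite opprD addrACA subrr add0r max0_lip.
Qed.

(** It dominates [K] and satisfies [KD * r + K * mean_Lam <= KD], hence is a Lipschitz constant
    preserved by a step of the queue, uniform in [n] and in [T]. *)
Definition KD := K + K * mean_Lam / (1 - r).

Lemma KD_ge0 : 0 <= KD.
Proof.
have := mean_Lam_ge0 => ?.
by rewrite addr_ge0// divr_ge0 ?subr_ge0 ?(ltW r_lt1)// mulr_ge0.
Qed.

Lemma queue_lipD n x y (m : R) : `|G_ n x m - G_ n y m| <= KD * D x y.
Proof.
have l1r : 0 < 1 - r by rewrite subr_gt0.
have L0 := mean_Lam_ge0.
elim: n x y m => [|n ih] x y m /=.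
  apply: le_trans (H_lipD _ _ _) _; rewrite ler_wpM2r// lerDl.
  by rewrite divr_ge0 ?(ltW l1r)// mulr_ge0.
rewrite -RintB; [|exact: L1_queue..].
have l : L1 mu (fun a => G_ n (act a x) (s a x + Num.max m 0)
    - G_ n (act a y) (s a y + Num.max m 0)) by apply: L1B; exact: L1_queue.
apply: le_trans (Rint_norm l) _.
apply: (@le_trans _ _ (\int[mu]_a (KD * D (act a x) (act a y)
    + (K * D x y) * Lam a))).
  apply: Rint_le => [||a]; first exact: L1_norm.
    by apply: L1D; apply: L1Z => //; exact: L1_D.
  apply: le_trans (ler_distD (G_ n (act a y) (s a x + Num.max m 0)) _ _) _.
  apply: lerD; first exact: ih.
  apply: le_trans (queue_lip _ _ _ _) _; rewrite opprD addrACA subrr addr0.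
  by rewrite -mulrA ler_wpM2l// mulrC.
rewrite RintD; [|by apply: L1Z => //; exact: L1_D|exact: L1Z].
rewrite RintZ ?(L1_D x y)// RintZ//.
apply: (@le_trans _ _ (KD * (r * D x y) + K * D x y * mean_Lam)).
  by rewrite lerD2r ler_wpM2l// KD_ge0.
rewrite [leLHS](_ : _ = (KD * r + K * mean_Lam) * D x y); last by ring.
rewrite ler_wpM2r//.
have -> : K * mean_Lam = (KD - K) * (1 - r).
  by rewrite /KD addrC addKr divfK// gt_eqF.
have : 0 <= K * (1 - r) by rewrite mulr_ge0// ltW.
by nra.
Qed.

Lemma queue_neg n x (m : R) : m <= 0 -> G_ n x m = G_ n x 0.
Proof.
case: n => [|n] m0 /=; last by rewrite (max_idPr m0) maxxx.
(* At time 0 it is [C <= T] that puts [m - T] below [- C], where [H x] is constant. *)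
rewrite H_in; last by rewrite lerBlDr -lerBlDl opprK (le_trans _ T_ge)// gerDr.
by rewrite [RHS]H_in// sub0r lerN2.
Qed.

Definition base n x := G_ n x 0.
(** What is lost by taking the queue at [act a x] from the level [s a x] rather than from 0
    ([lossE]). It is non-negative, Lipschitz uniformly in [n], and its mean is the decrease of
    [mean_base]. *)
Definition loss n x := markov (base n) x - base n.+1 x.

Lemma mf_base n : mble (base n).
Proof. exact: mf_queue1. Qed.

Lemma mf_loss n : mble (loss n).
Proof.
by apply: mfB; [exact/mf_markov/mf_base|exact: mf_base].
Qed.

Lemma base_norm n x : `|base n x| <= K. Proof. exact: queue_norm. Qed.

Lemma lipD_base n : lipD KD (base n). Proof. by move=> x y; exact: queue_lipD. Qed.

Lemma lossE n x : loss n x = \int[mu]_a (G_ n (act a x) 0 - G_ n (act a x) (s a x)).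
Proof.
rewrite RintB.
- by rewrite /loss /markov /base /= maxxx; under [X in _ - X]eq_Rint do rewrite addr0.
- exact: L1_act (mf_base n) (base_norm n).
- have := L1_queue n x 0; rewrite maxxx.
  by under [X in L1 _ X -> _]eq_fun do rewrite addr0.
Qed.

Lemma queue_drop_ge0 n x (m : R) : 0 <= G_ n x 0 - G_ n x m.
Proof.
rewrite subr_ge0; have [m0|/ltW m0] := leP m 0; first by rewrite queue_neg.
exact: queue_noninc.
Qed.

Lemma loss_ge0 n x : 0 <= loss n x.
Proof. by rewrite lossE; apply: Rint_ge0 => a; exact: queue_drop_ge0. Qed.

Lemma loss_leK n x : loss n x <= K.
Proof.
rewrite /loss lerBlDr (le_trans (ler_norm _))//.
apply: le_trans (markov_bounded x (mf_base n) (base_norm n)) _.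
by rewrite lerDl queue_ge0.
Qed.

Lemma lipD_loss n : lipD (KD *+ 2) (loss n).
Proof.
move=> x y; rewrite /loss (_ : _ - _ = (markov (base n) x - markov (base n) y)
  + (base n.+1 y - base n.+1 x)); last by ring.
rewrite mulr2n mulrDl; apply: le_trans (ler_normD _ _) _; apply: lerD.
  have h := lipD_markov (mf_base n) (base_norm n) KD_ge0 (lipD_base n) x y.
  by apply: le_trans h _; rewrite ler_wpM2r// ler_piMr ?KD_ge0// ltW.
by rewrite distrC; exact: lipD_base.
Qed.

Definition mean_base n := \int[nu]_x base n x.

Lemma L1_base n : L1 nu (base n).
Proof. exact: L1_bounded _ (mf_base n) (base_norm n). Qed.

Lemma integral_loss n : \int[nu]_x loss n x = mean_base n - mean_base n.+1.
Proof.
rewrite RintB//; last 2 first.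
- apply: (L1_bounded K); first exact/mf_markov/mf_base.
  by move=> x; apply: markov_bounded; [exact: mf_base|exact: base_norm].
- exact: L1_base.
by rewrite (integral_markov (mf_base n) (base_norm n)).
Qed.

Lemma mean_base_noninc n : mean_base n.+1 <= mean_base n.
Proof. by rewrite -subr_ge0 -integral_loss; apply: Rint_ge0; exact: loss_ge0. Qed.

Lemma mean_base_ge0 n : 0 <= mean_base n.
Proof. by apply: Rint_ge0 => x; exact: queue_ge0. Qed.

Lemma mean_base_leK n : mean_base n <= K.
Proof. by apply: Rint_lec => [|x]; [exact: L1_base|exact: queue_leK]. Qed.

Notation leb := (@lebesgue_measure R).
Notation tailq n y u := (tail (G_ n y) u).

Lemma mf_tailq n : mble2 (fun y u => tailq n y u).
Proof.
pose f (w : (X * R) * measurableTypeR R) : \bar R :=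
  (if 0 <= w.2 then G_ n w.1.1 (w.1.2 + w.2) else 0)%:E.
have mf : mble f.
  apply/mf_EFin; apply: measurable_fun_ifT => //=.
    exact: measurable_fun_ler.
  have m1 : mble (fun w : (X * R) * measurableTypeR R => w.1.1).
    by apply: mf_comp => //; exact: mf_fst.
  have m2 : mble (fun w : (X * R) * measurableTypeR R => w.1.2 + w.2).
    apply: mfD => //.
    by apply: mf_comp => //; exact: mf_snd.
  exact: (mf_comp (mf_queue n) (mf_pair m1 m2)).
have f0 w : (0 <= f w)%E by rewrite lee_fin; case: ifP => // _; exact: queue_ge0.
have := @measurable_fun_fubini_tonelli_F _ _ _ _ _ leb f mf f0.
apply: eq_measurable_fun => -[y u] _; rewrite /fubini_F /tail/= [RHS]integral_mkcond.
by apply: eq_integral => m _; rewrite patchE mem_setE in_itv/= andbT /f; case: ifP.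
Qed.

Lemma tailq0_lty y : (tailq 0 y 0 < +oo)%E.
Proof.
have TC0 : 0 <= T + C by rewrite addr_ge0 ?(le_trans C_ge0).
have le1 : (tailq 0 y 0 <= \int[leb]_(m in `[0%R, (T + C)%R]) K%:E)%E.
  rewrite /tail [leLHS]integral_mkcond [leRHS]integral_mkcond.
  apply: ge0_le_integral => //=.
  - by move=> m _; rewrite patchE; case: ifP => // _; rewrite lee_fin H_ge0.
  - apply/(measurable_restrictT _ _).1 => //; apply: measurable_funTS.
    apply/mf_EFin; apply: (mf_comp (mf_queue2 0 y)).
    exact: mfD.
  - exact/(measurable_restrictT _ _).1.
  move=> m _; rewrite !patchE !mem_setE !in_itv/= andbT.
  case: ifP => //= m0; case: (leP m (T + C)) => mT; rewrite lee_fin//.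
  by rewrite H_out// add0r lerBrDr addrC ltW.
apply: le_lt_trans le1 _.
by rewrite integral_cst//= lebesgue_measure_itv/=; case: ifP => _;
  rewrite -EFinM ltry.
Qed.

(** By [killed_mass_queue], the mass at time [n] of the walk killed below 0, weighted by its
    starting level. *)
Definition integrated n y := fine (tailq n y 0).

Lemma tailq_ge0 n y u : (0 <= tailq n y u)%E.
Proof. by apply: integral_ge0 => m _; rewrite lee_fin queue_ge0. Qed.

Lemma tailq_le n y u : (tailq n y 0 < +oo)%E ->
  fine (tailq n y u) <= integrated n y + `|u| * K.
Proof.
move=> lt.
apply: le_trans (fine_tail_le (mf_queue2 n y) (queue_ge0 n y)
  (queue_noninc n y) (queue_neg n y) lt u) _.
rewrite -addrA lerD2l; have [u0|/ltW u0] := leP u 0.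
  rewrite mul0r addr0 ler0_norm// -mulNr ler_wpM2l// ?oppr_ge0//.
  exact: queue_leK.
rewrite (_ : _ + _ = - (u * G_ n y u)); last by ring.
by rewrite (@le_trans _ _ 0)// ?oppr_le0 ?mulr_ge0 ?queue_ge0.
Qed.

Lemma integrated_ge0 n y : 0 <= integrated n y.
Proof. by rewrite fine_ge0// tailq_ge0. Qed.

Lemma mf_integrated n : mble (integrated n).
Proof.
apply: mf_comp => //.
have m1 : mble (fun x : X => (x, 0 : R)).
  exact: mf_pair.
exact: (mf_comp (mf_tailq n) m1).
Qed.

(** For [m >= 0] the maximum in the recursion disappears, and a step merely translates the variable
    of integration by [s a x]. *)
Lemma tailqS n x :
  (tailq n.+1 x 0 = \int[mu]_a tailq n (act a x) (s a x))%E.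
Proof.
pose f (w : G * measurableTypeR R) : \bar R :=
  (if 0 <= w.2 then G_ n (act w.1 x) (s w.1 x + Num.max w.2 0) else 0)%:E.
have mf : mble f.
  apply/mf_EFin; apply: measurable_fun_ifT => //=.
    exact: measurable_fun_ler.
  have m1 : mble (fun w : G * measurableTypeR R => (w.1, (x, w.2))).
    apply: mf_pair => //; apply: mf_pair => //.
  exact: (mf_comp (mf_step (mf_queue n)) m1).
have f0 w : (0 <= f w)%E by rewrite lee_fin; case: ifP => // _; exact: queue_ge0.
have -> : (\int[mu]_a tailq n (act a x) (s a x) =
    \int[mu]_a \int[leb]_m f (a, m))%E.
  apply: eq_integral => a _; rewrite /tail integral_mkcond; apply: eq_integral => m _.
  rewrite patchE mem_setE in_itv/= andbT /f /=.
  by case: ifP => // m0; rewrite (max_idPl m0).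
rewrite (@fubini_tonelli _ _ _ _ _ mu leb f mf f0) /tail integral_mkcond.
apply: eq_integral => m _.
rewrite patchE mem_setE in_itv/= andbT /f /=; case: ifP => m0.
  by rewrite add0r EFin_Rint//; exact: L1_queue.
by rewrite integral0.
Qed.

Definition int_bound n := (T + C) * K + n%:R * (K * mean_ell).

(** Crude and growing with [n]: it serves finiteness and integrability, not the asymptotics. *)
Lemma tailq_bound n y : (tailq n y 0 <= (int_bound n)%:E)%E.
Proof.
have TC0 : 0 <= T + C by rewrite addr_ge0 ?(le_trans C_ge0).
elim: n y => [|n ih] y.
  rewrite /int_bound mul0r addr0 -[leLHS]fineK ?ge0_fin_numE ?tailq_ge0 ?tailq0_lty//.
  rewrite lee_fin.
  have := fine_tail_ge (mf_queue2 0 y) (queue_ge0 0 y)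
    (queue_noninc 0 y) (queue_neg 0 y) (tailq0_lty y) (T + C).
  rewrite [X in _ <= fine X](_ : _ = 0%E) /=.
    rewrite subr_le0 => h; apply: le_trans h _.
    by rewrite ler_wpM2l// H_leK.
  apply: integral0_eq => m /=; rewrite in_itv/= andbT => m0.
  by rewrite /= H_out// (_ : T + C + m - T = C + m) ?lerDl//; ring.
rewrite tailqS.
have bound a : (tailq n (act a y) (s a y) <= (int_bound n + K * ell a)%:E)%E.
  have lt : (tailq n (act a y) 0 < +oo)%E by apply: le_lt_trans (ih _) _; rewrite ltry.
  have ltu := tail_lty (mf_queue2 n (act a y)) (queue_ge0 n _)
    (queue_neg n _) lt (s a y).
  rewrite -[leLHS]fineK ?ge0_fin_numE ?tailq_ge0// lee_fin.
  apply: le_trans (tailq_le _ lt) _; apply: lerD; last by rewrite mulrC ler_wpM2l.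
  by rewrite -lee_fin /integrated fineK ?ge0_fin_numE ?tailq_ge0.
have mL : mble ell := L1_measurable L1ell.
have Il : L1 mu (fun a => int_bound n + K * ell a).
  by apply: L1D; [exact: L1_cst|exact: L1Z].
apply: (@le_trans _ _ (\int[mu]_a (int_bound n + K * ell a)%:E)%E).
  apply: ge0_le_integral => //.
  - by move=> a _; exact: tailq_ge0.
  - have m1 := mf_pair (mf_comp mact (pair2_measurable y))
      (mf_s1 y).
    exact: (mf_comp (mf_tailq n) m1).
  - by apply/mf_EFin; exact: L1_measurable Il.
rewrite -EFin_Rint// RintD; [|exact: L1_cst|exact: L1Z].
rewrite Rint_cst RintZ// -/mean_ell.
by rewrite lee_fin /int_bound -addrA lerD2l -(natr1 n) mulrDl mul1r.
Qed.

Lemma tailq_fin n y : (tailq n y 0 < +oo)%E.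
Proof. by apply: le_lt_trans (tailq_bound _ _) _; rewrite ltry. Qed.

Lemma tailq_num n y u : tailq n y u \is a fin_num.
Proof.
rewrite ge0_fin_numE ?tailq_ge0//.
exact: tail_lty (mf_queue2 n y) (queue_ge0 n y) (queue_neg n y) (tailq_fin n y) u.
Qed.

Lemma integrated_bound n y : `|integrated n y| <= int_bound n.
Proof.
by rewrite ger0_norm ?integrated_ge0// -lee_fin fineK ?tailq_num// tailq_bound.
Qed.

Definition mean_integrated n := \int[nu]_x integrated n x.

Lemma integrated_le n y u : fine (tailq n y u) <= integrated n y - u * G_ n y 0 +
  Num.max u 0 * (G_ n y 0 - G_ n y u).
Proof.
apply: le_trans (fine_tail_le (mf_queue2 n y) (queue_ge0 n y)
  (queue_noninc n y) (queue_neg n y) (tailq_fin n y) u) _.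
by rewrite lerD2l; case: (leP u 0) => u0; rewrite ?mul0r.
Qed.

Lemma integrated_ge n y u : integrated n y - u * G_ n y 0 <= fine (tailq n y u).
Proof.
exact: (fine_tail_ge (mf_queue2 n y) (queue_ge0 n y)
  (queue_noninc n y) (queue_neg n y) (tailq_fin n y) u).
Qed.

Let TC_le (a : G) (e x : R) : 0 <= x -> x <= K -> Num.max e 0 <= ell a ->
  forall A, 0 <= A -> Num.max e 0 * x <= A * x + K * Num.max (ell a - A) 0.
Proof.
move=> x0 xK el A A0; apply: (@le_trans _ _ ((A + Num.max (ell a - A) 0) * x)).
  rewrite ler_wpM2r// (le_trans el)// -lerBlDl le_max lexx//.
by rewrite mulrDl lerD2l mulrC ler_wpM2r// le_max lexx orbT.
Qed.

Lemma mf_queue_kappa n :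
  mble (fun z : G * X => G_ n (act z.1 z.2) (s z.1 z.2)).
Proof. exact: (mf_comp (mf_queue n) (mf_pair mact ms)). Qed.

Lemma integral_drop n :
  \int[kappa]_z (G_ n (act z.1 z.2) 0 - G_ n (act z.1 z.2) (s z.1 z.2)) =
  \int[nu]_x loss n x.
Proof.
have m1 : mble (fun z : G * X =>
    G_ n (act z.1 z.2) 0 - G_ n (act z.1 z.2) (s z.1 z.2)).
  apply: mfB; last exact: mf_queue_kappa.
  exact: mf_act2 (mf_base n).
have b1 (z : G * X) : `|G_ n (act z.1 z.2) 0 - G_ n (act z.1 z.2) (s z.1 z.2)| <= K.
  by rewrite ger0_norm ?queue_drop_ge0// lerBlDr (le_trans (queue_leK _ _ _))// lerDl queue_ge0.
rewrite Rint_prod21; last 2 first.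
- exact: L1_bounded _ m1 b1.
- move=> x; apply: (L1_bounded K); last by move=> a; exact: (b1 (a, x)).
  exact: (mf_pair2 x m1).
by apply: eq_Rint => x; rewrite lossE.
Qed.

(** By stationarity both masses are integrals over the same pair of an increment and a position, and
    [integrated_ge], [integrated_le] expand the tail at [s a x] around 0. The first-order term is
    [corr (base n)]. The error is the positive part of the increment times the drop of the queue:
    the mean drop is the decrease of [mean_base], and increments beyond [A] are charged to
    [tail_ell A]. *)
Lemma mean_integrated_step n (A : R) : 0 <= A ->
  `|mean_integrated n.+1 - mean_integrated n + corr (base n)| <=
  A * (mean_base n - mean_base n.+1) + K * tail_ell A.
Proof.
move=> A0.
have mt : mble (fun z : G * X => fine (tailq n (act z.1 z.2) (s z.1 z.2))).
  apply: mf_comp => //.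
  exact: (mf_comp (mf_tailq n) (mf_pair mact ms)).
have ib0 : 0 <= int_bound n by apply: le_trans (integrated_bound n point).
have lell := L1_fst nu L1ell.
have bt (z : G * X) : `|fine (tailq n (act z.1 z.2) (s z.1 z.2))| <= int_bound n + K * ell z.1.
  rewrite ger0_norm ?fine_ge0 ?tailq_ge0//.
  apply: le_trans (tailq_le _ (tailq_fin n _)) _; apply: lerD.
    by apply: le_trans (ler_norm _) (integrated_bound _ _).
  by rewrite mulrC ler_wpM2l.
have lt : L1 kappa (fun z => fine (tailq n (act z.1 z.2) (s z.1 z.2))).
  by apply: (L1_le mt _ bt); apply: L1D; [exact: L1_cst|exact: L1Z].
have IS : mean_integrated n.+1 =
    \int[kappa]_z fine (tailq n (act z.1 z.2) (s z.1 z.2)).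
  rewrite Rint_prod21//; last first.
    move=> x; apply: (L1_le (g := fun a => int_bound n + K * ell a)).
    - exact: (mf_pair2 x mt).
    - by apply: L1D; [exact: L1_cst|exact: L1Z].
    - by move=> a; exact: (bt (a, x)).
  apply: eq_Rint => x /=; rewrite /integrated tailqS /Rintegral; congr fine.
  by apply: eq_integral => a _ /=; rewrite fineK// tailq_num.
have lI : L1 kappa (fun z => integrated n (act z.1 z.2)).
  apply: (L1_bounded (int_bound n)) => [|z]; last exact: integrated_bound.
  exact: mf_act2 (mf_integrated n).
have lsF := L1_sM (mf_base n) (base_norm n).
have I0 : mean_integrated n = \int[kappa]_z integrated n (act z.1 z.2).
  exact: integral_stationary (mf_integrated n).
have lmax := L1_fst nu (L1_tail_ell A).
have lIs := L1B lI lsF.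
have le1 : mean_integrated n - corr (base n) <= mean_integrated n.+1.
  rewrite IS I0 /corr -RintB//; apply: Rint_le => // z; exact: integrated_ge.
apply: (ler_norm_between le1).
have ldrop : L1 kappa (fun z : G * X => G_ n (act z.1 z.2) 0 - G_ n (act z.1 z.2) (s z.1 z.2)).
  apply: (L1_bounded K).
    apply: mfB; last exact: mf_queue_kappa.
    exact: mf_act2 (mf_base n).
  move=> z; rewrite ger0_norm ?queue_drop_ge0// lerBlDr.
  by rewrite (le_trans (queue_leK _ _ _))// lerDl queue_ge0.
rewrite -integral_loss -integral_drop -integral_tail_ell_kappa -!RintZ//.
rewrite IS I0 /corr -RintB//.
have lr : L1 kappa (fun z : G * X => A * (G_ n (act z.1 z.2) 0 - G_ n (act z.1 z.2) (s z.1 z.2))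
    + K * Num.max (ell z.1 - A) 0) by apply: L1D; exact: L1Z.
rewrite -[X in _ <= _ + X]RintD; [|exact: L1Z..].
rewrite -RintD//; apply: Rint_le => //; first exact: L1D.
move=> z; apply: le_trans (integrated_le _ _ _) _; rewrite lerD2l.
apply: TC_le => //; first exact: queue_drop_ge0.
  by rewrite lerBlDr (le_trans (queue_leK _ _ _))// lerDl queue_ge0.
by rewrite ge_max ell_pos andbT (le_trans (ler_norm _) (s_ell _ _)).
Qed.

(** The definition of [loss] carried through [i] iterations, in the form required by
    [double_sum_le]. *)
Lemma iter_markov_baseS i k x : iter i markov (base k.+1) x =
  iter i.+1 markov (base k) x - iter i markov (loss k) x.
Proof.
have mb k' := mf_base k'.
have bl y : `|loss k y| <= K by rewrite ger0_norm ?loss_ge0 ?loss_leK.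
elim: i x => [|i ih] x; first by rewrite /= /loss; ring.
have -> : iter i.+1 markov (base k.+1) x =
    markov (fun y => iter i.+1 markov (base k) y - iter i markov (loss k) y) x.
  by apply: eq_Rint => a; exact: ih.
rewrite (@markovB _ _ K K)//.
- exact: mf_iter.
- exact/mf_iter/mf_loss.
- by move=> y; apply: iter_bounded => //; exact: base_norm.
- by move=> y; apply: iter_bounded => //; exact: mf_loss.
Qed.

Lemma corrB (f g : X -> R) (M N : R) : mble f ->
  mble g -> (forall y, `|f y| <= M) -> (forall y, `|g y| <= N) ->
  corr (fun y => f y - g y) = corr f - corr g.
Proof.
move=> mf mg fM gN; rewrite /corr -RintB; [|exact: L1_sM mf fM|exact: L1_sM mg gN].
by apply: eq_Rint => z; rewrite mulrBr.
Qed.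

Lemma tail_ell_ge0 A : 0 <= tail_ell A.
Proof. by apply: Rint_ge0 => a; rewrite le_max lexx orbT. Qed.

Definition KM := mean_ell * (KD *+ 2).

Lemma KM_ge0 : 0 <= KM.
Proof. by rewrite mulr_ge0 ?mean_ell_ge0// mulrn_wge0// KD_ge0. Qed.

(** All the functions [base k] are traced back to [base 0], whose iterates decorrelate
    exponentially, at the price of correlations of iterated losses. These are small for two reasons:
    losses have small means, used for the first [w j] iterates, and iterates flatten, used for the
    others. [w j] is also the level at which increments are truncated. *)
Lemma sum_corr_base n (w : nat -> nat) :
  `|\sum_(k < n) corr (base k)| <= KM / (1 - r) + \sum_(j < n)
    (((w j)%:R * (mean_base j - mean_base j.+1) + K * tail_ell (w j)%:R) *+ w j
      + KM * r ^+ w j / (1 - r)).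
Proof.
have mb k' := mf_base k'.
have bl k y : `|loss k y| <= K by rewrite ger0_norm ?loss_ge0 ?loss_leK.
pose a i k := corr (iter i markov (base k)).
pose b i k := corr (iter i markov (loss k)).
have ab i k : a i k.+1 = a i.+1 k - b i k.
  rewrite /a /b -(@corrB _ _ K K).
  - by congr corr; apply/funext => x; exact: iter_markov_baseS.
  - exact: mf_iter.
  - exact/mf_iter/mf_loss.
  - by move=> y; apply: iter_bounded => //; exact: base_norm.
  - by move=> y; apply: iter_bounded => //; exact: mf_loss.
have := double_sum_le n 0 ab; rewrite /a /= => h; apply: le_trans h _.
apply: lerD.
  apply: (@le_trans _ _ (KM * \sum_(k < n) r ^+ k)); last first.
    by rewrite ler_wpM2l ?KM_ge0 ?geometric_sum_le.
  rewrite mulr_sumr; apply: ler_sum => k _; rewrite add0n.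
  apply: le_trans (corr_iter_markov k (mb 0) (base_norm 0) KD_ge0 (lipD_base 0)) _.
  rewrite /KM mulrA ler_wpM2r ?exprn_ge0// ler_wpM2l ?mean_ell_ge0//.
  by rewrite mulr2n lerDl KD_ge0.
apply: ler_sum => j _.
have KD2 : 0 <= KD *+ 2 by rewrite mulrn_wge0// KD_ge0.
apply: (truncated_sum_le (b := fun i => b (0 + i)%N j)) => //.
- by rewrite addr_ge0// mulr_ge0 ?tail_ell_ge0 ?subr_ge0 ?mean_base_noninc.
- exact: KM_ge0.
- move=> i; rewrite add0n /KM -mulrA.
  by apply: corr_iter_markov (mf_loss j) (bl j) KD2 (lipD_loss j).
- move=> i; rewrite add0n -integral_loss.
  rewrite -(integral_iter_markov i (mf_loss j) (bl j)).
  apply: (corr_nonneg (M := K)) => //.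
    exact/mf_iter/mf_loss.
  move=> y; rewrite iter_markov_ge0 /=; last by move=> ?; exact: loss_ge0.
  apply: le_trans (ler_norm _) _.
  by apply: iter_bounded (mf_loss j) (bl j).
Qed.

Lemma mean_integrated_sum n (w : nat -> nat) :
  `|mean_integrated n - mean_integrated 0| <= KM / (1 - r) + \sum_(j < n)
    (((w j)%:R * (mean_base j - mean_base j.+1) + K * tail_ell (w j)%:R) *+ (w j).+1
      + KM * r ^+ w j / (1 - r)).
Proof.
have h : `|mean_integrated n - mean_integrated 0 + \sum_(k < n) corr (base k)| <=
    \sum_(j < n) ((w j)%:R * (mean_base j - mean_base j.+1) + K * tail_ell (w j)%:R).
  elim: n => [|n ih]; first by rewrite !big_ord0 subrr addr0 normr0.
  rewrite !big_ord_recr/=.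
  exact: ler_norm_telescope ih (mean_integrated_step n (ler0n R (w n))).
apply: le_trans (ler_norm_cancel h (sum_corr_base n w)) _.
rewrite addrCA lerD2l -big_split/=; apply: ler_sum => j _.
by rewrite mulrSr addrA (addrC (_ *+ w j)).
Qed.

(** At time 0 the integrand equals [H x (- C)] up to [T - C] and vanishes from [T + C] on. *)
Lemma integrated0_bounds x : (T - C) * H x (- C) <= integrated 0 x <= (T + C) * H x (- C).
Proof.
have g0 : G_ 0 x 0 = H x (- C) by rewrite /= H_in// sub0r lerN2.
apply/andP; split.
  have := integrated_le 0 x (T - C); rewrite g0 (_ : G_ 0 x (T - C) = H x (- C)).
    rewrite subrr mulr0 addr0 => h; rewrite -subr_ge0; apply: le_trans h.
    by rewrite fine_ge0// tailq_ge0.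
  by rewrite /= addrC addKr.
have := integrated_ge 0 x (T + C); rewrite g0 [X in _ <= fine X](_ : _ = 0%E)/=.
  by rewrite subr_le0.
apply: integral0_eq => m /=; rewrite in_itv/= andbT => m0.
by rewrite /= H_out// (_ : T + C + m - T = C + m) ?lerDl//; ring.
Qed.

Lemma L1_integrated n : L1 nu (integrated n).
Proof. exact: L1_bounded _ (mf_integrated n) (integrated_bound n). Qed.

Lemma mean_integrated0 : `|mean_integrated 0 - T * \int[nu]_x H x (- C)| <= C * K.
Proof.
have mHC : mble (H ^~ (- C)) by exact: (mf_pair2 _ mH).
have lH : L1 nu (H ^~ (- C)).
  by apply: (L1_bounded K) => // x; rewrite ger0_norm.
have lH' c := L1Z c lH.
rewrite -RintZ// -RintB//; last exact: L1_integrated.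
have l := L1B (L1_integrated 0) (lH' T).
apply: le_trans (Rint_norm l) _; apply: Rint_lec => [|x]; first exact: L1_norm.
apply: (@le_trans _ _ (C * H x (- C))); last by rewrite ler_wpM2l.
have /andP[h1 h2] := integrated0_bounds x.
rewrite ler_norml lerBrDr lerBlDr -mulNr -!mulrDl addrC h1 /=.
by rewrite [C + T]addrC.
Qed.

End FixedLevel.


(** * The Poisson equation and martingale increments *)

Definition sbar x := \int[mu]_a s a x.

Lemma mf_sbar : mble sbar.
Proof. exact: (mf_Rint1 (f := fun z : G * X => s z.1 z.2)). Qed.

Lemma sbar_bounded x : `|sbar x| <= mean_ell.
Proof.
apply: le_trans (Rint_norm (L1_s x)) _.
by apply: Rint_le => //; exact/L1_norm/L1_s.
Qed.

Lemma lipD_sbar : lipD mean_Lam sbar.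
Proof.
move=> x y; rewrite -RintB; [|exact: L1_s..].
have l := L1B (L1_s x) (L1_s y).
apply: le_trans (Rint_norm l) _.
rewrite mulrC -RintZ//; apply: Rint_le => [||a]; [exact: L1_norm|exact: L1Z|].
by rewrite mulrC.
Qed.

Lemma mean_sbar : \int[nu]_x sbar x = 0.
Proof. by rewrite -centered Rint_prod21//; [exact: L1_s_kappa|exact: L1_s]. Qed.

Lemma iter_sbar_le k x : `|iter k markov sbar x| <= mean_Lam * r ^+ k.
Proof.
have h := lipD_iter_markov k mf_sbar sbar_bounded mean_Lam_ge0 lipD_sbar.
have := lipD_mean x (mf_iter k mf_sbar)
  (fun y => iter_bounded k y mf_sbar sbar_bounded) _ h.
rewrite (integral_iter_markov k mf_sbar sbar_bounded) mean_sbar subr0; apply.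
by rewrite mulr_ge0 ?exprn_ge0// mean_Lam_ge0.
Qed.

Definition potential_sum n x := \sum_(k < n) iter k markov sbar x.
(** The solution of the Poisson equation [potential - markov potential = sbar]. The series converges
    geometrically because [sbar] has mean 0 under [nu] and Lipschitz constants contract. *)
Definition potential x := limn (potential_sum ^~ x).
Definition Theta := mean_Lam / (1 - r).

Lemma Theta_ge0 : 0 <= Theta.
Proof. by rewrite divr_ge0 ?mean_Lam_ge0// subr_ge0 ltW. Qed.

Lemma potential_sum_cauchy n p x :
  `|potential_sum (n + p) x - potential_sum n x| <= Theta * r ^+ n.
Proof.
rewrite (_ : _ - _ = \sum_(k < p) iter (n + k) markov sbar x); last first.
  by rewrite /potential_sum big_split_ord/= [X in X - _]addrC addrK.
apply: le_trans (ler_norm_sum _ _ _) _.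
apply: (@le_trans _ _ (mean_Lam * r ^+ n * \sum_(k < p) r ^+ k)).
  by rewrite mulr_sumr; apply: ler_sum => k _; rewrite -mulrA -exprD iter_sbar_le.
rewrite /Theta mulrAC ler_wpM2r ?exprn_ge0// ler_wpM2l ?mean_Lam_ge0//.
exact: geometric_sum_le.
Qed.

Lemma cvg_potential x : potential_sum ^~ x @ \oo --> potential x.
Proof.
apply: cauchy_cvg; apply: cauchy_exP => e e0.
have : (Theta * r ^+ n) @[n --> \oo] --> (0 : R).
  by rewrite -(mulr0 Theta); apply: cvgMr; apply: cvg_expr; rewrite ger0_norm.
move=> /cvgrPdist_lt/(_ (e / 2)); rewrite divr_gt0// => /(_ isT)[N _ hN].
exists (potential_sum N x); rewrite /nbhs/=; near=> n; rewrite /ball/=.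
have -> : n = (N + (n - N))%N by rewrite subnKC//; near: n; exact: nbhs_infty_ge.
rewrite distrC (le_lt_trans (potential_sum_cauchy _ _ _))//.
have := hN N (leqnn N); rewrite sub0r normrN ger0_norm; last first.
  by rewrite mulr_ge0 ?exprn_ge0// Theta_ge0.
by move=> h; rewrite (lt_trans h)// gtr_pMr// invf_lt1// ltr1n.
Unshelve. all: by end_near. Qed.

Lemma potential_dist n x : `|potential x - potential_sum n x| <= Theta * r ^+ n.
Proof.
have h : (fun p => `|potential_sum p x - potential_sum n x|) @ \oo -->
    `|potential x - potential_sum n x|.
  by apply: cvg_norm; apply: cvgB; [exact: cvg_potential|exact: cvg_cst].
rewrite -(cvg_lim _ h)//; apply: limr_le; first by apply/cvg_ex; eexists; exact: h.
near=> p; have -> : p = (n + (p - n))%N.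
  by rewrite subnKC//; near: p; exact: nbhs_infty_ge.
exact: potential_sum_cauchy.
Unshelve. all: by end_near. Qed.

Lemma potential_bounded x : `|potential x| <= Theta.
Proof.
by have := potential_dist 0 x; rewrite /potential_sum big_ord0 subr0 expr0 mulr1.
Qed.

Lemma mf_potential_sum n : mble (potential_sum n).
Proof.
by apply: measurable_sum => k; exact/mf_iter/mf_sbar.
Qed.

Lemma mf_potential : mble potential.
Proof.
apply: (measurable_fun_cvg (h := fun n x => potential_sum n x)) => [n|x _].
  exact: mf_potential_sum.
exact: cvg_potential.
Qed.

Lemma lipD_potential : lipD Theta potential.
Proof.
move=> x y.
have hn n : `|potential_sum n x - potential_sum n y| <= Theta * D x y.
  rewrite /potential_sum -sumrB; apply: le_trans (ler_norm_sum _ _ _) _.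
  apply: (@le_trans _ _ (mean_Lam * D x y * \sum_(k < n) r ^+ k)).
    rewrite mulr_sumr; apply: ler_sum => k _; rewrite mulrAC.
    exact: (lipD_iter_markov k mf_sbar sbar_bounded mean_Lam_ge0 lipD_sbar).
  rewrite /Theta [leRHS]mulrAC ler_wpM2l//; last exact: geometric_sum_le.
  by rewrite mulr_ge0 ?mean_Lam_ge0.
have h : (fun n => `|potential_sum n x - potential_sum n y|) @ \oo -->
    `|potential x - potential y|.
  by apply: cvg_norm; apply: cvgB; exact: cvg_potential.
rewrite -(cvg_lim _ h)//; apply: limr_le; first by apply/cvg_ex; eexists; exact: h.
by near=> n; exact: hn.
Unshelve. all: by end_near. Qed.

Lemma potential_sumS n x : potential_sum n.+1 x = sbar x + markov (potential_sum n) x.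
Proof.
rewrite /potential_sum big_ord_recl/=; congr (_ + _).
apply/esym; apply: (@Rint_sum _ _ _ mu n (fun i a => iter i markov sbar (act a x))).
move=> i _; apply: (@L1_act _ mean_ell); first exact/mf_iter/mf_sbar.
by move=> y; exact: iter_bounded mf_sbar sbar_bounded.
Qed.

Lemma poisson x : markov potential x = potential x - sbar x.
Proof.
apply/eqP; rewrite -subr_eq0 -normr_le0.
have hn n : `|markov potential x - (potential x - sbar x)| <= (Theta *+ 2) * r ^+ n.
  have bn y : `|potential_sum n y| <= Theta + Theta.
    have := lerD (potential_dist n y) (potential_bounded y).
    rewrite distrC => h; rewrite -[X in `|X|](subrK (potential y)).
    apply: le_trans (ler_normD _ _) (le_trans h _).
    by rewrite lerD2r ler_piMr ?Theta_ge0// exprn_ile1// ltW.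
  have e1 : `|markov potential x - markov (potential_sum n) x| <= Theta * r ^+ n.
    rewrite -(markovB x mf_potential (mf_potential_sum n)
      potential_bounded bn).
    apply: markov_bounded => [|y]; last exact: potential_dist.
    by apply: mfB; [exact: mf_potential|exact: mf_potential_sum].
  have e2 := potential_dist n.+1 x.
  rewrite (_ : _ - _ = (markov potential x - markov (potential_sum n) x)
    - (potential x - potential_sum n.+1 x)); last by rewrite potential_sumS; ring.
  rewrite mulr2n mulrDl; apply: le_trans (ler_normB _ _) (lerD e1 (le_trans e2 _)).
  by rewrite ler_wpM2l ?Theta_ge0// exprS ler_piMl ?exprn_ge0// ltW.
have : ((Theta *+ 2) * r ^+ n) @[n --> \oo] --> (0 : R).
  by rewrite -(mulr0 (Theta *+ 2)); apply: cvgMr; apply: cvg_expr; rewrite ger0_norm.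
move=> h; rewrite -(cvg_lim _ h)//; apply: limr_ge.
  by apply/cvg_ex; eexists; exact: h.
by near=> n; exact: hn.
Unshelve. all: by end_near. Qed.


Hypotheses (L1ell4 : L1 mu (fun a => ell a ^+ 4))
  (L1ellLam : L1 mu (fun a => ell a * Lam a)).

(** The coboundary of [potential] makes the mean over [a] vanish at every [x], whereas [s] is
    centered only after integration over [nu]: sums of [xi] along the chain are martingales. *)
Definition xi a x := s a x + potential (act a x) - potential x.
Definition xib a := ell a + Theta *+ 2.

Lemma xib_ge0 a : 0 <= xib a.
Proof. by rewrite addr_ge0 ?ell_pos// mulrn_wge0 ?Theta_ge0. Qed.

Lemma xi_le a x : `|xi a x| <= xib a.
Proof.
rewrite /xi /xib -addrA mulr2n; apply: le_trans (ler_normD _ _) _; apply: lerD => //.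
by apply: le_trans (ler_normB _ _) _; apply: lerD; exact: potential_bounded.
Qed.

Lemma mf_xi : mble2 xi.
Proof.
apply: mfB.
  by apply: mfD => //; exact: mf_act2 mf_potential.
by apply: mf_comp => //; exact: mf_potential.
Qed.

Lemma mf_xi1 x : mble (xi ^~ x).
Proof. exact: (mf_pair2 x mf_xi). Qed.

Lemma L1_xib : L1 mu xib.
Proof. by apply: L1D => //; exact: L1_cst. Qed.

Lemma L1_xib4 : L1 mu (fun a => xib a ^+ 4).
Proof.
apply: (L1_le (g := fun a => 8 * (ell a ^+ 4 + (Theta *+ 2) ^+ 4))).
- by apply: mfX; exact: L1_measurable L1_xib.
- by apply: L1Z; apply: L1D => //; exact: L1_cst.
- by move=> a; rewrite ger0_norm ?exprn_even_ge0// pow4_add_le.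
Qed.

Lemma L1_xib2 : L1 mu (fun a => xib a ^+ 2).
Proof.
apply: (L1_le (g := fun a => 1 + xib a ^+ 4)).
- by apply: mfX; exact: L1_measurable L1_xib.
- by apply: L1D; [exact: L1_cst|exact: L1_xib4].
- move=> a; rewrite ger0_norm ?sqr_ge0//.
  by rewrite (exprM (xib a) 2 2) sqr_le_1addsqr.
Qed.

Lemma L1_xi x : L1 mu (xi ^~ x).
Proof.
apply: (L1_le _ L1_xib) => [|a]; last exact: xi_le.
exact: mf_xi1.
Qed.

Lemma mean_xi x : \int[mu]_a xi a x = 0.
Proof.
have lp : L1 mu (fun a => potential (act a x)).
  exact: L1_act mf_potential potential_bounded.
rewrite RintB//; [|exact: L1D (L1_s x) lp|exact: L1_cst].
rewrite Rint_cst RintD//; last exact: L1_s.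
by rewrite -/(markov potential x) poisson -/(sbar x) [sbar x + _]addrC subrK subrr.
Qed.

Lemma xi2_le a x : xi a x ^+ 2 <= xib a ^+ 2.
Proof. by rewrite -(real_normK (num_real (xi a x))) ler_sqr ?nnegrE ?xib_ge0// xi_le. Qed.

Lemma xi4_le a x : xi a x ^+ 4 <= xib a ^+ 4.
Proof.
rewrite (exprM _ 2 2) (exprM (xib a) 2 2) ler_sqr ?nnegrE ?sqr_ge0//.
exact: xi2_le.
Qed.

Lemma L1_xi2 x : L1 mu (fun a => xi a x ^+ 2).
Proof.
apply: (L1_le _ L1_xib2) => [|a]; last by rewrite ger0_norm ?sqr_ge0 ?xi2_le.
by apply: mfX; exact: mf_xi1.
Qed.

Definition variance x := \int[mu]_a xi a x ^+ 2.
Definition m2 := \int[mu]_a xib a ^+ 2.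
Definition m4 := \int[mu]_a xib a ^+ 4.

Lemma m2_ge0 : 0 <= m2. Proof. by apply: Rint_ge0 => a; exact: sqr_ge0. Qed.

Lemma variance_ge0 x : 0 <= variance x.
Proof. by apply: Rint_ge0 => a; exact: sqr_ge0. Qed.

Lemma variance_le x : variance x <= m2.
Proof.
by apply: Rint_le => [||a]; [exact: L1_xi2|exact: L1_xib2|exact: xi2_le].
Qed.

Lemma variance_norm x : `|variance x| <= m2.
Proof. by rewrite ger0_norm ?variance_ge0 ?variance_le. Qed.

Lemma mf_variance : mble variance.
Proof.
apply: (mf_Rint1 (f := fun z : G * X => xi z.1 z.2 ^+ 2)).
by apply: mfX; exact: mf_xi.
Qed.

Definition KV := \int[mu]_a ((Lam a * (1 + Theta) + Theta) * (xib a *+ 2)).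

Lemma L1_KV : L1 mu (fun a => (Lam a * (1 + Theta) + Theta) * (xib a *+ 2)).
Proof.
pose t := Theta.
have -> : (fun a => (Lam a * (1 + Theta) + Theta) * (xib a *+ 2)) = (fun a =>
    (2 * (1 + t)) * (ell a * Lam a) + ((4 * t * (1 + t)) * Lam a
      + (2 * t * ell a + 4 * t ^+ 2))).
  by apply/funext => a; rewrite /xib -/t !mulr2n; ring.
apply: L1D; first exact: L1Z.
apply: L1D; first exact: L1Z.
by apply: L1D; [exact: L1Z|exact: L1_cst].
Qed.

Lemma lipD_variance : lipD KV variance.
Proof.
move=> x y; rewrite -RintB; [|exact: L1_xi2..].
have l := L1B (L1_xi2 x) (L1_xi2 y).
apply: le_trans (Rint_norm l) _; rewrite mulrC -RintZ; last exact: L1_KV.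
apply: Rint_le => [||a]; [exact: L1_norm|exact/L1Z/L1_KV|].
rewrite subr_sqr normrM mulrA; apply: ler_pM => //; last first.
  by apply: le_trans (ler_normD _ _) _; rewrite mulr2n lerD// xi_le.
rewrite (_ : xi a x - xi a y = (s a x - s a y)
  + ((potential (act a x) - potential (act a y)) - (potential x - potential y)));
  last by rewrite /xi; ring.
rewrite (_ : D x y * _ = Lam a * D x y + (Theta * (Lam a * D x y) + Theta * D x y));
  last by ring.
apply: le_trans (ler_normD _ _) _; apply: lerD => //.
apply: le_trans (ler_normB _ _) _; apply: lerD; last exact: lipD_potential.
by apply: le_trans (lipD_potential _ _) _; rewrite ler_wpM2l ?Theta_ge0.
Qed.

Lemma KV_ge0 : 0 <= KV.
Proof.
apply: Rint_ge0 => a; rewrite mulr_ge0// ?mulrn_wge0 ?xib_ge0//.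
by rewrite addr_ge0 ?Theta_ge0// mulr_ge0// addr_ge0 ?Theta_ge0.
Qed.

Definition mean_variance := \int[nu]_x variance x.
(** By orthogonality of martingale increments, the variance after [n] steps of the walk with
    increments [xi] started at [x]. *)
Definition variance_sum n x := \sum_(k < n) iter k markov variance x.

(** The iterates of [variance] approach their mean geometrically, so the total deviation is bounded
    uniformly in [n] and [x]. *)
Lemma variance_sum_ge n x : mean_variance *+ n - KV / (1 - r) <= variance_sum n x.
Proof.
rewrite lerBlDr -lerBlDl; apply: (@le_trans _ _ (\sum_(k < n) (KV * r ^+ k))).
  rewrite -[in X in X - _](card_ord n) -sumr_const -sumrB; apply: ler_sum => k _.
  have h := lipD_iter_markov k mf_variance variance_norm KV_ge0 lipD_variance.
  have := lipD_mean x (mf_iter k mf_variance)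
    (fun y => iter_bounded k y mf_variance variance_norm) _ h.
  rewrite (integral_iter_markov k mf_variance variance_norm).
  rewrite mulr_ge0 ?KV_ge0 ?exprn_ge0// => /(_ isT).
  by rewrite distrC; apply: le_trans; rewrite ler_norm.
by rewrite -mulr_sumr ler_wpM2l ?KV_ge0 ?geometric_sum_le.
Qed.

Lemma variance_sum_bound n x : `|variance_sum n x| <= m2 *+ n.
Proof.
apply: le_trans (ler_norm_sum _ _ _) _; rewrite -[in leRHS](card_ord n) -sumr_const.
apply: ler_sum => k _.
exact: iter_bounded mf_variance variance_norm.
Qed.

Lemma mf_variance_sum n : mble (variance_sum n).
Proof. by apply: measurable_sum => k; exact/mf_iter/mf_variance. Qed.

Lemma variance_sumS n x : variance_sum n.+1 x = variance x + markov (variance_sum n) x.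
Proof.
rewrite /variance_sum big_ord_recl/=; congr (_ + _).
apply/esym; apply: (@Rint_sum _ _ _ mu n (fun i a => iter i markov variance (act a x))).
move=> i _; apply: (@L1_act _ m2); first exact/mf_iter/mf_variance.
by move=> y; exact: iter_bounded mf_variance variance_norm.
Qed.

(* The centered walk (X_n, z + xi_1 + ... + xi_n), applied to the Huber function. *)
Fixpoint walk (rho : R) n x z :=
  if n is k.+1 then \int[mu]_a walk rho k (act a x) (z + xi a x) else huber rho z.

Definition mean_xib := \int[mu]_a xib a.

Lemma mf_walk rho n : mble2 (walk rho n).
Proof.
elim: n => [|n ih] /=.
  apply: (mf_comp (f := huber rho)) => //.
  apply: mfB; apply: mfX; apply: measurable_maxr => //.
  exact: mfB.
apply: (mf_Rint1 (f := fun w : G * (X * R) =>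
  walk rho n (act w.1 w.2.1) (w.2.2 + xi w.1 w.2.1))).
have m21 : mble (fun w : G * (X * R) => w.2.1).
  by apply: mf_comp => //; exact: mf_fst.
have m22 : mble (fun w : G * (X * R) => w.2.2).
  by apply: mf_comp => //; exact: mf_snd.
have m1 := mf_pair (f := fun w : G * (X * R) => w.1) mf_fst m21.
have m2' := mf_comp mact m1.
have m3 : mble (fun w : G * (X * R) => w.2.2 + xi w.1 w.2.1).
  by apply: mfD => //; exact: (mf_comp mf_xi m1).
exact: (mf_comp ih (mf_pair m2' m3)).
Qed.

Lemma mf_walk1 rho n x z :
  mble (fun a => walk rho n (act a x) (z + xi a x)).
Proof.
have m1 : mble (fun a => z + xi a x).
  by apply: mfD => //; exact: mf_xi1.
exact: (mf_comp (mf_walk rho n)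
  (mf_pair (mf_comp mact (pair2_measurable x)) m1)).
Qed.

Lemma walk_bound rho n x z : 0 <= rho ->
  `|walk rho n x z| <= 2 * rho * (`|z| + mean_xib *+ n).
Proof.
move=> r0; elim: n x z => [|n ih] x z /=.
  rewrite ger0_norm ?huber_ge0// addr0; apply: le_trans (huber_le _ r0) _.
  by rewrite ler_wpM2l ?mulr_ge0// ge_max ler_norm normr_ge0.
have li : L1 mu (fun a => 2 * rho * (`|z| + mean_xib *+ n + xib a)).
  by apply: L1Z; apply: L1D; [exact: L1_cst|exact: L1_xib].
have b1 a : `|walk rho n (act a x) (z + xi a x)| <= 2 * rho * (`|z| + mean_xib *+ n + xib a).
  apply: le_trans (ih _ _) _; rewrite ler_wpM2l ?mulr_ge0// addrAC lerD2r.
  by apply: le_trans (ler_normD _ _) _; rewrite lerD2l xi_le.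
have lw := L1_le (mf_walk1 rho n x z) li b1.
apply: le_trans (Rint_norm lw) _.
apply: le_trans (Rint_le (L1_norm lw) li b1) _.
rewrite RintZ; last by apply: L1D; [exact: L1_cst|exact: L1_xib].
by rewrite RintD ?Rint_cst -?addrA ?mulrSr//; [exact: L1_cst|exact: L1_xib].
Qed.

Lemma L1_walk rho n x z : 0 <= rho ->
  L1 mu (fun a => walk rho n (act a x) (z + xi a x)).
Proof.
move=> r0; apply: (L1_le (g := fun a => 2 * rho * (`|z| + mean_xib *+ n + xib a))).
- exact: mf_walk1.
- by apply: L1Z; apply: L1D; [exact: L1_cst|exact: L1_xib].
- move=> a; apply: le_trans (walk_bound _ _ _ r0) _.
  rewrite ler_wpM2l ?mulr_ge0// addrAC lerD2r.
  by apply: le_trans (ler_normD _ _) _; rewrite lerD2l xi_le.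
Qed.

Lemma walk_mono rho n x z z' : 0 <= rho -> z <= z' -> walk rho n x z <= walk rho n x z'.
Proof.
move=> r0; elim: n x z z' => [|n ih] x z z' zz /=; first exact: huber_mono.
by apply: Rint_le => [||a]; [exact: L1_walk..|apply: ih; rewrite lerD2r].
Qed.

(** Fourth moments accumulated over [n] steps, each multiplied by a power of 8 through
    [pow4_add_le]. *)
Fixpoint fourth n := if n is k.+1 then 8 ^+ n * m4 + fourth k else 0.

(** Terms linear in [xi] have mean 0, squares accumulate into [variance_sum], and the quartic
    correction grows in a controlled way. With [e = 0] this is Jensen's inequality along the
    martingale; with [e = 1] it records the gain due to curvature. *)
Lemma walk_lower (rho A p e b z0 : R) n x z : 0 <= rho -> 0 <= e -> 0 < b ->
  (forall z, A + p * (z - z0) + e * ((z - z0) ^+ 2 - (z - z0) ^+ 4 / b) <= huber rho z) ->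
  A + p * (z - z0) + e * ((z - z0) ^+ 2 + variance_sum n x
    - (8 ^+ n * (z - z0) ^+ 4 + fourth n) / b) <= walk rho n x z.
Proof.
move=> r0 e0 b0 hz; elim: n x z => [|n ih] x z.
  by rewrite /variance_sum big_ord0 addr0 expr0 mul1r /= addr0.
set y := z - z0.
have lV : L1 mu (fun a => variance_sum n (act a x)).
  by apply: L1_act (mf_variance_sum n) (fun y => variance_sum_bound n y).
have l4 := L1_xib4.
pose c0 := A + p * y + e * (y ^+ 2 - (8 ^+ n.+1 * y ^+ 4 + fourth n) / b).
pose low a := c0 + (p + 2 * e * y) * xi a x + e * (xi a x ^+ 2)
    + e * variance_sum n (act a x) + (- (e * (8 ^+ n.+1 / b))) * xib a ^+ 4.
have l1 : L1 mu (fun a => c0 + (p + 2 * e * y) * xi a x).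
  by apply: L1D; [exact: L1_cst|exact/L1Z/L1_xi].
have l2 : L1 mu (fun a => c0 + (p + 2 * e * y) * xi a x + e * (xi a x ^+ 2)).
  by apply: L1D => //; exact/L1Z/L1_xi2.
have l3 : L1 mu (fun a => c0 + (p + 2 * e * y) * xi a x + e * (xi a x ^+ 2)
    + e * variance_sum n (act a x)) by apply: L1D => //; exact: L1Z.
have ll : L1 mu low by apply: L1D => //; exact: L1Z.
have -> : A + p * y + e * (y ^+ 2 + variance_sum n.+1 x
    - (8 ^+ n.+1 * y ^+ 4 + fourth n.+1) / b) = \int[mu]_a low a.
  rewrite RintD//; last exact: L1Z.
  rewrite RintD//; last exact: L1Z.
  rewrite RintD//; last exact/L1Z/L1_xi2.
  rewrite RintD//; [|exact: L1_cst|exact/L1Z/L1_xi].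
  rewrite !RintZ//; [|exact: L1_xi2|exact: L1_xi].
  rewrite Rint_cst mean_xi -/(variance x) -/m4 -/(markov _ x) variance_sumS /c0 /=.
  by field; rewrite gt_eqF.
apply: Rint_le => //; first exact: L1_walk.
have e80 : 0 <= 8 ^+ n :> R by rewrite exprn_ge0.
move=> a; apply: le_trans (ih _ _); rewrite (_ : z + xi a x - z0 = y + xi a x); last first.
  by rewrite /y addrAC.
apply: (le_trans _ (quartic_drift A p y (fourth n) (variance_sum n (act a x)) e0 b0 e80 (xi4_le a x))).
have -> : low a = A + p * y +
  e * (y ^+ 2 - (8 * 8 ^+ n * (y ^+ 4 + xib a ^+ 4) + fourth n) / b) +
  (p + 2 * e * y) * xi a x + e * xi a x ^+ 2 + e * variance_sum n (act a x).
  by rewrite /low /c0 (exprS 8 n); field; rewrite gt_eqF.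
by [].
Qed.

(* The same walk reflected at 0: transition operator of the queue. *)
Definition queueop (f : X -> R -> R) x (m : R) :=
  \int[mu]_a f (act a x) (s a x + Num.max m 0).

(** A class stable under [queueop] on which it is linear and monotone; it contains the queue itself,
    Huber functions and squares of levels. *)
Definition qgrowth (f : X -> R -> R) := mble2 f /\
  exists2 A : R, 0 <= A & forall x (m : R), `|f x m| <= A * (1 + Num.max m 0 ^+ 2).

Lemma queueE T n : queue T n = iter n queueop (fun x m => H x (m - T)).
Proof. by elim: n => //= n <-. Qed.

Let max_step (e u m : R) : `|u| <= e -> Num.max (u + Num.max m 0) 0 ^+ 2 <=
  2 * (e ^+ 2 + Num.max m 0 ^+ 2).
Proof.
rewrite ler_norml => /andP[u1 u2]; have m0 : 0 <= Num.max m 0 by rewrite le_max lexx orbT.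
move: m0; set v := Num.max m 0 => v0.
have := sqr_ge0 (e - v); case: (leP (u + v) 0) => h; have := sqr_ge0 e; have := sqr_ge0 v; nra.
Qed.

Lemma L1_ell2 : L1 mu (fun a => ell a ^+ 2).
Proof.
apply: (L1_le (g := fun a => 1 + ell a ^+ 4)).
- by apply: mfX; exact: L1_measurable L1ell.
- by apply: L1D => //; exact: L1_cst.
- move=> a; rewrite ger0_norm ?sqr_ge0//.
  by rewrite (exprM (ell a) 2 2) sqr_le_1addsqr.
Qed.

Lemma L1_growth (f : X -> R -> R) (A : R) x (m : R) : mble2 f -> 0 <= A ->
  (forall x (m : R), `|f x m| <= A * (1 + Num.max m 0 ^+ 2)) ->
  L1 mu (fun a => f (act a x) (s a x + Num.max m 0)) /\
  `|queueop f x m| <= A * 3 * (1 + \int[mu]_a ell a ^+ 2) * (1 + Num.max m 0 ^+ 2).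
Proof.
move=> mf A0 fA.
have bd a : `|f (act a x) (s a x + Num.max m 0)| <=
    (A * 2) * ell a ^+ 2 + A * (1 + 2 * Num.max m 0 ^+ 2).
  apply: le_trans (fA _ _) _; have h := max_step m (s_ell a x).
  rewrite -mulrA -mulrDr ler_wpM2l//; apply: le_trans (lerD (lexx 1) h) _.
  by rewrite mulrDr addrCA.
have lg : L1 mu (fun a => (A * 2) * ell a ^+ 2 + A * (1 + 2 * Num.max m 0 ^+ 2)).
  by apply: L1D; [exact/L1Z/L1_ell2|exact: L1_cst].
have mfa : mble (fun a => f (act a x) (s a x + Num.max m 0)).
  exact: (mf_pair2 (f := fun w : G * (X * R) =>
    f (act w.1 w.2.1) (s w.1 w.2.1 + Num.max w.2.2 0)) (x, m) (mf_step mf)).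
have l := L1_le mfa lg bd; split => //.
apply: le_trans (Rint_norm l) _; apply: le_trans (Rint_le (L1_norm l) lg bd) _.
rewrite RintD; [|exact/L1Z/L1_ell2|exact: L1_cst].
rewrite Rint_cst RintZ; last exact: L1_ell2.
have := Rint_ge0 mu (fun a => sqr_ge0 (ell a)); have := sqr_ge0 (Num.max m 0).
move: A A0 {fA bd lg} (_ ^+ 2) (\int[mu]_a _) => B B0 u v u0 v0.
rewrite -!mulrA -mulrDr ler_wpM2l//.
have : 0 <= v * u by rewrite mulr_ge0.
by nra.
Qed.

Lemma L1_qgrowth f x (m : R) : qgrowth f ->
  L1 mu (fun a => f (act a x) (s a x + Num.max m 0)).
Proof. by move=> [mf [A A0 fA]]; have [] := L1_growth x m mf A0 fA. Qed.

Lemma qgrowth_op f : qgrowth f -> qgrowth (queueop f).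
Proof.
move=> [mf [A A0 fA]]; split.
  exact: (mf_Rint1 (f := fun w : G * (X * R) =>
    f (act w.1 w.2.1) (s w.1 w.2.1 + Num.max w.2.2 0)) (mf_step mf)).
exists (A * 3 * (1 + \int[mu]_a ell a ^+ 2)).
  by rewrite !mulr_ge0// addr_ge0//; apply: Rint_ge0 => a; exact: sqr_ge0.
by move=> x m; have [] := L1_growth x m mf A0 fA.
Qed.

Lemma qgrowth_iter n f : qgrowth f -> qgrowth (iter n queueop f).
Proof. by move=> qf; elim: n => //= n; exact: qgrowth_op. Qed.

Lemma queueop_le f g : qgrowth f -> qgrowth g -> (forall x m, f x m <= g x m) ->
  forall x m, queueop f x m <= queueop g x m.
Proof. by move=> qf qg fg x m; apply: Rint_le => [||a]; [exact: L1_qgrowth..|]. Qed.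

Lemma iter_queueop_le n f g : qgrowth f -> qgrowth g -> (forall x m, f x m <= g x m) ->
  forall x m, iter n queueop f x m <= iter n queueop g x m.
Proof.
move=> qf qg fg; elim: n => //= n ih x m.
by apply: queueop_le => //; exact: qgrowth_iter.
Qed.

Lemma qgrowth_lin f g (c d : R) : qgrowth f -> qgrowth g ->
  qgrowth (fun x m => c * f x m + d * g x m).
Proof.
move=> [mf [A A0 fA]] [mg [B B0 gB]]; split.
  by apply: mfD; apply: mfM.
exists (`|c| * A + `|d| * B); first by rewrite addr_ge0// mulr_ge0.
move=> x m; apply: le_trans (ler_normD _ _) _; rewrite mulrDl !normrM.
by apply: lerD; rewrite -mulrA ler_wpM2l.
Qed.

Lemma iter_queueop_lin n f g (c d : R) x m : qgrowth f -> qgrowth g ->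
  iter n queueop (fun x m => c * f x m + d * g x m) x m =
  c * iter n queueop f x m + d * iter n queueop g x m.
Proof.
move=> qf qg; elim: n x m => //= n ih x m.
transitivity (queueop (fun x m => c * iter n queueop f x m + d * iter n queueop g x m) x m).
  by apply: eq_Rint => a; exact: ih.
have lf := L1_qgrowth x m (qgrowth_iter n qf).
have lg := L1_qgrowth x m (qgrowth_iter n qg).
by rewrite /queueop RintD ?RintZ//; exact: L1Z.
Qed.

Lemma qgrowth_cst (c : R) : qgrowth (fun _ _ => c).
Proof.
split; first exact: measurable_cst.
exists `|c| => // x m; rewrite ler_peMr// lerDl sqr_ge0//.
Qed.

Lemma iter_queueop_cst n (c : R) x m : iter n queueop (fun _ _ => c) x m = c.
Proof.
elim: n x m => //= n ih x m; rewrite /queueop.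
by under eq_Rint do rewrite ih; rewrite Rint_cst.
Qed.

(** Height of the queue, corrected by [potential] so as to dominate a martingale; [Theta] makes the
    correction non-negative and [B] is a margin above 0. *)
Definition level (B : R) x (m : R) := Num.max m 0 + (potential x + Theta + B).

Lemma potential_range x : 0 <= potential x + Theta <= Theta *+ 2.
Proof.
have := potential_bounded x; rewrite ler_norml mulr2n => /andP[h1 h2].
by rewrite -lerBlDr sub0r h1 lerD2r.
Qed.

Lemma level_range B x (m : R) : Num.max m 0 + B <= level B x m <= Num.max m 0 + (Theta *+ 2 + B).
Proof.
have /andP[h1 h2] := potential_range x.
by rewrite /level !lerD2l lerD2r h2 andbT lerDr.
Qed.

Lemma mf_level B : mble2 (level B).
Proof.
apply: mfD; first exact: measurable_maxr.
apply: mfD => //; apply: mfD => //.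
by apply: mf_comp => //; exact: mf_potential.
Qed.

(** Reflection at 0 only pushes upwards, so the level gains at least the martingale increment. *)
Lemma level_step B a x (m : R) :
  level B x m + xi a x <= level B (act a x) (s a x + Num.max m 0).
Proof.
rewrite /level /xi; set u := s a x; set v := Num.max m 0.
apply: (@le_trans _ _ ((u + v) + (potential (act a x) + Theta + B))).
  by rewrite (_ : v + (potential x + Theta + B) + (u + potential (act a x) - potential x) =
    u + v + (potential (act a x) + Theta + B))//; ring.
by rewrite lerD2r le_max lexx.
Qed.

Lemma qgrowth_level2 B : 0 <= B -> qgrowth (fun x m => level B x m ^+ 2).
Proof.
move=> B0; have t0 : 0 <= Theta *+ 2 + B by rewrite addr_ge0// mulrn_wge0 ?Theta_ge0.
split; first by apply: mfX; exact: mf_level.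
exists (2 * (1 + (Theta *+ 2 + B) ^+ 2)); first by rewrite mulr_ge0// addr_ge0// sqr_ge0.
move=> x m; rewrite ger0_norm ?sqr_ge0//.
have /andP[h1 h2] := level_range B x m.
have m0 : 0 <= Num.max m 0 by rewrite le_max lexx orbT.
move: h1 h2 m0 t0 B0; move: (level B x m) (Num.max m 0) (Theta *+ 2 + B) => l u t h1 h2 m0 t0 B0.
have : l ^+ 2 <= (u + t) ^+ 2 by rewrite ler_sqr ?nnegrE//; lra.
have := sqr_ge0 (u - t); have := mulr_ge0 (sqr_ge0 u) (sqr_ge0 t); nra.
Qed.

Lemma qgrowth_huber rho B : 0 <= rho -> 0 <= B ->
  qgrowth (fun x m => huber rho (level B x m)).
Proof.
move=> r0 B0; have [_ [A A0 hA]] := qgrowth_level2 B0; split.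
  have mh : mble (huber rho).
    apply: mfB; apply: mfX; apply: measurable_maxr => //.
    exact: mfB.
  by apply: mf_comp => //; exact: mf_level.
exists (rho * (A + 1)); first by rewrite mulr_ge0// addr_ge0.
move=> x m; rewrite ger0_norm ?huber_ge0//.
apply: le_trans (huber_le_quad _ r0 ltr01) _; rewrite -mulrA ler_wpM2l//.
rewrite mul1r invr1 mulrDl; apply: lerD.
  by have := hA x m; rewrite ger0_norm ?sqr_ge0.
by rewrite mul1r lerDl sqr_ge0.
Qed.

Lemma iter_queueop_huber rho B n x m : 0 <= rho -> 0 <= B ->
  walk rho n x (level B x m) <=
  iter n queueop (fun x m => huber rho (level B x m)) x m.
Proof.
move=> r0 B0; elim: n x m => [|n ih] x m //=.
apply: Rint_le => [||a]; first exact: L1_walk.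
  exact/L1_qgrowth/qgrowth_iter/qgrowth_huber.
apply: le_trans (ih _ _); apply: walk_mono => //; exact: level_step.
Qed.

Definition level2_step B := m2 + (Theta *+ 2 + B) ^+ 2.

(** Without reflection the level moves by [xi], of mean 0 and variance at most [m2]; after a
    reflection it is at most [Theta *+ 2 + B]. The sum of the two squares covers both cases. *)
Lemma queueop_level2 B x (m : R) : 0 <= B ->
  queueop (fun x m => level B x m ^+ 2) x m <= level B x m ^+ 2 + level2_step B.
Proof.
move=> B0; set z := level B x m.
have t0 : 0 <= Theta *+ 2 + B by rewrite addr_ge0// mulrn_wge0 ?Theta_ge0.
pose up a := (z ^+ 2 + (Theta *+ 2 + B) ^+ 2) + (2 * z) * xi a x + xi a x ^+ 2.
have l1 : L1 mu (fun a => (z ^+ 2 + (Theta *+ 2 + B) ^+ 2) + (2 * z) * xi a x).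
  by apply: L1D; [exact: L1_cst|exact/L1Z/L1_xi].
have lu : L1 mu up by apply: L1D => //; exact: L1_xi2.
apply: (@le_trans _ _ (\int[mu]_a up a)).
  apply: Rint_le => //; first exact: (L1_qgrowth x m (qgrowth_level2 B0)).
  move=> a; rewrite /up.
  have [/ltW h|h] := ltP (s a x + Num.max m 0) 0.
    have l0 : level B (act a x) (s a x + Num.max m 0) ^+ 2 <= (Theta *+ 2 + B) ^+ 2.
      have := level_range B (act a x) (s a x + Num.max m 0).
      rewrite (max_idPr h) !add0r => /andP[h1 h2].
      by rewrite ler_sqr ?nnegrE// (le_trans B0).
    apply: le_trans l0 _; rewrite (_ : _ + _ + _ + _ = (z + xi a x) ^+ 2 + (Theta *+ 2 + B) ^+ 2); last by ring.
    by rewrite lerDr sqr_ge0.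
  have -> : level B (act a x) (s a x + Num.max m 0) = z + xi a x.
    by rewrite /z /level /xi (max_idPl h); ring.
  rewrite (_ : _ + _ + _ = (z + xi a x) ^+ 2 + (Theta *+ 2 + B) ^+ 2); last by ring.
  by rewrite lerDl sqr_ge0.
rewrite RintD//; last exact: L1_xi2.
rewrite RintD//; [|exact: L1_cst|exact/L1Z/L1_xi].
rewrite RintZ ?mean_xi ?mulr0 ?addr0; last exact: L1_xi.
rewrite Rint_cst -/(variance x) /level2_step -addrA lerD2l addrC lerD2r.
exact: variance_le.
Qed.

Lemma iter_queueop_level2 B n x m : 0 <= B ->
  iter n queueop (fun x m => level B x m ^+ 2) x m <= level B x m ^+ 2 + level2_step B *+ n.
Proof.
move=> B0; elim: n x m => [|n ih] x m; first by rewrite addr0.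
have q2 := qgrowth_level2 B0.
have qc := qgrowth_cst (level2_step B *+ n).
apply: le_trans (queueop_le (g := fun x m => 1 * level B x m ^+ 2 + 1 * (level2_step B *+ n)) _ _ _ x m) _.
- exact: qgrowth_iter.
- exact: qgrowth_lin.
- by move=> y u; rewrite !mul1r; exact: ih.
have := @iter_queueop_lin 1 _ _ 1 1 x m q2 qc; rewrite /= => ->.
have := iter_queueop_cst 1 (level2_step B *+ n) x m; rewrite /= => ->.
rewrite !mul1r mulrS addrA lerD2r; exact: queueop_level2.
Qed.

(** * Decay in time of the queue started at 0, for a positive variance *)

Section Decay.
Hypothesis variance_gt0 : 0 < mean_variance.

Lemma variance_sum_large : exists n, forall x, 2 <= variance_sum n x.
Proof.
have hn := archi_boundP (normr_ge0 ((2 + KV / (1 - r)) / mean_variance)).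
set n := Num.bound _ in hn; exists n => x; apply: le_trans (variance_sum_ge n x).
rewrite lerBrDr -[mean_variance *+ n]mulr_natl -ler_pdivrMr//; apply: le_trans (ler_norm _) (ltW hn).
Qed.

End Decay.

Lemma fourth_ge0 n : 0 <= fourth n.
Proof.
elim: n => //= n ih; rewrite addr_ge0// mulr_ge0 ?exprn_ge0//.
by apply: Rint_ge0 => a; rewrite exprn_even_ge0.
Qed.

(** At least 1 and at least [fourth n], so that the quartic correction [fourth n / margin n ^ 2] is
    at most 1. *)
Definition margin n := 1 + fourth n.
(** As long as [m <= T + C], the level stays at distance at least [margin n] from both 0 and
    [radius n T], which is what [huber_tangent_quad] asks for. *)
Definition radius n (T : R) := T + C + Theta *+ 2 + margin n *+ 2.

Lemma margin_ge0 n : 0 <= margin n. Proof. by rewrite addr_ge0// fourth_ge0. Qed.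

Lemma radius_ge0 n (T : R) : C <= T -> 0 <= radius n T.
Proof.
move=> CT; by rewrite /radius addr_ge0 ?(mulrn_wge0 _ (margin_ge0 n))// addr_ge0 ?(mulrn_wge0 _ Theta_ge0)//
  addr_ge0// (le_trans C_ge0).
Qed.

Notation Phi n T := (fun x m => huber (radius n T) (level (margin n) x m)).

(** The Huber function of the level is a Lyapunov function. For [m <= T + C], its mean over [n]
    steps grows by at least 1: a variance of at least 2 minus a quartic correction of at most 1. For
    larger [m] it does not decrease, and [H] vanishes. *)
Lemma huber_drift n (T : R) x (m : R) : (forall x, 2 <= variance_sum n x) -> C <= T ->
  K * Phi n T x m + H x (m - T) <= K * iter n queueop (Phi n T) x m.
Proof.
move=> v2 CT; have r0 := radius_ge0 n CT; have B0 := margin_ge0 n.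
have B1 : 1 <= margin n by rewrite lerDl fourth_ge0.
have Bp : 0 < margin n by apply: lt_le_trans B1.
have hw := iter_queueop_huber n x m r0 B0.
set z0 := level (margin n) x m in hw *.
have [hm|hm] := leP m (T + C).
  have /andP[l1 l2] := level_range (margin n) x m.
  have m0 : 0 <= Num.max m 0 by rewrite le_max lexx orbT.
  have mT : Num.max m 0 <= T + C by rewrite ge_max hm addr_ge0// (le_trans C_ge0).
  have [z1 z2] := level_window m0 mT l1 l2 B0.
  have b0 : 0 < margin n ^+ 2 by rewrite exprn_gt0.
  have ht z : huber (radius n T) z0 + 2 * z0 * (z - z0) +
      1 * ((z - z0) ^+ 2 - (z - z0) ^+ 4 / margin n ^+ 2) <= huber (radius n T) z.
    by rewrite mul1r; exact: huber_tangent_quad.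
  have := walk_lower n x z0 r0 ler01 b0 ht.
  rewrite subrr !expr0n/= !mulr0 addr0 !add0r mul1r => hl.
  apply: (@le_trans _ _ (K * (huber (radius n T) z0 + 1))).
    by rewrite [leRHS]mulrDr mulr1 lerD2l.
  rewrite ler_wpM2l//; apply: le_trans hw; apply: le_trans hl; rewrite lerD2l.
  rewrite lerBrDr; apply: le_trans (v2 x); rewrite -[leRHS]/(1 + 1) lerD2l.
  rewrite ler_pdivrMr// mul1r; apply: (@le_trans _ _ (margin n)); first by rewrite lerDr.
  by rewrite expr2 ler_peMr.
rewrite H_out ?addr0; last by rewrite lerBrDl ltW.
rewrite ler_wpM2l//; apply: le_trans hw.
(* Beyond [T + C] plain convexity suffices: this is [walk_lower] with [e = 0]. *)
have [p hp] := huber_tangent z0 r0.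
have ht z : huber (radius n T) z0 + p * (z - z0) +
    0 * ((z - z0) ^+ 2 - (z - z0) ^+ 4 / 1) <= huber (radius n T) z.
  by rewrite mul0r addr0.
have := walk_lower n x z0 r0 (lexx 0) ltr01 ht.
by rewrite subrr mulr0 mul0r !addr0.
Qed.

Lemma qgrowth_queue (T : R) n : qgrowth (queue T n).
Proof.
split; first exact: mf_queue.
exists K => [|x m]; first exact: K_ge0.
apply: le_trans (queue_norm T n x m) _.
by rewrite ler_peMr// lerDl sqr_ge0.
Qed.

Lemma queueD (T : R) n k : queue T (n + k) = iter n queueop (queue T k).
Proof. by rewrite !queueE iterD. Qed.

(** [huber_drift] telescopes when applied every [n] steps: the visits of the queue to levels where
    [H] does not vanish are paid for by the growth of the Huber function. *)
Lemma sum_queue_le n (T : R) N x (m : R) : (forall x, 2 <= variance_sum n x) -> C <= T ->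
  K * Phi n T x m + \sum_(i < N) queue T (i * n) x m <=
  K * iter (N * n) queueop (Phi n T) x m.
Proof.
move=> v2 CT; elim: N => [|N ih]; first by rewrite big_ord0 addr0 mul0n.
have qP : qgrowth (Phi n T) by apply: qgrowth_huber; [exact: radius_ge0|exact: margin_ge0].
have q0 := qgrowth_queue T 0.
rewrite big_ord_recr/= addrA; apply: le_trans (lerD ih (lexx _)) _.
have := iter_queueop_le (N * n) (qgrowth_lin K 1 qP q0) (qgrowth_lin K 0 (qgrowth_iter n qP) q0)
  (fun y u => _) x m.
rewrite !iter_queueop_lin//; last exact: qgrowth_iter.
rewrite mul0r addr0 mul1r -iterD -queueD addn0 mulSn addnC; apply => y u.
by rewrite mul1r mul0r addr0; exact: huber_drift.
Qed.

Definition decay_cst n := (Theta *+ 2 + margin n) ^+ 2 + level2_step (margin n) *+ n + 1.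

Lemma decay_cst_ge1 n : 1 <= decay_cst n.
Proof.
rewrite lerDr addr_ge0 ?sqr_ge0// mulrn_wge0// addr_ge0 ?m2_ge0//; exact: sqr_ge0.
Qed.

Let sqrt_scale (a b rho q : R) : 1 <= q -> 0 <= a -> 0 <= b -> 0 <= rho ->
  rho * (q^-1 * (a + b * q ^+ 2) + q) <= rho * q * (a + b + 1).
Proof.
move=> q1 a0 b0 r0; have q0 : 0 < q by apply: lt_le_trans q1.
rewrite -mulrA ler_wpM2l//.
have -> : q * (a + b + 1) = q^-1 * (a * q ^+ 2 + b * q ^+ 2) + q by field; rewrite gt_eqF.
rewrite lerD2r ler_wpM2l ?invr_ge0 ?(ltW q0)// lerD2r ler_peMr// expr2.
by rewrite -[1]mulr1 ler_pM.
Qed.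

(** Squares of levels grow linearly in time, so over [q ^ 2 * n] steps [huber_le_quad] with
    [lam = 1 / q] gives the diffusive order [radius n T * q]. *)
Lemma iter_huber_le n (T : R) q x : C <= T -> (0 < q)%N ->
  iter (q ^ 2 * n) queueop (Phi n T) x 0 <= radius n T * q%:R * decay_cst n.
Proof.
move=> CT q0; have r0 := radius_ge0 n CT; have B0 := margin_ge0 n.
have t0 : 0 <= Theta *+ 2 + margin n by rewrite addr_ge0// mulrn_wge0 ?Theta_ge0.
have qi : 0 < q%:R^-1 :> R by rewrite invr_gt0 ltr0n.
have q2 := qgrowth_level2 B0; have qc := qgrowth_cst 1.
have qh : qgrowth (Phi n T) by exact: qgrowth_huber.
have h := iter_queueop_le (q ^ 2 * n) qh
  (qgrowth_lin (radius n T * q%:R^-1) (radius n T * q%:R) q2 qc) (fun y u => _) x 0.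
apply: le_trans (h _) _ => {h}.
  move=> y u; apply: le_trans (huber_le_quad _ r0 qi) _.
  by rewrite invrK mulr1 mulrDr mulrA.
rewrite iter_queueop_lin// iter_queueop_cst mulr1.
have l2 := iter_queueop_level2 (q ^ 2 * n) x 0 B0.
have h0 : level (margin n) x 0 ^+ 2 <= (Theta *+ 2 + margin n) ^+ 2.
  have /andP[h1 h2] := level_range (margin n) x 0.
  rewrite maxxx !add0r in h1 h2.
  by rewrite ler_sqr ?nnegrE// (le_trans B0).
have s0 : 0 <= level2_step (margin n) *+ n.
  by rewrite mulrn_wge0// addr_ge0 ?m2_ge0//; exact: sqr_ge0.
have q1 : 1 <= q%:R :> R by rewrite ler1n.
apply: (le_trans _ (sqrt_scale q1 (sqr_ge0 _) s0 r0)).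
rewrite [leRHS]mulrDr lerD2r -mulrA !ler_wpM2l ?(ltW qi)//.
apply: le_trans l2 _; apply: lerD => //.
by rewrite mulnC mulrnA -[leLHS]mulr_natr natrX.
Qed.

Lemma mean_base_noninc_le (T : R) i j : C <= T -> (i <= j)%N ->
  mean_base T j <= mean_base T i.
Proof.
move=> CT /subnK <-; elim: (j - i)%N => // k; apply: le_trans.
exact: mean_base_noninc.
Qed.

(** [mean_base] is non-increasing, so [q ^ 2] times its last value is at most the mean of the sum in
    [sum_queue_le], which is of order [radius n T * q]. *)
Lemma mean_base_decay n (T : R) q : (forall x, 2 <= variance_sum n x) -> C <= T -> (0 < q)%N ->
  mean_base T (q ^ 2 * n) * q%:R <= K * radius n T * decay_cst n.
Proof.
move=> v2 CT q0; have q1 : 0 < q%:R :> R by rewrite ltr0n.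
rewrite -(ler_pM2r q1) -[leLHS]mulrA -expr2 -natrX mulr_natr.
have l i : L1 nu (fun x => queue T (i * n) x 0) by exact: L1_base.
apply: (@le_trans _ _ (\int[nu]_x \sum_(i < q ^ 2) queue T (i * n) x 0)).
  rewrite (@Rint_sum _ _ _ nu _ (fun i x => queue T (i * n) x 0))//.
  rewrite -[X in _ *+ X](card_ord (q ^ 2)) -sumr_const; apply: ler_sum => i _.
  by apply: mean_base_noninc_le => //; rewrite leq_mul2r; apply/orP; right; apply/ltnW/ltn_ord.
apply: Rint_lec => [|x]; first exact: (L1_sum (f := fun i x => queue T (i * n) x 0)).
apply: (@le_trans _ _ (K * Phi n T x 0 + \sum_(i < q ^ 2) queue T (i * n) x 0)).
  by rewrite lerDr mulr_ge0// huber_ge0// radius_ge0.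
apply: le_trans (sum_queue_le _ x 0 v2 CT) _.
rewrite -!mulrA ler_wpM2l// (mulrC (decay_cst n)) mulrA; exact: iter_huber_le.
Qed.

(** * The degenerate case of zero variance *)

Definition xiabs x := \int[mu]_a `|xi a x|.

Lemma mf_xiabs : mble xiabs.
Proof.
apply: (mf_Rint1 (f := fun z => `|xi z.1 z.2|)).
by apply: mf_comp => //; exact: mf_xi.
Qed.

Lemma xiabs_ge0 x : 0 <= xiabs x. Proof. exact: Rint_ge0. Qed.

Lemma xiabs_le x : `|xiabs x| <= mean_xib.
Proof.
rewrite ger0_norm ?xiabs_ge0//; apply: Rint_le; [exact/L1_norm/L1_xi|exact: L1_xib|by move=> a; exact: xi_le].
Qed.

(** [norm_le_quad] with [e] arbitrarily small plays the role of the Cauchy-Schwarz inequality. *)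
Lemma mean_xiabs0 : mean_variance = 0 -> \int[nu]_x xiabs x = 0.
Proof.
move=> v0; apply/eqP; rewrite eq_le (Rint_ge0 _ xiabs_ge0) andbT.
apply/ler_addgt0Pl => e e0; rewrite addr0.
have lv : L1 nu (fun x => e^-1 * variance x).
  by apply: L1Z; exact: L1_bounded _ mf_variance variance_norm.
apply: (@le_trans _ _ (\int[nu]_x (e + e^-1 * variance x))).
  apply: Rint_le => [||x].
  - exact: L1_bounded _ mf_xiabs xiabs_le.
  - by apply: L1D => //; exact: L1_cst.
  - have lx := L1Z e^-1 (L1_xi2 x).
    have -> : e + e^-1 * variance x = \int[mu]_a (e + e^-1 * xi a x ^+ 2).
      by rewrite (RintD (L1_cst mu e) lx) Rint_cst RintZ//; exact: L1_xi2.
    apply: Rint_le => [||a]; [exact/L1_norm/L1_xi|by apply: L1D => //; exact: L1_cst|].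
    by rewrite -[xi a x ^+ 2]real_normK ?num_real//; exact: norm_le_quad.
rewrite RintD//; last exact: L1_cst.
rewrite Rint_cst RintZ; last exact: L1_bounded _ mf_variance variance_norm.
by rewrite -/mean_variance v0 mulr0 addr0.
Qed.

Lemma level_overshoot a x (m A : R) : Theta *+ 2 <= A ->
  Num.max (level 0 (act a x) (s a x + Num.max m 0) - A) 0 <=
  Num.max (level 0 x m - A) 0 + `|xi a x|.
Proof.
move=> hA.
have [/ltW h|h] := ltP (s a x + Num.max m 0) 0.
  have /andP[_ h2] := level_range 0 (act a x) (s a x + Num.max m 0).
  rewrite (max_idPr h) add0r addr0 in h2.
  rewrite (max_idPr _) ?addr_ge0// ?le_max ?lexx ?orbT//.
  by rewrite subr_le0 (le_trans h2).
have -> : level 0 (act a x) (s a x + Num.max m 0) = level 0 x m + xi a x.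
  by rewrite /level /xi (max_idPl h); ring.
exact: max0_step.
Qed.

Let Hin x := H x (- C).

Lemma mf_Hin : mble Hin.
Proof. exact: (mf_pair2 (f := fun z : X * R => H z.1 z.2)). Qed.

Lemma Hin_norm x : `|Hin x| <= K.
Proof. by rewrite ger0_norm /Hin. Qed.

Definition xisum n x := \sum_(k < n) iter k markov xiabs x.

Lemma mf_xisum n : mble (xisum n).
Proof. by apply: measurable_sum => k; exact/mf_iter/mf_xiabs. Qed.

Lemma xisum_bound n x : `|xisum n x| <= mean_xib *+ n.
Proof.
apply: le_trans (ler_norm_sum _ _ _) _; rewrite -[in leRHS](card_ord n) -sumr_const.
apply: ler_sum => k _.
exact: iter_bounded mf_xiabs xiabs_le.
Qed.

Lemma xisumS n x : xisum n.+1 x = xiabs x + markov (xisum n) x.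
Proof.
rewrite /xisum big_ord_recl/=; congr (_ + _).
apply/esym; apply: (@Rint_sum _ _ _ mu n (fun i a => iter i markov xiabs (act a x))).
move=> i _; apply: (@L1_act _ mean_xib); first exact/mf_iter/mf_xiabs.
by move=> y; exact: iter_bounded mf_xiabs xiabs_le.
Qed.

(** The queue falls below the unkilled value [iter n markov Hin x] only when the level climbs above
    [T - C], and by [level_overshoot] each step raises the overshoot by at most the size of [xi]. *)
Lemma queue_lower n (T : R) x (m : R) : C <= T -> Theta *+ 2 <= T - C ->
  iter n markov Hin x - queue T n x m <=
  K * (Num.max (level 0 x m - (T - C)) 0 + xisum n x).
Proof.
move=> CT hT; elim: n x m => [|n ih] x m /=.
  rewrite /xisum big_ord0 addr0 /Hin.
  have l1 : m <= level 0 x m.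
    have /andP[l1 _] := level_range 0 x m; apply: le_trans l1.
    by rewrite addr0 le_max lexx.
  have [h|/ltW h] := leP (m - T) (- C).
    by rewrite (H_in _ h) subrr mulr_ge0// le_max lexx orbT.
  apply: le_trans (ler_norm _) _; apply: le_trans (H_lip _ _ _) _.
  rewrite ler_wpM2l// distrC ger0_norm ?subr_ge0// le_max; apply/orP; left.
  by rewrite opprK opprB -addrA [- T + C]addrC lerD2r.
have lm := L1_act x (mf_iter n mf_Hin)
  (fun y => iter_bounded n y mf_Hin Hin_norm).
have lq := L1_queue T n x m.
have lx := L1_act x (mf_xisum n) (xisum_bound n).
have la := L1_norm (L1_xi x).
set p := Num.max (level 0 x m - (T - C)) 0.
have lr : L1 mu (fun a => K * ((p + `|xi a x|) + xisum n (act a x))).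
  by apply: L1Z; apply: L1D => //; apply: L1D => //; exact: L1_cst.
rewrite {1}/markov -(RintB lm lq).
apply: le_trans (Rint_le (L1B lm lq) lr _) _.
  move=> a; apply: le_trans (ih _ _) _; rewrite ler_wpM2l// lerD2r.
  exact: level_overshoot.
rewrite RintZ; last by apply: L1D => //; apply: L1D => //; exact: L1_cst.
rewrite RintD//; last by apply: L1D => //; exact: L1_cst.
by rewrite RintD ?Rint_cst//; [rewrite xisumS addrA|exact: L1_cst].
Qed.

(** With zero variance the stationary mean of the overshoot accumulated from level 0 vanishes, so
    that nothing is lost. *)
Lemma mean_base_cst n (T : R) : mean_variance = 0 -> C <= T -> Theta *+ 2 <= T - C ->
  mean_base T n = mean_base T 0.
Proof.
move=> v0 CT hT; apply/eqP; rewrite eq_le mean_base_noninc_le//=.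
have e0 : mean_base T 0 = \int[nu]_x iter n markov Hin x.
  rewrite (integral_iter_markov n mf_Hin Hin_norm); apply: eq_Rint => x.
  by rewrite /base/= /Hin H_in// sub0r lerN2.
rewrite e0 -subr_le0 -RintB.
- have h x : iter n markov Hin x - base T n x <= K * xisum n x.
    apply: le_trans (queue_lower n x 0 CT hT) _.
    have /andP[_ h2] := level_range 0 x 0; rewrite maxxx add0r addr0 in h2.
    by rewrite (max_idPr _) ?add0r// subr_le0 (le_trans h2).
  have lxs : L1 nu (xisum n) := L1_bounded _ (mf_xisum n) (xisum_bound n).
  apply: le_trans (Rint_le _ (L1Z K lxs) h) _.
    apply: L1B; last exact: L1_base.
    apply: (L1_bounded _ (mf_iter n mf_Hin)) => y.
    exact: iter_bounded mf_Hin Hin_norm.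
  rewrite RintZ// (@Rint_sum _ _ _ nu n (fun i => iter i markov xiabs)).
    rewrite big1 ?mulr0// => i _.
    by rewrite (integral_iter_markov i mf_xiabs xiabs_le) mean_xiabs0.
  move=> i _; apply: (L1_bounded _ (mf_iter i mf_xiabs)) => y.
  exact: iter_bounded mf_xiabs xiabs_le.
- apply: (L1_bounded _ (mf_iter n mf_Hin)) => y.
  exact: iter_bounded mf_Hin Hin_norm.
- exact: L1_base.
Qed.

Definition decay_sum n (T : R) := K * (K + K * radius n T * decay_cst n).

(** The square of [mean_base] is at most [K] times the bound of [mean_base_decay] at
    [q = 4 ^ l - 1]. This geometric mean weakens the decay from [4 ^- l] to [2 ^- l] but lowers the
    dependence on [T] from linear to a square root. *)
Lemma mean_base_block n (T : R) l : (0 < n)%N -> (forall x, 2 <= variance_sum n x) -> C <= T ->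
  mean_base T (block n l) <= Num.sqrt (decay_sum n T) * 2^-1 ^+ l.
Proof.
move=> n0 v2 CT; set f := mean_base _ _.
have f0 : 0 <= f by exact: mean_base_ge0.
have fK : f <= K by exact: mean_base_leK.
have Z0 : 0 <= K * radius n T * decay_cst n.
  by rewrite !mulr_ge0 ?radius_ge0// (le_trans ler01)// decay_cst_ge1.
have fq : f * (4 ^ l - 1)%:R <= K * radius n T * decay_cst n.
  have [q0|q0] := posnP (4 ^ l - 1)%N; first by rewrite q0 mulr0.
  apply: le_trans (mean_base_decay v2 CT q0); rewrite ler_wpM2r//.
  apply: mean_base_noninc_le => //; rewrite /block mulnC leq_mul2l; apply/orP; right.
  exact: sqr_pred_pow4.
have f4 : f * 4 ^+ l <= K + K * radius n T * decay_cst n.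
  have -> : 4 ^+ l = 1 + (4 ^ l - 1)%:R :> R.
    by rewrite natrB ?expn_gt0// natrX addrC subrK.
  by rewrite mulrDr mulr1 lerD.
have f2 : f * 2 ^+ l <= Num.sqrt (decay_sum n T).
  rewrite -(ler_sqr) ?nnegrE ?mulr_ge0 ?exprn_ge0 ?sqrtr_ge0//.
  rewrite sqr_sqrtr; last by rewrite mulr_ge0// addr_ge0.
  rewrite exprMn -exprM mulnC exprM (_ : 2 ^+ 2 = 4); last by ring.
  by rewrite expr2 -mulrA; apply: ler_pM => //; rewrite mulr_ge0// exprn_ge0.
by rewrite exprVn ler_pdivlMr// exprn_gt0.
Qed.

(** [c] depends neither on [T] nor on [L]. The times [u L] are ends of blocks; a subsequence is
    enough because the convergence in [n] is part of the definition of the harmonic measure. *)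
Theorem mean_integrated_asymptotic (Ct q1 : R) : 0 <= Ct -> 0 <= q1 -> q1 < 1 ->
    (forall n, tail_ell n%:R <= Ct * q1 ^+ n) ->
  exists c, exists2 u : nat -> nat, (forall L, (L <= u L)%N) &
    forall (T : R) L, C + Theta *+ 2 <= T ->
    `|mean_integrated T (u L) - T * \int[nu]_x H x (- C)| <= c * (1 + Num.sqrt T).
Proof.
move=> Ct0 q10 q11 htail.
have r1 : 0 < 1 - r by rewrite subr_gt0.
have KM0 : 0 <= KM / (1 - r) by rewrite divr_ge0 ?KM_ge0 ?(ltW r1).
have KX : 0 <= K * Ct + KM / (1 - r) by rewrite addr_ge0// mulr_ge0.
have pos n b : 0 <= KM / (1 - r) + n%:R * (K * Ct + KM / (1 - r)) * b%:R ^+ 2 * 22 + C * K.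
  apply: addr_ge0; last exact: mulr_ge0.
  by apply: addr_ge0 => //; rewrite mulr_ge0// mulr_ge0 ?sqr_ge0// mulr_ge0.
have [b [b1 b2]] : exists b, q1 ^+ b <= 32^-1 /\ r ^+ b <= 32^-1.
  exact: common_power_small.
(* Only the differences of [mean_base] matter, so it may be replaced by any [f] with the same
   differences: 0 when the variance vanishes, [mean_base T] otherwise. *)
have main (T : R) n0 c1 L : (0 < n0)%N -> C <= T -> 0 <= c1 ->
    (exists f : nat -> R, [/\ forall j, 0 <= f j,
       forall j, mean_base T j - mean_base T j.+1 = f j - f j.+1 &
       forall l, f (block n0 l) <= c1 * 2^-1 ^+ l]) ->
    `|mean_integrated T (block n0 L) - T * \int[nu]_x H x (- C)| <=
      KM / (1 - r) + (c1 + n0%:R * (K * Ct + KM / (1 - r))) * b.+1%:R ^+ 2 * 22 + C * K.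
  move=> n00 CT c10 [f [f0 fE fb]].
  have h1 := mean_integrated_sum CT (block n0 L) (window n0 b).
  have h2 := block_sum_le L n00 c10 K_ge0 Ct0 KM0 q10 r_ge0 b1 b2 htail f0 fb.
  have h3 := mean_integrated0 CT.
  apply: (ler_norm_trans _ h3); apply: le_trans h1 _; rewrite lerD2l.
  apply: le_trans h2; apply: ler_sum => j _; rewrite fE lerD2l.
  by rewrite mulrAC.
have TC T : C + Theta *+ 2 <= T -> C <= T.
  by apply: le_trans; rewrite lerDl mulrn_wge0 ?Theta_ge0.
have sT (T : R) : 1 <= 1 + Num.sqrt T by rewrite lerDl sqrtr_ge0.
have [v0|v0] := eqVneq mean_variance 0.
  exists (KM / (1 - r) + (0 + 1%:R * (K * Ct + KM / (1 - r))) * b.+1%:R ^+ 2 * 22 + C * K).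
  exists (block 1) => [L|T L hT]; first exact: leq_block.
  apply: (@le_trans _ _ _ _ _ (main T 1%N 0 L _ (TC T hT) _ _)) => //; last first.
    rewrite ler_peMr//.
    by rewrite add0r; exact: pos.
  exists (fun=> 0); split => [j|j|l]; rewrite ?mul0r//.
  rewrite !(mean_base_cst _ v0 (TC T hT)) ?subrr//.
  by rewrite lerBrDl.
  by rewrite lerBrDl.
have {}v0 : 0 < mean_variance by rewrite lt0r v0 Rint_ge0//; exact: variance_ge0.
have [n v2] := variance_sum_large v0.
have n0 : (0 < n)%N.
  case: n v2 => // /(_ point); rewrite /variance_sum big_ord0 => h; exfalso.
  by move: h; rewrite leNgt ltr0n.
(* [decay_sum n T] is the affine function [al + be * T]. *)
pose al := K * (K + K * (C + Theta *+ 2 + margin n *+ 2) * decay_cst n).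
pose be := K * K * decay_cst n.
have dc0 : 0 <= decay_cst n by rewrite (le_trans ler01)// decay_cst_ge1.
have al0 : 0 <= al.
  have x0 : 0 <= C + Theta *+ 2 + margin n *+ 2.
    apply: addr_ge0; last by rewrite mulrn_wge0 ?margin_ge0.
    by apply: addr_ge0 => //; rewrite mulrn_wge0 ?Theta_ge0.
  by rewrite /al mulr_ge0// addr_ge0// mulr_ge0// mulr_ge0.
have be0 : 0 <= be by rewrite /be !mulr_ge0.
pose c2 := KM / (1 - r) + n%:R * (K * Ct + KM / (1 - r)) * b.+1%:R ^+ 2 * 22 + C * K.
exists (c2 + Num.sqrt (al + be) * b.+1%:R ^+ 2 * 22).
exists (block n) => [L|T L hT]; first exact: leq_block.
have CT := TC T hT; have T0 : 0 <= T by exact: le_trans CT.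
apply: (le_trans (main T n (Num.sqrt (decay_sum n T)) L n0 CT (sqrtr_ge0 _) _)).
  exists (mean_base T); split => //; first exact: mean_base_ge0.
  by move=> l; exact: mean_base_block.
have hs : Num.sqrt (decay_sum n T) <= Num.sqrt (al + be) * (1 + Num.sqrt T).
  have -> : decay_sum n T = al + be * T by rewrite /decay_sum /al /be /radius; ring.
  exact: sqrt_affine_le.
have c20 : 0 <= c2 by exact: pos.
apply: (@le_trans _ _ (c2 + Num.sqrt (decay_sum n T) * b.+1%:R ^+ 2 * 22)).
  by rewrite /c2; apply: le_of_eq; ring.
rewrite mulrDl; apply: lerD; first by rewrite ler_peMr.
rewrite (_ : Num.sqrt (al + be) * _ * 22 * _ =
  Num.sqrt (al + be) * (1 + Num.sqrt T) * b.+1%:R ^+ 2 * 22); last by ring.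
by rewrite ler_wpM2r// ler_wpM2r// sqr_ge0.
Qed.

End CocycleChain.

(** * Euclidean geometry: operator norms, exterior squares, angles between lines *)

Section EuclideanNorm.
Context {R : realType} {d : nat} (dot : {dot 'cV[R]_d.+1 for idfun}).
Local Notation V := 'cV[R]_d.+1.
Local Notation N := (enorm dot).
Local Notation op := (opnorm dot).

Lemma dotC u v : (dot u v) = (dot v u).
Proof. by rewrite hermC /= expr0 mul1r. Qed.

Lemma dotDl u v w : (dot (u + v) w) = (dot u w) + (dot v w). Proof. exact: linearDl. Qed.
Lemma dotZl (c : R) u v : (dot (c *: u) v) = c * (dot u v). Proof. exact: linearZl_LR. Qed.
Lemma dotNl u v : (dot (- u) v) = - (dot u v). Proof. exact: linearNl. Qed.
Lemma dotDr u v w : (dot u (v + w)) = (dot u v) + (dot u w).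
Proof. by rewrite dotC dotDl !(dotC u). Qed.
Lemma dotZr (c : R) u v : (dot u (c *: v)) = c * (dot u v).
Proof. by rewrite dotC dotZl (dotC u). Qed.
Lemma dotNr u v : (dot u (- v)) = - (dot u v).
Proof. by rewrite dotC dotNl (dotC u). Qed.
Lemma dot0l u : (dot 0 u) = 0. Proof. exact: linear0l. Qed.
Lemma dot0r u : (dot u 0) = 0. Proof. by rewrite dotC dot0l. Qed.

Lemma dot_suml n (F : 'I_n -> V) v : dot (\sum_i F i) v = \sum_i dot (F i) v.
Proof.
by elim/big_rec2 : _ => [|i y1 y2 _ h]; rewrite ?dot0l// dotDl h.
Qed.

Lemma dot_sumr n (F : 'I_n -> V) v : dot v (\sum_i F i) = \sum_i dot v (F i).
Proof. by rewrite dotC dot_suml; apply: eq_bigr => i _; rewrite dotC. Qed.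

Lemma dot_gt0 u : u != 0 -> 0 < (dot u u). Proof. exact: neq0_dnorm_gt0. Qed.

Lemma dot_ge0 u : 0 <= (dot u u).
Proof. by have [->|/dot_gt0/ltW//] := eqVneq u 0; rewrite dot0l. Qed.

(** The Gram determinant, squared area of the parallelogram on [u] and [v]. *)
Definition gram u v := (dot u u) * (dot v v) - (dot u v) ^+ 2.

Lemma gram_ge0 u v : 0 <= gram u v.
Proof.
rewrite /gram; have [->|v0] := eqVneq v 0; first by rewrite !dot0r expr0n mulr0 subrr.
have vv := dot_gt0 v0.
have := dot_ge0 ((dot v v) *: u - (dot u v) *: v).
rewrite !(dotDl, dotDr, dotNl, dotNr, dotZl, dotZr) (dotC v u).
move=> h; rewrite -(pmulr_rge0 _ vv); apply: le_trans h _.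
by apply: le_of_eq; ring.
Qed.

Lemma gramC u v : gram u v = gram v u.
Proof. by rewrite /gram (dotC v u) mulrC. Qed.

Lemma gramDr u v (c : R) : gram u (v + c *: u) = gram u v.
Proof. by rewrite /gram !(dotDl, dotDr, dotZl, dotZr) (dotC v u); ring. Qed.

Lemma gramZ (a b : R) u v : gram (a *: u) (b *: v) = (a * b) ^+ 2 * gram u v.
Proof. by rewrite /gram !(dotZl, dotZr); ring. Qed.

Lemma enorm_ge0 v : 0 <= (N v). Proof. exact: sqrtr_ge0. Qed.

Lemma sqr_enorm v : (N v) ^+ 2 = (dot v v). Proof. by rewrite sqr_sqrtr// dot_ge0. Qed.

Lemma enorm_gt0 v : v != 0 -> 0 < (N v). Proof. by move=> v0; rewrite sqrtr_gt0 dot_gt0. Qed.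

Lemma enorm0 : (N 0) = 0. Proof. by rewrite /enorm dot0l sqrtr0. Qed.

Lemma enormN v : (N (- v)) = (N v). Proof. by rewrite /enorm dotNl dotNr opprK. Qed.

Lemma dot_le u v : `|(dot u v)| <= (N u) * (N v).
Proof.
rewrite -ler_sqr ?nnegrE ?mulr_ge0 ?enorm_ge0// exprMn !sqr_enorm.
by rewrite real_normK ?num_real// -subr_ge0 gram_ge0.
Qed.

Lemma enormD u v : (N (u + v)) <= (N u) + (N v).
Proof.
rewrite -ler_sqr ?nnegrE ?addr_ge0 ?enorm_ge0// sqrrD !sqr_enorm !(dotDl, dotDr).
rewrite (dotC v u) addrA lerD2r -!addrA lerD2l -mulr2n ler_pMn2r//.
by apply: le_trans (dot_le u v); exact: ler_norm.
Qed.

Lemma enormB u v : (N (u - v)) <= (N u) + (N v).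
Proof. by rewrite -(enormN v) enormD. Qed.

Lemma enorm_sum n (F : 'I_n -> V) : (N (\sum_i F i)) <= \sum_i (N (F i)).
Proof.
elim/big_rec2 : _ => [|i y1 y2 _ h]; first by rewrite enorm0.
by apply: le_trans (enormD _ _) _; rewrite lerD2l.
Qed.

Local Notation e_ i := (delta_mx i 0 : V).

Lemma vec_sum_delta (v : V) : v = \sum_i v i 0 *: e_ i.
Proof.
rewrite {1}(matrix_sum_delta v); apply: eq_bigr => i _.
by rewrite big_ord1.
Qed.

Definition gmx : 'M[R]_d.+1 := \matrix_(i, j) (dot (e_ i) (e_ j)).

Lemma dot_gmx u v : (dot u v) = \sum_i \sum_j u i 0 * v j 0 * gmx i j.
Proof.
rewrite {1}(vec_sum_delta u) dot_suml; apply: eq_bigr => i _.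
rewrite dotZl {1}(vec_sum_delta v) dot_sumr mulr_sumr; apply: eq_bigr => j _.
by rewrite dotZr mxE mulrA.
Qed.

Lemma dot_mx u v : (dot u v) = (u^T *m gmx *m v) 0 0.
Proof.
rewrite dot_gmx mxE exchange_big/=; apply: eq_bigr => j _; rewrite mxE mulr_suml.
by apply: eq_bigr => i _; rewrite !mxE; ring.
Qed.

Lemma gmx_unit : gmx \in unitmx.
Proof.
rewrite -row_free_unit -kermx_eq0; apply/eqP/row_matrixP => i.
have k0 : row i (kermx gmx) *m gmx = 0 by rewrite -row_mul mulmx_ker row0.
rewrite row0; apply/eqP/negP => /negP r0.
have r1 : (row i (kermx gmx))^T != 0.
  by apply: contra r0 => /eqP/(congr1 trmx); rewrite trmxK trmx0 => ->.
by have := dot_gt0 r1; rewrite dot_mx trmxK k0 mul0mx mxE ltxx.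
Qed.

(* Coordinates are inner products with the dual basis. *)
Lemma coord_le_ex : exists2 C : R, 0 < C & forall (v : V) i, `|v i 0| <= C * (N v).
Proof.
pose f j : V := (invmx gmx) *m e_ j.
have vf (v : V) j : v j 0 = (dot v (f j)).
  rewrite dot_mx /f mulmxA -(mulmxA _ gmx) mulmxV ?gmx_unit// mulmx1.
  by rewrite -colE mxE mxE.
exists (1 + \sum_j (N (f j))); first by rewrite ltr_pwDl// sumr_ge0// => j _; exact: enorm_ge0.
move=> v i; rewrite vf; apply: le_trans (dot_le _ _) _; rewrite mulrC ler_wpM2r ?enorm_ge0//.
rewrite (bigD1 i)//= addrCA lerDl addr_ge0// sumr_ge0// => j _; exact: enorm_ge0.
Qed.

Definition Cco : R := projT1 (cid2 coord_le_ex).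
Lemma Cco_gt0 : 0 < Cco. Proof. by rewrite /Cco; case: cid2. Qed.
Lemma coord_le (v : V) i : `|v i 0| <= Cco * (N v).
Proof. by rewrite /Cco; case: cid2. Qed.

Definition Ce : R := \sum_i (N (e_ i)).
Lemma Ce_ge0 : 0 <= Ce. Proof. by apply: sumr_ge0 => i _; exact: enorm_ge0. Qed.

Lemma enorm_le_coord (v : V) (c : R) : (forall i, `|v i 0| <= c) -> (N v) <= Ce * c.
Proof.
move=> h; rewrite (vec_sum_delta v); apply: le_trans (enorm_sum _) _.
rewrite /Ce mulr_suml; apply: ler_sum => i _; rewrite enormZ mulrC ler_wpM2l ?enorm_ge0//.
Qed.

Lemma mulmx_enorm_le (A : 'M[R]_d.+1) (v : V) (c : R) : (forall i j, `|A i j| <= c) ->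
  (N (A *m v)) <= Ce * (d.+1%:R * c * Cco) * (N v).
Proof.
move=> h; rewrite -!mulrA; apply: enorm_le_coord => i; rewrite mxE.
apply: le_trans (ler_norm_sum _ _ _) _; rewrite -[d.+1 in leRHS]card_ord mulr_natl -sumr_const.
by apply: ler_sum => j _; rewrite normrM ler_pM// coord_le.
Qed.

Lemma opnorm_has_sup (A : 'M[R]_d.+1) :
  has_sup [set enorm dot (A *m v) | v in [set v | enorm dot v <= 1]].
Proof.
split; first by exists (N (A *m 0)), 0 => //=; rewrite enorm0.
pose c := \sum_i \sum_j `|A i j|.
have hc i j : `|A i j| <= c.
  rewrite /c (bigD1 i)//= (bigD1 j)//= -addrA lerDl addr_ge0//.
    exact: sumr_ge0.
  by apply: sumr_ge0 => k _; exact: sumr_ge0.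
exists (Ce * (d.+1%:R * c * Cco)) => _ [v /= v1 <-].
apply: le_trans (mulmx_enorm_le v hc) _; rewrite ler_piMr//.
rewrite mulr_ge0 ?Ce_ge0// !mulr_ge0 ?(ltW Cco_gt0)//.
by apply: sumr_ge0 => i _; exact: sumr_ge0.
Qed.

Lemma opnorm_ge0 A : 0 <= (op A).
Proof.
apply: ub_le_sup; first by have [] := opnorm_has_sup A.
by exists 0; rewrite /= ?mulmx0 enorm0.
Qed.

Lemma opnormP A v : (N (A *m v)) <= (op A) * (N v).
Proof.
have [->|v0] := eqVneq v 0; first by rewrite mulmx0 enorm0 mulr0.
have n0 := enorm_gt0 v0; rewrite -ler_pdivrMr// mulrC.
rewrite -(ger0_norm (ltW n0)) -normfV -enormZ scalemxAr.
apply: ub_le_sup; first by have [] := opnorm_has_sup A.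
exists ((N v)^-1 *: v) => //=.
by rewrite enormZ normfV ger0_norm ?(ltW n0)// mulVf// gt_eqF.
Qed.

Lemma opnorm_le A c : 0 <= c -> (forall v, (N (A *m v)) <= c * (N v)) -> (op A) <= c.
Proof.
move=> c0 h; apply: ge_sup; first by have [] := opnorm_has_sup A.
by move=> _ [v /= v1 <-]; apply: le_trans (h v) _; rewrite ler_piMr.
Qed.

Lemma opnorm_gt A c : c < (op A) -> exists2 v, (N v) <= 1 & c < (N (A *m v)).
Proof.
move=> h; have [_ [v /= v1 <-] hv] := sup_gt (opnorm_has_sup A).1 h.
by exists v.
Qed.

Lemma opnormM A B : (op (A *m B)) <= (op A) * (op B).
Proof.
apply: opnorm_le => [|v]; first by rewrite mulr_ge0 ?opnorm_ge0.
rewrite -mulmxA; apply: le_trans (opnormP _ _) _.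
by rewrite -mulrA ler_wpM2l ?opnorm_ge0// opnormP.
Qed.

Lemma opnorm1_ge A B : A *m B = 1%:M -> 1 <= (op A) * (op B).
Proof.
move=> AB; have v0 := @const_mx1_neq0 R d.
have := opnormP (A *m B) (const_mx 1); rewrite {1}AB mul1mx.
rewrite -{1}[N _]mul1r ler_pM2r ?enorm_gt0// => h; apply: le_trans h (opnormM _ _).
Qed.

Lemma opnorm_entries (A : 'M[R]_d.+1) (c : R) : 0 <= c -> (forall i j, `|A i j| <= c) ->
  (op A) <= Ce * d.+1%:R * Cco * c.
Proof.
move=> c0 h; have := Ce_ge0; have := ltW Cco_gt0 => ? ?.
apply: opnorm_le => [|v]; first by rewrite !mulr_ge0.
apply: le_trans (mulmx_enorm_le v h) _.
by apply: le_of_eq; ring.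
Qed.

(** A near-maximiser taken from the supremum; the factor 2 spares a compactness argument. *)
Lemma opnorm_attained A : exists2 v, v != 0 & (op A) * (N v) <= 2 * (N (A *m v)).
Proof.
have [A0|A0] := leP (op A) 0.
  exists (const_mx 1); first exact: const_mx1_neq0.
  apply: (@le_trans _ _ 0); first by rewrite mulr_le0_ge0 ?enorm_ge0.
  by rewrite mulr_ge0 ?enorm_ge0.
have h : (op A) / 2 < (op A) by rewrite ltr_pdivrMr// ltr_pMr// ltrDl.
have [v v1 hv] := opnorm_gt h; exists v.
  apply/eqP => v0; move: hv; rewrite v0 mulmx0 enorm0 ltNge divr_ge0//.
  exact: ltW.
apply: (@le_trans _ _ (op A)); first by rewrite ler_piMr// ltW.
by rewrite mulrC -ler_pdivrMr// ltW.
Qed.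

Definition wedge u v := Num.sqrt (gram u v).

Lemma wedge_ge0 u v : 0 <= wedge u v. Proof. exact: sqrtr_ge0. Qed.
Lemma wedgeC u v : wedge u v = wedge v u. Proof. by rewrite /wedge gramC. Qed.

Lemma wedgeZ (a b : R) u v : wedge (a *: u) (b *: v) = `|a| * `|b| * wedge u v.
Proof. by rewrite /wedge gramZ sqrtrM ?sqr_ge0// sqrtr_sqr normrM. Qed.

Lemma wedge_le u v : wedge u v <= (N u) * (N v).
Proof.
rewrite /enorm -sqrtrM ?dot_ge0// ler_wsqrtr// gerBl sqr_ge0//.
Qed.

Lemma wedge_vv u : wedge u u = 0.
Proof. by rewrite /wedge /gram -expr2 subrr sqrtr0. Qed.

(** Subtracting from [v] its component along [u] changes neither area, and the area of an orthogonal
    pair is the product of the norms. *)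
Lemma wedge_mulmx A u v : wedge (A *m u) (A *m v) <= op A ^+ 2 * wedge u v.
Proof.
have [->|u0] := eqVneq u 0.
  by rewrite mulmx0 /wedge /gram !dot0l !mul0r expr0n subrr sqrtr0 mulr0.
have uu := dot_gt0 u0; pose c := - dot u v / dot u u.
have gA : gram (A *m u) (A *m v) = gram (A *m u) (A *m (v + c *: u)).
  by rewrite mulmxDr -scalemxAr gramDr.
have o : dot u (v + c *: u) = 0 by rewrite dotDr dotZr /c divfK ?subrr// gt_eqF.
have gE : wedge u v = N u * N (v + c *: u).
  rewrite /wedge -(gramDr u v c) /gram o expr0n subr0 sqrtrM ?dot_ge0//.
rewrite gE {1}/wedge gA -/(wedge _ _); apply: le_trans (wedge_le _ _) _.
by rewrite expr2 mulrACA; apply: ler_pM; rewrite ?enorm_ge0 ?opnormP.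
Qed.

(** The norm of the exterior square of [A] on decomposable bivectors, expressed through areas of
    pairs of vectors. *)
Definition opnorm2 (A : 'M[R]_d.+1) : R :=
  sup [set wedge (A *m w.1) (A *m w.2) | w in [set w | wedge w.1 w.2 <= 1]].

Lemma opnorm2_has_sup A :
  has_sup [set wedge (A *m w.1) (A *m w.2) | w in [set w | wedge w.1 w.2 <= 1]].
Proof.
split; first by exists (wedge (A *m 0) (A *m 0)), (0, 0) => //=; rewrite wedge_vv.
exists (op A ^+ 2) => _ [[u v] /= h <-].
by apply: le_trans (wedge_mulmx _ _ _) _; rewrite ler_piMr// sqr_ge0.
Qed.

Lemma opnorm2_ge0 A : 0 <= opnorm2 A.
Proof.
apply: ub_le_sup; first by have [] := opnorm2_has_sup A.
by exists (0, 0); rewrite /= ?mulmx0 wedge_vv.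
Qed.

Lemma wedge_eq0 A u v : wedge u v = 0 -> wedge (A *m u) (A *m v) = 0.
Proof.
move=> h; apply/eqP; rewrite eq_le wedge_ge0 andbT.
by apply: le_trans (wedge_mulmx _ _ _) _; rewrite h mulr0.
Qed.

Lemma opnorm2P A u v : wedge (A *m u) (A *m v) <= opnorm2 A * wedge u v.
Proof.
have [w0|w0] := eqVneq (wedge u v) 0; first by rewrite wedge_eq0// w0 mulr0.
have wp : 0 < wedge u v by rewrite lt0r w0 wedge_ge0.
rewrite -ler_pdivrMr//; apply: ub_le_sup; first by have [] := opnorm2_has_sup A.
exists ((wedge u v)^-1 *: u, v) => /=.
  by rewrite -[v]scale1r wedgeZ scale1r normr1 mulr1 normfV ger0_norm ?wedge_ge0// mulVf.
rewrite -scalemxAr -[A *m v]scale1r wedgeZ scale1r normr1 mulr1 normfV.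
by rewrite ger0_norm ?wedge_ge0// mulrC.
Qed.

Lemma opnorm2_le A c : 0 <= c -> (forall u v, wedge (A *m u) (A *m v) <= c * wedge u v) ->
  opnorm2 A <= c.
Proof.
move=> c0 h; apply: ge_sup; first by have [] := opnorm2_has_sup A.
by move=> _ [[u v] /= w1 <-]; apply: le_trans (h u v) _; rewrite ler_piMr.
Qed.

Lemma opnorm2_sqr A : opnorm2 A <= op A ^+ 2.
Proof. by apply: opnorm2_le => [|u v]; rewrite ?sqr_ge0 ?wedge_mulmx. Qed.

Lemma opnorm2M A B : opnorm2 (A *m B) <= opnorm2 A * opnorm2 B.
Proof.
apply: opnorm2_le => [|u v]; first by rewrite mulr_ge0 ?opnorm2_ge0.
rewrite -!mulmxA; apply: le_trans (opnorm2P _ _ _) _.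
by rewrite -mulrA ler_wpM2l ?opnorm2_ge0// opnorm2P.
Qed.

Definition sine u v := wedge u v / (N u * N v).

Lemma sine_ge0 u v : 0 <= sine u v.
Proof. by rewrite divr_ge0 ?mulr_ge0 ?enorm_ge0 ?wedge_ge0. Qed.

Lemma sineC u v : sine u v = sine v u.
Proof. by rewrite /sine wedgeC (mulrC (N u)). Qed.

Lemma sine_le1 u v : sine u v <= 1.
Proof.
have [h|h] := eqVneq (N u * N v) 0; first by rewrite /sine h invr0 mulr0.
by rewrite /sine ler_pdivrMr ?mul1r ?wedge_le// lt0r h mulr_ge0 ?enorm_ge0.
Qed.

Lemma sineZ (a b : R) u v : a != 0 -> b != 0 -> sine (a *: u) (b *: v) = sine u v.
Proof.
move=> a0 b0; rewrite /sine wedgeZ !enormZ mulrACA invfM mulrACA mulfV ?mul1r//.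
by rewrite mulf_neq0 ?normr_eq0.
Qed.

Lemma sine_mulmx A u v : u != 0 -> v != 0 ->
  sine (A *m u) (A *m v) <= opnorm2 A * (N u / N (A *m u)) * (N v / N (A *m v)) * sine u v.
Proof.
move=> u0 v0; have nu := enorm_gt0 u0; have nv := enorm_gt0 v0.
rewrite /sine (_ : _ * _ * _ * _ = (opnorm2 A * wedge u v) / (N (A *m u) * N (A *m v))).
  by rewrite ler_wpM2r ?opnorm2P// invr_ge0 mulr_ge0 ?enorm_ge0.
rewrite (invfM (N (A *m u))); move: (N (A *m u))^-1 (N (A *m v))^-1 => p q.
by field; rewrite !gt_eqF.
Qed.

(* Unit representatives can be chosen with |v - w| <= sqrt 2 * sine v w. *)
Lemma sine_chord u v : u != 0 -> v != 0 -> exists2 c : R, c != 0 &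
  N (u - c *: v) <= 2 * N u * sine u v /\ `|c| * N v = N u.
Proof.
move=> u0 v0; have nu := enorm_gt0 u0; have nv := enorm_gt0 v0.
wlog duv : v v0 nv / 0 <= dot u v.
  move=> h; have [/h|/ltW d0] := leP 0 (dot u v); first exact.
  have v0' : - v != 0 by rewrite oppr_eq0.
  have [|c c0 [h1 h2]] := h _ v0' (enorm_gt0 v0'); first by rewrite dotNr oppr_ge0.
  exists (- c); first by rewrite oppr_eq0.
  rewrite scaleNr -scalerN normrN; split; last by rewrite enormN in h2.
  suff -> : sine u v = sine u (- v) by [].
  have n1 : -1 != 0 :> R by rewrite oppr_eq0 oner_eq0.
  by rewrite -{2}(scale1r u) -(scaleN1r v) sineZ// oner_neq0.
exists (N u / N v); first by rewrite mulf_neq0// ?invr_eq0 gt_eqF.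
have cp : 0 < N u / N v by rewrite divr_gt0.
split; last by rewrite gtr0_norm// divfK// gt_eqF.
rewrite -ler_sqr ?nnegrE ?enorm_ge0//; last first.
  by apply: mulr_ge0; [rewrite mulr_ge0 ?enorm_ge0|exact: sine_ge0].
have e : sine u v ^+ 2 = 1 - (dot u v / (N u * N v)) ^+ 2.
  rewrite /sine !exprMn !exprVn exprMn !sqr_enorm /wedge sqr_sqrtr ?gram_ge0// /gram.
  by field; rewrite !gt_eqF// dot_gt0.
rewrite sqr_enorm !(dotDl, dotDr, dotNl, dotNr, dotZl, dotZr) (dotC v u) exprMn e.
rewrite -(sqr_enorm u) -(sqr_enorm v).
have : 0 <= dot u v / (N u * N v) by rewrite divr_ge0// mulr_ge0 ?enorm_ge0.
have : dot u v / (N u * N v) <= 1.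
  by rewrite ler_pdivrMr ?mulr_gt0// mul1r; apply: le_trans (ler_norm _) (dot_le _ _).
have -> : dot u v = (dot u v / (N u * N v)) * (N u * N v).
  by rewrite divfK// gt_eqF// mulr_gt0.
rewrite !mulfK ?gt_eqF ?mulr_gt0//; set t := _ / _ => t1 t0.
rewrite (_ : _ + _ = 2 * N u ^+ 2 * (1 - t)); last by field; rewrite gt_eqF.
rewrite exprMn (_ : _ * _ * (1 - t ^+ 2) = 2 * N u ^+ 2 * (2 * (1 - t ^+ 2))); last by ring.
by rewrite ler_wpM2l ?mulr_ge0 ?sqr_ge0//; nra.
Qed.

End EuclideanNorm.

(** * Measurability through finitely many coordinates *)

Section CoordinateTopology.
Context {R : realType} {T : topologicalType} {I : finType} (c : I -> T -> R).
Hypothesis c_gen : forall U x, open U -> U x -> exists2 e : R, 0 < e &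
  forall y, (forall i, `|c i y - c i x| < e) -> U y.

(** An open set is the union of the rational coordinate boxes that it contains, and these are
    countably many. *)
Lemma mf_coord_open {d} {Y : measurableType d} (f : Y -> T) U :
  (forall i, mble (fun y => c i (f y))) -> open U ->
  measurable (f @^-1` U).
Proof.
move=> mf oU.
pose box (q : {ffun I -> rat} * nat) : set T :=
  [set x | forall i, `|c i x - ratr (q.1 i)| < q.2.+1%:R^-1].
pose F q := if pselect (box q `<=` U) then f @^-1` box q else set0.
have -> : f @^-1` U = \bigcup_q F q.
  apply/seteqP; split => [y /= Uy|y [q _]]; last first.
    by rewrite /F; case: pselect => // h /h.
  have [e e0 he] := c_gen oU Uy.
  have := archi_boundP (ltW (divr_gt0 (ltr0Sn R 1) e0)); set k := Num.bound _ => hk.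
  have k0 : 0 < k.+1%:R^-1 :> R by rewrite invr_gt0.
  have ke : k.+1%:R^-1 + k.+1%:R^-1 <= e.
    rewrite -mulr2n -[_ *+ 2]mulr_natr mulrC ler_pdivrMr// mulrC -ler_pdivrMr//.
    by apply: le_trans (ltW hk) _; rewrite ler_nat.
  have hq i : exists q : rat, `|c i (f y) - ratr q| < k.+1%:R^-1.
    have : c i (f y) - k.+1%:R^-1 < c i (f y) + k.+1%:R^-1 by rewrite ltrD2l gtrN.
    move=> /rat_in_itvoo[q]; rewrite in_itv/= => /andP[q1 q2]; exists q.
    by rewrite distrC ltr_distl q1 q2.
  have [q qP] := choice hq.
  exists ([ffun i => q i], k) => //; rewrite /F; case: pselect => [h|].
    by move=> i /=; rewrite ffunE.
  move=> nb; exfalso; apply: nb => x xq; apply: he => i; apply: lt_le_trans ke.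
  rewrite -(subrK (ratr (q i)) (c i x)) -addrA; apply: le_lt_trans (ler_normD _ _) _.
  by apply: ltrD; [have := xq i; rewrite /= ffunE|rewrite distrC].
apply: countable_bigcupT_measurable => [|q]; first exact: countableP.
rewrite /F; case: pselect => h0 /=; last exact: measurable0.
rewrite (_ : _ @^-1` _ = \bigcap_(i in [set: I])
  (fun y => `|c i (f y) - ratr (q.1 i)|) @^-1` `]-oo, q.2.+1%:R^-1[); last first.
  apply/seteqP; split => y /= h => [i _|i]; first by rewrite /= in_itv/= h.
  by have := h i Logic.I; rewrite /= in_itv.
apply: fin_bigcap_measurable => // i _; rewrite -[X in measurable X]setTI.
have : mble (fun y => `|c i (f y) - ratr (q.1 i)|).
  by apply: mf_comp => //; apply: mfB.
exact.
Qed.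

End CoordinateTopology.

Lemma mf_open_preimage {R : realType} {T : topologicalType} {d}
    {Y : measurableType d} (f : Y -> T) (g : T -> R) :
    (forall U, open U -> measurable (f @^-1` U)) -> continuous g ->
  mble (g \o f).
Proof.
move=> mf cg; apply: (measurability _ (RGenOpens.measurableE R)).
move=> _ [_ [a [b ->] <-]]; rewrite setTI comp_preimage; apply: mf.
by move/continuousP : cg; apply; exact: interval_open.
Qed.

Lemma mf_generated {T : ptopologicalType} {d}
    {Y : measurableType d} (f : Y -> g_sigma_algebraType (@open T)) :
    (forall U : set T, open U -> measurable (f @^-1` U)) -> mble f.
Proof.
have h : @measurable _ (g_sigma_algebraType (@open T)) = <<s @open T >> by [].
by move=> mf; apply: (measurability _ h) => _ [U oU <-]; rewrite setTI; exact: mf.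
Qed.

Lemma compact_uniform {T : topologicalType} (K : set T) (P : nat -> T -> Prop) :
    compact K -> (forall n m x, (n <= m)%N -> P n x -> P m x) ->
    (forall x, K x -> exists n, nbhs x [set y | P n y]) ->
  exists n, forall x, K x -> P n x.
Proof.
move=> /compact_near_coveringP cK mono loc.
have [n _ hn] : \forall n \near \oo, K `<=` P n.
  apply: cK => x /loc[n nx]; exists ([set y | P n y], [set m | (n <= m)%N]) => /=.
    by split => //; exists n.
  by move=> [y m] /= [h1 h2]; exact: mono h1.
by exists n => x; exact: (hn n (leqnn n)).
Qed.

(** * Topology and measurable structure of the general linear group *)

Section MatrixGroup.
Context {R : realType} {d : nat}.
Implicit Types g h : GL R d.

Lemma continuous_val_GL : continuous (val : GL R d -> 'M[R]_d.+1).
Proof. exact: (@initial_continuous _ _ (val : GL R d -> 'M[R]_d.+1)). Qed.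

Lemma GL_ball g (e : R) : 0 < e ->
  nbhs g [set h : GL R d | forall i j, `|val h i j - val g i j| < e].
Proof.
move=> e0; pose A := [set B : 'M[R]_d.+1 | forall i j, `|B i j - val g i j| < e].
suff gA : nbhs (val g) A by exact: (@continuous_val_GL g A gA).
exists (fun i j => [set x | `|x - val g i j| < e]) => //= i j.
apply/nbhs_ballP; exists e => // x; rewrite /ball/= distrC//.
Qed.

Lemma GL_gen U g : open U -> U g -> exists2 e : R, 0 < e &
  forall h, (forall ij : 'I_d.+1 * 'I_d.+1, `|val h ij.1 ij.2 - val g ij.1 ij.2| < e) -> U h.
Proof.
move=> [B oB <-] /= Bg.
have /nbhs_ballP[e /= e0 he] : nbhs (val g) B by apply: open_nbhs_nbhs; split.
exists e => // h hh; apply: he; split => // i j.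
by rewrite /ball/= distrC; exact: (hh (i, j)).
Qed.

Lemma continuous_coord (i j : 'I_d.+1) : continuous (fun g : GL R d => val g i j : R).
Proof.
move=> g; apply: (@continuous_comp (GL R d) 'M[R]_d.+1 R val (fun B => B i j)).
  exact: continuous_val_GL.
exact: coord_continuous.
Qed.

Lemma open_measurable_GL (U : set (GL R d)) : open U -> measurable U.
Proof. by move=> oU; exact: sub_sigma_algebra. Qed.

Lemma continuous_measurable_GL (f : GL R d -> R) : continuous f -> mble f.
Proof.
move=> cf; apply: (mf_open_preimage (f := fun g : GL R d => g)) => // U oU.
exact: open_measurable_GL.
Qed.

Lemma mf_coord (i j : 'I_d.+1) : mble (fun g : GL R d => val g i j : R).
Proof. apply: continuous_measurable_GL; exact: continuous_coord. Qed.

Lemma mf_GL {dy} {Y : measurableType dy} (f : Y -> GL R d) :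
  (forall i j, mble (fun y => val (f y) i j)) -> mble f.
Proof.
move=> mf; apply: mf_generated => U oU.
apply: (mf_coord_open (c := fun (ij : 'I_d.+1 * 'I_d.+1) (g : GL R d) =>
  val g ij.1 ij.2)) => // U' x; exact: GL_gen.
Qed.

Lemma mf_mulGL : mble (fun z : GL R d * GL R d => (z.1 * z.2)%g).
Proof.
apply: mf_GL => i j; apply: (eq_measurable_fun
  (fun z : GL R d * GL R d => \sum_k val z.1 i k * val z.2 k j)).
  by move=> z _; rewrite /= mxE.
apply: measurable_sum => k; apply: mfM.
  exact: (mf_comp (mf_coord i k) mf_fst).
exact: (mf_comp (mf_coord k j) mf_snd).
Qed.

End MatrixGroup.

(** * Coordinates, compactness and angle on the projective space *)

Section ProjectiveTopology.
Local Open Scope quotient_scope.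
Context {R : realType} {d : nat} (dot : {dot 'cV[R]_d.+1 for idfun}).
Local Notation V := 'cV[R]_d.+1.
Local Notation N := (enorm dot).
Local Notation X := (PV R d).
Local Notation piX v := (\pi_(PV R d) v).

Definition vec (x : X) : V := val (repr x).

Lemma vec_neq0 x : vec x != 0. Proof. exact: nzvec_neq0. Qed.

Lemma vec_pi (v : nzvec) : exists2 c : R, c != 0 & vec (piX v) = c *: val v.
Proof.
have /eqmodP/asboolP[c c0 E] : piX (repr (piX v)) = piX v by rewrite reprK.
by exists c.
Qed.

Lemma pi_vec x : piX (tonzvec (vec_neq0 x)) = x.
Proof. by rewrite -[RHS]reprK; congr (piX _); apply: val_inj. Qed.

Lemma vec_act g x : exists2 c : R, c != 0 & vec (GL_act g x) = c *: (val g *m vec x).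
Proof. exact: vec_pi. Qed.

Lemma eq_PV x y (c : R) : vec x = c *: vec y -> x = y.
Proof.
move=> xy; rewrite -(pi_vec x) -(pi_vec y); apply/eqmodP/asboolP => /=; exists c => //.
by apply: contra (vec_neq0 x) => /eqP c0; rewrite xy c0 scale0r.
Qed.

Lemma continuous_val_nzvec : continuous (val : @nzvec R d -> V).
Proof. exact: (@initial_continuous _ _ (val : @nzvec R d -> V)). Qed.

Lemma continuous_vcoord i : continuous (fun v : @nzvec R d => val v i 0 : R).
Proof.
move=> v; apply: (@continuous_comp (@nzvec R d) V R val (fun B => B i 0)).
  exact: continuous_val_nzvec.
exact: coord_continuous.
Qed.

Lemma continuous_sum (T : topologicalType) (J : finType) (F : J -> T -> R) :
  (forall j, continuous (F j)) -> continuous (fun x => \sum_j F j x).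
Proof.
move=> cF; apply: continuous_big => //.
exact: add_continuous.
Qed.

(** Entries of the rank one matrix of a vector times its transpose, normalised so as not to depend
    on the representative: they embed the projective space into a space of matrices. *)
Definition pc i j (x : X) : R := vec x i 0 * vec x j 0 / dot (vec x) (vec x).

Lemma pc_pi i j (v : nzvec) : pc i j (piX v) = val v i 0 * val v j 0 / dot (val v) (val v).
Proof.
rewrite /pc; have [c c0 ->] := vec_pi v; rewrite !mxE dotZl dotZr.
have := dot_gt0 dot (nzvec_neq0 v); move: (dot _ _) => n n0.
by field; rewrite c0 gt_eqF.
Qed.

Lemma continuous_pc i j : continuous (pc i j).
Proof.
apply/quotient_continuous => v; rewrite /comp.
under [X in continuous_at _ X]eq_fun do rewrite pc_pi.
have cij k l (w : @nzvec R d) : (fun w : @nzvec R d => val w k 0 * val w l 0 : R) @ w -->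
    (val w k 0 * val w l 0 : R).
  exact: (cvgM (@continuous_vcoord k w) (@continuous_vcoord l w)).
have cd : (fun w : @nzvec R d => dot (val w) (val w)) @ v --> dot (val v) (val v).
  under eq_fun do rewrite dot_gmx; rewrite dot_gmx.
  apply: (@continuous_sum nzvec _ (fun k w => \sum_l val w k 0 * val w l 0 * gmx dot k l)) => k.
  apply: (@continuous_sum nzvec _ (fun l w => val w k 0 * val w l 0 * gmx dot k l)) => l w.
  by apply: (cvgM (cij k l w)); exact: cvg_cst.
have d0 : dot (val v) (val v) != 0 by rewrite gt_eqF// dot_gt0// nzvec_neq0.
exact: (cvgM (cij i j v) (cvgV d0 cd)).
Qed.

Lemma pc_inj x y : (forall i j, pc i j x = pc i j y) -> x = y.
Proof.
move=> h; have v0 := vec_neq0 y; have n0 := dot_gt0 dot v0; have m0 := dot_gt0 dot (vec_neq0 x).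
pose S := \sum_j gmx dot j j.
have E i : vec y i 0 = (dot (vec x) (vec y) / dot (vec x) (vec x)) * vec x i 0.
  have e z w : \sum_j \sum_k pc i j z * gmx dot j k * vec w k 0 =
      vec z i 0 * dot (vec z) (vec w) / dot (vec z) (vec z).
    rewrite [dot _ (vec w)]dot_gmx mulr_sumr mulr_suml; apply: eq_bigr => j _.
    rewrite mulr_sumr mulr_suml; apply: eq_bigr => k _.
    by rewrite /pc; field; rewrite gt_eqF// dot_gt0// vec_neq0.
  have := e x y; rewrite (_ : \sum_j _ = \sum_j \sum_k pc i j y * gmx dot j k * vec y k 0).
    by rewrite e mulfK ?gt_eqF// => ->; ring.
  by apply: eq_bigr => j _; apply: eq_bigr => k _; rewrite h.
apply/esym; apply: (@eq_PV _ _ (dot (vec x) (vec y) / dot (vec x) (vec x))).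
by apply/matrixP => i j; rewrite !mxE ord1 E.
Qed.

(** The projective space is a continuous image of the unit sphere of row vectors, which is closed
    and bounded. *)
Lemma compact_PV : compact [set: X].
Proof.
pose K := [set w : 'rV[R]_d.+1 | `|w| = 1].
pose f (w : 'rV[R]_d.+1) : X :=
  if pselect (w^T != 0) is left w0 then piX (tonzvec w0) else point.
have cK : compact K.
  apply: bounded_closed_compact.
    by exists 1; split => // x x1 w; rewrite /K/= => ->; exact: ltW.
  rewrite (_ : K = (fun w : 'rV[R]_d.+1 => `|w|) @^-1` [set 1])//; apply: preimage_closed => //.
  by move=> w _; exact: norm_continuous.
have K0 w : K w -> w^T != 0.
  move=> w1; apply/eqP => /(congr1 trmx); rewrite trmxK trmx0 => w0.
  by move: w1; rewrite /K/= w0 normr0 => /esym/eqP; rewrite oner_eq0.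
suff -> : [set: X] = f @` K.
  apply: continuous_compact => //; apply: continuous_in_subspaceT => w /set_mem /K0 w0.
  have fw : f w = piX (tonzvec w0).
    by rewrite /f; case: pselect => // w1; congr (piX _); apply: val_inj.
  move=> U; rewrite /= fw nbhsE => -[B [oB Bfw] BU].
  have [A oA AB] : open (\pi_X @^-1` B : set nzvec) by exact: oB.
  have : nbhs w^T A.
    by apply: open_nbhs_nbhs; split => //; move: Bfw; rewrite -[B _]/((\pi_X @^-1` B) (tonzvec w0)) -AB.
  move=> [P wP PA].
  have n1 : nbhs w [set w' : 'rV[R]_d.+1 | A w'^T].
    exists (fun i j => P j i) => [i j|w' /= h]; first by have := wP j i; rewrite mxE.
    by apply: PA => i j; rewrite mxE.
  have n2 : nbhs w [set w' : 'rV[R]_d.+1 | 0 < `|w'|].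
    apply: (@norm_continuous R 'rV[R]_d.+1 w [set x : R | 0 < x]).
    apply: open_nbhs_nbhs; split; first exact: open_gt.
    rewrite /= normr_gt0; apply/eqP => w00; by move: (w0); rewrite w00 trmx0 eqxx.
  apply: filterS2 n1 n2 => w' /= Aw' nw'; apply: BU.
  rewrite /f; case: pselect => [w1|/negP].
    by rewrite -[B _]/((\pi_X @^-1` B) (tonzvec w1)) -AB.
  rewrite negbK => /eqP/(congr1 trmx); rewrite trmxK trmx0 => w'0.
  by move: nw'; rewrite w'0 normr0 ltxx.
apply/seteqP; split => // x _.
have n0 : `|(vec x)^T| != 0.
  rewrite normr_eq0; apply: contra (vec_neq0 x) => /eqP/(congr1 trmx).
  by rewrite trmxK trmx0 => ->.
exists (`|(vec x)^T|^-1 *: (vec x)^T).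
  by rewrite /K/= normrZ normfV normr_id mulVf.
rewrite /f; case: pselect => [w0|/negP]; last first.
  by rewrite negbK linearZ/= trmxK scaler_eq0 invr_eq0 (negbTE n0) (negbTE (vec_neq0 x)).
rewrite -[RHS]pi_vec; apply/eqmodP/asboolP; exists (`|(vec x)^T|^-1).
  by rewrite invr_eq0.
by rewrite /= linearZ/= trmxK.
Qed.

(** The sum [phi] of the coordinate differences is continuous and vanishes only at [x], hence has a
    positive lower bound on the compact complement of [U]. *)
Lemma PV_gen (U : set X) x : open U -> U x -> exists2 e : R, 0 < e &
  forall y, (forall ij : 'I_d.+1 * 'I_d.+1, `|pc ij.1 ij.2 y - pc ij.1 ij.2 x| < e) -> U y.
Proof.
move=> oU Ux; pose phi y := \sum_(ij : 'I_d.+1 * 'I_d.+1) `|pc ij.1 ij.2 y - pc ij.1 ij.2 x|.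
have cphi : continuous phi.
  apply: continuous_sum => ij y.
  have h : (fun y => pc ij.1 ij.2 y - pc ij.1 ij.2 x) @ y --> pc ij.1 ij.2 y - pc ij.1 ij.2 x.
    by apply: (cvgB (@continuous_pc ij.1 ij.2 y)); exact: cvg_cst.
  exact: (cvg_norm h).
have cU : compact (~` U).
  apply: (subclosed_compact _ compact_PV) => //; exact: open_closedC.
have [n hn] : exists n, forall y, (~` U) y -> n.+1%:R^-1 < phi y.
  apply: (@compact_uniform _ _ (fun n y => n.+1%:R^-1 < phi y)) => // [n m y nm h|y Uy].
    by apply: le_lt_trans h; rewrite lef_pV2 ?posrE ?ltr0n// ler_nat.
  have p0 : 0 < phi y.
    rewrite lt_neqAle eq_sym sumr_ge0// andbT; apply/eqP => p0; apply: Uy.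
    suff -> : y = x by [].
    apply: pc_inj => i j; apply/eqP; rewrite -subr_eq0 -normr_eq0; apply/eqP.
    apply: le_anti; rewrite normr_ge0 andbT -[leRHS]p0 /phi (bigD1 (i, j))//= lerDl.
    exact: sumr_ge0.
  have := archi_boundP (ltW (divr_gt0 (ltr0Sn R 0) p0)); set k := Num.bound _ => hk.
  exists k.
  have kp : k.+1%:R^-1 < phi y.
    rewrite -[ltRHS]invrK ltf_pV2 ?posrE ?invr_gt0 ?ltr0n//.
    by rewrite -[ltLHS]mul1r; apply: lt_le_trans hk _; rewrite ler_nat.
  by apply: (cphi y [set z : R | k.+1%:R^-1 < z]); apply: open_nbhs_nbhs; split => //; exact: open_gt.
pose m : R := #|{: 'I_d.+1 * 'I_d.+1}|%:R.
have m0 : 0 < m by rewrite ltr0n; apply/card_gt0P; exists (ord0, ord0).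
exists (n.+1%:R^-1 / m); first by rewrite divr_gt0// invr_gt0 ltr0n.
move=> y hy; apply: contrapT => /hn; apply/negP; rewrite -leNgt.
apply: (@le_trans _ _ (\sum_(ij : 'I_d.+1 * 'I_d.+1) n.+1%:R^-1 / m)).
  by apply: ler_sum => ij _; exact: ltW.
by rewrite sumr_const -[leLHS]mulr_natr divfK// gt_eqF.
Qed.

Lemma continuous_measurable_PV (f : X -> R) : continuous f -> mble f.
Proof.
move=> cf; apply: (mf_open_preimage (f := fun x : X => x)) => // U oU.
exact: sub_sigma_algebra.
Qed.

Lemma mf_pc i j : mble (pc i j).
Proof. by apply: continuous_measurable_PV; exact: continuous_pc. Qed.

Lemma mf_PV {dy} {Y : measurableType dy} (f : Y -> X) :
  (forall i j, mble (fun y => pc i j (f y))) -> mble f.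
Proof.
move=> mf; apply: mf_generated => U oU.
apply: (mf_coord_open (c := fun (ij : 'I_d.+1 * 'I_d.+1) (x : X) =>
  pc ij.1 ij.2 x)) => // U' x; exact: PV_gen.
Qed.

(** The squared dilation of the line [x] by [g] ([qformE]), as a polynomial in the entries of [g]
    and the coordinates of [x]: joint measurability is then immediate. *)
Definition qform (g : GL R d) x : R :=
  \sum_i \sum_j gmx dot i j * \sum_k \sum_l val g i k * val g j l * pc k l x.

Lemma act_coord (g : GL R d) x i j : (val g *m vec x) i 0 * (val g *m vec x) j 0 =
  dot (vec x) (vec x) * \sum_k \sum_l val g i k * val g j l * pc k l x.
Proof.
rewrite !mxE mulr_suml mulr_sumr; apply: eq_bigr => k _.
rewrite !mulr_sumr; apply: eq_bigr => l _; rewrite /pc.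
by field; rewrite gt_eqF// dot_gt0// vec_neq0.
Qed.

Lemma qformE g x : qform g x = dot (val g *m vec x) (val g *m vec x) / dot (vec x) (vec x).
Proof.
have n0 : dot (vec x) (vec x) != 0 by rewrite gt_eqF// dot_gt0// vec_neq0.
apply: (mulIf n0); rewrite divfK// [RHS]dot_gmx /qform mulr_suml; apply: eq_bigr => i _.
rewrite mulr_suml; apply: eq_bigr => j _; rewrite act_coord; ring.
Qed.

Lemma act_neq0 (g : GL R d) x : val g *m vec x != 0. Proof. exact: GL_act_subproof. Qed.

Lemma qform_gt0 g x : 0 < qform g x.
Proof. by rewrite qformE divr_gt0// dot_gt0 ?act_neq0 ?vec_neq0. Qed.

Lemma pc_act g x i j :
  pc i j (GL_act g x) = (\sum_k \sum_l val g i k * val g j l * pc k l x) / qform g x.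
Proof.
have [c c0 gx] := vec_act g x; rewrite /pc gx.
have zE (v : V) k : (c *: v) k 0 = c * v k 0 by rewrite mxE.
rewrite !zE -/(pc _ _ _).
rewrite mulrACA act_coord dotZl dotZr qformE.
have := dot_gt0 dot (act_neq0 g x); have := dot_gt0 dot (vec_neq0 x).
move: (dot _ _) (dot _ _) (\sum_k _) => p q S p0 q0.
by field; rewrite c0 !gt_eqF.
Qed.

Let mf_pcsum i j : mble
  (fun z : GL R d * X => \sum_k \sum_l val z.1 i k * val z.1 j l * pc k l z.2).
Proof.
apply: measurable_sum => k; apply: measurable_sum => l; apply: mfM.
  apply: mfM; first exact: (mf_comp (mf_coord i k) mf_fst).
  exact: (mf_comp (mf_coord j l) mf_fst).
exact: (mf_comp (mf_pc k l) mf_snd).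
Qed.

Lemma mf_qform : mble2 qform.
Proof.
by apply: measurable_sum => i; apply: measurable_sum => j; apply: mfM.
Qed.

Lemma mf_lnqform : mble (fun z : GL R d * X => ln (qform z.1 z.2)).
Proof. by apply: mf_comp mf_qform; exact: measurable_ln. Qed.

Lemma mf_GL_act : mble2 (@GL_act R d).
Proof.
apply: mf_PV => i j.
(* The division in [pc_act] is replaced by a multiplication by [expR (- ln _)], which agrees with it
   because [qform] is positive. *)
apply: (eq_measurable_fun (fun z : GL R d * X =>
  (\sum_k \sum_l val z.1 i k * val z.1 j l * pc k l z.2) * expR (- ln (qform z.1 z.2)))).
  by move=> z _; rewrite pc_act expRN lnK ?posrE ?qform_gt0.
apply: mfM => //; apply: mf_comp => //.
by apply: mf_comp => //; exact: mf_lnqform.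
Qed.

Lemma sigma_qform g x : sigma dot g x = 2^-1 * ln (qform g x).
Proof.
rewrite /sigma -[val (repr x)]/(vec x) qformE -!sqr_enorm -expr_div_n lnXn.
  by field.
by rewrite divr_gt0// enorm_gt0 ?act_neq0 ?vec_neq0.
Qed.

Lemma mf_sigma : mble2 (sigma dot).
Proof.
apply: (eq_measurable_fun (fun z : GL R d * X => 2^-1 * ln (qform z.1 z.2))).
  by move=> z _; rewrite sigma_qform.
by apply: mfM => //; exact: mf_lnqform.
Qed.

Definition sd (x y : X) : R := sine dot (vec x) (vec y).

Definition cosq x y : R :=
  \sum_i \sum_j \sum_k \sum_l gmx dot i j * gmx dot k l * pc i k x * pc j l y.

Lemma cosqE x y :
  cosq x y = dot (vec x) (vec y) ^+ 2 / (dot (vec x) (vec x) * dot (vec y) (vec y)).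
Proof.
have p0 := dot_gt0 dot (vec_neq0 x); have q0 := dot_gt0 dot (vec_neq0 y).
rewrite expr2 {1}dot_gmx /cosq !mulr_suml; apply: eq_bigr => i _.
rewrite !mulr_suml; apply: eq_bigr => j _.
rewrite dot_gmx mulr_sumr mulr_suml; apply: eq_bigr => k _.
rewrite mulr_sumr mulr_suml; apply: eq_bigr => l _; rewrite /pc.
by field; rewrite !gt_eqF.
Qed.

Lemma sdE x y : sd x y = Num.sqrt (1 - cosq x y).
Proof.
have p0 := dot_gt0 dot (vec_neq0 x); have q0 := dot_gt0 dot (vec_neq0 y).
have n1 := enorm_gt0 dot (vec_neq0 x); have n2 := enorm_gt0 dot (vec_neq0 y).
have s0 := sine_ge0 dot (vec x) (vec y); rewrite -[LHS]ger0_norm// -sqrtr_sqr.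
congr Num.sqrt; rewrite cosqE /sd /sine /wedge expr_div_n sqr_sqrtr ?gram_ge0// /gram.
by rewrite exprMn !sqr_enorm; field; rewrite !gt_eqF.
Qed.

Lemma continuous_sd x : continuous (sd x).
Proof.
have e : sd x = fun y => Num.sqrt (1 - cosq x y) by apply/funext => y; exact: sdE.
rewrite e => y.
suff h : (fun y => 1 - cosq x y) @ y --> 1 - cosq x y.
  by apply: (@continuous_comp _ _ _ (fun y => 1 - cosq x y)) => //; exact: sqrt_continuous.
suff hc : cosq x @ y --> cosq x y by exact: (cvgB (cvg_cst (1 : R)) hc).
apply: (@continuous_sum X _ (fun i y => \sum_j \sum_k \sum_l gmx dot i j * gmx dot k l * pc i k x * pc j l y)) => i.
apply: (@continuous_sum X _ (fun j y => \sum_k \sum_l gmx dot i j * gmx dot k l * pc i k x * pc j l y)) => j.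
apply: (@continuous_sum X _ (fun k y => \sum_l gmx dot i j * gmx dot k l * pc i k x * pc j l y)) => k.
apply: (@continuous_sum X _ (fun l y => gmx dot i j * gmx dot k l * pc i k x * pc j l y)) => l.
move=> z; exact: (cvgM (cvg_cst (gmx dot i j * gmx dot k l * pc i k x)) (@continuous_pc j l z)).
Qed.

Lemma mf_sd : mble2 sd.
Proof.
apply: (eq_measurable_fun (fun z : X * X => Num.sqrt (1 - cosq z.1 z.2))).
  by move=> z _; rewrite sdE.
apply: mf_comp.
  by apply: continuous_measurable_fun => x; exact: sqrt_continuous.
apply: mfB => //.
do 4 apply: measurable_sum => ?.
apply: mfM; last exact: (mf_comp (mf_pc _ _) mf_snd).
apply: mfM => //; exact: (mf_comp (mf_pc _ _) mf_fst).
Qed.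

Lemma sd_xx x : sd x x = 0. Proof. by rewrite /sd /sine wedge_vv mul0r. Qed.
Lemma sd_ge0 x y : 0 <= sd x y. Proof. exact: sine_ge0. Qed.
Lemma sd_le1 x y : sd x y <= 1. Proof. exact: sine_le1. Qed.
Lemma sdC x y : sd x y = sd y x. Proof. exact: sineC. Qed.

Lemma nbhs_sd x (e : R) : 0 < e -> nbhs x [set y | sd x y < e].
Proof.
move=> e0; apply: (@continuous_sd x x [set z : R | z < e]).
by apply: open_nbhs_nbhs; split; [exact: open_lt|rewrite /= sd_xx].
Qed.

Lemma sd_eq0 x y : sd x y = 0 -> x = y.
Proof.
move=> h; have [c c0 [h1 h2]] := sine_chord dot (vec_neq0 x) (vec_neq0 y).
apply: (@eq_PV _ _ c); apply/eqP; rewrite -subr_eq0; apply/negPn/negP => /(enorm_gt0 dot).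
by rewrite ltNge => /negP; apply; apply: le_trans h1 _; rewrite -[sine _ _ _]/(sd x y) h mulr0.
Qed.

Lemma PV_uniform (P : nat -> X -> Prop) :
  (forall n m x, (n <= m)%N -> P n x -> P m x) ->
  (forall x, exists n, exists2 e : R, 0 < e & forall y, sd x y < e -> P n y) ->
  exists n, forall x, P n x.
Proof.
move=> mono loc.
have [|n hn] := compact_uniform compact_PV mono; last by exists n => x; exact: hn.
move=> x _; have [n [e e0 he]] := loc x; exists n.
by apply: filterS (nbhs_sd x e0) => y /= /he.
Qed.

End ProjectiveTopology.

(** * Strong irreducibility: orbits in general position *)

Section StrongIrreducibility.
Context {R : realType} {d : nat} (S : set (GL R d)).
Local Notation V := 'cV[R]_d.+1.
Hypotheses (S_mul : forall g h, S g -> S h -> S (g * h)%g)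
  (S_irr : strongly_irreducible S)
  (S_ex : exists g, S g).

Definition lact (g : GL R d) : 'End(V) := linfun (mulmx (val g)).

Lemma lactE g v : lact g v = val g *m v. Proof. by rewrite lfunE. Qed.

Lemma lact_inj g : lker (lact g) == 0%VS.
Proof.
have inj : injective (fun u : V => val g *m u) := can_inj (mulKmx (Defs.GL_unit g)).
by apply/lker0P => u v; rewrite !lactE; exact: inj.
Qed.

Lemma dim_lact g U : \dim (lact g @: U) = \dim U.
Proof. by rewrite limg_dim_eq// (eqP (lact_inj g)) capv0. Qed.

Lemma lact_neq0 (g : GL R d) (v : V) : v != 0 -> val g *m v != 0.
Proof.
apply: contra => /eqP gv; apply/eqP; have /lker0P := lact_inj g; apply.
by rewrite !lactE gv mulmx0.
Qed.

(* A covering of the orbit by finitely many subspaces, minimal for the largest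
   dimension [r] and then for the number of [r]-dimensional members: its
   [r]-dimensional members are permuted by [S]. *)
Lemma orbit_avoids (Us : seq {vspace V}) (v : V) : v != 0 ->
  (forall U, U \in Us -> U != fullv) ->
  exists2 g, S g & forall U, U \in Us -> val g *m v \notin U.
Proof.
move=> v0 Us_proper; apply: contrapT => nav.
pose cov (Ts : seq {vspace V}) := forall g, S g -> exists2 U, U \in Ts & val g *m v \in U.
have covU : cov Us.
  move=> g Sg; apply: contrapT => nU; apply: nav; exists g => // U UU.
  by apply/negP => gvU; apply: nU; exists U.
have dimU U : U \in Us -> (\dim U <= d)%N.
  move=> /Us_proper; apply: contraNT; rewrite -ltnNge => h.
  by rewrite eqEdim subvf/= dimvf /dim/= muln1.
pose Pr r := `[< exists Ts, cov Ts /\ forall U, U \in Ts -> (\dim U <= r)%N >].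
have exr : exists r, Pr r by exists d; apply/asboolP; exists Us.
case: (ex_minnP exr) => r /asboolP[T0 [covT0 dimT0]] rmin.
have rd : (r <= d)%N by apply: rmin; apply/asboolP; exists Us.
pose PN N := `[< exists Ts, [/\ cov Ts, forall U, U \in Ts -> (\dim U <= r)%N, uniq Ts &
  size [seq U <- Ts | \dim U == r] = N] >].
have exN : exists N, PN N.
  exists (size [seq U <- undup T0 | \dim U == r]); apply/asboolP; exists (undup T0).
  split => //; last exact: undup_uniq; last by move=> U; rewrite mem_undup; exact: dimT0.
  by move=> g /covT0[U UT gv]; exists U => //; rewrite mem_undup.
case: (ex_minnP exN) => N /asboolP[Ts [covT dimT uT sT]] Nmin.
set T := [seq U <- Ts | \dim U == r] in sT.
(* Intersecting members with preimages of members by [g] gives another covering, hence by minimality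
   at least [N] intersections of dimension [r]. Such an intersection is a whole member of [T] that
   [g] maps onto a member of [T]; as there are only [N] members, each of them is of this kind. *)
have inv g U : S g -> U \in T -> (lact g @: U)%VS \in T.
  move=> Sg UT.
  pose T2 := undup [seq (U :&: lact g @^-1: U')%VS | U <- Ts, U' <- Ts].
  have h : (N <= size [seq U <- T2 | \dim U == r])%N.
    apply: Nmin; apply/asboolP; exists T2; split => //; last exact: undup_uniq.
      move=> h Sh; have [U1 U1T hv] := covT _ Sh; have [U2 U2T ghv] := covT _ (S_mul Sg Sh).
      exists (U1 :&: lact g @^-1: U2)%VS.
        by rewrite mem_undup; apply/allpairsP; exists (U1, U2).
      by rewrite memv_cap hv -memv_preim lactE mulmxA.
    move=> W; rewrite mem_undup => /allpairsP[[U1 U2] /= [U1T _ ->]].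
    by apply: leq_trans (dimvS (capvSl _ _)) (dimT _ U1T).
  pose T3 := [seq U <- T | (lact g @: U)%VS \in T].
  have h2 : (size [seq U <- T2 | \dim U == r] <= size T3)%N.
    apply: uniq_leq_size; first by rewrite filter_uniq// undup_uniq.
    move=> W; rewrite mem_filter mem_undup => /andP[/eqP dW /allpairsP[[U1 U2] /= [U1T U2T WE]]].
    have WU : W = U1.
      apply/eqP; rewrite eqEdim {1}WE capvSl/= dW; exact: dimT.
    have gW : (lact g @: W)%VS = U2.
      apply/eqP; rewrite eqEdim dim_lact dW dimT// andbT; apply/subvP => _ /memv_imgP[u uW ->].
      by move: uW; rewrite WE memv_cap => /andP[_]; rewrite -memv_preim.
    have U2r : \dim U2 == r by rewrite -gW dim_lact dW.
    by rewrite mem_filter gW !mem_filter U2T U2r WU U1T -WU dW eqxx.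
  have h3 : size T3 = size T.
    by apply/eqP; rewrite eqn_leq size_filter count_size/= -size_filter sT (leq_trans h).
  have : all (fun U => (lact g @: U)%VS \in T) T.
    by rewrite all_count -size_filter -/T3 h3.
  by move=> /allP; apply.
have r0 : (0 < r)%N.
  rewrite lt0n; apply/eqP => r0; have [g Sg] := S_ex; have [U UT gv] := covT _ Sg.
  have := dimT _ UT; rewrite r0 leqn0 dimv_eq0 => /eqP U0; move: gv; rewrite U0 memv0.
  by rewrite (negbTE (lact_neq0 g v0)).
have T_ex : T != [::].
  apply/eqP => T_nil; have : (r <= r.-1)%N.
    apply: rmin; apply/asboolP; exists Ts; split => // U UT.
    rewrite -ltnS prednK// ltn_neqAle dimT// andbT; apply/negP => dU.
    have : U \in T by rewrite mem_filter dU.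
    by rewrite T_nil.
  by rewrite leqNgt prednK// leqnn.
apply: (S_irr T_ex) => [U|g u Sg [U UT uU]].
  rewrite mem_filter => /andP[/eqP dU _]; split.
    by rewrite -dimv_eq0 dU -lt0n.
  apply/eqP => Uf; move: rd; rewrite -dU Uf dimvf /dim/= muln1 ltnn//.
exists (lact g @: U)%VS; first exact: inv.
by rewrite -lactE memv_img.
Qed.

(** Each new vector avoids the finitely many proper subspaces spanned by at most [d] of the previous
    ones. *)
Lemma general_position (v : V) M : v != 0 -> exists s : seq (GL R d),
  [/\ size s = M, forall g, g \in s -> S g &
  forall t, subseq t [seq val g *m v | g <- s] -> (size t <= d.+1)%N -> free t].
Proof.
move=> v0; elim: M => [|M [s [sM sS sf]]].
  exists [::]; split => // t; rewrite subseq0 => /eqP -> _; exact: nil_free.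
set l := [seq val g *m v | g <- s] in sf.
pose Us := [seq <<mask m l>>%VS | m <- [seq tval m | m <- enum {: (size l).-tuple bool}] &
  (size (mask m l) <= d)%N].
have [U /mapP[m]|g Sg gU] := @orbit_avoids Us v v0.
  rewrite mem_filter => /andP[md _] ->; apply/eqP => mf.
  have := dim_span (mask m l); rewrite mf dimvf /dim/= muln1 => h.
  by have := leq_trans h md; rewrite ltnn.
exists (g :: s); split; first by rewrite /= sM.
  by move=> h; rewrite inE => /orP[/eqP ->//|/sS].
case=> [|w t]; first by move=> _ _; exact: nil_free.
rewrite /= -/l; have [->|_] := eqVneq w (val g *m v) => tl td; last by apply: sf.
have tl2 : (size t <= d)%N by [].
rewrite free_cons sf ?(leq_trans tl2)// andbT; apply: gU.
have /subseqP[m ml tE] := tl; apply/mapP; exists m; last by rewrite tE.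
rewrite mem_filter -tE tl2/=; apply/mapP; exists (Tuple (introT eqP ml)) => //.
by rewrite mem_enum.
Qed.

End StrongIrreducibility.

(** * The eigenline of a simple eigenvalue *)

Section RankOne.
Context {R : realType} {d : nat} (A : 'M[R]_d.+1) (lam : R).
Local Notation V := 'cV[R]_d.+1.

(* If [A E = lam E] then [('X - lam)] to the power [\rank E] divides the
   characteristic polynomial of [A]. *)
Lemma rank_le1 (E : 'M[R]_d.+1) : A *m E = lam *: E ->
  ~~ (('X - lam%:P) ^+ 2 %| char_poly A) -> (\rank E <= 1)%N.
Proof.
move=> AE; apply: contraNT; rewrite -ltnNge => rE.
(* In a basis adapted to the image of [E], the first [\rank E] columns of [A] are [lam] times those
   of the identity, and each contributes a factor ['X - lam%:P] to the determinant. *)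
pose L := col_ebase E; pose B := invmx L *m A *m L.
have LU : L \in unitmx by exact: col_ebase_unit.
have Bpid : B *m pid_mx (\rank E) = lam *: (pid_mx (\rank E) : 'M[R]_d.+1).
  have EL : L *m pid_mx (\rank E) = E *m invmx (row_ebase E).
    by apply: (canRL (mulmxK (row_ebase_unit E))); exact: mulmx_ebase.
  by rewrite /B -!mulmxA EL (mulmxA A) AE -scalemxAl -EL -scalemxAr mulmxA mulVmx// mul1mx.
have charB : char_poly B = char_poly A.
  have LUp : map_mx polyC L \in unitmx by rewrite map_unitmx.
  rewrite /char_poly (_ : char_poly_mx B =
    invmx (map_mx polyC L) *m char_poly_mx A *m map_mx polyC L).
    by rewrite !det_mulmx mulrAC det_inv mulVr ?mul1r// -unitmxE.
  rewrite /char_poly_mx mulmxBr mulmxBl /B !map_mxM map_invmx; congr (_ - _).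
  by rewrite mul_mx_scalar -scalemxAl mulVmx// scalemx1.
clearbody B; rewrite -charB /char_poly.
pose D : 'rV[{poly R}]_d.+1 := \row_j (if (j < \rank E)%N then 'X - lam%:P else 1).
pose M : 'M[{poly R}]_d.+1 :=
  \matrix_(i, j) (if (j < \rank E)%N then (i == j)%:R else char_poly_mx B i j).
have -> : char_poly_mx B = M *m diag_mx D.
  apply/matrixP => i j; rewrite mul_mx_diag !mxE.
  case: ifP => jr; last by rewrite mulr1.
  have Bij : B i j = lam * (i == j)%:R.
    have := congr1 (fun C : 'M[R]_d.+1 => C i j) Bpid; rewrite !mxE (bigD1 j)//= big1.
      rewrite !mxE eqxx jr/= mulr1 addr0 => ->.
      by rewrite -[in RHS]val_eqE /=; case: eqP => [->|_] /=; rewrite ?jr.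
    move=> k kj; rewrite !mxE; case: eqP => [/val_inj kj'|]; last by rewrite mulr0.
    by rewrite kj' eqxx in kj.
  rewrite Bij; case: eqP => _ /=; first by rewrite mulr1n mul1r mulr1.
  by rewrite mulr0n mul0r mulr0 subr0.
rewrite det_mulmx dvdp_mull// det_diag (bigD1 ord0)//=.
have i1 : (1 < d.+1)%N by apply: leq_trans rE (rank_leq_row E).
rewrite (bigD1 (Ordinal i1))//= mulrA dvdp_mulr// !mxE /= (ltnW rE) rE expr2.
exact: dvdpp.
Qed.

Lemma rank_le1_colinear (E : 'M[R]_d.+1) : (\rank E <= 1)%N ->
  exists e : V, forall u : V, exists c : R, E *m u = c *: e.
Proof.
move=> rE; exists (col_base E *m const_mx 1) => u; exists (\sum_j (row_base E *m u) j 0).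
transitivity (col_base E *m (row_base E *m u)); first by rewrite mulmxA mulmx_base.
rewrite scalemxAr; congr (_ *m _).
apply/colP => i; rewrite [RHS]mxE [X in _ * X]mxE mulr1 (bigD1 i)//= big1 ?addr0// => j.
have h (k : 'I_(\rank E)) : k = 0%N :> nat.
  by apply/eqP; rewrite -leqn0 -ltnS (leq_trans (ltn_ord k)).
by rewrite -val_eqE/= !h.
Qed.

End RankOne.

(** * Growth of the powers of a proximal matrix *)

Section MatrixPowers.
Context {R : realType} {d : nat}.
Local Notation C := R[i].
Local Open Scope complex_scope.
Let normc (z : C) : R := Num.sqrt (complex.Re z ^+ 2 + complex.Im z ^+ 2).

(** Induction on the roots instead of a Jordan form: [B' = (A - w) B] is killed by the remaining
    factors, and the powers applied to [B] satisfy a first-order recursion of ratio [w], smaller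
    than [r] in modulus, with a source of order [r ^ k]. *)
Lemma complex_pow_decay (A : 'M[C]_d.+1) (ws : seq C) (r : R) (B : 'M[C]_d.+1) : 0 < r ->
  (forall w, w \in ws -> `|w| < r%:C) ->
  horner_mx A (\prod_(w <- ws) ('X - w%:P)) *m B = 0 ->
  exists2 c : R, 0 <= c & forall k i j, `|(A ^+ k *m B) i j| <= (c * r ^+ k)%:C.
Proof.
move=> r0; elim: ws B => [|w ws ih] B hw.
  rewrite big_nil rmorph1 mul1mx => ->; exists 0 => // k i j.
  by rewrite mulmx0 mxE normr0 mul0r.
rewrite big_cons mulrC rmorphM rmorphB /= horner_mx_X horner_mx_C -mulmxA.
set B' := (A - w%:M) *m B => hB'.
have [|c' c'0 hc'] := ih B' _ hB'; first by move=> u uw; apply: hw; rewrite inE uw orbT.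
have wr : `|w| < r%:C by apply: hw; rewrite inE eqxx.
pose nw := normc w; have nwE : `|w| = nw%:C := normc_def w.
have nwr : nw < r by rewrite nwE ltcR in wr.
have nw0 : 0 <= nw by exact: sqrtr_ge0.
pose c0 := \sum_i \sum_j normc (B i j).
have hB i j : `|B i j| <= c0%:C.
  have n0 k l : 0 <= normc (B k l) by exact: sqrtr_ge0.
  rewrite normc_def lecR -/(normc _) /c0 (bigD1 i)//= (bigD1 j)//= -addrA lerDl addr_ge0//.
    by apply: sumr_ge0.
  by apply: sumr_ge0 => k _; apply: sumr_ge0.
have c00 : 0 <= c0.
  by apply: sumr_ge0 => k _; apply: sumr_ge0 => l _; exact: sqrtr_ge0.
(* [c0] bounds the initial value, and [c * (r - nw) >= c'] absorbs the source. *)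
pose c := c0 + c' / (r - nw).
have c_ge0 : 0 <= c by rewrite addr_ge0// divr_ge0// subr_ge0 ltW.
exists c => // k i j; elim: k i j => [|k ihk] i j.
  rewrite expr0 mul1mx expr0 mulr1; apply: le_trans (hB i j) _.
  by rewrite lecR lerDl divr_ge0// subr_ge0 ltW.
have -> : A ^+ k.+1 *m B = w *: (A ^+ k *m B) + A ^+ k *m B'.
  by rewrite /B' exprSr -mulmxA mulmxBl mulmxBr mul_scalar_mx -scalemxAr addrC subrK.
have -> : (w *: (A ^+ k *m B) + A ^+ k *m B') i j =
    w * (A ^+ k *m B) i j + (A ^+ k *m B') i j by rewrite mxE [X in X + _]mxE.
apply: le_trans (ler_normD _ _) _; rewrite normrM.
apply: le_trans (lerD (ler_wpM2l (normr_ge0 _) (ihk i j)) (hc' k i j)) _.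
rewrite nwE -rmorphM -rmorphD lecR exprSr.
have rk : 0 <= r ^+ k by rewrite exprn_ge0// ltW.
have -> : c * (r ^+ k * r) = nw * (c * r ^+ k) + (c * (r - nw)) * r ^+ k by ring.
rewrite lerD2l ler_wpM2r// /c mulrDl divfK ?gt_eqF ?subr_gt0//.
by rewrite lerDr mulr_ge0// subr_ge0 ltW.
Qed.

Lemma real_pow_decay (A B : 'M[R]_d.+1) (q : {poly R}) (ws : seq C) (r : R) : 0 < r ->
  (forall w, w \in ws -> `|w| < r%:C) ->
  map_poly (real_complex R) q = \prod_(w <- ws) ('X - w%:P) ->
  horner_mx A q *m B = 0 ->
  exists2 c : R, 0 <= c & forall k i j, `|(A ^+ k *m B) i j| <= c * r ^+ k.
Proof.
move=> r0 hw qE qB; pose f := map_mx (real_complex R) : 'M[R]_d.+1 -> 'M[C]_d.+1.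
have [|c c0 hc] := @complex_pow_decay (f A) ws r (f B) r0 hw.
  by rewrite -qE -map_horner_mx -map_mxM qB map_mx0.
exists c => // k i j; have := hc k i j.
rewrite -rmorphXn /= -map_mxM mxE normc_def /= expr0n addr0 sqrtr_sqr.
by rewrite lecR.
Qed.

Lemma radius_between (ws : seq C) (a : R) : 0 < a -> (forall w, w \in ws -> `|w| < a%:C) ->
  exists r : R, [/\ 0 < r, r < a & forall w, w \in ws -> `|w| < r%:C].
Proof.
move=> a0; elim: ws => [|w ws ih] h.
  by exists (a / 2); split; rewrite ?divr_gt0// ltr_pdivrMr// ltr_pMr// ltrDl.
have [|r [r0 ra hr]] := ih; first by move=> u uw; apply: h; rewrite inE uw orbT.
have wa : normc w < a.
  by have := h w; rewrite inE eqxx => /(_ isT); rewrite normc_def ltcR.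
exists (Num.max r ((normc w + a) / 2)); split.
- by rewrite lt_max r0.
- by rewrite gt_max ra/= ltr_pdivrMr// mulr_natr mulr2n ltrD2r.
- move=> u; rewrite inE => /orP[/eqP ->|/hr h']; last first.
    by apply: lt_le_trans h' _; rewrite lecR le_max lexx.
  by rewrite normc_def ltcR lt_max ltr_pdivlMr// mulr_natr mulr2n ltrD2l wa orbT.
Qed.

(* The spectral data of a proximal matrix: [E] is a multiple of the projection
   onto the dominant eigenline, [F] takes values in the complementary
   hyperplane. *)
Lemma proximal_split (g : GL R d) (z : C) :
  let p := map_poly (real_complex R) (char_poly (val g)) in
  root p z -> mup z p = 1%N -> (forall w, root p w -> w != z -> `|w| < `|z|) ->
  exists (lam : R) (b : R) (E F : 'M[R]_d.+1) (r c : R),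
    [/\ b != 0, E != 0, (\rank E <= 1)%N, 0 < r < `|lam| & 0 <= c] /\
    forall k, b *: val g ^+ k = lam ^+ k *: E + val g ^+ k *m F /\
      forall i j, `|(val g ^+ k *m F) i j| <= c * r ^+ k.
Proof.
set A := val g => p rz mz hz.
(* The conjugate is a root of the same modulus, so a unique dominant root is real. *)
have zconj : z^* = z.
  apply: contrapT => /eqP zz; have : `|z^*| < `|z|.
    apply: hz => //; rewrite -complex_root_conj (_ : map_poly _ _ = p)//.
    by rewrite -map_poly_comp; apply: eq_map_poly => x; rewrite /= oppr0.
  by rewrite normcJ ltxx.
have [lam zE] : exists lam : R, z = lam%:C.
  exists (complex.Re z); case: z zconj {rz mz hz} => a b /= [/eqP].
  by rewrite eqNr => /eqP ->.
have rlam : root (char_poly A) lam by move: rz; rewrite zE /p fmorph_root.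
have pmonic : p \is monic by rewrite map_monic char_poly_monic.
have lam0 : lam != 0.
  apply/eqP => l0; move: rlam; rewrite l0 /root horner_coef0 char_poly_det.
  rewrite mulf_eq0 signr_eq0/=; apply/negP.
  by rewrite -unitfE -unitmxE; exact: Defs.GL_unit.
have [q qE] := factor_theorem _ _ rlam.
have [rs rsE] := closed_field_poly_normal p.
rewrite (monicP pmonic) scale1r in rsE.
have crs : count_mem z rs = 1%N by rewrite -mu_prod_XsubC -rsE.
have zrs : z \in rs by rewrite -has_pred1 has_count crs.
pose ws := rem z rs.
have prs := perm_to_rem zrs.
have pE : p = ('X - z%:P) * \prod_(w <- ws) ('X - w%:P).
  by rewrite rsE (perm_big _ prs) big_cons.
have zws : z \notin ws.
  by apply/count_memPn; move: crs; rewrite (permP prs)/= eqxx => -[].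
have qws : map_poly (real_complex R) q = \prod_(w <- ws) ('X - w%:P).
  have x0 : 'X - z%:P != 0 by rewrite polyXsubC_eq0.
  apply: (mulIf x0); rewrite [RHS]mulrC -pE /p qE rmorphM rmorphB/= map_polyX map_polyC/= zE.
  by [].
have pdvd : ~~ (('X - lam%:P) ^+ 2 %| char_poly A).
  rewrite -(dvdp_map (real_complex R)) rmorphXn rmorphB/= map_polyX map_polyC/= -zE.
  by rewrite -mup_geq ?monic_neq0// mz.
(* [q] is the cofactor of ['X - lam%:P], so [b] is the eigenvalue of [q(A)] on the eigenline; it is
   non-zero because the root is simple. *)
pose b := q.[lam].
have b0 : b != 0.
  apply: contra pdvd => /factor_theorem[q' q'E].
  by rewrite qE q'E -mulrA -expr2 dvdp_mull.
pose E := horner_mx A q; pose F := b%:M - E.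
have EA : (A - lam%:M) *m E = 0.
  have := Cayley_Hamilton A; rewrite qE mulrC rmorphM rmorphB/= horner_mx_X horner_mx_C.
  exact.
have AE : A *m E = lam *: E.
  by move/eqP: EA; rewrite mulmxBl subr_eq0 mul_scalar_mx => /eqP.
have EF : E *m F = 0.
  have [q2 q2E] : exists q2, q - b%:P = q2 * ('X - lam%:P).
    by apply/factor_theorem; rewrite /root !hornerE subrr.
  have -> : F = - horner_mx A (q2 * ('X - lam%:P)).
    by rewrite -q2E rmorphB/= horner_mx_C opprB.
  rewrite mulmxN mulrC -[E *m _]/(E * _) -rmorphM/= mulrA [q * _]mulrC -mulrA rmorphM/=.
  rewrite rmorphB/= horner_mx_X horner_mx_C (rmorphM (horner_mx A) q) /=.
  rewrite -[_ * (_ * _)]/((A - lam%:M) *m (E *m horner_mx A q2)) mulmxA EA mul0mx oppr0//.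
have lam_gt0 : 0 < `|lam| by rewrite normr_gt0.
have hws w : w \in ws -> `|w| < `|lam|%:C.
  move=> wws; have := hz w; rewrite (_ : `|z| = `|lam|%:C); last first.
    by rewrite zE normc_def /= expr0n addr0 sqrtr_sqr.
  apply; last by apply: contraNneq zws => <-.
  by rewrite pE rootM root_prod_XsubC wws orbT.
have [r [r0 rlam' hr]] := radius_between lam_gt0 hws.
have [c c0 hc] := real_pow_decay r0 hr qws EF.
  exists lam, b, E, F, r, c; split; last first.
    move=> k; split => [|i j]; last exact: hc.
    have -> : lam ^+ k *: E = A ^+ k *m E.
      elim: k => [|k ih]; first by rewrite !expr0 scale1r mul1mx.
      by rewrite (exprSr A) (exprS lam) -mulmxA AE -scalemxAr -ih scalerA.
    by rewrite -mulmxDr addrC subrK mul_mx_scalar.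
  split => //; last by rewrite r0.
    apply/eqP => E0; have := mxminpoly_min E0; rewrite dvdp_eq => /eqP qm.
    move: b0; rewrite /b qm hornerM; have : root (mxminpoly A) lam by rewrite root_mxminpoly.
    by move=> /rootP ->; rewrite mulr0 eqxx.
  exact: rank_le1 AE pdvd.
Qed.

End MatrixPowers.

(** * Contraction of angles by the powers of a proximal element *)

Section ProximalContraction.
Context {R : realType} {d : nat} (dot : {dot 'cV[R]_d.+1 for idfun}).
Local Notation V := 'cV[R]_d.+1.
Local Notation N := (enorm dot).
Local Notation op := (opnorm dot).
Local Notation op2 := (opnorm2 dot).
Local Notation wedge := (wedge dot).

(** Every pair can be replaced by an orthogonal one without changing the areas, and the area of an
    orthogonal pair scales by the product of the norms. *)
Lemma opnorm2_unit (A : 'M[R]_d.+1) c : 0 <= c ->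
  (forall u v, N u = 1 -> N v = 1 -> wedge (A *m u) (A *m v) <= c) -> op2 A <= c.
Proof.
move=> c0 h; apply: opnorm2_le => // u v.
have [w0|w0] := eqVneq (wedge u v) 0; first by rewrite wedge_eq0// w0 mulr0.
have u0 : u != 0.
  by apply: contra w0 => /eqP ->; rewrite !/(wedge _ _) /gram !dot0l mul0r expr0n subrr sqrtr0.
pose t := - dot u v / dot u u; pose w := v + t *: u.
have o : dot u w = 0 by rewrite dotDr dotZr /t divfK ?subrr// gt_eqF// dot_gt0.
have wE : wedge u v = N u * N w.
  by rewrite !/(wedge _ _) -(gramDr dot u v t) /gram -/w o expr0n subr0 sqrtrM ?dot_ge0.
have nu : N u != 0 by apply: contra w0 => /eqP nu; rewrite wE nu mul0r.
have nw : N w != 0 by apply: contra w0 => /eqP nw; rewrite wE nw mulr0.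
have -> : wedge (A *m u) (A *m v) = wedge (A *m u) (A *m w).
  by rewrite !/(wedge _ _) /w mulmxDr -scalemxAr gramDr.
have unit x : N x != 0 -> N ((N x)^-1 *: x) = 1.
  by move=> x0; rewrite enormZ normfV ger0_norm ?enorm_ge0// mulVf.
have -> : A *m u = N u *: (A *m ((N u)^-1 *: u)) by rewrite -scalemxAr scalerA mulfV// scale1r.
have -> : A *m w = N w *: (A *m ((N w)^-1 *: w)) by rewrite -scalemxAr scalerA mulfV// scale1r.
rewrite wedgeZ !ger0_norm ?enorm_ge0// wE mulrC ler_wpM2r ?mulr_ge0 ?enorm_ge0//.
by apply: h; exact: unit.
Qed.

(** Both vectors are close to the line of [e]: subtracting a multiple, of ratio at most 1, of the
    one with the larger coefficient from the other cancels [e] and leaves only [f] and [g]. *)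
Lemma wedge_close (e f g : V) (a b : R) :
  wedge (a *: e + f) (b *: e + g) <= (N (a *: e + f) + N (b *: e + g)) * (N f + N g).
Proof.
wlog ab : a b f g / `|b| <= `|a|.
  move=> h; have [/h//|/ltW/h h'] := leP `|b| `|a|.
  by rewrite wedgeC [N _ + N _]addrC [N f + _]addrC.
have [a0|a0] := eqVneq a 0.
  move: ab; rewrite a0 normr0 normr_le0 => /eqP ->; rewrite !scale0r !add0r.
  apply: le_trans (wedge_le _ _ _) _; rewrite mulrDl mulrDr.
  have := enorm_ge0 dot f; have := enorm_ge0 dot g; nra.
pose t := b / a; have t1 : `|t| <= 1 by rewrite normrM normfV ler_pdivrMr ?normr_gt0// mul1r.
have -> : wedge (a *: e + f) (b *: e + g) = wedge (a *: e + f) (g - t *: f).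
  rewrite !/(wedge _ _) -(gramDr _ _ (b *: e + g) (- t)); congr (Num.sqrt (gram _ _ _)).
  rewrite scalerDr scalerA mulNr divfK// !scaleNr addrACA subrr add0r//.
apply: le_trans (wedge_le _ _ _) _.
apply: (@le_trans _ _ (N (a *: e + f) * (N f + N g))); last first.
  by rewrite ler_wpM2r ?addr_ge0 ?enorm_ge0// lerDl enorm_ge0.
rewrite ler_wpM2l ?enorm_ge0//; apply: le_trans (enormB _ _ _) _.
by rewrite addrC lerD2r enormZ ler_piMl ?enorm_ge0.
Qed.

Lemma small_power (s a B1 B2 e : R) : 0 <= s -> s < 1 -> 0 < a -> 0 <= B1 -> 0 <= B2 -> 0 < e ->
  exists k, B1 * s ^+ k <= e * (a - B2 * s ^+ k) ^+ 2 /\ B2 * s ^+ k <= a / 2.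
Proof.
move=> s0 s1 a0 B10 B20 e0.
pose eta := Num.min (a / 2 / (B2 + 1)) (e * (a / 2) ^+ 2 / (B1 + 1)).
have eta0 : 0 < eta.
  by rewrite lt_min !divr_gt0 ?ltr_wpDl//= mulr_gt0// exprn_gt0// divr_gt0.
have s1' : `|s| < 1 by rewrite ger0_norm.
have /cvgrPdist_le/(_ eta eta0) := cvg_expr s1' => -[k _ /(_ k (leqnn k))].
rewrite /= sub0r normrN ger0_norm ?exprn_ge0// => h; exists k.
have h1 : B2 * s ^+ k <= a / 2.
  apply: (@le_trans _ _ ((B2 + 1) * s ^+ k)); first by rewrite ler_wpM2r ?exprn_ge0// lerDl.
  rewrite -ler_pdivlMl ?ltr_wpDl//; apply: le_trans h _; rewrite ge_min; apply/orP; left.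
  by rewrite mulrC.
split => //; apply: (@le_trans _ _ (e * (a / 2) ^+ 2)).
  apply: (@le_trans _ _ ((B1 + 1) * s ^+ k)); first by rewrite ler_wpM2r ?exprn_ge0// lerDl.
  rewrite -ler_pdivlMl ?ltr_wpDl//; apply: le_trans h _; rewrite ge_min; apply/orP; right.
  by rewrite mulrC.
rewrite ler_pM2l// ler_sqr ?nnegrE ?divr_ge0 ?(ltW a0)//; lra.
Qed.

(** The powers of [g] are [lam ^ k] times a rank one matrix, up to a relative error [(r / lam) ^ k].
    Areas are thus smaller than [lam ^ (2 k)] by this factor, whereas a vector outside the kernel
    [W] of the rank one matrix is dilated by the order of [lam ^ k]. *)
Lemma proximal_contraction (S : set (GL R d)) : proximal S ->
  exists2 g, S g & exists2 W : {vspace V}, W != fullv &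
  forall u, u \notin W -> forall e : R, 0 < e ->
    exists k, op2 (val g ^+ k) * N u ^+ 2 <= e * N (val g ^+ k *m u) ^+ 2.
Proof.
move=> [g Sg [z [rz mz hz]]]; exists g => //; set A := val g.
have [lam [b [E [F [r [c [[b0 E0 rE /andP[r0 rlam] c0] hk]]]]]]] := proximal_split rz mz hz.
have [v hv] := rank_le1_colinear rE.
exists (lker (linfun (mulmx E) : 'Hom(V, V))).
  apply/eqP => kf; case/eqP: E0; apply/matrixP => i j.
  have : (delta_mx j 0 : V) \in lker (linfun (mulmx E) : 'Hom(V, V)) by rewrite kf memvf.
  rewrite memv_ker lfunE /= -colE => /eqP/(congr1 (fun w : V => w i 0)).
  by rewrite !mxE.
move=> u; rewrite memv_ker lfunE /= => Eu e e0.
have a0 : 0 < N (E *m u) by exact: enorm_gt0.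
pose c2 := Ce dot * d.+1%:R * Cco dot * c.
have c20 : 0 <= c2 by rewrite !mulr_ge0 ?Ce_ge0// ltW// Cco_gt0.
have hF k w : N (A ^+ k *m F *m w) <= c2 * r ^+ k * N w.
  apply: le_trans (opnormP _ _ _) _; rewrite ler_wpM2r ?enorm_ge0//.
  rewrite /c2 -[leRHS]mulrA; apply: opnorm_entries; first by rewrite mulr_ge0// exprn_ge0// ltW.
  exact: (hk k).2.
have lam0 : 0 < `|lam| by apply: lt_trans rlam.
pose s := r / `|lam|; have s0 : 0 <= s by rewrite divr_ge0// ltW.
have s1 : s < 1 by rewrite ltr_pdivrMr// mul1r.
have rs k : r ^+ k = s ^+ k * `|lam| ^+ k by rewrite -exprMn divfK// gt_eqF.
pose M := op E + c2.
have M0 : 0 <= M by rewrite addr_ge0// opnorm_ge0.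
have [k [k1 k2]] := @small_power s (N (E *m u)) (4 * M * c2 * N u ^+ 2) (c2 * N u) e
  s0 s1 a0 (mulr_ge0 (mulr_ge0 (mulr_ge0 (ler0n _ 4) M0) c20) (sqr_ge0 _))
  (mulr_ge0 c20 (enorm_ge0 _ _)) e0.
exists k; set l := `|lam| ^+ k; have l0 : 0 < l by rewrite exprn_gt0.
have sk1 : s ^+ k <= 1 by rewrite exprn_ile1// ltW.
have sk0 : 0 <= s ^+ k by rewrite exprn_ge0.
have decomp w : b *: (A ^+ k *m w) = lam ^+ k *: (E *m w) + A ^+ k *m F *m w.
  by rewrite scalemxAl (hk k).1 mulmxDl -scalemxAl.
have up : op2 (A ^+ k) <= 4 * M * c2 * s ^+ k * l ^+ 2 / b ^+ 2.
  apply: opnorm2_unit => [|x y nx ny].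
    have h4 : 0 <= 4 * M * c2 * s ^+ k by exact: (mulr_ge0 (mulr_ge0 (mulr_ge0 (ler0n _ 4) M0) c20) sk0).
    exact: (divr_ge0 (mulr_ge0 h4 (sqr_ge0 l)) (sqr_ge0 b)).
  rewrite ler_pdivlMr ?exprn_even_gt0//.
  have -> : wedge (A ^+ k *m x) (A ^+ k *m y) * b ^+ 2 =
      wedge (b *: (A ^+ k *m x)) (b *: (A ^+ k *m y)).
    by rewrite wedgeZ -expr2 real_normK ?num_real// mulrC.
  have bnd w : N w = 1 -> N (b *: (A ^+ k *m w)) <= M * l.
    move=> nw; rewrite decomp; apply: le_trans (enormD _ _ _) _; rewrite /M mulrDl; apply: lerD.
      rewrite enormZ normrX mulrC ler_wpM2r ?exprn_ge0//.
      by apply: le_trans (opnormP _ _ _) _; rewrite nw mulr1.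
    apply: le_trans (hF _ _) _; rewrite nw mulr1 rs mulrA ler_wpM2r ?(ltW l0)//.
    by rewrite ler_piMr.
  have fb w : N w = 1 -> N (A ^+ k *m F *m w) <= c2 * s ^+ k * l.
    by move=> nw; apply: le_trans (hF _ _) _; rewrite nw mulr1 rs mulrA.
  have bx := bnd x nx; have b_y := bnd y ny.
  rewrite !decomp in bx b_y *; have [cx hx] := hv x; have [cy hy] := hv y.
  rewrite hx hy !scalerA in bx b_y *.
  apply: le_trans (wedge_close _ _ _ _ _) _.
  apply: (@le_trans _ _ ((M * l + M * l) * (c2 * s ^+ k * l + c2 * s ^+ k * l))).
    by apply: ler_pM; rewrite ?addr_ge0 ?enorm_ge0//; apply: lerD => //; exact: fb.
  by apply: le_of_eq; ring.
have low : (N (E *m u) - c2 * N u * s ^+ k) ^+ 2 * l ^+ 2 <= b ^+ 2 * N (A ^+ k *m u) ^+ 2.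
  rewrite -exprMn -(real_normK (num_real b)) -exprMn -enormZ ler_sqr ?nnegrE ?enorm_ge0//; last first.
    by rewrite mulr_ge0 ?(ltW l0)// subr_ge0 (le_trans k2)// ler_pdivrMr// ler_pMr// ler1n.
  rewrite decomp mulrBl lerBlDr; apply: (@le_trans _ _ (N (lam ^+ k *: (E *m u)))).
    by rewrite enormZ normrX mulrC.
  rewrite -[X in N X <= _](addrK (A ^+ k *m F *m u)); apply: le_trans (enormB _ _ _) _.
  rewrite lerD2l; apply: le_trans (hF _ _) _; rewrite rs -/l.
  by apply: le_of_eq; ring.
have b2 : 0 < b ^+ 2 by rewrite exprn_even_gt0.
rewrite -(ler_pM2l b2); apply: (@le_trans _ _ (4 * M * c2 * N u ^+ 2 * s ^+ k * l ^+ 2)).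
  apply: (@le_trans _ _ (b ^+ 2 * ((4 * M * c2 * s ^+ k * l ^+ 2 / b ^+ 2) * N u ^+ 2))).
    by rewrite ler_wpM2l ?(ltW b2)// ler_wpM2r ?sqr_ge0.
  by apply: le_of_eq; field.
apply: (@le_trans _ _ (e * ((N (E *m u) - c2 * N u * s ^+ k) ^+ 2 * l ^+ 2))).
  by rewrite mulrA ler_wpM2r ?sqr_ge0.
by rewrite [leRHS]mulrCA ler_wpM2l// ltW.
Qed.

End ProximalContraction.

(** * The space of sequences of increments and its product law *)

Section PathSpace.
Context {dT : measure_display} (T : measurableType dT).

Definition path : Type := nat -> T.

HB.instance Definition _ := gen_eqMixin path.
HB.instance Definition _ := gen_choiceMixin path.
HB.instance Definition _ := isPointed.Build path (fun=> point).

Definition cylinder (n : nat) (B : nat -> set T) : set path :=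
  [set s | forall k, (k < n)%N -> B k (s k)].

Definition cylinders : set (set path) :=
  [set C | exists n B, (forall k, measurable (B k)) /\ C = cylinder n B].

HB.instance Definition _ := Measurable.copy path (g_sigma_algebraType cylinders).

Lemma cylinders_setI : setI_closed cylinders.
Proof.
move=> _ _ [n [B [mB ->]]] [m [B' [mB' ->]]].
exists (maxn n m), (fun k => (if (k < n)%N then B k else setT) `&`
  (if (k < m)%N then B' k else setT)); split.
  by move=> k; apply: measurableI; case: ifP.
apply/seteqP; split => s /=.
  by move=> [h1 h2] k _; split; case: ifP => // kn; [exact: h1|exact: h2].
move=> h; split => k kn.
  by have [] := h k (leq_trans kn (leq_maxl _ _)); rewrite kn.
by have [] := h k (leq_trans kn (leq_maxr _ _)); rewrite kn.
Qed.

Lemma mf_path {dY} {Y : measurableType dY} (f : Y -> path) :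
  (forall k, mble (fun y => f y k)) -> mble f.
Proof.
move=> mf; have h : @measurable _ path = <<s cylinders >> by [].
apply: (measurability _ h) => _ [_ [n [B [mB ->]] <-]]; rewrite setTI.
rewrite (_ : _ @^-1` _ = \bigcap_k (if (k < n)%N then (fun y => f y k) @^-1` B k else setT)).
  apply: bigcapT_measurable => k; case: (k < n)%N => //.
  by rewrite -[X in measurable X]setTI; exact: mf.
apply/seteqP; split => y /=.
  by move=> By k _; case: ifPn => // kn; exact: By.
by move=> By k kn; have := By k I; rewrite kn.
Qed.

Lemma mf_coordinate k : mble (fun s : path => s k).
Proof.
move=> _ B mB; rewrite setTI; apply: sub_sigma_algebra.
exists k.+1, (fun i => if i == k then B else setT); split; first by move=> i; case: ifP.
apply/seteqP; split => s /=; first by move=> h i _; case: eqP => // ->.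
by move=> /(_ k (ltnSn k)); rewrite eqxx.
Qed.

Definition scons (a : T) (s : path) : path := fun i => if i is j.+1 then s j else a.

Definition glue k (s s' : path) : path := fun i => if (i < k)%N then s i else s' (i - k)%N.

Lemma mf_scons : mble2 scons.
Proof.
apply: mf_path => -[|k] /=; first exact: mf_fst.
exact: (mf_comp (mf_coordinate k) mf_snd).
Qed.

Lemma mf_glue k : mble2 (glue k).
Proof.
apply: mf_path => i; rewrite /glue; have [_|_] := ltnP i k.
  exact: (mf_comp (mf_coordinate i) mf_fst).
exact: (mf_comp (mf_coordinate (i - k)) mf_snd).
Qed.

Definition iid_law {R : realType} (mu : probability T R) (Q : probability path R) :=
  forall n B, (forall k, measurable (B k)) ->
  Q (cylinder n B) = (\prod_(k < n) mu (B k))%E.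

Section Law.
Context {R : realType} (mu : probability T R) (Q : probability path R).
Hypothesis Q_cyl : iid_law mu Q.

Lemma path_law_unique (m : {measure set path -> \bar R}) :
  (forall n B, (forall k, measurable (B k)) -> m (cylinder n B) = (\prod_(k < n) mu (B k))%E) ->
  forall B, measurable B -> Q B = m B.
Proof.
move=> mC B mB; apply: (measure_unique cylinders (fun=> setT)) => //.
- exact: cylinders_setI.
- move=> _; exists 0%N, (fun=> setT); split => //.
  by apply/seteqP; split.
- by rewrite bigcup_const.
- by move=> A [n [C [mC' ->]]]; rewrite mC//; exact: Q_cyl.
- move=> _; apply: (@le_lt_trans _ _ 1%E); last exact: ltry.
  by apply: le_of_eq; exact: probability_setT.
Qed.

Lemma glue_cylinder k n B : (fun z : path * path => glue k z.1 z.2) @^-1` cylinder n B =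
  cylinder (minn n k) B `*` cylinder (n - k) (fun i => B (k + i)%N).
Proof.
apply/seteqP; split => -[s s'] /=.
  move=> h; split => i.
    by rewrite leq_min => /andP[i_n ik]; have := h i i_n; rewrite /glue ik.
  move=> i_n; have h' : glue k s s' (k + i) = s' i by rewrite /glue ltnNge leq_addr/= addKn.
  by rewrite -h'; apply: h; rewrite -ltn_subRL.
move=> [h1 h2] i i_n; rewrite /glue; case: ifP => ik.
  by apply: h1; rewrite leq_min i_n.
have ki : (k <= i)%N by rewrite leqNgt ik.
by have := h2 (i - k)%N; rewrite subnKC//; apply; rewrite ltn_sub2rE.
Qed.

(** Independence of the past and the future of time [k]: both laws agree on cylinders, which are
    stable under intersection and generate. *)
Lemma Q_glue k B : measurable B ->
  Q B = prodP Q Q ((fun z : path * path => glue k z.1 z.2) @^-1` B).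
Proof.
move=> mB; apply: (path_law_unique
  (m := pushforward (prodP Q Q) (fun z : path * path => glue k z.1 z.2))) => // [|mg n C mC].
  exact: mf_glue.
rewrite -[LHS]/(prodP Q Q ((fun z : path * path => glue k z.1 z.2) @^-1` cylinder n C)).
rewrite glue_cylinder /prodP/= product_measure1E; last 2 first.
- by apply: sub_sigma_algebra; exists (minn n k), C.
- by apply: sub_sigma_algebra; exists (n - k)%N, (fun i => C (k + i)%N).
transitivity ((\prod_(i < minn n k) mu (C i)) * \prod_(i < n - k) mu (C (k + i)%N))%E.
  congr (_ * _)%E; first exact: Q_cyl.
  by apply: (@Q_cyl (n - k)%N (fun i => C (k + i)%N)) => i; exact: mC.
have [nk|kn] := leqP n k.
  by rewrite (eqP nk) [X in (_ * X)%E]big_ord0 mule1.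
by rewrite -[in RHS](subnKC (ltnW kn)) big_split_ord.
Qed.

Lemma Q_cons B : measurable B ->
  Q B = prodP mu Q ((fun z : T * path => scons z.1 z.2) @^-1` B).
Proof.
move=> mB; apply: (path_law_unique
  (m := pushforward (prodP mu Q) (fun z : T * path => scons z.1 z.2))) => // [|mg n C mC].
  exact: mf_scons.
rewrite -[LHS]/(prodP mu Q ((fun z : T * path => scons z.1 z.2) @^-1` cylinder n C)).
case: n => [|n].
  rewrite big_ord0 (_ : _ @^-1` _ = setT) ?probability_setT//.
  by apply/seteqP; split.
rewrite (_ : _ @^-1` _ = C 0%N `*` cylinder n (fun i => C i.+1)); last first.
  apply/seteqP; split => -[a s] /=.
    by move=> h; split => [|i i_n]; [exact: (h 0%N)|exact: (h i.+1)].
  by move=> [h1 h2] [|i] i_n //=; exact: h2.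
rewrite /prodP/= product_measure1E//; last first.
  by apply: sub_sigma_algebra; exists n, (fun i => C i.+1).
rewrite big_ord_recl; congr (_ * _)%E; by apply: (@Q_cyl n (fun i => C i.+1)) => i; exact: mC.
Qed.

Lemma Rint_glue k (f : path -> R) : mble f ->
  \int[Q]_s f s = \int[prodP Q Q]_z f (glue k z.1 z.2).
Proof.
by move=> mf; apply: (Rint_pushforward (phi := fun z => glue k z.1 z.2) (mf_glue k) mf
  (@Q_glue k)).1.
Qed.

Lemma Rint_cons (f : path -> R) : mble f ->
  \int[Q]_s f s = \int[prodP mu Q]_z f (scons z.1 z.2).
Proof.
by move=> mf; apply: (Rint_pushforward (phi := fun z => scons z.1 z.2) mf_scons mf
  Q_cons).1.
Qed.

Lemma Rint_glue_bounded k (f : path -> R) (M : R) : mble f ->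
  (forall s, `|f s| <= M) ->
  \int[Q]_s f s = \int[Q]_s \int[Q]_s' f (glue k s s').
Proof.
move=> mf fM; rewrite (Rint_glue k)// Rint_prod12//.
  apply: (L1_bounded M) => //; exact: (mf_comp mf (mf_glue k)).
move=> s; apply: (L1_bounded M) => //.
exact: (mf_pair1 (f := fun z => f (glue k z.1 z.2)) s
  (mf_comp mf (mf_glue k))).
Qed.

Lemma Rint_cons_bounded (f : path -> R) (M : R) : mble f ->
  (forall s, `|f s| <= M) ->
  \int[Q]_s f s = \int[mu]_a \int[Q]_s' f (scons a s').
Proof.
move=> mf fM; rewrite Rint_cons// Rint_prod12//.
  apply: (L1_bounded M) => //; exact: (mf_comp mf mf_scons).
move=> s; apply: (L1_bounded M) => //.
exact: (mf_pair1 (f := fun z => f (scons z.1 z.2)) s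
  (mf_comp mf mf_scons)).
Qed.

Lemma Rint_coordinate k (f : T -> R) : mble f ->
  \int[Q]_s f (s k) = \int[mu]_a f a /\ (L1 mu f -> L1 Q (fun s => f (s k))).
Proof.
move=> mf; have E B : measurable B -> mu B = Q ((fun s : path => s k) @^-1` B).
  move=> mB; pose C i := if i == k then B else setT.
  have -> : (fun s : path => s k) @^-1` B = cylinder k.+1 C.
    apply/seteqP; split => s /=; first by move=> h i _; rewrite /C; case: eqP => // ->.
    by move=> /(_ k (ltnSn k)); rewrite /C eqxx.
  rewrite Q_cyl; last by move=> i; rewrite /C; case: ifP.
  rewrite big_ord_recr/= big1 ?mul1e /C ?eqxx// => i _.
  by rewrite ltn_eqF// probability_setT.
split; first by apply/esym; exact: (Rint_pushforward (mf_coordinate k) mf E).1.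
move=> /integrableP[_ lt]; apply/integrableP; split.
  by apply/mf_EFin; exact: (mf_comp mf (mf_coordinate k)).
rewrite (_ : (\int[Q]_x _)%E = (\int[mu]_x `|(EFin \o f) x|)%E)//.
transitivity (\int[pushforward Q (fun s : path => s k)]_x `|(EFin \o f) x|)%E; last first.
  apply: eq_measure_integral => [|mk B mB _]; first exact: mf_coordinate.
  exact: esym (E B mB).
rewrite ge0_integral_pushforward ?preimage_setT//; first exact: mf_coordinate.
by apply: mf_comp => //; exact/mf_EFin.
Qed.

End Law.
End PathSpace.

(** * Products of increments along a path *)

Section Words.
Context {R : realType} {d : nat}.
Local Notation G := (GL R d).

Fixpoint word (n : nat) (s : path G) : G := if n is k.+1 then (s k * word k s)%g else 1%g.

Lemma mf_word n : mble (word n).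
Proof.
elim: n => [|n IH] /=; first exact: measurable_cst.
exact: (mf_comp mf_mulGL
  (mf_pair (mf_coordinate n) IH)).
Qed.

Lemma eq_word n (s s' : path G) : (forall i, (i < n)%N -> s i = s' i) -> word n s = word n s'.
Proof.
elim: n => //= n IH h; rewrite h// IH// => i i_n; apply: h; exact: ltnW.
Qed.

Lemma word_cons n a s : word n.+1 (scons a s) = (word n s * a)%g.
Proof.
elim: n => [|n IH]; first by rewrite /= mulg1 mul1g.
by rewrite -[LHS]/(s n * word n.+1 (scons a s))%g IH mulgA.
Qed.

Lemma word_glue_le k n s s' : (n <= k)%N -> word n (glue k s s') = word n s.
Proof.
by move=> nk; apply: eq_word => i i_n; rewrite /glue (leq_trans i_n nk).
Qed.

Lemma word_glue k n s s' : word (k + n) (glue k s s') = (word n s' * word k s)%g.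
Proof.
elim: n => [|n IH]; first by rewrite addn0 /= mul1g word_glue_le.
by rewrite addnS /= IH mulgA /glue ltnNge leq_addr/= addKn.
Qed.

End Words.

Lemma upper_semicontinuous_measurable {R : realType} {d : nat} (f : GL R d -> R) :
  (forall g c, f g < c -> nbhs g [set h | f h < c]) -> mble f.
Proof.
move=> fc; apply: (measurability _ (@RGenCInfty.measurableE R)) => _ [_ [c ->] <-].
rewrite setTI (_ : _ @^-1` _ = ~` [set g | f g < c]); last first.
  by apply/seteqP; split => g /=; rewrite in_itv/= andbT leNgt => /negP.
apply: measurableC; apply: open_measurable_GL; rewrite openE => g /= fg.
exact: fc.
Qed.

(** * Dilation of lines, the norm cocycle and the action on angles *)

Section CocycleFunctions.
Local Open Scope quotient_scope.
Context {R : realType} {d : nat} (dot : {dot 'cV[R]_d.+1 for idfun}).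
Local Notation V := 'cV[R]_d.+1.
Local Notation N := (enorm dot).
Local Notation G := (GL R d).
Local Notation X := (PV R d).
Local Notation op := (opnorm dot).
Implicit Types (g h : G) (x y : X).

Definition nm g : R := Num.max (op (val g)) (op (val g^-1%g)).

Lemma val_mulV g : val g *m val g^-1%g = 1%:M.
Proof. by rewrite mulmxV// Defs.GL_unit. Qed.

Lemma val_Vmul g : val g^-1%g *m val g = 1%:M.
Proof. by rewrite mulVmx// Defs.GL_unit. Qed.

Lemma op_nm g : op (val g) <= nm g. Proof. by rewrite le_max lexx. Qed.

Lemma opV_nm g : op (val g^-1%g) <= nm g. Proof. by rewrite le_max lexx orbT. Qed.

Lemma nm_ge1 g : 1 <= nm g.
Proof.
have h := opnorm1_ge dot (val_mulV g).
rewrite leNgt; apply/negP => lt1.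
have: op (val g) * op (val g^-1%g) < 1.
  apply: (le_lt_trans (ler_pM _ _ (op_nm g) (opV_nm g))); rewrite ?opnorm_ge0//.
  by rewrite mulr_ilte1// (le_trans _ (op_nm g))// opnorm_ge0.
by rewrite ltNge h.
Qed.

Lemma nm_gt0 g : 0 < nm g. Proof. exact: lt_le_trans ltr01 (nm_ge1 g). Qed.

Lemma nmV g : nm g^-1%g = nm g.
Proof. by rewrite /nm invgK maxC. Qed.

Lemma nmM g h : nm (g * h)%g <= nm g * nm h.
Proof.
rewrite ge_max; apply/andP; split.
  apply: le_trans (opnormM _ _ _) _.
  by apply: ler_pM; rewrite ?opnorm_ge0 ?op_nm.
rewrite invgM mulrC; apply: le_trans (opnormM _ _ _) _.
by apply: ler_pM; rewrite ?opnorm_ge0 ?opV_nm.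
Qed.

Lemma nm1 : nm 1%g = 1.
Proof.
apply/eqP; rewrite eq_le nm_ge1 andbT /nm invg1 maxxx.
by apply: opnorm_le => // v; rewrite mul1mx mul1r.
Qed.

Lemma enorm_vec_gt0 x : 0 < N (vec x). Proof. by rewrite enorm_gt0// vec_neq0. Qed.

Lemma enorm_act_gt0 g x : 0 < N (val g *m vec x).
Proof. by rewrite enorm_gt0// act_neq0. Qed.

Lemma enorm_act_ge g (v : V) : N v <= op (val g^-1%g) * N (val g *m v).
Proof. by rewrite -{1}(mul1mx v) -(val_Vmul g) -mulmxA opnormP. Qed.

Definition dil g x : R := N (val g *m vec x) / N (vec x).

Lemma dil_gt0 g x : 0 < dil g x.
Proof. by rewrite divr_gt0// (enorm_act_gt0, enorm_vec_gt0). Qed.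

Lemma dilE g x (c : R) (v : V) : c != 0 -> vec x = c *: v -> dil g x = N (val g *m v) / N v.
Proof.
move=> c0 E; rewrite /dil E -scalemxAr !enormZ invfM mulrACA divff ?mul1r//.
by rewrite normr_eq0.
Qed.

Lemma dilM g h x : dil (g * h)%g x = dil g (GL_act h x) * dil h x.
Proof.
have [c c0 E] := vec_act h x.
rewrite (dilE _ c0 E) /dil /= mulmxA mulrA mulfVK// gt_eqF//.
exact: enorm_act_gt0.
Qed.

Lemma dil_le g x : dil g x <= op (val g).
Proof. by rewrite ler_pdivrMr ?enorm_vec_gt0// opnormP. Qed.

Lemma dil_ge g x : 1 <= op (val g^-1%g) * dil g x.
Proof. by rewrite mulrA ler_pdivlMr ?enorm_vec_gt0// mul1r enorm_act_ge. Qed.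

Lemma dilV_le g x : (dil g x)^-1 <= nm g.
Proof.
rewrite -[_^-1]mul1r ler_pdivrMr ?dil_gt0//; apply: le_trans (dil_ge g x) _.
by rewrite ler_wpM2r ?opV_nm// ltW// dil_gt0.
Qed.

Lemma sigmaE g x : sigma dot g x = ln (dil g x). Proof. by []. Qed.

Lemma act1 x : GL_act 1%g x = x.
Proof.
by have [c _] := vec_act 1%g x; rewrite mul1mx => /eq_PV.
Qed.

Lemma actM g h x : GL_act (g * h)%g x = GL_act g (GL_act h x).
Proof.
have [a a0 Ea] := vec_act (g * h)%g x; have [b b0 Eb] := vec_act h x.
have [c c0 Ec] := vec_act g (GL_act h x).
apply: (@eq_PV R d _ _ (a / (b * c))).
rewrite Ea Ec Eb -scalemxAr !scalerA mulmxA; congr (_ *: _).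
by rewrite -mulrA [c * b]mulrC mulfVK// mulf_neq0.
Qed.

Lemma sigmaM g h x : sigma dot (g * h)%g x = sigma dot g (GL_act h x) + sigma dot h x.
Proof. by rewrite !sigmaE dilM lnM// posrE dil_gt0. Qed.

Definition ell g : R := ln (nm g).

Lemma ell_ge0 g : 0 <= ell g. Proof. by rewrite ln_ge0// nm_ge1. Qed.

Lemma expR_ell g : expR (ell g) = nm g. Proof. by rewrite lnK// posrE nm_gt0. Qed.

Lemma ellM g h : ell (g * h)%g <= ell g + ell h.
Proof.
by rewrite -lnM ?posrE ?nm_gt0// ler_ln ?nmM// posrE ?mulr_gt0// nm_gt0.
Qed.

Lemma sigma_ell g x : `|sigma dot g x| <= ell g.
Proof.
rewrite sigmaE ler_norml; apply/andP; split.
  rewrite lerNl -lnV ?posrE ?dil_gt0// ler_ln ?posrE ?invr_gt0 ?dil_gt0 ?nm_gt0//.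
  exact: dilV_le.
by rewrite ler_ln ?posrE ?dil_gt0 ?nm_gt0// (le_trans (dil_le g x)) ?op_nm.
Qed.

(* [rr g x] measures how far the line [x] is from being maximally dilated by
   [g], and [e2 g x] bounds the contraction of angles around [x]. *)
Definition rr g x : R := op (val g) / dil g x.

Definition e2 g x : R := opnorm2 dot (val g) / dil g x ^+ 2.

Lemma rr_ge1 g x : 1 <= rr g x.
Proof. by rewrite ler_pdivlMr ?dil_gt0// mul1r dil_le. Qed.

Lemma rr_nm g x : rr g x <= nm g ^+ 2.
Proof.
rewrite expr2; apply: ler_pM; rewrite ?opnorm_ge0 ?op_nm ?dilV_le//.
by rewrite invr_ge0 ltW// dil_gt0.
Qed.

Lemma rrM g h x : rr (g * h)%g x <= rr g (GL_act h x) * rr h x.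
Proof.
rewrite /rr dilM invfM mulrACA ler_wpM2r ?opnormM//.
by rewrite mulr_ge0// invr_ge0 ltW// dil_gt0.
Qed.

(** [y] is a line dilated by [g] maximally up to a factor 2. If [h] dilates [g y] well, the norm of
    [h g] is comparable with the product of the norms, and [h] cannot repair the poor dilation of
    [x] by [g]. *)
Lemma rr_persist g x : exists y, forall h, rr g x <= 2 * rr h (GL_act g y) * rr (h * g)%g x.
Proof.
have [v v0 hv] := opnorm_attained dot (val g).
exists (\pi_(PV R d) (tonzvec v0)) => h; set y := \pi_(PV R d) _.
have gy : op (val g) <= 2 * dil g y.
  have [c c0 E] := vec_pi (tonzvec v0).
  rewrite (dilE _ c0 E) /= mulrA ler_pdivlMr// enorm_gt0//.
have hg : dil h (GL_act g y) * dil g y <= op (val (h * g)%g).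
  by rewrite -dilM dil_le.
rewrite /rr dilM ler_pdivrMr ?dil_gt0//.
have h1 := dil_gt0 h (GL_act g y); have h2 := dil_gt0 h (GL_act g x).
have h3 := dil_gt0 g x; have h4 := dil_le h (GL_act g x).
have E : 2 * (op (val h) / dil h (GL_act g y)) *
    (op (val (h * g)%g) / (dil h (GL_act g x) * dil g x)) * dil g x =
  2 * (op (val h) / dil h (GL_act g x)) * (op (val (h * g)%g) / dil h (GL_act g y)).
  by field; rewrite !gt_eqF.
rewrite E; apply: le_trans gy _; rewrite -mulrA ler_pM2l//.
have a1 : dil g y <= op (val (h * g)%g) / dil h (GL_act g y).
  by rewrite ler_pdivlMr// mulrC.
apply: le_trans a1 _; rewrite ler_peMl//; last by rewrite ler_pdivlMr// mul1r.
by rewrite divr_ge0 ?opnorm_ge0// ltW.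
Qed.

Lemma e2_ge0 g x : 0 <= e2 g x.
Proof. by rewrite divr_ge0 ?opnorm2_ge0// exprn_ge0// ltW// dil_gt0. Qed.

Lemma e2_rr g x : e2 g x <= rr g x ^+ 2.
Proof.
rewrite [rr g x ^+ 2]expr_div_n; apply: ler_wpM2r; last exact: opnorm2_sqr.
by rewrite invr_ge0 exprn_ge0// ltW// dil_gt0.
Qed.

Lemma e2M g h x : e2 (g * h)%g x <= e2 g (GL_act h x) * e2 h x.
Proof.
rewrite /e2 dilM exprMn invfM mulrACA ler_wpM2r ?opnorm2M//.
by rewrite mulr_ge0// invr_ge0 exprn_ge0// ltW// dil_gt0.
Qed.

Lemma sd_act g x y : sd dot (GL_act g x) (GL_act g y) <=
  opnorm2 dot (val g) / (dil g x * dil g y) * sd dot x y.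
Proof.
have [a a0 Ea] := vec_act g x; have [b b0 Eb] := vec_act g y.
rewrite {1}/sd Ea Eb sineZ//; apply: le_trans (sine_mulmx _ _ (vec_neq0 x) (vec_neq0 y)) _.
by rewrite invfM /dil !invf_div !mulrA.
Qed.

Lemma sd_act_e2 g x y (eta : R) : 0 <= eta -> e2 g x <= eta -> e2 g y <= eta ->
  sd dot (GL_act g x) (GL_act g y) <= eta * sd dot x y.
Proof.
move=> eta0 hx hy; apply: le_trans (sd_act g x y) _; rewrite ler_wpM2r ?sd_ge0//.
have h1 := dil_gt0 g x; have h2 := dil_gt0 g y.
have {}hx : opnorm2 dot (val g) <= eta * dil g x ^+ 2 by rewrite -ler_pdivrMr// exprn_gt0.
have {}hy : opnorm2 dot (val g) <= eta * dil g y ^+ 2 by rewrite -ler_pdivrMr// exprn_gt0.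
rewrite ler_pdivrMr; last exact: mulr_gt0.
have [le|/ltW le] := leP (dil g x) (dil g y).
  by apply: le_trans hx _; rewrite expr2; apply: ler_wpM2l => //; apply: ler_wpM2l => //; exact: ltW.
by apply: le_trans hy _; rewrite expr2; apply: ler_wpM2l => //; apply: ler_wpM2r => //; exact: ltW.
Qed.

Lemma sd_act_rr g x y :
  sd dot (GL_act g x) (GL_act g y) <= rr g x * rr g y * sd dot x y.
Proof.
apply: le_trans (sd_act g x y) _; rewrite ler_wpM2r ?sd_ge0//.
rewrite [leRHS]mulrACA -[op _ * _]expr2 invfM; apply: ler_wpM2r; last exact: opnorm2_sqr.
by rewrite mulr_ge0// invr_ge0 ltW// dil_gt0.
Qed.

Lemma sd_act_nm g x y : sd dot (GL_act g x) (GL_act g y) <= nm g ^+ 4 * sd dot x y.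
Proof.
apply: le_trans (sd_act_rr g x y) _; rewrite ler_wpM2r ?sd_ge0//.
by rewrite (exprD _ 2 2) ler_pM ?rr_nm// (le_trans ler01) ?rr_ge1.
Qed.

Lemma sd_act_ge g x y : sd dot x y <= nm g ^+ 4 * sd dot (GL_act g x) (GL_act g y).
Proof.
by have := sd_act_nm g^-1%g (GL_act g x) (GL_act g y); rewrite -!actM mulVg !act1 nmV.
Qed.

Lemma ln_le_sub1 (z : R) : 0 < z -> ln z <= z - 1.
Proof. by move=> z0; have := le_ln1Dx; move=> /(_ R (z - 1)); rewrite subrKC; apply; lra. Qed.

(** Representatives of equal norm chosen by [sine_chord] have images at distance at most [op g]
    times the chord; the second factor [nm g] comes from dividing by the dilation. *)
Lemma sigma_lip g x y : `|sigma dot g x - sigma dot g y| <= 2 * nm g ^+ 2 * sd dot x y.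
Proof.
have key x' y' : sigma dot g x' - sigma dot g y' <= 2 * nm g ^+ 2 * sd dot x' y'.
  have [c c0 [h1 h2]] := sine_chord dot (vec_neq0 x') (vec_neq0 y').
  set u := vec x'; set v := vec y'.
  have u0 := enorm_vec_gt0 x'; have v0 := enorm_vec_gt0 y'; have w0 := enorm_act_gt0 g y'.
  have d0 := dil_gt0 g x'; have d1 := dil_gt0 g y'.
  have E : dil g y' = N (val g *m (c *: v)) / N u.
    by rewrite -h2 -enormZ /dil -scalemxAr !enormZ invfM mulrACA divff ?mul1r// normr_eq0.
  have B : N (val g *m u) <= N (val g *m (c *: v)) + op (val g) * (2 * N u * sd dot x' y').
    rewrite -[u in X in X <= _](subrK (c *: v)) mulmxDr addrC.
    apply: le_trans (enormD _ _ _) _; rewrite lerD2l.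
    by apply: le_trans (opnormP _ _ _) _; rewrite ler_wpM2l// opnorm_ge0.
  have D : dil g x' <= dil g y' + op (val g) * (2 * sd dot x' y').
    rewrite E /dil ler_pdivrMr// mulrDl mulfVK ?gt_eqF//.
    by rewrite -[op (val g) * _ * _]mulrA [2 * _ * N _]mulrAC; exact: B.
  rewrite !sigmaE -ln_div ?posrE//; apply: le_trans (ln_le_sub1 _) _; first exact: divr_gt0.
  rewrite lerBlDr ler_pdivrMr//; apply: le_trans D _.
  rewrite [leRHS]mulrDl mul1r [leRHS]addrC lerD2l.
  have s0 := sd_ge0 dot x' y'.
  have P : 1 <= nm g * dil g y'.
    by apply: le_trans (dil_ge g y') _; rewrite ler_wpM2r ?opV_nm// ltW.
  have E2 : 2 * nm g ^+ 2 * sd dot x' y' * dil g y' =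
    nm g * (2 * sd dot x' y') * (nm g * dil g y') by ring.
  rewrite E2; apply: (@le_trans _ _ (nm g * (2 * sd dot x' y'))).
    by rewrite ler_wpM2r ?op_nm// mulr_ge0.
  by rewrite ler_peMr//; apply: mulr_ge0; [rewrite ltW// nm_gt0|rewrite mulr_ge0].
by rewrite ler_norml key andbT lerNl opprB sdC key.
Qed.

(** Closeness in multiplicative form, so that upper semicontinuity of the norms follows from their
    submultiplicativity. *)
Lemma GL_close g (e : R) : 0 < e -> nbhs g [set h | op (val (h * g^-1)%g) < 1 + e].
Proof.
move=> e0; set C := Ce dot * d.+1%:R * Cco dot * op (val g^-1%g).
have C0 : 0 <= C by rewrite !mulr_ge0 ?Ce_ge0 ?(ltW (Cco_gt0 dot)) ?opnorm_ge0.
have p0 : 0 < e / (C + 1) by rewrite divr_gt0// ltr_wpDl.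
apply: filterS (GL_ball g p0) => h hg /=.
have [le1|] : op (val h - val g) <= Ce dot * d.+1%:R * Cco dot * (e / (C + 1)) \/ False.
  left; apply: opnorm_entries => [|i j]; first exact: ltW.
  by rewrite !mxE ltW// hg.
  2: by [].
have opD (v : V) : N (val h *m (val g^-1%g *m v)) <= (1 + C * (e / (C + 1))) * N v.
  rewrite -[val h](subrK (val g)) addrC mulmxDl mulmxA val_mulV mul1mx.
  apply: le_trans (enormD _ _ _) _; rewrite mulrDl mul1r lerD2l.
  apply: le_trans (opnormP _ _ _) _.
  apply: le_trans (ler_wpM2l (opnorm_ge0 _ _) (opnormP _ _ _)) _.
  rewrite [leLHS]mulrA; apply: ler_wpM2r; first exact: enorm_ge0.
  apply: le_trans (ler_wpM2r (opnorm_ge0 _ _) le1) _.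
  by rewrite /C [leRHS]mulrAC.
have le2 : op (val (h * g^-1)%g) <= 1 + C * (e / (C + 1)).
  apply: opnorm_le => [|v]; last by rewrite -mulmxA.
  by rewrite addr_ge0// mulr_ge0// ltW.
apply: le_lt_trans le2 _; rewrite ltrD2l mulrCA gtr_pMr//.
by rewrite ltr_pdivrMr ?mul1r ?ltrDl// ltr_wpDl.
Qed.

Lemma GL_closeV g (e : R) : 0 < e -> nbhs g [set h | op (val (g * h^-1)%g) < 1 + e].
Proof.
move=> e0.
(* [(1 - r)^-1] will bound the norm of the inverse of a perturbation of the identity of size [r]. *)
have [r [r0 r1 re]] : exists r : R, [/\ 0 < r, r < 1 & (1 - r)^-1 < 1 + e].
  exists (e / (2 * (1 + e))); have e1 : 0 < 1 + e by rewrite ltr_wpDl.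
  have r0 : 0 < e / (2 * (1 + e)) by rewrite divr_gt0// mulr_gt0.
  have E : 1 - e / (2 * (1 + e)) = (2 + e) / (2 * (1 + e)) by field; rewrite gt_eqF.
  split=> //.
    by rewrite ltr_pdivrMr ?mulr_gt0// mul1r; lra.
  rewrite E invf_div ltr_pdivrMr; last by lra.
  by rewrite [ltRHS]mulrC ltr_pM2r//; lra.
set C := Ce dot * d.+1%:R * Cco dot * op (val g^-1%g).
have C0 : 0 <= C by rewrite !mulr_ge0 ?Ce_ge0 ?(ltW (Cco_gt0 dot)) ?opnorm_ge0.
have p0 : 0 < r / (C + 1) by rewrite divr_gt0// ltr_wpDl.
apply: filterS (GL_ball g p0) => h hg /=.
have le1 : op (val g - val h) <= Ce dot * d.+1%:R * Cco dot * (r / (C + 1)).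
  apply: opnorm_entries => [|i j]; first exact: ltW.
  by rewrite !mxE distrC ltW// hg.
have le2 (v : V) : N ((val g - val h) *m v) <= r * N (val g *m v).
  apply: le_trans (opnormP _ _ _) _.
  apply: le_trans (ler_wpM2l (opnorm_ge0 _ _) (enorm_act_ge g v)) _.
  rewrite mulrA ler_wpM2r ?enorm_ge0//.
  apply: le_trans (ler_wpM2r (opnorm_ge0 _ _) le1) _.
  have -> : Ce dot * d.+1%:R * Cco dot * (r / (C + 1)) * op (val g^-1%g) = C * (r / (C + 1)).
    by rewrite /C [RHS]mulrAC.
  rewrite mulrCA ger_pMr// ler_pdivrMr ?mul1r ?lerDl// ltr_wpDl//.
apply: le_lt_trans re; apply: opnorm_le => [|v].
  by rewrite invr_ge0 subr_ge0 ltW.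
rewrite -ler_pdivrMl ?invr_gt0 ?subr_gt0// invrK.
set w := val h^-1%g *m v; have -> : v = val h *m w by rewrite mulmxA val_mulV mul1mx.
rewrite -mulmxA -/w [val h^-1%g *m _]mulmxA val_Vmul mul1mx.
have := enormD dot ((val g - val h) *m w) (val h *m w); rewrite -mulmxDl subrK => t.
have := le2 w; lra.
Qed.

Lemma mf_op : mble (fun g => op (val g)).
Proof.
apply: upper_semicontinuous_measurable => g c gc.
have [e e0 he] : exists2 e : R, 0 < e & (1 + e) * op (val g) < c.
  exists ((c - op (val g)) / (2 * (op (val g) + 1))); have o0 := opnorm_ge0 dot (val g).
    by rewrite divr_gt0 ?subr_gt0// mulr_gt0// ltr_wpDl.
  rewrite mulrDl mul1r -ltrBrDl mulrAC ltr_pdivrMr ?mulr_gt0 ?ltr_wpDl//.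
  by rewrite ltr_pM2l ?subr_gt0//; lra.
apply: filterS (GL_close g e0) => h /= hg; apply: le_lt_trans he.
have -> : val h = val (h * g^-1)%g *m val g by rewrite -[RHS]/(val (h * g^-1 * g)%g) mulgVK.
by apply: le_trans (opnormM _ _ _) _; rewrite ler_wpM2r ?opnorm_ge0// ltW.
Qed.

Lemma mf_op2 : mble (fun g : G => opnorm2 dot (val g)).
Proof.
apply: upper_semicontinuous_measurable => g c gc.
have [e e0 he] : exists2 e : R, 0 < e & (1 + e) ^+ 2 * opnorm2 dot (val g) < c.
  set a := opnorm2 _ _ in gc *; have o0 : 0 <= a by exact: opnorm2_ge0.
  have c0 : 0 < c by exact: le_lt_trans gc.
  exists (Num.min 1 ((c - a) / (4 * (a + 1)))).
    by rewrite lt_min ltr01/= divr_gt0 ?subr_gt0// mulr_gt0// ltr_wpDl.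
  set e := Num.min _ _; have e1 : e <= 1 by rewrite ge_min lexx.
  have e2' : e * (4 * (a + 1)) <= c - a.
    by rewrite -ler_pdivlMr ?mulr_gt0 ?ltr_wpDl// ge_min lexx orbT.
  have e0 : 0 < e by rewrite lt_min ltr01/= divr_gt0 ?subr_gt0// mulr_gt0// ltr_wpDl.
  nra.
apply: filterS (GL_close g e0) => h /= hg; apply: le_lt_trans he.
have -> : val h = val (h * g^-1)%g *m val g by rewrite -[RHS]/(val (h * g^-1 * g)%g) mulgVK.
apply: le_trans (opnorm2M _ _ _) _; rewrite ler_wpM2r ?opnorm2_ge0//.
by apply: le_trans (opnorm2_sqr _ _) _; rewrite ler_pXn2r ?nnegrE ?opnorm_ge0 ?(ltW hg)// ltW// addr_gt0.
Qed.

Lemma mf_opV : mble (fun g : G => op (val g^-1%g)).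
Proof.
apply: upper_semicontinuous_measurable => g c gc.
have [e e0 he] : exists2 e : R, 0 < e & op (val g^-1%g) * (1 + e) < c.
  exists ((c - op (val g^-1%g)) / (2 * (op (val g^-1%g) + 1))).
    by rewrite divr_gt0 ?subr_gt0// mulr_gt0// ltr_wpDl// opnorm_ge0.
  have o0 := opnorm_ge0 dot (val g^-1%g); set a := op _ in o0 gc *.
  have b0 : 0 < 2 * (a + 1) by rewrite mulr_gt0// ltr_wpDl.
  rewrite -[(c - a) / _]mulr1 -/a mulrDr mulr1 -ltrBrDl mulr1 mulrCA gtr_pMr ?subr_gt0//.
  by rewrite ltr_pdivrMr// mul1r; lra.
apply: filterS (GL_closeV g e0) => h /= hg; apply: le_lt_trans he.
have E : val h^-1%g = val g^-1%g *m val (g * h^-1)%g.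
  by rewrite -[RHS]/(val (g^-1 * (g * h^-1))%g) mulKg.
rewrite -[invmx (sval h)]/(val h^-1%g) E.
by apply: le_trans (opnormM _ _ _) _; rewrite ler_wpM2l ?opnorm_ge0// ltW.
Qed.

Lemma mf_nm : mble nm.
Proof. exact: measurable_maxr mf_op mf_opV. Qed.

Lemma mf_ell : mble ell.
Proof. exact: (mf_comp (@measurable_ln R) mf_nm). Qed.

Lemma dil_expR g x : dil g x = expR (sigma dot g x).
Proof. by rewrite sigmaE lnK// posrE dil_gt0. Qed.

Lemma mf_dilV : mble (fun z : G * X => (dil z.1 z.2)^-1).
Proof.
rewrite (_ : (fun z => _) = fun z : G * X => expR (- sigma dot z.1 z.2)).
  apply: mf_comp => //; apply: mf_comp => //.
  exact: mf_sigma.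
by apply/funext => z; rewrite dil_expR expRN.
Qed.

Lemma mf_rr : mble2 rr.
Proof.
apply: mfM; last exact: mf_dilV.
exact: (mf_comp mf_op mf_fst).
Qed.

Lemma mf_e2 : mble2 e2.
Proof.
rewrite (_ : (fun z => _) =
  fun z : G * X => opnorm2 dot (val z.1) * (dil z.1 z.2)^-1 ^+ 2); last first.
  by apply/funext => z; rewrite exprVn.
apply: mfM; first exact: (mf_comp mf_op2 mf_fst).
by apply: mfX; exact: mf_dilV.
Qed.

End CocycleFunctions.

(** * Neighbourhoods in the group described by the operator norm *)

Section MatrixNeighbourhoods.
Context {R : realType} {d : nat} (dot : {dot 'cV[R]_d.+1 for idfun}).
Local Notation V := 'cV[R]_d.+1.
Local Notation N := (enorm dot).
Local Notation op := (opnorm dot).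
Local Notation G := (GL R d).

Lemma opball_nbhs (g : G) (e : R) : 0 < e -> nbhs g [set h : G | op (val h - val g) < e].
Proof.
move=> e0; set C := Ce dot * d.+1%:R * Cco dot.
have C0 : 0 <= C by rewrite !mulr_ge0 ?Ce_ge0 ?(ltW (Cco_gt0 dot)).
have p0 : 0 < e / (C + 1) by rewrite divr_gt0// ltr_wpDl.
apply: filterS (GL_ball g p0) => h hg /=; apply: (@le_lt_trans _ _ (C * (e / (C + 1)))).
  by apply: opnorm_entries => [|i j]; [exact: ltW|rewrite !mxE ltW// hg].
by rewrite mulrCA gtr_pMr// ltr_pdivrMr ?mul1r ?ltrDl// ltr_wpDl.
Qed.

Lemma entry_le_op (A : 'M[R]_d.+1) i j : `|A i j| <= Cco dot * Ce dot * op A.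
Proof.
have -> : A i j = (A *m (delta_mx j 0 : V)) i 0 by rewrite -colE mxE.
apply: le_trans (coord_le dot _ i) _; rewrite -mulrA.
apply: ler_wpM2l; first exact: ltW (Cco_gt0 dot).
apply: le_trans (opnormP _ _ _) _; rewrite mulrC; apply: ler_wpM2r; first exact: opnorm_ge0.
by rewrite /Ce (bigD1 j)//= lerDl sumr_ge0// => k _; rewrite enorm_ge0.
Qed.

Lemma opball_gen (U : set G) (g : G) : nbhs g U ->
  exists2 e : R, 0 < e & forall h : G, op (val h - val g) < e -> U h.
Proof.
rewrite nbhsE => -[U' [oU Ug] UU].
have [e e0 he] := GL_gen oU Ug; set C := Cco dot * Ce dot.
have C0 : 0 <= C by rewrite mulr_ge0 ?Ce_ge0 ?(ltW (Cco_gt0 dot)).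
exists (e / (C + 1)) => [|h hg]; first by rewrite divr_gt0// ltr_wpDl.
apply: UU; apply: he => -[i j] /=.
have := entry_le_op (val h - val g) i j; rewrite !mxE => t; apply: le_lt_trans t _.
apply: (@le_lt_trans _ _ (C * (e / (C + 1)))); first by rewrite ler_wpM2l// ltW.
by rewrite mulrCA gtr_pMr// ltr_pdivrMr ?mul1r ?ltrDl// ltr_wpDl.
Qed.

Lemma opnormD (A B : 'M[R]_d.+1) : op (A + B) <= op A + op B.
Proof.
apply: opnorm_le => [|v]; first by rewrite addr_ge0 ?opnorm_ge0.
by rewrite mulmxDl mulrDl; apply: le_trans (enormD _ _ _) _; rewrite lerD ?opnormP.
Qed.

Lemma mulGL_nbhs (g h : G) (U : set G) : nbhs (g * h)%g U ->
  exists2 e : R, 0 < e & forall a b : G, op (val a - val g) < e -> op (val b - val h) < e ->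
    U (a * b)%g.
Proof.
move=> /opball_gen[e e0 he]; set p := op (val g); set q := op (val h).
have p0 : 0 <= p by exact: opnorm_ge0.
have q0 : 0 <= q by exact: opnorm_ge0.
pose r := Num.min 1 (e / (2 * (p + q + 1))).
have r0 : 0 < r by rewrite lt_min ltr01 divr_gt0// mulr_gt0// ltr_wpDl// addr_ge0.
exists r => // a b ha hb; apply: he.
have -> : val (a * b)%g - val (g * h)%g =
    (val a - val g) *m val b + val g *m (val b - val h).
  by rewrite mulmxBl mulmxBr addrA subrK.
apply: le_lt_trans (opnormD _ _) _.
have b1 : op (val b) <= q + 1.
  rewrite -[val b](subrK (val h)) addrC; apply: le_trans (opnormD _ _) _; rewrite lerD2l ltW//.
  by apply: lt_le_trans hb _; rewrite ge_min lexx.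
have t1 : op ((val a - val g) *m val b) <= r * (q + 1).
  by apply: le_trans (opnormM _ _ _) _; apply: ler_pM; rewrite ?opnorm_ge0// ltW.
have t2 : op (val g *m (val b - val h)) <= p * r.
  by apply: le_trans (opnormM _ _ _) _; apply: ler_wpM2l => //; exact: ltW.
apply: (@le_lt_trans _ _ (r * (p + q + 1))); first by lra.
apply: (@le_lt_trans _ _ (e / (2 * (p + q + 1)) * (p + q + 1))).
  by rewrite ler_wpM2r ?addr_ge0// ge_min lexx orbT.
rewrite invfM mulrA mulfVK; last by rewrite gt_eqF// ltr_wpDl// addr_ge0.
by rewrite gtr_pMr// invf_lt1 ?ltr1n.
Qed.

End MatrixNeighbourhoods.

(** * Operator norms controlled by vectors in general position *)

Section Frames.
Context {R : realType} {d : nat} (dot : {dot 'cV[R]_d.+1 for idfun}).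
Local Notation V := 'cV[R]_d.+1.
Local Notation N := (enorm dot).
Local Notation op := (opnorm dot).

Lemma frame_coord (t : d.+1.-tuple V) : free t -> exists2 K : R, 0 <= K &
  forall u, exists2 c : 'I_d.+1 -> R, u = \sum_i c i *: t`_i & forall i, `|c i| <= K * N u.
Proof.
move=> ft; pose K := (\sum_i \sum_j `|coord t i (delta_mx j 0)|) * Cco dot.
have K0 : 0 <= K.
  by rewrite mulr_ge0 ?(ltW (Cco_gt0 dot))// sumr_ge0// => i _; rewrite sumr_ge0.
exists K => // u; exists (fun i => coord t i u).
  apply: coord_span; have /eqP -> : (<<t>>%VS == fullv) by
    rewrite eqEdim subvf/= (eqP ft) size_tuple dimvf /dim /= muln1.
  exact: memvf.
move=> i; rewrite {1}(vec_sum_delta u) linear_sum /=.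
apply: le_trans (ler_norm_sum _ _ _) _.
apply: (@le_trans _ _ (\sum_j (Cco dot * N u) * `|coord t i (delta_mx j 0)|)).
  by apply: ler_sum => j _; rewrite linearZ normrM ler_wpM2r// coord_le.
rewrite -mulr_sumr /K mulrC mulrA ler_wpM2r ?enorm_ge0// ler_wpM2r ?(ltW (Cco_gt0 dot))//.
by rewrite [leRHS](bigD1 i)//= lerDl sumr_ge0// => k _; rewrite sumr_ge0.
Qed.

(** Expanding a vector in the basis [t] and replacing [t] by the nearby [w] leaves an error of at
    most half of [op A], which is absorbed by the left-hand side. *)
Lemma frame_op (t : d.+1.-tuple V) : free t -> exists2 K : R, 0 <= K &
  forall (A : 'M[R]_d.+1) (w : 'I_d.+1 -> V) (r : R), (forall i, N (w i - t`_i) <= r) ->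
    d.+1%:R * (K * r) <= 2^-1 -> op A <= 2 * (K * \sum_i N (A *m w i)).
Proof.
move=> ft; have [K K0 hK] := frame_coord ft; exists K => // A w r hw hr.
suff h : op A <= K * (\sum_i N (A *m w i)) + 2^-1 * op A by lra.
have s0 : 0 <= \sum_i N (A *m w i) by apply: sumr_ge0 => i _; exact: enorm_ge0.
have a0 := opnorm_ge0 dot A.
apply: opnorm_le => [|u]; first by rewrite addr_ge0// mulr_ge0.
have [c E hc] := hK u.
have {1}-> : u = \sum_i c i *: w i - \sum_i c i *: (w i - t`_i).
  rewrite {1}E -sumrB; apply: eq_bigr => i _.
  by rewrite scalerBr opprB addrC subrK.
rewrite mulmxBr; apply: le_trans (enormB _ _ _) _; rewrite mulrDl; apply: lerD.
  rewrite mulmx_sumr; apply: le_trans (enorm_sum _ _) _.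
  rewrite [leRHS]mulrAC mulr_sumr; apply: ler_sum => i _.
  by rewrite -scalemxAr enormZ ler_wpM2r ?enorm_ge0.
apply: le_trans (opnormP _ _ _) _; rewrite [leRHS]mulrAC [leRHS]mulrC; apply: ler_wpM2l => //.
apply: le_trans (enorm_sum _ _) _.
apply: (@le_trans _ _ (\sum_(i < d.+1) K * N u * r)).
  by apply: ler_sum => i _; rewrite enormZ ler_pM ?enorm_ge0.
have -> : \sum_(i < d.+1) K * N u * r = d.+1%:R * (K * r) * N u.
  by rewrite sumr_const card_ord -[LHS]mulr_natl; ring.
by apply: ler_wpM2r => //; exact: enorm_ge0.
Qed.

(** If [d + 1] of the images were that small, the corresponding vectors would be close to a basis,
    and [frame_op] would make [op A] smaller than itself. There are finitely many subfamilies, so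
    the constants do not depend on [A]. *)
Lemma position_count (M : nat) (s : M.-tuple V) :
  (forall t, subseq t s -> (size t <= d.+1)%N -> free t) ->
  exists K r : R, [/\ 0 <= K, 0 < r & forall (A : 'M[R]_d.+1) (w : 'I_M -> V),
    (forall i, N (w i - tnth s i) <= r) -> 0 < op A ->
    (#|[set i | (K * N (A *m w i) < op A)%R]| <= d)%N].
Proof.
move=> fs.
have ex (I : d.+1.-tuple 'I_M) : exists K : R, 0 <= K /\ (subseq I (enum 'I_M) ->
    forall (A : 'M[R]_d.+1) (w : 'I_M -> V) (r : R), (forall i, N (w i - tnth s i) <= r) ->
    d.+1%:R * (K * r) <= 2^-1 -> op A <= 2 * (K * \sum_(i < d.+1) N (A *m w (tnth I i)))).
  have [sI|nsI] := boolP (subseq I (enum 'I_M)); last by exists 0.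
  pose t := [tuple of map (tnth s) I].
  have [|K K0 hK] := @frame_op t.
    apply: fs; last by rewrite size_tuple.
    by rewrite -(map_tnth_enum s); apply: map_subseq.
  exists K; split=> // _ A w r hw hr; apply: (hK _ (fun i => w (tnth I i)) r) => // i.
  by rewrite -tnth_nth tnth_map.
have /choice[F hF] := ex.
pose K1 := \sum_I F I.
have FK I : F I <= K1.
  by rewrite /K1 (bigD1 I)//= lerDl sumr_ge0// => J _; case: (hF J).
have K10 : 0 <= K1 by rewrite sumr_ge0// => J _; case: (hF J).
pose r := (2 * d.+1%:R * (K1 + 1))^-1 : R.
have r0 : 0 < r by rewrite invr_gt0 !mulr_gt0// ltr_wpDl.
have rK : d.+1%:R * (K1 * r) <= 2^-1.
  have -> : d.+1%:R * (K1 * r) = 2^-1 * (K1 / (K1 + 1)).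
    have D0 : d.+1%:R != 0 :> R by rewrite pnatr_eq0.
    have K2 : K1 + 1 != 0 by rewrite gt_eqF// ltr_wpDl.
    by rewrite /r; move: (d.+1%:R : R) D0 (K1) K2 => D D0 K2 K20; field; rewrite K20 D0.
  by rewrite ger_pMr// ler_pdivrMr ?ltr_wpDl// mul1r lerDl.
exists (2 * K1 * d.+1%:R), r; split=> //; first by rewrite !mulr_ge0.
move=> A w hw A0; rewrite leqNgt; apply/negP => big.
set B := [set i | _] in big.
have sz : (d < size (enum B))%N by rewrite -cardE.
have szt : size (take d.+1 (enum B)) = d.+1 by rewrite size_takel.
pose I : d.+1.-tuple 'I_M := Tuple (introT eqP szt).
have sI : subseq I (enum 'I_M).
  apply: subseq_trans (take_subseq _ _) _.
  by rewrite /enum_mem; apply: subseq_trans (filter_subseq _ _) _; rewrite filter_predT.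
have rF : d.+1%:R * (F I * r) <= 2^-1.
  by apply: le_trans rK; apply: ler_wpM2l => //; apply: ler_wpM2r; rewrite ?FK// ltW.
have := (hF I).2 sI A w r hw rF; apply/negP; rewrite -ltNge.
have IB i : tnth I i \in B.
  by rewrite -mem_enum; apply: (mem_take (n0 := d.+1)); rewrite -[take _ _]/(tval I) mem_tnth.
have [K1e|K1n] := eqVneq K1 0.
  have -> : F I = 0 by apply/eqP; rewrite eq_le (hF I).1 andbT -K1e FK.
  by rewrite mul0r mulr0.
have K1p : 0 < K1 by rewrite lt_neqAle eq_sym K1n.
apply: (@le_lt_trans _ _ (2 * (K1 * \sum_(i < d.+1) N (A *m w (tnth I i))))).
  rewrite ler_wpM2l// ler_wpM2r ?FK//.
  by apply: sumr_ge0 => i _; exact: enorm_ge0.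
have lt i : N (A *m w (tnth I i)) < op A / (2 * K1 * d.+1%:R).
  by rewrite ltr_pdivlMr ?mulr_gt0// mulrC; have := IB i; rewrite inE.
apply: (@lt_le_trans _ _ (2 * (K1 * \sum_(i < d.+1) op A / (2 * K1 * d.+1%:R)))).
  rewrite ltr_pM2l// ltr_pM2l//; apply: ltr_sum => [|i _]; last exact: lt.
  by apply/hasP; exists ord0; rewrite ?mem_index_enum.
rewrite sumr_const card_ord -[(op A / _) *+ _]mulr_natr.
have D0 : d.+1%:R != 0 :> R by rewrite pnatr_eq0.
rewrite le_eqVlt; apply/orP; left; apply/eqP.
by move: (d.+1%:R : R) D0 => D D0; field; rewrite K1n D0.
Qed.

End Frames.

(** * Laws of random products and the group elements that they approach *)

Section Means.
Context {R : realType} {d : nat} (dot : {dot 'cV[R]_d.+1 for idfun}).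
Local Notation G := (GL R d).
Variables (mu : probability G R) (Q : probability (path G) R).
Hypothesis Q_cyl : iid_law mu Q.

Definition unitary (f : G -> R) := mble f /\ forall g, 0 <= f g <= 1.

Definition mean n (f : G -> R) : R := \int[Q]_s f (word n s).

Lemma unitary_ge0 f g : unitary f -> 0 <= f g. Proof. by case=> _ /(_ g) /andP[]. Qed.

Lemma unitary_le1 f g : unitary f -> f g <= 1. Proof. by case=> _ /(_ g) /andP[]. Qed.

Lemma unitary_L1 n f : unitary f -> L1 Q (fun s => f (word n s)).
Proof.
move=> [mf f01]; apply: (L1_bounded 1); first exact: (mf_comp mf (mf_word n)).
by move=> s; exact: norm_bounds (f01 (word n s)).
Qed.

Lemma unitary_mulr f a : unitary f -> unitary (fun g => f (g * a)%g).
Proof.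
move=> [mf f01]; split=> [|g]; last exact: f01.
apply: (mf_comp (f := f) (g := fun g : G => (g * a)%g)) => //.
apply: (mf_comp (f := fun z : G * G => (z.1 * z.2)%g) (g := fun g : G => (g, a : G))).
  exact: mf_mulGL.
exact: mf_pair.
Qed.

Lemma mean_ge0 n f : unitary f -> 0 <= mean n f.
Proof. by move=> uf; apply: Rint_ge0 => s; exact: unitary_ge0. Qed.

Lemma mean_le1 n f : unitary f -> mean n f <= 1.
Proof.
by move=> uf; apply: Rint_lec => [|s]; [exact: unitary_L1|exact: unitary_le1].
Qed.

Lemma mean_le n f f' : unitary f -> unitary f' -> (forall g, f g <= f' g) -> mean n f <= mean n f'.
Proof. by move=> uf uf' h; apply: Rint_le => //; exact: unitary_L1. Qed.

Lemma mean_le_affine n f f1 f2 (a b c : R) : unitary f -> unitary f1 -> unitary f2 ->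
  (forall g, f g <= a * f1 g + b * f2 g + c) -> mean n f <= a * mean n f1 + b * mean n f2 + c.
Proof.
move=> uf u1 u2 h.
have L1' := L1Z a (unitary_L1 n u1); have L2' := L1Z b (unitary_L1 n u2).
apply: le_trans (Rint_le (unitary_L1 n uf) (L1D (L1D L1' L2') (L1_cst Q c)) (fun s => h (word n s))) _.
by rewrite RintD ?RintD ?RintZ ?Rint_cst//; [exact: unitary_L1|exact: unitary_L1|
  exact: L1D|exact: L1_cst].
Qed.

Lemma mean_glue k n f : unitary f ->
  mean (k + n) f = mean k (fun b => mean n (fun a => f (a * b)%g)).
Proof.
move=> uf; rewrite /mean.
rewrite (@Rint_glue_bounded _ _ _ mu Q Q_cyl k (fun s => f (word (k + n) s)) 1).
- by apply: eq_Rint => s; apply: eq_Rint => s'; rewrite word_glue.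
- exact: (mf_comp uf.1 (mf_word (k + n))).
- by move=> s; exact: norm_bounds (uf.2 (word (k + n) s)).
Qed.

Lemma unitary_mean {dy} {Y : measurableType dy} n (f : Y -> G -> R) :
  mble2 f -> (forall y, unitary (f y)) ->
  mble (fun y => mean n (f y)) /\ forall y, 0 <= mean n (f y) <= 1.
Proof.
move=> mf uf; split; last by move=> y; rewrite mean_ge0 ?mean_le1.
apply: (mf_Rint2 (f := fun z : Y * path G => f z.1 (word n z.2))).
apply: (mf_app2 (F := f)) => //.
exact: (mf_comp (mf_word n) mf_snd).
Qed.

Lemma mf_ind {dy} {Y : measurableType dy} (f : Y -> R) (c : R) :
  mble f -> mble (fun y => (c < f y)%R%:R : R).
Proof.
move=> mf; pose A := f @^-1` `]c, +oo[%classic.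
rewrite (_ : (fun y => _) = \1_A); last first.
  apply/funext => y; rewrite indicE; congr ((nat_of_bool _)%:R).
  by apply/idP/idP => [h|/set_mem/=]; [apply/mem_set|]; rewrite /A/= in_itv/= andbT.
by apply: measurable_indic; rewrite -[X in measurable X]setTI; exact: mf.
Qed.

Lemma unitary_ind (f : G -> R) (c : R) : mble f ->
  unitary (fun g => (c < f g)%R%:R).
Proof. by move=> mf; split; [exact: mf_ind|move=> g; case: (_ < _); rewrite ?lexx ?ler01]. Qed.

Lemma unitary_indic (B : set G) : measurable B -> unitary \1_B.
Proof.
move=> mB; split; first exact: measurable_indic.
by move=> g; rewrite indicE; case: (_ \in _); rewrite ?lexx ?ler01.
Qed.

Lemma unitary_cst (c : R) : 0 <= c <= 1 -> unitary (fun=> c).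
Proof. by move=> h; split=> //; exact: measurable_cst. Qed.

(** Designed as a closed subsemigroup that contains the support, and hence contains [Gamma mu]. *)
Definition reached (g : G) := forall U : set G, nbhs g U ->
  exists k (B : set G), [/\ measurable B, B `<=` U & 0 < mean k \1_B].

Lemma reachedM g h : reached g -> reached h -> reached (g * h)%g.
Proof.
move=> rg rh U; rewrite nbhsE => -[U' [oU Ugh] UU].
have : nbhs (g * h)%g U' by apply: open_nbhs_nbhs.
move=> gU; have [e e0 he] := mulGL_nbhs dot gU.
have [k [A [mA AU A0]]] := rg _ (opball_nbhs dot g e0).
have [l [B [mB BU B0]]] := rh _ (opball_nbhs dot h e0).
have mU := open_measurable_GL oU.
exists (l + k)%N, U'; split=> //; rewrite mean_glue; last exact: unitary_indic.
apply: lt_le_trans (mulr_gt0 A0 B0) _; rewrite -[leLHS](RintZ _ (unitary_L1 l (unitary_indic mB))).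
have [mm m01] := unitary_mean (Y := G) k (f := fun b a => \1_U' (a * b)%g : R)
  (mf_comp (unitary_indic mU).1 (mf_comp mf_mulGL (@measurable_swap _ _ G G)))
  (fun b => unitary_mulr b (unitary_indic mU)).
apply: Rint_le => [||s].
- exact: L1Z (unitary_L1 l (unitary_indic mB)).
- exact: (@unitary_L1 l (fun b => mean k (fun a => \1_U' (a * b)%g))).
have [Bs|nBs] := pselect (B (word l s)); last first.
  by rewrite [X in _ * X]indicE memNset// mulr0; have /andP[] := m01 (word l s).
rewrite [X in _ * X]indicE mem_set// mulr1; apply: mean_le; [exact: unitary_indic|exact: unitary_mulr (unitary_indic mU)|].
move=> a; have [Aa|nAa] := pselect (A a); last first.
  by rewrite indicE memNset//; exact: unitary_ge0 (unitary_mulr _ (unitary_indic mU)).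
by rewrite !indicE !mem_set//; apply: he; [exact: AU|exact: BU].
Qed.

Lemma reached_closed : closed reached.
Proof.
move=> g cg U; rewrite nbhsE => -[U' [oU Ug] UU].
have [h [rh Uh]] := cg U' (open_nbhs_nbhs (conj oU Ug)).
have [k [B [mB BU B0]]] := rh U' (open_nbhs_nbhs (conj oU Uh)).
by exists k, B; split=> // z /BU/UU.
Qed.

Lemma mean1 f : unitary f -> mean 1 f = \int[mu]_a f a.
Proof.
move=> uf; rewrite -(Rint_coordinate Q_cyl 0 uf.1).1; apply: eq_Rint => s /=.
by rewrite mulg1.
Qed.

Lemma reached_supp g : supp mu g -> reached g.
Proof.
move=> sg U; rewrite nbhsE => -[U' [oU Ug] UU]; exists 1%N, U'.
have mU := open_measurable_GL oU.
split=> //; rewrite mean1; last exact: unitary_indic.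
rewrite /Rintegral integral_indic// setIT fine_gt0// sg//=.
exact: le_lt_trans (probability_le1 _ mU) (ltry _).
Qed.

Lemma Gamma_reached : Gamma mu `<=` reached.
Proof.
move=> g; apply; split; last by move=> h; exact: reached_supp.
by split; [exact: reached_closed|exact: reachedM].
Qed.

End Means.

Lemma inv_sqr_le {R : realFieldType} (p q : R) : 0 < p -> 0 < q -> p <= 2 * q ->
  (q ^+ 2)^-1 <= 4 * (p ^+ 2)^-1.
Proof.
move=> p0 q0 h; rewrite ler_pdivlMr ?exprn_gt0// mulrC ler_pdivrMr ?exprn_gt0//.
by have := ltW p0; nra.
Qed.

(** * Finite blocks of steps, uniform in the line: escape from bad directions, contraction of
    angles *)

Section Blocks.
Context {R : realType} {d : nat} (dot : {dot 'cV[R]_d.+1 for idfun}).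
Local Notation V := 'cV[R]_d.+1.
Local Notation N := (enorm dot).
Local Notation op := (opnorm dot).
Local Notation G := (GL R d).
Local Notation X := (PV R d).
Local Notation rr := (rr dot).
Local Notation e2 := (e2 dot).
Variables (mu : probability G R) (Q : probability (path G) R).
Hypotheses (Q_cyl : iid_law mu Q)
  (mu_proximal : proximal (Gamma mu))
  (mu_irreducible : strongly_irreducible (Gamma mu)).

(** There are [M] ways to spend at most [n] steps, each of probability bounded below, such that any
    continuation [A] dilates badly at most [d] of the resulting lines. The same [n] bounds the
    times, the inverse probabilities and the defect of dilation, which makes the property monotone
    in [n] and fit for compactness. *)
Definition good1 M n (x : X) := exists (k : 'I_M -> nat) (B : 'I_M -> set G),
  (forall i, [/\ (k i <= n)%N, measurable (B i) & n.+1%:R^-1 <= mean Q (k i) \1_(B i)]) /\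
  forall (A : G) (b : 'I_M -> G), (forall i, B i (b i)) ->
    (#|[set i | (n%:R < rr A (GL_act (b i) x))%R]| <= d)%N.

Definition good2 (eta : R) n (x : X) := exists (k : nat) (B : set G),
  [/\ (k <= n)%N, measurable B, n.+1%:R^-1 <= mean Q k \1_B &
  forall b, B b -> e2 b x <= eta].

Lemma Gamma_mul g h : Gamma mu g -> Gamma mu h -> Gamma mu (g * h)%g.
Proof. move=> Sg Sh T [[cT mT] sT].
by apply: (mT g h); [exact: (Sg T)|exact: (Sh T)]. Qed.

Lemma Gamma_ex : exists g, Gamma mu g.
Proof. by have [g Sg _] := mu_proximal; exists g. Qed.

Lemma upper_nat (r : R) : exists n : nat, r <= n%:R.
Proof.
exists (Num.bound `|r|); apply: le_trans (ler_norm r) _.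
by rewrite ltW// archi_boundP.
Qed.

Lemma leV_succ (p : R) n : 0 < p -> p^-1 <= n%:R -> n.+1%:R^-1 <= p.
Proof.
move=> p0 h; rewrite invf_ple ?posrE//; apply: le_trans h _.
by rewrite ler_nat.
Qed.

Lemma chord x y : exists2 c : R, c != 0 &
  N (c *: vec y) = N (vec x) /\ N (c *: vec y - vec x) <= 2 * N (vec x) * sd dot x y.
Proof.
have [c c0 [h1 h2]] := sine_chord dot (vec_neq0 x) (vec_neq0 y).
by exists c => //; rewrite enormZ h2; split=> //; rewrite -enormN opprB.
Qed.

(** Elements of [Gamma mu] sending [vec x] to vectors in general position are approached by the
    walk. Of the error [r] tolerated by [position_count], one half is left to this approximation and
    one half to the replacement of [x] by [y]. *)
Lemma good1_local M x : exists n, exists2 e : R, 0 < e & forall y, sd dot x y < e -> good1 M n y.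
Proof.
set v := vec x; have v0 : 0 < N v := enorm_vec_gt0 dot x.
have [s [sM sS sfree]] := general_position Gamma_mul mu_irreducible Gamma_ex M (vec_neq0 x).
pose t : M.-tuple G := Tuple (introT eqP sM).
have tS i : Gamma mu (tnth t i) by apply: sS; exact: mem_tnth.
have [|K [r [K0 r0 hK]]] := position_count dot (s := [tuple of [seq val g *m v | g <- t]]).
  exact: sfree.
pose C := \sum_i op (val (tnth t i)).
have Ci i : op (val (tnth t i)) <= C.
  by rewrite /C (bigD1 i)//= lerDl sumr_ge0// => j _; exact: opnorm_ge0.
have C0 : 0 <= C by rewrite sumr_ge0// => j _; exact: opnorm_ge0.
pose eps := r / (2 * N v); have eps0 : 0 < eps by rewrite divr_gt0// mulr_gt0.
have ex i : exists kB : nat * set G, [/\ measurable kB.2,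
    kB.2 `<=` [set h | op (val h - val (tnth t i)) < eps] & 0 < mean Q kB.1 \1_kB.2].
  have [k [B [mB BU B0]]] := Gamma_reached dot Q_cyl (tS i) (opball_nbhs dot (tnth t i) eps0).
  by exists (k, B).
have /choice[kB hkB] := ex.
pose W := C * N v + r; have W0 : 0 < W by rewrite ltr_wpDl// mulr_ge0// ltW.
have [n hn] := upper_nat (K * W + \sum_i ((kB i).1%:R + (mean Q (kB i).1 \1_((kB i).2))^-1)).
have T0 i : 0 <= (kB i).1%:R + (mean Q (kB i).1 \1_((kB i).2))^-1 :> R.
  by rewrite addr_ge0// invr_ge0 ltW//; case: (hkB i).
have KW : K * W <= n%:R by apply: le_trans hn; rewrite lerDl sumr_ge0.
have Ti i : (kB i).1%:R + (mean Q (kB i).1 \1_((kB i).2))^-1 <= n%:R :> R.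
  apply: le_trans hn; rewrite (bigD1 i)//= addrCA lerDl addr_ge0 ?mulr_ge0 ?(ltW W0)//.
  by apply: sumr_ge0.
exists n, (r / (4 * (C + 1) * N v)); first by rewrite divr_gt0// !mulr_gt0// ltr_wpDl.
move=> y hy; exists (fun i => (kB i).1), (fun i => (kB i).2); split.
  move=> i; have [mB _ p0] := hkB i; split=> //.
    by rewrite -(ler_nat R); apply: le_trans (Ti i); rewrite lerDl invr_ge0 ltW.
  by apply: leV_succ => //; apply: le_trans (Ti i); rewrite lerDr.
move=> A b hb; have [c c0 [cN cd]] := chord x y.
pose w i := val (b i) *m (c *: vec y).
have wr i : N (w i - tnth [tuple of [seq val g *m v | g <- t]] i) <= r.
  rewrite tnth_map; have -> : w i - val (tnth t i) *m v =
      (val (b i) - val (tnth t i)) *m (c *: vec y) + val (tnth t i) *m (c *: vec y - v).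
    by rewrite mulmxBl mulmxBr addrA subrK.
  apply: le_trans (enormD _ _ _) _.
  have t1 : N ((val (b i) - val (tnth t i)) *m (c *: vec y)) <= eps * N v.
    apply: le_trans (opnormP _ _ _) _; rewrite cN; apply: ler_wpM2r; first exact: ltW.
    by have [_ sB _] := hkB i; exact: ltW (sB _ (hb i)).
  have t2 : N (val (tnth t i) *m (c *: vec y - v)) <=
      (C + 1) * (2 * N v * (r / (4 * (C + 1) * N v))).
    apply: le_trans (opnormP _ _ _) _; apply: ler_pM; rewrite ?opnorm_ge0 ?enorm_ge0//.
      by rewrite (le_trans (Ci i))// lerDl.
    by apply: le_trans cd _; apply: ler_wpM2l; rewrite ?mulr_ge0 ?ltW.
  have E1 : eps * N v = r / 2 by rewrite /eps; field; rewrite gt_eqF.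
  have E2 : (C + 1) * (2 * N v * (r / (4 * (C + 1) * N v))) = r / 2.
    by field; rewrite !gt_eqF// ltr_wpDl.
  rewrite E1 in t1; rewrite E2 in t2; apply: le_trans (lerD t1 t2) _.
  by rewrite -splitr.
have A0 : 0 < op (val A).
  rewrite lt_neqAle opnorm_ge0 andbT eq_sym; apply/eqP => A0.
  by have := opnorm1_ge dot (val_mulV A); rewrite A0 mul0r ler10.
apply: leq_trans (hK (val A) w wr A0); apply: subset_leq_card; apply/fintype.subsetP => i.
rewrite !inE /= => hi.
have w0 : w i != 0 by apply: lact_neq0; rewrite scaler_eq0 negb_or c0 vec_neq0.
have Aw0 : val A *m w i != 0 by exact: lact_neq0.
have wW : N (w i) <= W.
  have := wr i; rewrite tnth_map => h.
  rewrite -[w i](subrK (val (tnth t i) *m v)) addrC; apply: le_trans (enormD _ _ _) _.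
  apply: lerD => //; apply: le_trans (opnormP _ _ _) _.
  by apply: ler_wpM2r => //; exact: ltW.
have [a a0 Ea] := vec_act (b i) y.
have Ea' : vec (GL_act (b i) y) = (a / c) *: w i.
  by rewrite Ea /w -scalemxAr scalerA mulfVK.
have ac0 : a / c != 0 by rewrite mulf_neq0// invr_eq0.
have dE := dilE dot A ac0 Ea'.
have hi2 : n%:R * N (val A *m w i) < op (val A) * N (w i).
  move: hi; rewrite !/(rr _ _) dE invf_div mulrA ltr_pdivlMr//; exact: enorm_gt0.
have Nw0 := enorm_gt0 dot w0.
rewrite -(ltr_pM2r W0); apply: le_lt_trans (_ : n%:R * N (val A *m w i) < _).
  by rewrite mulrAC; apply: ler_wpM2r => //; exact: enorm_ge0.
by apply: lt_le_trans hi2 _; apply: ler_wpM2l => //; exact: ltW.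
Qed.

Lemma good1_uniform M : exists n, forall x, good1 M n x.
Proof.
apply: (PV_uniform (dot := dot)) => [n m x nm|x]; last exact: good1_local.
move=> [k [B [h1 h2]]]; exists k, B; split.
  move=> i; have [h3 h4 h5] := h1 i; split=> //; first exact: leq_trans nm.
  by apply: le_trans h5; rewrite lef_pV2 ?posrE ?ltr0Sn// ler_nat.
move=> A b hb; apply: leq_trans (h2 A b hb); apply: subset_leq_card; apply/fintype.subsetP => i.
by rewrite !inE /=; apply: le_lt_trans; rewrite ler_nat.
Qed.

(** By irreducibility some [h] moves [x] out of the exceptional subspace [W], after which a power of
    the proximal element contracts. The constant 64 is 16 times 4: 16 for replacing the product by a
    nearby element, 4 for replacing [x] by a nearby line. *)
Lemma good2_local (eta : R) x : 0 < eta ->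
  exists n, exists2 e : R, 0 < e & forall y, sd dot x y < e -> good2 eta n y.
Proof.
move=> eta0; have [g Sg [W Wp hW]] := proximal_contraction dot mu_proximal.
have [|h Sh hv] := orbit_avoids Gamma_mul mu_irreducible Gamma_ex (Us := [:: W]) (vec_neq0 x).
  by move=> U; rewrite inE => /eqP ->.
have {}hv : vec (GL_act h x) \notin W.
  have [c c0 ->] := vec_act h x; apply: contra (hv _ (mem_head _ _)) => cW.
  by rewrite -[_ *m _]scale1r -(mulVf c0) -scalerA; exact: memvZ.
(* The factor [rr h x ^ 2] compensates the effect of [h] on angles around [x]. *)
have q0 : 0 < eta / (64 * rr h x ^+ 2).
  by rewrite divr_gt0// mulr_gt0// exprn_gt0// (lt_le_trans ltr01)// rr_ge1.
have [k hk] := hW _ hv _ q0; set z := GL_act h x in hk.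
pose a := (iter k (fun b => (g * b)%g) h).
have [aS [aE _]] : Gamma mu a /\ (val a = val g ^+ k *m val h /\ True).
  rewrite /a; elim: k {hk a} => [|k [IH1 [IH2 _]]] /=; first by rewrite mul1mx.
  split; first exact: Gamma_mul.
  by split => //; rewrite [sval (iter _ _ _)]IH2 mulmxA exprS.
have ae : e2 a x <= eta / 64.
  have r0 : 0 < rr h x by rewrite (lt_le_trans ltr01)// rr_ge1.
  have h0 := dil_gt0 dot h x; have a0 := dil_gt0 dot a x.
  have E : dil dot a x = N (val g ^+ k *m vec z) / N (vec z) * dil dot h x.
    have [c c0 Ec] := vec_act h x; rewrite -/z in Ec.
    rewrite Ec -scalemxAr !enormZ -mulf_div divff ?normr_eq0// mul1r.
    by rewrite /dil aE mulmxA mulrA mulfVK// gt_eqF// enorm_act_gt0.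
  have z0 := enorm_vec_gt0 dot z.
  have D0 : 0 < N (val g ^+ k *m vec z).
    move: a0; rewrite E pmulr_lgt0// pmulr_lgt0// invr_gt0//.
  rewrite !/(e2 _ _) aE E ler_pdivrMr; last by rewrite exprn_gt0// mulr_gt0// divr_gt0.
  apply: le_trans (opnorm2M _ _ _) _.
  apply: le_trans (ler_wpM2l (opnorm2_ge0 _ _) (opnorm2_sqr dot (val h))) _.
  rewrite -(ler_pM2r (exprn_gt0 2 z0)) mulrAC.
  apply: le_trans (ler_wpM2r _ hk) _; first by rewrite exprn_ge0 ?opnorm_ge0.
  rewrite !/(rr _ _); apply: le_of_eq; field.
  rewrite !gt_eqF//; have := opnorm1_ge dot (val_mulV h); case: ltgtP (opnorm_ge0 dot (val h)) => // <-.
  by rewrite mul0r ler10.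
have e10 : 0 < 2^-1 :> R by [].
have U1 : nbhs a [set b | op (val (b * a^-1)%g) < 1 + 1 /\ op (val (a * b^-1)%g) < 1 + 1].
  exact: filterI (GL_close dot a ltr01) (GL_closeV dot a ltr01).
have [l [B [mB BU B0]]] := Gamma_reached dot Q_cyl aS U1.
have [n hn] := upper_nat (l%:R + (mean Q l \1_B)^-1).
pose e := ln 2 / (2 * nm dot a ^+ 2) : R.
have e0 : 0 < e by rewrite divr_gt0 ?ln_gt0 ?ltr1n// mulr_gt0// exprn_gt0// nm_gt0.
exists n, e => // y hy; exists l, B; split=> //.
- by rewrite -(ler_nat R); apply: le_trans hn; rewrite lerDl invr_ge0 ltW.
- by apply: leV_succ => //; apply: le_trans hn; rewrite lerDr.
move=> b /BU[b1 b2].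
have -> : b = (b * a^-1 * a)%g by rewrite mulgVK.
apply: le_trans (e2M _ _ _ _) _.
have f1 : e2 (b * a^-1)%g (GL_act a y) <= 16.
  apply: le_trans (e2_rr _ _ _) _.
  have nm2 : nm dot (b * a^-1)%g <= 2.
    by rewrite ge_max invgF !ltW.
  have r1 : rr (b * a^-1)%g (GL_act a y) <= 4.
    apply: le_trans (rr_nm _ _ _) _; rewrite (_ : 4 = 2 ^+ 2); last by ring.
    by rewrite ler_pXn2r ?nnegrE ?(ltW (nm_gt0 _ _)).
  rewrite (_ : 16 = 4 ^+ 2); last by ring.
  by rewrite ler_pXn2r ?nnegrE// (le_trans ler01)// rr_ge1.
have f2 : e2 a y <= 4 * (eta / 64).
  apply: (@le_trans _ _ (4 * e2 a x)); last by rewrite ler_wpM2l.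
  have : `|sigma dot a x - sigma dot a y| <= ln 2.
    apply: le_trans (sigma_lip _ _ _ _) _; rewrite mulrC -ler_pdivlMr; first exact: ltW.
    by rewrite mulr_gt0// exprn_gt0// nm_gt0.
  have a0 := dil_gt0 dot a x; have a1 := dil_gt0 dot a y.
  rewrite !sigmaE => /ler_normlW; rewrite lerBlDr -lnM ?posrE// => le2'.
  have le2 : dil dot a x <= 2 * dil dot a y.
    by rewrite -ler_ln ?posrE//; apply: mulr_gt0.
  rewrite !/(e2 _ _) mulrCA; apply: ler_wpM2l; first exact: opnorm2_ge0.
  exact: inv_sqr_le.
apply: le_trans (ler_pM (e2_ge0 _ _ _) (e2_ge0 _ _ _) f1 f2) _.
by apply: le_of_eq; field.
Qed.

Lemma good2_uniform (eta : R) : 0 < eta -> exists n, forall x, good2 eta n x.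
Proof.
move=> eta0; apply: (PV_uniform (dot := dot)) => [n m x nm|x]; last exact: good2_local.
move=> [k [B [h1 h2 h3 h4]]]; exists k, B; split=> //; first exact: leq_trans nm.
by apply: le_trans h3; rewrite lef_pV2 ?posrE ?ltr0Sn// ler_nat.
Qed.

End Blocks.

Lemma small_power_ex {R : realType} (q e : R) : 0 <= q -> q < 1 -> 0 < e -> exists j, q ^+ j <= e.
Proof.
move=> q0 q1 e0; have qn : `|q| < 1 by rewrite ger0_norm.
have /cvgrPdist_lt/(_ e e0)[j _ hj] := cvg_expr qn.
exists j; have := hj j (leqnn j); rewrite /= sub0r normrN ger0_norm ?exprn_ge0//.
exact: ltW.
Qed.

Lemma shift_sum_le {R : realType} (f : nat -> R) k N : (forall i, 0 <= f i <= 1) ->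
  \sum_(i < N) f i <= k%:R + \sum_(i < N) f (k + i)%N.
Proof.
move=> f01; apply: (@le_trans _ _ (\sum_(i < k + N) f i)).
  rewrite -!(big_mkord xpredT) (big_cat_nat (n := N) (p := k + N))//= ?leq_addl//.
  by rewrite lerDl sumr_ge0// => i _; have /andP[] := f01 i.
rewrite big_split_ord/= lerD2r; apply: (@le_trans _ _ (\sum_(i < k) 1)).
  by apply: ler_sum => i _; have /andP[] := f01 i.
by rewrite sumr_const card_ord.
Qed.

Lemma Rint_sum_seq {R : realType} {dT} {T : measurableType dT} (P : probability T R) {I : Type}
    (r : seq I) (F : I -> T -> R) : (forall i, L1 P (F i)) ->
  L1 P (fun x => \sum_(i <- r) F i x) /\
  \int[P]_x (\sum_(i <- r) F i x) = \sum_(i <- r) \int[P]_x F i x.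
Proof.
move=> LF; elim: r => [|i r [IH1 IH2]].
  split; first by apply: L1_le (L1_cst P 0) _ => [|x]; rewrite ?big_nil ?normr0//;
    under eq_fun do rewrite big_nil; exact: measurable_cst.
  by under eq_Rint do rewrite big_nil; rewrite Rint_cst big_nil.
split; first by under eq_fun do rewrite big_cons; exact: L1D.
rewrite big_cons -IH2 -RintD//; apply: eq_Rint => x; exact: big_cons.
Qed.

(** * Tightness of the defect of dilation, uniformly in time and in the line *)

Section Tightness.
Context {R : realType} {d : nat} (dot : {dot 'cV[R]_d.+1 for idfun}).
Local Notation G := (GL R d).
Local Notation X := (PV R d).
Local Notation rr := (rr dot).
Local Notation e2 := (e2 dot).
Local Notation ell := (ell dot).
Variables (mu : probability G R) (Q : probability (path G) R).
Hypotheses (Q_cyl : iid_law mu Q)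
  (mu_proximal : proximal (Gamma mu))
  (mu_irreducible : strongly_irreducible (Gamma mu))
  (L1_ell : L1 mu ell).
Local Notation mean := (mean Q).

Lemma L1_sum_ell n : L1 Q (fun s => \sum_(i < n) ell (s i)).
Proof.
apply: (L1_sum (f := fun i (s : path G) => ell (s i))) => i _.
exact: (Rint_coordinate Q_cyl i (mf_ell dot)).2.
Qed.

Lemma Rint_sum_ell n : \int[Q]_s (\sum_(i < n) ell (s i)) = n%:R * \int[mu]_a ell a.
Proof.
rewrite (Rint_sum (f := fun i (s : path G) => ell (s i))).
  rewrite (eq_bigr (fun=> \int[mu]_a ell a)).
    by rewrite sumr_const card_ord mulr_natl.
  by move=> i _; exact: (Rint_coordinate Q_cyl i (mf_ell dot)).1.
by move=> i _; exact: (Rint_coordinate Q_cyl i (mf_ell dot)).2.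
Qed.

Lemma ell_word n s : ell (word n s) <= \sum_(i < n) ell (s i).
Proof.
elim: n => [|n IH] /=; first by rewrite big_ord0 !/(ell _) nm1 ln1.
rewrite big_ord_recr /= addrC; apply: le_trans (ellM _ _ _) _; exact: lerD.
Qed.

Lemma mf_rr_act x : mble (fun z : G * G => rr z.2 (GL_act z.1 x)).
Proof.
apply: (mf_app2 (F := rr)); [exact: mf_rr|exact: mf_snd|].
apply: (mf_app2 (F := GL_act)) => //; exact: mf_GL_act.
Qed.

Lemma mf_rr1 x : mble (fun a : G => rr a x).
Proof. exact: (mf_pair2 x (mf_rr dot)). Qed.

Lemma mf_e2_1 x : mble (fun a : G => e2 a x).
Proof. exact: (mf_pair2 x (mf_e2 dot)). Qed.

Definition pr (L : R) n x : R := mean n (fun a => (L < rr a x)%R%:R).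

Lemma unitary_rr (L : R) x : unitary (fun a : G => (L < rr a x)%R%:R : R).
Proof. exact: unitary_ind (mf_rr1 x). Qed.

Lemma pr_ge0 L n x : 0 <= pr L n x. Proof. exact: mean_ge0 (unitary_rr L x). Qed.

Lemma pr_le1 L n x : pr L n x <= 1. Proof. exact: mean_le1 (unitary_rr L x). Qed.

Lemma unitary_pr_act L n x : unitary (fun b : G => pr L n (GL_act b x)).
Proof.
by apply: (@unitary_mean _ _ Q _ G n (fun b a => (L < rr a (GL_act b x))%R%:R : R)) => [|y];
  [exact: mf_ind (mf_rr_act x)|exact: unitary_rr].
Qed.

(** Markov's inequality for the sum of the [ell], which bounds half the logarithm of the defect;
    this works for a bounded number of steps only. *)
Lemma pr_tail (e : R) n : 0 < e -> exists2 C : R, 1 <= C & forall k x, (k <= n)%N -> pr C k x <= e.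
Proof.
move=> e0; set E := \int[mu]_a ell a.
have E0 : 0 <= E by apply: Rint_ge0 => a; exact: ell_ge0.
pose l := (2 * n%:R * E + 1) / e; have l0 : 0 < l.
  by rewrite divr_gt0// ltr_wpDl// !mulr_ge0.
exists (expR l); first by rewrite -expR0 ler_expR ltW.
move=> k x kn; rewrite /pr.
apply: le_trans (Rint_le (unitary_L1 Q k (unitary_rr _ x)) (L1Z (2 / l) (L1_sum_ell k)) _) _.
  move=> s; have sl : 0 <= \sum_(i < k) ell (s i) by apply: sumr_ge0 => i _; exact: ell_ge0.
  have [h|h] := ltP (expR l) (rr (word k s) x); last by rewrite mulr_ge0// divr_ge0// ltW.
  rewrite mulrAC ler_pdivlMr// mul1r.
  have h2 : expR l <= nm dot (word k s) ^+ 2 by exact: le_trans (ltW h) (rr_nm _ _ _).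
  have : l <= ln (nm dot (word k s) ^+ 2).
    by rewrite -[l]expRK ler_ln ?posrE ?expR_gt0// exprn_gt0// nm_gt0.
  rewrite lnXn ?nm_gt0// -[ln _ *+ 2]mulr_natl => h3; apply: le_trans h3 _.
  by apply: ler_wpM2l => //; exact: ell_word.
rewrite RintZ ?Rint_sum_ell; last exact: L1_sum_ell.
have el : 2 * (k%:R * E) <= e * l.
  rewrite /l [e * _]mulrC mulfVK ?gt_eqF// -mulrA; apply: (@le_trans _ _ (2 * (n%:R * E))).
    by rewrite ler_pM2l// ler_wpM2r// ler_nat.
  by rewrite lerDl.
by rewrite mulrAC ler_pdivrMr.
Qed.

(** Sums over time come before single times because a good branch is found only on average over the
    future. *)
Definition cesaro (L : R) N x := \sum_(i < N) pr L i x.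

Lemma cesaro_ge0 L N x : 0 <= cesaro L N x.
Proof. by apply: sumr_ge0 => i _; exact: pr_ge0. Qed.

Lemma cesaro_le L N x : cesaro L N x <= N%:R.
Proof.
apply: (@le_trans _ _ (\sum_(i < N) 1)); first by apply: ler_sum => i _; exact: pr_le1.
by rewrite sumr_const card_ord.
Qed.

Lemma pr_glue (L C : R) k n x : 0 <= L -> 0 <= C ->
  pr (L * C) (k + n) x <= mean k (fun b => pr L n (GL_act b x)) + pr C k x.
Proof.
move=> L0 C0; rewrite /pr (mean_glue Q_cyl); last exact: unitary_rr.
have h b : mean n (fun a => (L * C < rr (a * b)%g x)%R%:R) <=
    1 * pr L n (GL_act b x) + 1 * (C < rr b x)%R%:R + 0.
  rewrite addr0 !mul1r; have [Cb|bC] := ltP C (rr b x).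
    by apply: le_trans (mean_le1 _ _ (unitary_mulr b (unitary_rr _ x))) _; rewrite lerDr pr_ge0.
  rewrite addr0; apply: mean_le => [||a]; first exact: unitary_mulr (unitary_rr _ x).
    exact: unitary_rr.
  have [h|_] := ltP (L * C) (rr (a * b)%g x); last by case: (_ < _).
  suff -> : L < rr a (GL_act b x) by [].
  rewrite ltNge; apply/negP => aL; move: h; apply/negP; rewrite -leNgt.
  apply: le_trans (rrM _ _ _ _) _; apply: ler_pM => //; exact: (le_trans ler01 (rr_ge1 _ _ _)).
rewrite -[X in X <= _]addr0.
have um : unitary (fun b : G => mean n (fun a => (L * C < rr (a * b)%g x)%R%:R : R)).
  apply: (@unitary_mean _ _ Q _ G n (fun b a => (L * C < rr (a * b)%g x)%R%:R : R)) => [|b].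
    apply: mf_ind; apply: (mf_comp (f := fun a : G => rr a x)
      (g := fun z : G * G => (z.2 * z.1)%g)); first exact: mf_rr1.
    exact: (mf_comp (f := fun z : G * G => (z.1 * z.2)%g) (g := fun z : G * G => (z.2, z.1))
      mf_mulGL (@measurable_swap _ _ G G)).
  exact: unitary_mulr (unitary_rr _ x).
have gen (p q r : R) : p <= 1 * q + 1 * r + 0 -> p + 0 <= q + r by lra.
exact: gen (mean_le_affine Q k um (unitary_pr_act L n x) (unitary_rr C x) h).
Qed.

Section CesaroStep.
Variables (e : R) (M n N : nat) (L C S : R).
Hypotheses (e0 : 0 < e) (M0 : (0 < M)%N) (N0 : (0 < N)%N) (hM : d%:R / M%:R <= e / 4)
  (hn : forall x, good1 dot Q M n x) (nL : n%:R <= L) (L0 : 0 <= L) (C0 : 0 <= C)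
  (hC : forall k x, (k <= n)%N -> pr C k x <= n.+1%:R^-1 * (e / 8))
  (hN : n%:R <= n.+1%:R^-1 * (e / 8) * N%:R)
  (eS : e / 4 <= S) (hS : forall x, cesaro L N x <= S * N%:R).

Let avg (b : G) x := N%:R^-1 * cesaro L N (GL_act b x).

Let N0' : 0 < N%:R :> R. Proof. by rewrite ltr0n. Qed.

Lemma avg_unitary x : unitary (avg ^~ x).
Proof.
split.
  apply: mfM; first exact: measurable_cst.
  by apply: measurable_sum => i; have [] := unitary_pr_act L i x.
move=> b; apply/andP; split; first by rewrite mulr_ge0 ?invr_ge0 ?cesaro_ge0.
by rewrite /avg mulrC ler_pdivrMr// mul1r cesaro_le.
Qed.

(** At each future time at most [d] of the [M] branches are bad, so the averages over time cannot
    all exceed [e / 4], which is at least [d / M]. *)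
Lemma avg_pigeonhole x : exists (k : nat) (B : set G), [/\ (k <= n)%N, measurable B,
  n.+1%:R^-1 <= mean k \1_B & forall b, B b -> avg b x <= e / 4].
Proof.
have [k [B [h1 h2]]] := hn x.
have [[i hi]|no] := pselect (exists i, forall b, B i b -> avg b x <= e / 4).
  by exists (k i), (B i); have [? ? ?] := h1 i.
have ch (i : 'I_M) : exists b, B i b /\ e / 4 < avg b x.
  apply: contrapT => nb; apply: no; exists i => b Bb; rewrite leNgt; apply/negP => lt.
  by apply: nb; exists b.
have /choice[b hb] := ch.
have : \sum_(i < M) avg (b i) x <= d%:R.
  rewrite -mulr_sumr mulrC ler_pdivrMr// exchange_big/=.
  apply: (@le_trans _ _ (\sum_(j < N) d%:R)); last first.
    by rewrite sumr_const card_ord mulr_natr.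
  apply: ler_sum => j _.
  have LF (i : 'I_M) : L1 Q (fun s => (L < rr (word j s) (GL_act (b i) x))%R%:R : R).
    exact: unitary_L1 (unitary_rr L _).
  have [LS <-] := Rint_sum_seq (index_enum 'I_M) LF; apply: Rint_lec => // s.
  rewrite -natr_sum ler_nat; apply: leq_trans (h2 (word j s) b (fun i => (hb i).1)).
  rewrite -sum1_card [leqRHS]big_mkcond/=; apply: leq_sum => i _.
  have [h|//] := boolP (L < _); rewrite ifT//; apply/mem_set => /=; exact: le_lt_trans nL h.
move=> le; exfalso; move: le; apply/negP; rewrite -ltNge.
have lt i : e / 4 < avg (b i) x by have [] := hb i.
apply: le_lt_trans (_ : \sum_(i < M) e / 4 < _).
  rewrite sumr_const card_ord -[leRHS]mulr_natr -ler_pdivrMr ?ltr0n//.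
by apply: ltr_sum => //; apply/hasP; exists (Ordinal M0); rewrite ?mem_index_enum.
Qed.

(** With probability at least [1 / (n + 1)] the walk enters a branch whose average is at most
    [e / 4] instead of [S]. In the same unit [1 / (n + 1)], the shift of time and the threshold
    exceeded during the branch cost [e / 8] each. *)
Lemma cesaro_step x : cesaro (L * C) N x <= ((1 - n.+1%:R^-1) * S + n.+1%:R^-1 * (e / 2)) * N%:R.
Proof.
have [k [B [kn mB Bp hB]]] := avg_pigeonhole x.
have p01 i : 0 <= pr (L * C) i x <= 1 by rewrite pr_ge0 pr_le1.
apply: le_trans (shift_sum_le k N p01) _.
have s1 : \sum_(i < N) pr (L * C) (k + i) x <=
    \sum_(i < N) mean k (fun b => pr L i (GL_act b x)) + N%:R * (n.+1%:R^-1 * (e / 8)).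
  have -> : N%:R * (n.+1%:R^-1 * (e / 8)) = \sum_(i < N) n.+1%:R^-1 * (e / 8) :> R.
    by rewrite sumr_const card_ord mulr_natl.
  rewrite -big_split/=; apply: ler_sum => i _; apply: le_trans (pr_glue k i x L0 C0) _.
  by rewrite lerD2l hC.
have s2 : \sum_(i < N) mean k (fun b => pr L i (GL_act b x)) = N%:R * mean k (avg ^~ x).
  have LF (i : 'I_N) : L1 Q (fun s => pr L i (GL_act (word k s) x)).
    exact: unitary_L1 (unitary_pr_act L i x).
  have [LS E] := Rint_sum_seq (index_enum 'I_N) LF.
  rewrite /mean -E /avg RintZ// mulrA divff ?mul1r// gt_eqF//.
have s3 : mean k (avg ^~ x) <= - (S - e / 4) * mean k \1_B + 0 * mean k \1_B + S.
  apply: mean_le_affine; [exact: avg_unitary|exact: unitary_indic|exact: unitary_indic|].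
  move=> b; have [Bb|nB] := pselect (B b).
    by rewrite indicE mem_set// mulr1 mul0r addr0 opprB addrC subrKC ?hB//; have := hB b Bb; lra.
  rewrite indicE memNset// !mulr0 !add0r.
  by rewrite /avg mulrC ler_pdivrMr.
have kN : k%:R <= n.+1%:R^-1 * (e / 8) * N%:R.
  by apply: le_trans hN; rewrite ler_nat.
rewrite mul0r addr0 in s3.
have s4 : mean k (avg ^~ x) <= S - (S - e / 4) * n.+1%:R^-1.
  apply: le_trans s3 _; rewrite mulNr addrC lerD2l lerN2; apply: ler_wpM2l => //.
  by rewrite subr_ge0.
rewrite s2 in s1; apply: le_trans (lerD kN s1) _.
have := ler_wpM2l (ltW N0') s4.
move: (n.+1%:R^-1 : R) (N%:R : R) (mean k (avg ^~ x)) => c r m h; lra.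
Qed.

End CesaroStep.

(** From the trivial bound, [cesaro_step] shrinks the excess over [e / 2] geometrically, the
    threshold being multiplied by [C] each time; [N0] is the same for all iterations. *)
Lemma cesaro_tight (e : R) : 0 < e -> exists2 L : R, 1 <= L &
  exists N0, forall N x, (N0 <= N)%N -> (0 < N)%N -> cesaro L N x <= e * N%:R.
Proof.
move=> e0.
have [M M0 hM] : exists2 M, (0 < M)%N & d%:R / M%:R <= e / 4.
  have [m hm] := upper_nat (4 * d%:R / e); exists m.+1 => //.
  rewrite ler_pdivrMr ?ltr0n//; rewrite ler_pdivrMr// in hm.
  have : m%:R * e <= m.+1%:R * e by rewrite ler_pM2r// ler_nat.
  by move: (m%:R * e) (m.+1%:R : R) hm => a b; lra.
have [n hn] := good1_uniform dot Q_cyl mu_proximal mu_irreducible M.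
set c := n.+1%:R^-1 : R; have c0 : 0 < c by rewrite invr_gt0 ltr0Sn.
have c1 : c <= 1 by rewrite invf_le1 ?ltr0Sn// ler1n.
have ce0 : 0 < c * (e / 8) by rewrite mulr_gt0// divr_gt0.
have [C C1 hC] := pr_tail n ce0.
have [J hJ] : exists J, (1 - c) ^+ J <= e / 2.
  by apply: small_power_ex; rewrite ?subr_ge0 ?divr_gt0// gtrBl.
have [N0 hN0] := upper_nat (n%:R / (c * (e / 8))).
pose L j := (n%:R + 1) * C ^+ j.
have C0 : 0 <= C by exact: le_trans C1.
have L0 j : n%:R <= L j.
  rewrite -[n%:R]mulr1; apply: ler_pM => //; first by rewrite lerDl.
  exact: exprn_ege1.
exists (L J); first by rewrite -[1]mulr1; apply: ler_pM => //; [rewrite lerDr|exact: exprn_ege1].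
exists N0 => N x NN N1.
have hN : n%:R <= c * (e / 8) * N%:R.
  by rewrite mulrC -ler_pdivrMr//; apply: le_trans hN0 _; rewrite ler_nat.
suff H j y : cesaro (L j) N y <= (e / 2 + (1 - c) ^+ j) * N%:R.
  apply: le_trans (H J x) _; rewrite ler_wpM2r//; lra.
elim: j y => [|j IH] y.
  apply: le_trans (cesaro_le _ _ _) _; rewrite expr0 ler_peMl//.
  by rewrite lerDr divr_ge0// ltW.
have -> : L j.+1 = L j * C by rewrite /L exprSr mulrA.
have pj : 0 <= (1 - c) ^+ j by rewrite exprn_ge0// subr_ge0.
have := @cesaro_step e M n N (L j) C (e / 2 + (1 - c) ^+ j) M0 N1 hM hn (L0 j)
  (le_trans (ler0n _ _) (L0 j)) C0 hC hN _ IH y.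
have -> : (1 - n.+1%:R^-1) * (e / 2 + (1 - c) ^+ j) + n.+1%:R^-1 * (e / 2) =
  e / 2 + (1 - c) ^+ j.+1 by rewrite exprS -/c; ring.
apply; lra.
Qed.

(* A line that is badly dilated at time [n] stays so with large probability;
   hence the averages control every single time. *)
Lemma pr_tight (e : R) : 0 < e -> e <= 2^-1 -> exists2 L : R, 1 <= L &
  (forall n x, pr L n x <= e).
Proof.
move=> e0 e1; have e40 : 0 < e / 4 by rewrite divr_gt0.
have [L L1' [N0 hN]] := cesaro_tight e40.
(* By [rr_persist], a defect beyond [2 * L * L] remains beyond [L] unless the continuation itself
   has a defect beyond [L] at a certain line. *)
exists (2 * L * L) => [|n x].
  have : 1 * 1 <= L * L by apply: ler_pM.
  by rewrite -mulrA; move: (L * L) => l; lra.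
pose N := (N0 + n).+1; have N1 : 0 < N%:R :> R by rewrite ltr0n.
have L0 : 0 <= L by exact: le_trans L1'.
have h (b : G) : (2 * L * L < rr b x)%R%:R * (N%:R * (1 - e / 4)) <=
    \sum_(j < N) mean j (fun a => (L < rr (a * b)%g x)%R%:R).
  have [hb|_] := ltP (2 * L * L) (rr b x); last first.
    by rewrite mul0r sumr_ge0// => j _; exact: mean_ge0 (unitary_mulr b (unitary_rr L x)).
  have [y hy] := rr_persist dot b x.
  rewrite mul1r; apply: (@le_trans _ _ (N%:R - cesaro L N (GL_act b y))).
    rewrite mulrBr mulr1 lerD2l lerN2 mulrC; apply: hN => //.
    by rewrite /N -addnS leq_addr.
  have -> : N%:R - cesaro L N (GL_act b y) = \sum_(j < N) (1 - pr L j (GL_act b y)).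
    by rewrite sumrB sumr_const card_ord.
  apply: ler_sum => j _; rewrite lerBlDl.
  have := @mean_le_affine _ _ Q j (fun=> 1) (fun a => (L < rr a (GL_act b y))%R%:R)
    (fun a => (L < rr (a * b)%g x)%R%:R) 1 1 0.
  rewrite !mul1r addr0 {1}/mean Rint_cst; apply.
  - by apply: unitary_cst; rewrite ler01 lexx.
  - exact: unitary_rr.
  - exact: unitary_mulr (unitary_rr L x).
  move=> a; rewrite !mul1r addr0.
  have [//|ra] := ltP L (rr a (GL_act b y)); first by rewrite lerDl.
  rewrite add0r; suff -> : L < rr (a * b)%g x by [].
  rewrite ltNge; apply/negP => le; move: hb; apply/negP; rewrite -leNgt.
  apply: le_trans (hy a) _; apply: ler_pM => //; last by rewrite ler_pM2l.
    by rewrite mulr_ge0// (le_trans ler01)// rr_ge1.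
  by rewrite (le_trans ler01)// rr_ge1.
have h2 : (N%:R * (1 - e / 4)) * pr (2 * L * L) n x <=
    \sum_(j < N) mean n (fun b => mean j (fun a => (L < rr (a * b)%g x)%R%:R)).
  have um (j : 'I_N) : unitary (fun b : G => mean j (fun a => (L < rr (a * b)%g x)%R%:R : R)).
    apply: (@unitary_mean _ _ Q _ G j (fun b a => (L < rr (a * b)%g x)%R%:R : R)) => [|b].
      apply: mf_ind; apply: (mf_comp (f := fun a : G => rr a x)
        (g := fun z : G * G => (z.2 * z.1)%g)); first exact: mf_rr1.
      exact: (mf_comp (f := fun z : G * G => (z.1 * z.2)%g)
        (g := fun z : G * G => (z.2, z.1)) mf_mulGL (@measurable_swap _ _ G G)).
    exact: unitary_mulr (unitary_rr _ x).
  have [LS E] := Rint_sum_seq (index_enum 'I_N) (fun j => unitary_L1 Q n (um j)).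
  rewrite [leRHS](_ : _ = \sum_(j < N) \int[Q]_s
    (fun b => mean j (fun a => (L < rr (a * b)%g x)%R%:R : R)) (word n s))// -E -RintZ; last first.
    exact: unitary_L1 (unitary_rr _ x).
  apply: Rint_le => //; first exact: L1Z (unitary_L1 Q n (unitary_rr _ x)).
  by move=> s; rewrite mulrC; exact: h.
have h3 : \sum_(j < N) mean n (fun b => mean j (fun a => (L < rr (a * b)%g x)%R%:R)) =
    \sum_(j < N) pr L (n + j) x.
  by apply: eq_bigr => j _; rewrite /pr (mean_glue Q_cyl)//; exact: unitary_rr.
have h4 : \sum_(j < N) pr L (n + j) x <= e / 4 * (2 * N%:R).
  have -> : 2 * N%:R = (N + N)%:R :> R by rewrite natrD; ring.
  apply: le_trans (hN (N + N)%N x _ _) => //; last first.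
    exact: leq_trans (leq_addr n N0) (leq_trans (leqnSn _) (leq_addr _ _)).
  have p0 i : 0 <= pr L i x by exact: pr_ge0.
  rewrite /cesaro; apply: (@le_trans _ _ (\sum_(i < n + N) pr L i x)).
    by rewrite big_split_ord/= lerDr sumr_ge0.
  rewrite -!(big_mkord xpredT (fun i => pr L i x)).
  rewrite [leRHS](big_cat_nat (n := (n + N)%N))//=; last first.
    by rewrite leq_add2r /N ltnW// ltnS leq_addl.
  by rewrite lerDl sumr_ge0.
rewrite h3 in h2; have := le_trans h2 h4; rewrite mulrAC.
have -> : e / 4 * (2 * N%:R) = N%:R * (e / 2) by field.
rewrite -mulrA ler_pM2l// => h5.
have q0 := pr_ge0 (2 * L * L) n x.
move: (pr (2 * L * L) n x) q0 h5 => q q0 h5; nra.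
Qed.

End Tightness.

(** * Maximal inequality for the defect and contraction of angles in probability *)

Section AngleDecay.
Context {R : realType} {d : nat} (dot : {dot 'cV[R]_d.+1 for idfun}).
Local Notation G := (GL R d).
Local Notation X := (PV R d).
Local Notation rr := (rr dot).
Local Notation e2 := (e2 dot).
Local Notation ell := (ell dot).
Variables (mu : probability G R) (Q : probability (path G) R).
Hypothesis Q_cyl : iid_law mu Q.
Local Notation mean := (mean Q).
Local Notation pr := (pr dot Q).

Lemma mf_mulrGL (A : G) : mble (fun b : G => (b * A)%g).
Proof.
apply: (mf_comp (f := fun z : G * G => (z.1 * z.2)%g) (g := fun g : G => (g, A))).
  exact: mf_mulGL.
exact: mf_pair.
Qed.

Lemma mf_glue1 k (s : path G) : mble (glue k s).
Proof.
rewrite -[glue k s]/(fun s' => glue k s s').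
by apply: (mf_app2 (F := glue k)) => //; exact: mf_glue.
Qed.

(* The indicator of [exists i <= n, L < rr (word i s * A) x]. *)
Fixpoint hv (L : R) n (s : path G) (A : G) (x : X) : R :=
  if n is k.+1 then Num.max (hv L k s A x) ((L < rr (word n s * A)%g x)%R%:R)
  else (L < rr A x)%R%:R.

Lemma hv01 L n s A x : 0 <= hv L n s A x <= 1.
Proof.
elim: n => [|n /andP[h0 h1]] /=; first by case: (_ < _); rewrite lexx ler01.
by rewrite le_max h0/= ge_max h1/=; case: (_ < _); rewrite ?lexx ?ler01.
Qed.

Lemma hv_ge L n s A x i : (i <= n)%N -> (L < rr (word i s * A)%g x)%R%:R <= hv L n s A x.
Proof.
elim: n => [|n IH]; first by rewrite leqn0 => /eqP -> /=; rewrite mul1g.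
rewrite leq_eqVlt ltnS => /predU1P[->|/IH h] /=; first by rewrite le_max lexx orbT.
by rewrite le_max h.
Qed.

Lemma hv_eq0 L n s A x : hv L n s A x = 0 ->
  forall i, (i <= n)%N -> rr (word i s * A)%g x <= L.
Proof.
move=> h0 i i_n; have := hv_ge L s A x i_n; by rewrite h0; have [|//] := ltP L (rr (word i s * A)%g x); rewrite ler10.
Qed.

Lemma hv_bool L n s A x : hv L n s A x = 0 \/ hv L n s A x = 1.
Proof.
elim: n => [|n IH] /=; first by case: (_ < _); [right|left].
case: (_ < _); first by right; rewrite max_r//; have /andP[] := hv01 L n s A x.
by case: IH => ->; [left|right]; rewrite ?maxxx// max_l.
Qed.

Lemma hv_cons L n a s A x :
  hv L n.+1 (scons a s) A x = Num.max ((L < rr A x)%R%:R) (hv L n s (a * A)%g x).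
Proof.
elim: n => [|n IH]; first by rewrite /= !mulg1.
rewrite -[LHS]/(Num.max (hv L n.+1 (scons a s) A x) _) IH word_cons -maxA.
by rewrite /= mulgA.
Qed.

Lemma hv_glue L k n s s' A x : hv L n s' (word k s * A)%g x <= hv L (k + n) (glue k s s') A x.
Proof.
elim: n => [|n IH].
  by rewrite addn0 -(word_glue_le s s' (leqnn k)); exact: hv_ge.
rewrite addnS /= ge_max !le_max IH/=; apply/orP; right.
rewrite -[(_ * word _ (glue k s s'))%g]/(word (k + n).+1 (glue k s s')).
have -> : word (k + n).+1 (glue k s s') = (word n.+1 s' * word k s)%g.
  by rewrite -addnS word_glue.
by rewrite [(s' n * _ * (_ * A))%g]mulgA.
Qed.

Lemma mf_wordA n : mble (fun z : path G * G => (word n z.1 * z.2)%g).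
Proof.
apply: (mf_comp (f := fun z : G * G => (z.1 * z.2)%g)
  (g := fun z : path G * G => (word n z.1, z.2))); first exact: mf_mulGL.
apply: mf_pair; last exact: mf_snd.
exact: (mf_comp (mf_word n) mf_fst).
Qed.

Lemma mf_hv L n x : mble (fun z : path G * G => hv L n z.1 z.2 x).
Proof.
elim: n => [|n IH] /=.
  exact: (mf_ind (f := fun z : path G * G => rr z.2 x) L
    (mf_comp (mf_rr1 dot x) mf_snd)).
apply: measurable_maxr => //.
exact: (mf_ind (f := fun z : path G * G => rr (word n.+1 z.1 * z.2)%g x) L
  (mf_comp (mf_rr1 dot x) (mf_wordA n.+1))).
Qed.

Lemma L1_hv L n A x : L1 Q (fun s => hv L n s A x).
Proof.
apply: (L1_bounded 1) => [|s].
  exact: (mf_pair2 A (mf_hv L n x)).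
by exact: norm_bounds (hv01 L n s A x).
Qed.

Lemma unitary_mean_mulr n f : unitary f -> unitary (fun a : G => mean n (fun b => f (b * a)%g)).
Proof.
move=> uf; apply: (@unitary_mean _ _ Q _ G n (fun b a => f (a * b)%g)) => [|b]; last exact: unitary_mulr.
apply: (mf_comp (f := f) (g := fun z : G * G => (z.2 * z.1)%g)); first exact: uf.1.
exact: (mf_comp (f := fun z : G * G => (z.1 * z.2)%g)
  (g := fun z : G * G => (z.2, z.1)) mf_mulGL (@measurable_swap _ _ G G)).
Qed.

Lemma unitary_L1mu (f : G -> R) : unitary f -> L1 mu f.
Proof.
move=> [mf f01]; apply: (L1_bounded 1) => // a.
by exact: norm_bounds (f01 a).
Qed.

Lemma mean_S n f : unitary f -> mean n.+1 f = \int[mu]_a mean n (fun b => f (b * a)%g).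
Proof.
move=> uf; rewrite -add1n (mean_glue Q_cyl)// (mean1 Q_cyl)//.
exact: unitary_mean_mulr.
Qed.

Lemma pr_persist (L : R) n A x : 1 <= L -> (forall n x, pr L n x <= 2^-1) ->
  2 * L * L < rr A x -> 2^-1 <= mean n (fun b => (L < rr (b * A)%g x)%R%:R).
Proof.
move=> L1' hL hA; have [y hy] := rr_persist dot A x.
have L0 : 0 <= L by exact: le_trans L1'.
have := @mean_le_affine _ _ Q n (fun=> 1) (fun a => (L < rr a (GL_act A y))%R%:R)
    (fun a => (L < rr (a * A)%g x)%R%:R) 1 1 0.
have := hL n (GL_act A y); rewrite /pr [mean n (fun=> 1)]Rint_cst => h1 h2.
suff h3 : 1 <= 1 * mean n (fun a => (L < rr a (GL_act A y))%R%:R) +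
    1 * mean n (fun a => (L < rr (a * A)%g x)%R%:R) + 0.
  by move: (mean n _) (mean n _) h1 h3 => p q h1 h3; lra.
apply: h2.
- by apply: unitary_cst; rewrite ler01 lexx.
- exact: unitary_rr.
- exact: unitary_mulr (unitary_rr dot L x).
move=> a; rewrite !mul1r addr0.
have [//|ra] := ltP L (rr a (GL_act A y)); first by rewrite lerDl.
rewrite add0r; suff -> : L < rr (a * A)%g x by [].
rewrite ltNge; apply/negP => le; move: hA; apply/negP; rewrite -leNgt.
apply: le_trans (hy a) _; apply: ler_pM => //; last by rewrite ler_pM2l.
  by rewrite mulr_ge0// (le_trans ler01)// rr_ge1.
by rewrite (le_trans ler01)// rr_ge1.
Qed.

(** An inequality of Ottaviani type: once a defect beyond [2 * L * L] has occurred, a defect beyond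
    [L] is still present at time [n] with probability at least one half. The induction conditions on
    the first increment, which locates the first passage. *)
Lemma ottaviani (L : R) n A x : 1 <= L -> (forall n x, pr L n x <= 2^-1) ->
  \int[Q]_s hv (2 * L * L) n s A x <= 2 * mean n (fun b => (L < rr (b * A)%g x)%R%:R).
Proof.
move=> L1' hL.
have big m B : 2 * L * L < rr B x ->
    \int[Q]_s hv (2 * L * L) m s B x <= 2 * mean m (fun b => (L < rr (b * B)%g x)%R%:R).
  move=> hB; apply: (@le_trans _ _ 1).
    by apply: Rint_lec => [|s]; [exact: L1_hv|have /andP[] := hv01 (2 * L * L) m s B x].
  by rewrite mulrC -ler_pdivrMr// mul1r; exact: pr_persist.
have um B : unitary (fun b => (L < rr (b * B)%g x)%R%:R : R).
  exact: unitary_mulr (unitary_rr dot L x).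
elim: n A => [|n IH] A; have [hA|hA] := ltP (2 * L * L) (rr A x); try exact: big.
  apply: (@le_trans _ _ 0); last by rewrite mulr_ge0// mean_ge0.
  by apply: Rint_lec => [|s]; [exact: L1_hv|rewrite /= ltNge hA].
have mh : mble (fun s => hv (2 * L * L) n.+1 s A x).
  exact: L1_measurable (L1_hv _ _ _ _).
rewrite (Rint_cons_bounded Q_cyl (M := 1) mh); last first.
  by move=> s; exact: norm_bounds (hv01 (2 * L * L) n.+1 s A x).
rewrite mean_S// -RintZ; last first.
  exact: unitary_L1mu (unitary_mean_mulr n (um A)).
have mi : mble (fun a : G => \int[Q]_s hv (2 * L * L) n s (a * A)%g x).
  apply: (mf_Rint2 (f := fun z : G * path G => hv (2 * L * L) n z.2 (z.1 * A)%g x)).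
  apply: (mf_comp (f := fun z : path G * G => hv (2 * L * L) n z.1 z.2 x)
    (g := fun z : G * path G => (z.2, (z.1 * A)%g))); first exact: mf_hv.
  apply: mf_pair; first exact: mf_snd.
  apply: (mf_comp (f := fun a : G => (a * A)%g)); last exact: mf_fst.
  exact: mf_mulrGL.
have eq a : \int[Q]_s hv (2 * L * L) n.+1 (scons a s) A x =
    \int[Q]_s hv (2 * L * L) n s (a * A)%g x.
  apply: eq_Rint => s; rewrite hv_cons ltNge hA/= max_r//.
  by have /andP[] := hv01 (2 * L * L) n s (a * A)%g x.
under eq_Rint do rewrite eq.
apply: Rint_le => [||a].
- apply: (L1_bounded 1) => // a; rewrite ger0_norm.
    by apply: Rint_lec => [|s]; [exact: L1_hv|have /andP[] := hv01 (2 * L * L) n s (a * A)%g x].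
  by apply: Rint_ge0 => s; have /andP[] := hv01 (2 * L * L) n s (a * A)%g x.
- apply: L1Z; exact: unitary_L1mu (unitary_mean_mulr n (um A)).
apply: le_trans (IH (a * A)%g) _; rewrite ler_pM2l//; apply: mean_le => //.
  exact: unitary_mulr (um A).
by move=> b; rewrite mulgA.
Qed.

Section Decay.
Variables (eta e L L' : R) (x : X) (n0 : nat) (eta' : R).
Hypotheses (e0 : 0 <= e) (L0 : 0 <= L) (L'0 : 0 <= L') (hL : forall n x, pr L n x <= e)
  (hg : forall x, good2 dot Q eta' n0 x)
  (heta : L ^+ 2 * (eta' * L' ^+ 2) <= eta).

Let q n (s : path G) (A : G) : R :=
  (eta < e2 (word n s * A)%g x)%R%:R * (1 - hv L' n s A x).

Let q01 n s A : 0 <= q n s A <= 1.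
Proof.
have /andP[h0 h1] := hv01 L' n s A x; rewrite /q; case: (_ < _); rewrite ?mul0r ?lexx ?ler01//.
by rewrite mul1r subr_ge0 h1/= gerBl.
Qed.

Let mq n : mble2 (q n).
Proof.
apply: mfM; last by apply: mfB => //; exact: mf_hv.
exact: (mf_ind (f := fun z : path G * G => e2 (word n z.1 * z.2)%g x) eta
  (mf_comp (mf_e2_1 dot x) (mf_wordA n))).
Qed.

Let mq1 n A : mble (fun s => q n s A).
Proof. exact: (mf_pair2 A (mq n)). Qed.

Let Lq n A : L1 Q (fun s => q n s A).
Proof.
apply: (L1_bounded 1) => // s; exact: norm_bounds (q01 n s A).
Qed.

Let q_glue k n s s' A : q (k + n) (glue k s s') A <= q n s' (word k s * A)%g.
Proof.
rewrite /q word_glue -mulgA; apply: ler_wpM2l; first by case: (_ < _).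
by rewrite lerD2l lerN2 hv_glue.
Qed.

(** Each stretch of at most [n0] steps contracts by [eta'] with probability at least [1 / (n0 + 1)].
    After a contraction, [heta] keeps [e2] below [eta] provided that the defect is at most [L']
    before it, as [q] requires, and at most [L] after it, which fails with probability at most
    [e]. *)
Lemma late_decay J n A : (J * n0 <= n)%N -> \int[Q]_s q n s A <= e + (1 - n0.+1%:R^-1) ^+ J.
Proof.
set c := n0.+1%:R^-1; have c0 : 0 <= c by rewrite invr_ge0.
have c1 : c <= 1 by rewrite invf_le1 ?ltr0Sn// ler1n.
elim: J n A => [|J IH] n A hn.
  by apply: (@le_trans _ _ 1); [apply: Rint_lec => // s; have /andP[] := q01 n s A|
    rewrite expr0 lerDr].
have pJ : 0 <= (1 - c) ^+ J by rewrite exprn_ge0// subr_ge0.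
have [hA|hA] := ltP L' (rr A x).
  apply: (@le_trans _ _ 0); last by rewrite addr_ge0// exprn_ge0// subr_ge0.
  apply: Rint_lec => // s; rewrite /q.
  have := hv_ge L' s A x (leq0n n); rewrite /= mul1g hA => h1.
  by rewrite mulr_ge0_le0 ?subr_le0//; case: (_ < _).
have [k [B [kn mB hB eB]]] := hg (GL_act A x).
have En : n = (k + (n - k))%N.
  by rewrite subnKC//; apply: leq_trans kn (leq_trans _ hn); rewrite mulSn leq_addr.
have hn' : (J * n0 <= n - k)%N.
  rewrite leq_subRL; last by rewrite En leq_addr.
  by apply: leq_trans hn; rewrite mulSn leq_add2r.
rewrite [n in q n]En (Rint_glue_bounded Q_cyl k (M := 1) (mq1 _ A)); last first.
  by move=> s; exact: norm_bounds (q01 (k + (n - k)) s A).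
have u1 := unitary_L1 Q k (unitary_indic mB).
have Lb : L1 Q (fun s => - ((1 - c) ^+ J) * \1_B (word k s) + (e + (1 - c) ^+ J)).
  by apply: L1D; [exact: L1Z|exact: L1_cst].
apply: (@le_trans _ _ (\int[Q]_s (- ((1 - c) ^+ J) * \1_B (word k s) + (e + (1 - c) ^+ J)))).
  apply: Rint_le => // [|s].
    apply: (L1_bounded 1) => [|s].
      apply: (mf_Rint2 (f := fun z : path G * path G => q (k + (n - k)) (glue k z.1 z.2) A)).
      apply: (mf_comp (f := fun s => q (k + (n - k)) s A)
        (g := fun z : path G * path G => glue k z.1 z.2)); [exact: mq1|exact: mf_glue].
    have Lg : L1 Q (fun s' => q (k + (n - k)) (glue k s s') A).
      apply: (L1_bounded 1) => [|s'].
        apply: (mf_comp (f := fun s => q (k + (n - k)) s A) (g := fun s' => glue k s s')).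
          exact: mq1.
        exact: mf_glue1.
      by exact: norm_bounds (q01 (k + (n - k)) (glue k s s') A).
    rewrite ger0_norm; first by apply: Rint_lec => // s'; have /andP[] := q01 (k + (n - k)) (glue k s s') A.
    by apply: Rint_ge0 => s'; have /andP[] := q01 (k + (n - k)) (glue k s s') A.
  apply: (@le_trans _ _ (\int[Q]_s' q (n - k) s' (word k s * A)%g)).
    apply: Rint_le => [||s']; [|exact: Lq|exact: q_glue].
    apply: (L1_bounded 1) => [|s'].
      apply: (mf_comp (f := fun s => q (k + (n - k)) s A) (g := fun s' => glue k s s')).
        exact: mq1.
      exact: mf_glue1.
    by exact: norm_bounds (q01 (k + (n - k)) (glue k s s') A).
  have [Bs|nB] := pselect (B (word k s)); last first.
    by rewrite indicE memNset// mulr0 add0r; exact: IH.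
  rewrite indicE mem_set// mulr1 addrC addrK; set b := word k s.
  apply: le_trans (hL (n - k) (GL_act (b * A)%g x)); rewrite /pr /mean.
  apply: Rint_le => // [|s']; first exact: unitary_L1 (unitary_rr dot L _).
  have /andP[h0 h1] := hv01 L' (n - k) s' (b * A)%g x.
  rewrite /q; have [he|_] := ltP eta (e2 _ _); last by rewrite mul0r; case: (_ < _).
  suff -> : L < rr (word (n - k) s') (GL_act (b * A)%g x) by rewrite mul1r gerBl.
  rewrite ltNge; apply/negP => hr; move: he; apply/negP; rewrite -leNgt; apply: le_trans heta.
  apply: le_trans (e2M _ _ _ _) _; apply: ler_pM; rewrite ?e2_ge0//.
    apply: le_trans (e2_rr _ _ _) _; rewrite ler_pXn2r ?nnegrE//.
    by rewrite (le_trans ler01)// rr_ge1.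
  apply: le_trans (e2M _ _ _ _) _; apply: ler_pM; rewrite ?e2_ge0// ?eB//.
  apply: le_trans (e2_rr _ _ _) _; rewrite ler_pXn2r ?nnegrE//.
  by rewrite (le_trans ler01)// rr_ge1.
rewrite RintD ?RintZ ?Rint_cst//; [|exact: L1Z|exact: L1_cst].
rewrite addrC -addrA lerD2l exprS -[X in _ <= (_ - _) * X]/((1 - c) ^+ J) mulrBl mul1r.
by rewrite lerD2l mulNr lerN2 [leLHS]mulrC; apply: ler_wpM2l.
Qed.

End Decay.

(** Of the total [4 * e], one half comes from [late_decay] and one half from [ottaviani]. *)
Lemma e2_decay (e eta : R) : (forall e : R, 0 < e -> e <= 2^-1 -> exists2 L : R, 1 <= L &
  forall n x, pr L n x <= e) -> (forall eta : R, 0 < eta -> exists n, forall x, good2 dot Q eta n x) ->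
  0 < e -> e <= 2^-1 -> 0 < eta ->
  exists n0, forall n x, (n0 <= n)%N -> mean n (fun a => (eta < e2 a x)%R%:R) <= 4 * e.
Proof.
move=> tight good e0 e1 eta0.
have [L L1' hL] := tight e e0 e1; have L0 : 0 < L by exact: lt_le_trans L1'.
set L' := 2 * L * L; have L'0 : 0 < L' by rewrite !mulr_gt0.
pose eta' := eta / (L ^+ 2 * L' ^+ 2).
have p0 : 0 < eta' by rewrite divr_gt0// mulr_gt0// exprn_gt0.
have [n0 hg] := good eta' p0.
have heta : L ^+ 2 * (eta' * L' ^+ 2) <= eta.
  apply: le_of_eq; rewrite /eta'; field.
  by rewrite !gt_eqF.
have [J hJ] : exists J, (1 - n0.+1%:R^-1 : R) ^+ J <= e.
  have c0 : 0 < n0.+1%:R^-1 :> R by rewrite invr_gt0 ltr0Sn.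
  have q0 : 0 <= 1 - n0.+1%:R^-1 :> R by rewrite subr_ge0 invf_le1 ?ltr0Sn// ler1n.
  have q1 : 1 - n0.+1%:R^-1 < 1 :> R by rewrite ltrBlDr ltrDl.
  exact: small_power_ex.
exists (J * n0)%N => n x hn.
have h1 := late_decay x (ltW e0) (ltW L0) (ltW L'0) hL hg heta 1%g hn.
have h2 := ottaviani n 1%g x L1' (fun n x => le_trans (hL n x) e1).
have h3 : mean n (fun b => (L < rr (b * 1)%g x)%R%:R) <= e.
  by under [X in mean n X]eq_fun do rewrite mulg1; exact: hL.
have Lh := L1_hv L' n 1%g x.
have Le : L1 Q (fun s => (eta < e2 (word n s) x)%R%:R : R).
  exact: unitary_L1 (unitary_ind eta (mf_e2_1 dot x)).
have Lq : L1 Q (fun s => (eta < e2 (word n s * 1)%g x)%R%:R * (1 - hv L' n s 1%g x)).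
  apply: (L1_bounded 1) => [|s].
    apply: mfM; last by apply: mfB => //; exact: L1_measurable Lh.
    by under eq_fun do rewrite mulg1; exact: L1_measurable Le.
  have /andP[a0 a1] := hv01 L' n s 1%g x.
  by case: (_ < _); rewrite ?mul0r ?normr0// mul1r ger0_norm ?subr_ge0// gerBl.
have h4 : mean n (fun a => (eta < e2 a x)%R%:R) <=
    \int[Q]_s ((eta < e2 (word n s * 1)%g x)%R%:R * (1 - hv L' n s 1%g x)) +
    \int[Q]_s hv L' n s 1%g x.
  rewrite -RintD//; apply: Rint_le => // [|s]; first exact: L1D.
  rewrite mulg1; have /andP[a0 a1] := hv01 L' n s 1%g x.
  by case: (_ < _); rewrite ?mul0r ?add0r// mul1r subrK.
apply: le_trans h4 _; apply: le_trans (lerD h1 h2) _; lra.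
Qed.

End AngleDecay.

Lemma L1_pullback {d d'} {T : measurableType d} {T' : measurableType d'}
    {R : realType} (P : probability T R) (Q : probability T' R) (phi : T -> T') (f : T' -> R) :
    mble phi -> (forall B, measurable B -> Q B = P (phi @^-1` B)) ->
  L1 Q f -> L1 P (fun x => f (phi x)).
Proof.
move=> mphi E Lf; have mf := L1_measurable Lf; move: Lf => /integrableP[_ lt].
apply/integrableP; split; first by apply/mf_EFin; exact: mf_comp.
have -> : (\int[P]_x `|(EFin \o (fun x => f (phi x))) x| = \int[Q]_x `|(EFin \o f) x|)%E => //.
transitivity (\int[pushforward P phi]_x `|(EFin \o f) x|)%E; last first.
  by apply: eq_measure_integral => B mB _; exact: esym (E B mB).
rewrite ge0_integral_pushforward ?preimage_setT//.
by apply: mf_comp => //; exact/mf_EFin.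
Qed.

Lemma le_scaled_max {R : realFieldType} (f : nat -> R) m : (0 < m)%N ->
  exists2 i, (i < m)%N & \sum_(j < m) f j <= m%:R * f i.
Proof.
move=> m0; apply: contrapT => no.
have h (i : 'I_m) : m%:R * f i < \sum_(j < m) f j.
  by rewrite ltNge; apply/negP => le; apply: no; exists i.
have : \sum_(i < m) m%:R * f i < \sum_(i < m) \sum_(j < m) f j.
  by apply: ltr_sum => //; apply/hasP; exists (Ordinal m0); rewrite ?mem_index_enum.
by rewrite -mulr_sumr sumr_const card_ord -[X in _ < X]mulr_natl ltxx.
Qed.

(** [p], [q], [u], [v] stand for indicators of exceptional events; as soon as one occurs, the added
    term is non-positive and nothing has to be gained. *)
Lemma record_cancel {R : realFieldType} (p q u v D m M : R) : D + m <= M -> 0 <= p -> 0 <= q ->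
  0 <= u -> 0 <= v -> 1 <= p + q + u + v -> D + m + (1 - p - q - u - v) <= M.
Proof. lra. Qed.

Lemma record_cancel0 {R : realFieldType} (D m a b M : R) : D <= a -> m <= b -> a + b <= - 1 ->
  0 <= M -> D + m + (1 - 0 - 0 - 0 - 0) <= M.
Proof. lra. Qed.

Lemma hit_bound {R : realFieldType} (p q S st l m An : R) : 0 <= l -> m <= 4 * st ->
  p = 0 \/ p = 1 -> q = 0 \/ q = 1 -> p * st <= An * p + S -> q * st <= An * q + S ->
  0 <= S -> 0 <= An -> (p = 0 -> q = 0 -> m <= 2 * l) ->
  m <= 2 * l + 4 * An * p + 4 * An * q + 8 * S.
Proof.
move=> l0 h1 [->|->] [->|->] h2 h3 h4 h5 h6.
- by have := h6 erefl erefl; lra.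
- lra.
- lra.
- lra.
Qed.

(** * Records of the logarithm of the angle and its negative drift *)

Section Records.
Context {R : realType} {d : nat} (dot : {dot 'cV[R]_d.+1 for idfun}).
Local Notation G := (GL R d).
Local Notation X := (PV R d).
Local Notation rr := (rr dot).
Local Notation e2 := (e2 dot).
Local Notation ell := (ell dot).
Local Notation sd := (sd dot).
Local Notation hv := (hv dot).
Variables (mu : probability G R) (Q : probability (path G) R).
Hypotheses (Q_cyl : iid_law mu Q)
  (L1_ell : L1 mu ell).
Local Notation mean := (mean Q).
Local Notation pr := (pr dot Q).

(** A cocycle on pairs of lines ([DlM]), equal to 0 on the diagonal since both logarithms then take
    the same default value. *)
Definition Dl (g : G) (x y : X) : R := ln (sd (GL_act g x) (GL_act g y)) - ln (sd x y).

Lemma sd_gt0 x y : x != y -> 0 < sd x y.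
Proof.
move=> xy; rewrite lt_neqAle sd_ge0 andbT eq_sym; apply: contra xy => /eqP/sd_eq0 ->.
exact: eqxx.
Qed.

Lemma act_neq (g : G) x y : x != y -> GL_act g x != GL_act g y.
Proof.
apply: contra => /eqP E; apply/eqP.
by rewrite -(act1 x) -(act1 y) -(mulVg g) !actM E.
Qed.

Lemma DlM g h x y : Dl (g * h)%g x y = Dl g (GL_act h x) (GL_act h y) + Dl h x y.
Proof. by rewrite /Dl !actM addrA subrK. Qed.

Lemma Dl1 x y : Dl 1%g x y = 0. Proof. by rewrite /Dl !act1 subrr. Qed.

Lemma Dl_le g x y (c : R) : x != y -> 0 < c -> sd (GL_act g x) (GL_act g y) <= c * sd x y ->
  Dl g x y <= ln c.
Proof.
move=> xy c0 h; have s0 := sd_gt0 xy; have s1 := sd_gt0 (act_neq g xy).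
by rewrite lerBlDr -lnM ?posrE// ler_ln// ?posrE// mulr_gt0.
Qed.

Lemma Dl_rr g x y (L : R) : x != y -> 0 < L -> rr g x <= L -> rr g y <= L -> Dl g x y <= 2 * ln L.
Proof.
move=> xy L0 hx hy; have -> : 2 * ln L = ln (L * L) by rewrite lnM ?posrE//; ring.
apply: Dl_le => //; first exact: mulr_gt0.
apply: le_trans (sd_act_rr _ _ _ _) _; apply: ler_wpM2r; first exact: sd_ge0.
by apply: ler_pM => //; rewrite (le_trans ler01)// rr_ge1.
Qed.

Lemma Dl_e2 g x y (eta : R) : x != y -> 0 < eta -> e2 g x <= eta -> e2 g y <= eta ->
  Dl g x y <= ln eta.
Proof. by move=> xy eta0 hx hy; apply: Dl_le => //; apply: sd_act_e2 => //; exact: ltW. Qed.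

Lemma Dl_ell g x y : `|Dl g x y| <= 4 * ell g.
Proof.
have [->|xy] := eqVneq x y; first by rewrite /Dl !sd_xx subrr normr0 mulr_ge0// ell_ge0.
have E : 4 * ell g = ln (nm dot g ^+ 4) by rewrite lnXn ?nm_gt0// -[RHS]mulr_natl.
have n0 : 0 < nm dot g ^+ 4 by rewrite exprn_gt0// nm_gt0.
rewrite ler_norml E Dl_le ?sd_act_nm// andbT.
have s0 := sd_gt0 xy; have s1 := sd_gt0 (act_neq g xy).
rewrite /Dl lerNl opprB lerBlDr -lnM ?posrE//.
by rewrite ler_ln ?posrE; [exact: sd_act_ge|exact: s0|exact: mulr_gt0].
Qed.

(** The record, up to time [n], of the logarithm of the angle relative to its initial value. *)
Fixpoint mx n (s : path G) (x y : X) : R :=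
  if n is k.+1 then Num.max (mx k s x y) (Dl (word n s) x y) else 0.

Lemma mx_ge0 n s x y : 0 <= mx n s x y.
Proof. by elim: n => //= n IH; rewrite le_max IH. Qed.

Lemma mx_ge n s x y i : (i <= n)%N -> Dl (word i s) x y <= mx n s x y.
Proof.
elim: n => [|n IH]; first by rewrite leqn0 => /eqP -> /=; rewrite Dl1.
rewrite leq_eqVlt ltnS => /predU1P[->|/IH h] /=; first by rewrite le_max lexx orbT.
by rewrite le_max h.
Qed.

Lemma mx_le n s x y (c : R) : 0 <= c -> (forall i, (i <= n)%N -> Dl (word i s) x y <= c) ->
  mx n s x y <= c.
Proof.
move=> c0; elim: n => [//|n IH] h; rewrite -[mx _ _ _ _]/(Num.max _ _) ge_max.
apply/andP; split; last exact: h.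
by apply: IH => i i_n; apply: h; exact: ltnW.
Qed.

Lemma mx_glue k n s s' x y :
  Dl (word k s) x y + mx n s' (GL_act (word k s) x) (GL_act (word k s) y) <=
    mx (k + n) (glue k s s') x y.
Proof.
elim: n => [|n IH].
  by rewrite addr0 addn0 -(word_glue_le s s' (leqnn k)) mx_ge.
have E : word (k + n).+1 (glue k s s') = (word n.+1 s' * word k s)%g.
  by rewrite -addnS word_glue.
rewrite addnS -[leRHS]/(Num.max (mx (k + n) (glue k s s') x y)
  (Dl (word (k + n).+1 (glue k s s')) x y)) E DlM.
have := IH; rewrite /= [Num.max (mx n _ _ _) _]maxEle; case: ifP => _ h; rewrite le_max.
  by rewrite addrC lexx orbT.
by rewrite h.
Qed.

Definition steps n (s : path G) : R := \sum_(i < n) ell (s i).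

Lemma steps_ge0 n s : 0 <= steps n s.
Proof. by apply: sumr_ge0 => i _; exact: ell_ge0. Qed.

Lemma steps_glue k n s s' : steps (k + n) (glue k s s') = steps k s + steps n s'.
Proof.
rewrite /steps big_split_ord/=; congr (_ + _); apply: eq_bigr => i _.
  by rewrite /glue ltn_ord.
by rewrite /glue ltnNge leq_addr/= addKn.
Qed.

Lemma le_steps n m s : (n <= m)%N -> steps n s <= steps m s.
Proof.
move=> nm; rewrite /steps -!(big_mkord xpredT (fun i => ell (s i))).
by rewrite (big_cat_nat (n := n) (p := m))//= lerDl sumr_ge0// => i _; exact: ell_ge0.
Qed.

Lemma Dl_steps n s x y : `|Dl (word n s) x y| <= 4 * steps n s.
Proof. by apply: le_trans (Dl_ell _ _ _) _; rewrite ler_pM2l//; exact: ell_word. Qed.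

Lemma mx_steps n s x y : `|mx n s x y| <= 4 * steps n s.
Proof.
rewrite ger0_norm ?mx_ge0//; apply: mx_le => [|i i_n]; first by rewrite mulr_ge0// steps_ge0.
apply: le_trans (ler_norm _) _; apply: le_trans (Dl_steps _ _ _ _) _.
by rewrite ler_pM2l// le_steps.
Qed.

Lemma mf_Dl : mble (fun w : G * (X * X) => Dl w.1 w.2.1 w.2.2).
Proof.
have m1 : mble (fun w : G * (X * X) => GL_act w.1 w.2.1).
  apply: (mf_app2 (F := GL_act)); [exact: mf_GL_act|exact: mf_fst|].
  exact: (mf_comp mf_fst mf_snd).
have m2 : mble (fun w : G * (X * X) => GL_act w.1 w.2.2).
  apply: (mf_app2 (F := GL_act)); [exact: mf_GL_act|exact: mf_fst|].
  exact: (mf_comp mf_snd mf_snd).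
apply: mfB; apply: (mf_comp (@measurable_ln R)).
  exact: (mf_comp (f := fun z : X * X => sd z.1 z.2)
    (g := fun w : G * (X * X) => (GL_act w.1 w.2.1, GL_act w.1 w.2.2))
    (mf_sd dot) (mf_pair m1 m2)).
exact: (mf_comp (f := fun z : X * X => sd z.1 z.2) (mf_sd dot) mf_snd).
Qed.

Lemma mf_Dlw n :
  mble (fun w : path G * (X * X) => Dl (word n w.1) w.2.1 w.2.2).
Proof.
apply: (mf_comp (f := fun w : G * (X * X) => Dl w.1 w.2.1 w.2.2)
  (g := fun w : path G * (X * X) => (word n w.1, w.2))); first exact: mf_Dl.
apply: mf_pair; last exact: mf_snd.
exact: (mf_comp (mf_word n) mf_fst).
Qed.

Lemma mf_mx n : mble (fun w : path G * (X * X) => mx n w.1 w.2.1 w.2.2).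
Proof.
elim: n => [|n IH]; first exact: measurable_cst.
exact: (measurable_maxr IH (mf_Dlw n.+1)).
Qed.

Lemma mf_mx1 n x y : mble (fun s => mx n s x y).
Proof.
exact: (mf_pair2 (f := fun w : path G * (X * X) => mx n w.1 w.2.1 w.2.2) (x, y)
  (mf_mx n)).
Qed.

Lemma mf_Dlw1 n x y : mble (fun s => Dl (word n s) x y).
Proof.
exact: (mf_pair2 (f := fun w : path G * (X * X) => Dl (word n w.1) w.2.1 w.2.2) (x, y)
  (mf_Dlw n)).
Qed.

Lemma L1_steps n : L1 Q (steps n).
Proof. exact: (L1_sum_ell Q_cyl L1_ell). Qed.

Lemma L1_dominated n (f : path G -> R) (c : R) : mble f ->
  (forall s, `|f s| <= c * steps n s) -> L1 Q f.
Proof. by move=> mf h; apply: L1_le (L1Z c (L1_steps n)) _. Qed.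

Lemma L1_mx n x y : L1 Q (fun s => mx n s x y).
Proof. exact: L1_dominated (mf_mx1 n x y) (fun s => mx_steps n s x y). Qed.

Lemma L1_Dlw n x y : L1 Q (fun s => Dl (word n s) x y).
Proof. exact: L1_dominated (mf_Dlw1 n x y) (fun s => Dl_steps n s x y). Qed.

Lemma glue_dominated k n (f : path G -> R) : mble f ->
  (forall s, `|f s| <= 4 * steps (k + n) s) ->
  [/\ \int[Q]_s f s = \int[Q]_s \int[Q]_s' f (glue k s s'),
      forall s, L1 Q (fun s' => f (glue k s s')) &
      L1 Q (fun s => \int[Q]_s' f (glue k s s'))].
Proof.
move=> mf h; have Lf := L1_dominated mf h.
have mfg : mble (fun z : path G * path G => f (glue k z.1 z.2)).
  exact: (mf_comp (f := f) (g := fun z : path G * path G => glue k z.1 z.2) mf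
    (mf_glue k)).
have Ls s : L1 Q (fun s' => f (glue k s s')).
  apply: (L1_le (g := fun s' => 4 * (steps k s + steps n s'))) => [||s'].
  - exact: (mf_pair1 s mfg).
  - by apply: L1Z; apply: L1D; [exact: L1_cst|exact: L1_steps].
  - by rewrite -steps_glue.
have Lp : L1 (prodP Q Q) (fun z => f (glue k z.1 z.2)).
  exact: (L1_pullback (phi := fun z : path G * path G => glue k z.1 z.2) (mf_glue k)
    (fun B => @Q_glue _ _ _ _ _ Q_cyl k B) Lf).
split=> //.
  by rewrite (Rint_glue Q_cyl k)// Rint_prod12.
apply: (L1_le (g := fun s => 4 * (steps k s + \int[Q]_s' steps n s'))) => [||s].
- exact: (mf_Rint2 (f := fun z : path G * path G => f (glue k z.1 z.2))).
- by apply: L1Z; apply: L1D; [exact: L1_steps|exact: L1_cst].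
- apply: le_trans (Rint_norm (Ls s)) _.
  rewrite -[X in 4 * (X + _)](Rint_cst Q) -RintD; [|exact: L1_cst|exact: L1_steps].
  rewrite -RintZ; last by apply: L1D; [exact: L1_cst|exact: L1_steps].
  apply: Rint_le => [||s'].
  + exact: L1_norm.
  + by apply: L1Z; apply: L1D; [exact: L1_cst|exact: L1_steps].
  + by rewrite -steps_glue.
Qed.

Definition Emx n x y : R := \int[Q]_s mx n s x y.
Definition EDl n x y : R := \int[Q]_s Dl (word n s) x y.

Lemma EDl_glue k n x y :
  L1 Q (fun s => EDl n (GL_act (word k s) x) (GL_act (word k s) y)) /\
  EDl (k + n) x y =
    EDl k x y + \int[Q]_s EDl n (GL_act (word k s) x) (GL_act (word k s) y).
Proof.
have [E Ls Lo] := glue_dominated (mf_Dlw1 (k + n) x y) (fun s => Dl_steps (k + n) s x y).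
have eq s : \int[Q]_s' Dl (word (k + n) (glue k s s')) x y =
    EDl n (GL_act (word k s) x) (GL_act (word k s) y) + Dl (word k s) x y.
  rewrite /EDl -[X in _ + X](Rint_cst Q) -RintD; [|exact: L1_Dlw|exact: L1_cst].
  by apply: eq_Rint => s'; rewrite word_glue DlM.
have L2 : L1 Q (fun s => EDl n (GL_act (word k s) x) (GL_act (word k s) y)).
  have := L1B Lo (L1_Dlw k x y).
  by under eq_fun do rewrite eq addrK.
split=> //; rewrite /EDl E; under eq_Rint do rewrite eq.
rewrite RintD//; last exact: L1_Dlw.
by rewrite addrC.
Qed.

Section RecordStep.
Variables (L eta : R) (k : nat).
Hypotheses (L1' : 1 <= L) (hL : forall n x, \int[Q]_s hv L n s 1%g x <= 8^-1)
  (eta0 : 0 < eta) (heta : ln eta + 2 * ln L <= - 1)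
  (hk : forall x, mean k (fun a => (eta < e2 a x)%R%:R) <= 8^-1).

(** The record over [k + n] steps is at least both 0 and [Dl] over [k] steps plus the record of the
    restarted walk. Four exceptional events, of probability at most [1 / 8] each, are set aside;
    otherwise the second quantity is at most [- 1], and 0 exceeds it by 1. The mean gain is
    therefore at least one half. *)
Lemma record_step n x y : x != y ->
  EDl k x y + \int[Q]_s Emx n (GL_act (word k s) x) (GL_act (word k s) y) + 2^-1 <=
    Emx (k + n) x y /\
  L1 Q (fun s => Emx n (GL_act (word k s) x) (GL_act (word k s) y)).
Proof.
move=> xy; have L0 : 0 < L by exact: lt_le_trans L1'.
have [E Ls Lo] := glue_dominated (mf_mx1 (k + n) x y) (fun s => mx_steps (k + n) s x y).
have LE : L1 Q (fun s => Emx n (GL_act (word k s) x) (GL_act (word k s) y)).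
  apply: (L1_le (g := fun=> 4 * \int[Q]_s' steps n s')) => [||s].
  - apply: (mf_Rint2 (f := fun z : path G * path G =>
      mx n z.2 (GL_act (word k z.1) x) (GL_act (word k z.1) y))).
    apply: (mf_comp (f := fun w : path G * (X * X) => mx n w.1 w.2.1 w.2.2)
      (g := fun z : path G * path G => (z.2, (GL_act (word k z.1) x, GL_act (word k z.1) y)))).
      exact: mf_mx.
    apply: mf_pair; first exact: mf_snd.
    have ma z : mble (fun w : path G * path G => GL_act (word k w.1) z).
      apply: (mf_app2 (F := GL_act)); [exact: mf_GL_act| |exact: measurable_cst].
      exact: (mf_comp (mf_word k) mf_fst).
    by apply: mf_pair; exact: ma.
  - exact: L1_cst.
  - apply: le_trans (Rint_norm (L1_mx _ _ _)) _; rewrite -RintZ; last exact: L1_steps.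
    apply: Rint_le => [||s']; [exact: L1_norm (L1_mx _ _ _)|exact: L1Z (L1_steps n)|].
    exact: mx_steps.
split=> //; rewrite {2}/Emx E.
pose a s x := (eta < e2 (word k s) x)%R%:R : R.
have La z : L1 Q (a ^~ z) by exact: unitary_L1 (unitary_ind eta (mf_e2_1 dot z)).
have Lsum : L1 Q (fun s => Dl (word k s) x y +
    Emx n (GL_act (word k s) x) (GL_act (word k s) y) + (3 / 4 - a s x - a s y)).
  apply: L1D; first exact: L1D (L1_Dlw _ _ _) LE.
  by apply: L1B => //; apply: L1B => //; exact: L1_cst.
apply: (@le_trans _ _ (\int[Q]_s (Dl (word k s) x y +
    Emx n (GL_act (word k s) x) (GL_act (word k s) y) + (3 / 4 - a s x - a s y)))).
  have La2 : L1 Q (fun s => 3 / 4 - a s x - a s y).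
    by apply: L1B => //; apply: L1B => //; exact: L1_cst.
  have La1 : L1 Q (fun s => 3 / 4 - a s x) by apply: L1B => //; exact: L1_cst.
  rewrite RintD//; last exact: L1D (L1_Dlw _ _ _) LE.
  rewrite RintD//; last exact: L1_Dlw.
  rewrite (RintB La1 (La y)) (RintB (L1_cst Q _) (La x)) Rint_cst.
  have := hk x; have := hk y.
  rewrite /mean /EDl /a.
  move: (\int[Q]_s _) (\int[Q]_s _) (\int[Q]_s _) (\int[Q]_s _) => u v w z; lra.
apply: Rint_le => // s; set x' := GL_act (word k s) x; set y' := GL_act (word k s) y.
have Lh z : L1 Q (fun s' => hv L n s' 1%g z) by exact: L1_hv.
have Lm := L1_mx n x' y'.
have Lin : L1 Q (fun s' => Dl (word k s) x y + mx n s' x' y' +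
    (1 - a s x - a s y - hv L n s' 1%g x' - hv L n s' 1%g y')).
  apply: L1D; first by apply: L1D => //; exact: L1_cst.
  by apply: L1B => //; apply: L1B => //; exact: L1_cst.
apply: (@le_trans _ _ (\int[Q]_s' (Dl (word k s) x y + mx n s' x' y' +
    (1 - a s x - a s y - hv L n s' 1%g x' - hv L n s' 1%g y')))).
  have Lc (c : R) : L1 Q (fun=> c) by exact: L1_cst.
  have L2 := L1B (Lc (1 - a s x - a s y)) (Lh x').
  rewrite RintD; [|by apply: L1D|exact: L1B].
  rewrite (RintD (Lc _) Lm) (RintB L2 (Lh y')) (RintB (Lc _) (Lh x')) !Rint_cst.
  have := hL n x'; have := hL n y'; rewrite /Emx.
  move: (\int[Q]_s' hv L n s' 1%g x') (\int[Q]_s' hv L n s' 1%g y') => u v hu hv.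
  move: (\int[Q]_s' mx n s' x' y') (Dl _ _ _) (a s x) (a s y) => m D p q; lra.
apply: Rint_le => // s'; rewrite -/x' -/y'.
have M0 := mx_ge0 (k + n) (glue k s s') x y.
have G1 := mx_glue k n s s' x y; rewrite -/x' -/y' in G1.
have a01 z : a s z = 1 \/ a s z = 0 /\ e2 (word k s) z <= eta.
  by rewrite /a; case: ltP => h; [left|right].
have a0 z : 0 <= a s z by case: (a01 z) => [->|[-> _]] //; exact: ler01.
have /andP[hx0 _] := hv01 dot L n s' 1%g x'; have /andP[hy0 _] := hv01 dot L n s' 1%g y'.
have [ax|[ax ex]] := a01 x; rewrite ax.
  apply: record_cancel; rewrite ?ler01//.
  by rewrite -!addrA lerDl; apply: addr_ge0 => //; exact: addr_ge0.
have [ay|[ay ey]] := a01 y; rewrite ay.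
  apply: record_cancel; rewrite ?lexx ?ler01// add0r -addrA lerDl; exact: addr_ge0.
have [hx|hx] := hv_bool dot L n s' 1%g x'; rewrite hx; last first.
  by apply: record_cancel; rewrite ?lexx ?ler01// !add0r lerDl.
have [hy|hy] := hv_bool dot L n s' 1%g y'; rewrite hy; last first.
  by apply: record_cancel; rewrite ?lexx ?ler01// !add0r.
have D1 : Dl (word k s) x y <= ln eta by exact: Dl_e2.
have m1 : mx n s' x' y' <= 2 * ln L.
  apply: mx_le => [|i i_n]; first by rewrite mulr_ge0// ln_ge0.
  apply: Dl_rr => //; first exact: act_neq.
    by have := hv_eq0 hx i_n; rewrite mulg1.
  by have := hv_eq0 hy i_n; rewrite mulg1.
exact: record_cancel0 D1 m1 heta M0.
Qed.

Lemma record_iter J x y : x != y -> EDl (J * k) x y + J%:R / 2 <= Emx (J * k) x y.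
Proof.
elim: J x y => [|J IH] x y xy.
  have -> : EDl (0 * k) x y = 0.
    by rewrite -[RHS](Rint_cst Q); apply: eq_Rint => s; exact: Dl1.
  by rewrite mul0r addr0 /Emx Rint_ge0.
have [h1 LE] := record_step (J * k) xy.
have [LD ->] := EDl_glue k (J * k) x y.
rewrite mulSn; apply: le_trans h1; rewrite -!addrA lerD2l -natr1 mulrDl mul1r addrA lerD2r.
rewrite -[X in _ + X](Rint_cst Q) -RintD//; last exact: L1_cst.
apply: Rint_le => // [|s]; first by apply: L1D => //; exact: L1_cst.
by apply: IH; exact: act_neq.
Qed.

End RecordStep.

Hypotheses (tight : forall e : R, 0 < e -> e <= 2^-1 -> exists2 L : R, 1 <= L &
  forall n x, pr L n x <= e)
  (decay : forall e eta : R, 0 < e -> e <= 2^-1 -> 0 < eta ->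
  exists n0, forall n x, (n0 <= n)%N -> mean n (fun a => (eta < e2 a x)%R%:R) <= 4 * e)
  (tail : forall e : R, 0 < e -> exists2 A, 0 <= A &
  \int[mu]_a Num.max (ell a - A) 0 <= e).

Lemma tight_hv (e : R) : 0 < e -> e <= 2^-1 -> exists2 L : R, 1 <= L &
  forall n x, \int[Q]_s hv L n s 1%g x <= 2 * e.
Proof.
move=> e0 e1; have [L L1' hL] := tight e0 e1; exists (2 * L * L).
  have : 1 * 1 <= L * L by apply: ler_pM.
  by rewrite -mulrA; move: (L * L) => l; lra.
move=> n x; apply: le_trans (ottaviani Q_cyl n 1%g x L1' (fun n x => le_trans (hL n x) e1)) _.
by rewrite ler_pM2l//; under [X in mean n X]eq_fun do rewrite mulg1; exact: hL.
Qed.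

(** The record is at most [2 * ln L] unless the defect of one of the lines exceeds [L] before time
    [n], which for each line has probability at most [2 * e1]. In that case it is at most 4 times
    the sum of the [ell], whose part above [A] is controlled by [tail]. *)
Lemma Emx_sublinear (e : R) : 0 < e -> exists c, forall n x y, x != y -> Emx n x y <= c + e * n%:R.
Proof.
move=> e0; have [|A A0 hA] := tail (e := e / 16); first by rewrite divr_gt0.
pose e1 := Num.min 2^-1 (e / (32 * (A + 1))).
have e10 : 0 < e1 by rewrite lt_min invr_gt0 ltr0n divr_gt0// mulr_gt0// ltr_wpDl.
have [||L L1' hL] := tight_hv (e := e1) => //; first by rewrite ge_min lexx.
have L0 : 0 < L by exact: lt_le_trans L1'.
have e1A : e1 * (32 * (A + 1)) <= e.
  by rewrite -ler_pdivlMr ?ge_min ?lexx ?orbT// mulr_gt0// ltr_wpDl.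
exists (2 * ln L) => n x y xy; have lnL : 0 <= ln L by rewrite ln_ge0.
pose ta (a : G) : R := Num.max (ell a - A) 0.
have mta : mble ta.
  by apply: measurable_maxr => //; apply: mfB => //; exact: mf_ell.
have Lta : L1 mu ta.
  apply: (L1_le mta L1_ell) => a; rewrite ger0_norm ?le_max ?lexx ?orbT//.
  by rewrite ge_max ell_ge0 andbT lerBlDr lerDl.
have Lti i : L1 Q (fun s => ta (s i)) by exact: (Rint_coordinate Q_cyl i mta).2.
have Lsum : L1 Q (fun s => \sum_(i < n) ta (s i)).
  by apply: (L1_sum (f := fun i (s : path G) => ta (s i))) => i _; exact: Lti.
have Lh z : L1 Q (fun s => hv L n s 1%g z) by exact: L1_hv.
have key (s : path G) z : hv L n s 1%g z * steps n s <=
    A * n%:R * hv L n s 1%g z + \sum_(i < n) ta (s i).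
  have -> : A * n%:R * hv L n s 1%g z = \sum_(i < n) A * hv L n s 1%g z.
    by rewrite sumr_const card_ord -[RHS]mulr_natr mulrAC.
  rewrite -big_split /steps mulr_sumr/=; apply: ler_sum => i _.
  have t1 : ell (s i) - A <= ta (s i) by rewrite le_max lexx.
  have t0 : 0 <= ta (s i) by rewrite le_max lexx orbT.
  by case: (hv_bool dot L n s 1%g z) => ->; rewrite ?mul0r ?mulr0 ?add0r// mul1r mulr1; lra.
have mx_path (s : path G) : mx n s x y <= 2 * ln L + 4 * (A * n%:R) * hv L n s 1%g x +
    4 * (A * n%:R) * hv L n s 1%g y + 8 * \sum_(i < n) ta (s i).
  have S0 : 0 <= \sum_(i < n) ta (s i).
    by apply: sumr_ge0 => i _; rewrite le_max lexx orbT.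
  have kx := key s x; have ky := key s y; have ms := mx_steps n s x y.
  rewrite ger0_norm ?mx_ge0// in ms; have st0 := steps_ge0 n s.
  apply: (hit_bound (st := steps n s)) => //; try exact: hv_bool.
    by rewrite mulr_ge0.
  move=> hx hy; apply: mx_le => [|i i_n]; first by rewrite mulr_ge0.
  apply: Dl_rr => //.
    by have := hv_eq0 hx i_n; rewrite mulg1.
  by have := hv_eq0 hy i_n; rewrite mulg1.
have Lc (c : R) : L1 Q (fun=> c) by exact: L1_cst.
have T1 := L1D (Lc (2 * ln L)) (L1Z (4 * (A * n%:R)) (Lh x)).
have T2 := L1D T1 (L1Z (4 * (A * n%:R)) (Lh y)).
apply: le_trans (Rint_le (L1_mx n x y) (L1D T2 (L1Z 8 Lsum)) mx_path) _.
rewrite (RintD T2 (L1Z 8 Lsum)) (RintD T1 (L1Z _ (Lh y))) (RintD (Lc _) (L1Z _ (Lh x))) Rint_cst.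
rewrite !RintZ// (Rint_sum (f := fun i (s : path G) => ta (s i))); last by move=> i _; exact: Lti.
have -> : \sum_(i < n) \int[Q]_s ta (s i) = n%:R * \int[mu]_a ta a.
  rewrite (eq_bigr (fun=> \int[mu]_a ta a)).
    by rewrite sumr_const card_ord mulr_natl.
  by move=> i _; exact: (Rint_coordinate Q_cyl i mta).1.
have := hL n x; have := hL n y; move: hA; rewrite -/(ta _).
have n0 : 0 <= n%:R :> R by [].
move: (\int[Q]_s hv L n s 1%g x) (\int[Q]_s hv L n s 1%g y) => u v.
have -> : \int[mu]_a Num.max (ell a - A) 0 = \int[mu]_a ta a by [].
move: (\int[mu]_a ta a) => w hw hv' hu.
rewrite -!addrA lerD2l.
have p1 : A * u <= A * (2 * e1) by rewrite ler_wpM2l.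
have p2 : A * v <= A * (2 * e1) by rewrite ler_wpM2l.
have p3 : 4 * (A * u) + 4 * (A * v) + 8 * w <= e by lra.
have -> : 4 * (A * n%:R) * u + (4 * (A * n%:R) * v + 8 * (n%:R * w)) =
  (4 * (A * u) + 4 * (A * v) + 8 * w) * n%:R by ring.
exact: ler_wpM2r.
Qed.

(** After [J] blocks the expected logarithm lies [J / 2] below the expected record, while
    sublinearity lets the latter rise by at most [c + J / 4]. *)
Theorem EDl_negative : exists m, forall x y, x != y -> EDl m x y <= - 1.
Proof.
have [||L L1' hL] := tight_hv (e := 16^-1); rewrite ?invr_gt0//.
  by rewrite lef_pV2 ?posrE// ler_nat.
have [|||k hk] := decay (e := 32^-1) (eta := expR (- 1 - 2 * ln L)); rewrite ?invr_gt0 ?expR_gt0//.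
  by rewrite lef_pV2 ?posrE// ler_nat.
have hL' n x : \int[Q]_s hv L n s 1%g x <= 8^-1.
  by apply: le_trans (hL n x) _; lra.
have hk' x : mean k.+1 (fun a => (expR (- 1 - 2 * ln L) < e2 a x)%R%:R) <= 8^-1.
  by apply: le_trans (hk _ x (leqnSn k)) _; lra.
have heta : ln (expR (- 1 - 2 * ln L)) + 2 * ln L <= - 1 by rewrite expRK subrK.
pose e := (4 * k.+1%:R)^-1 : R; have e0 : 0 < e by rewrite invr_gt0 mulr_gt0.
have [c hc] := Emx_sublinear e0.
have [J hJ] := upper_nat (4 * (c + 1)).
exists (J * k.+1)%N => x y xy.
have h1 := record_iter L1' hL' (expR_gt0 _) heta hk' J xy.
have h2 := hc (J * k.+1)%N x y xy.
have E : e * (J * k.+1)%:R = J%:R / 4 by rewrite natrM /e; field; rewrite addrC natr1 pnatr_eq0.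
rewrite E in h2; lra.
Qed.

End Records.

(** * Inequalities for the exponential *)

Section ExponentialBounds.
Context {R : realType}.
Implicit Types u z b : R.

Lemma expR_quad u : expR u <= 1 + u + u ^+ 2 * expR `|u|.
Proof.
have e1 (v : R) : expR v - 1 <= v * expR v.
  have := expR_ge1Dx (- v); have p := expR_gt0 v; rewrite -(ler_pM2r p) -expRD addNr expR0.
  by rewrite mulrDl mul1r mulNr; lra.
have a1 : `|expR u - 1| <= `|u| * expR `|u|.
  have [u0|u0] := leP 0 u.
    by rewrite !ger0_norm ?e1// subr_ge0 -expR0 ler_expR.
  rewrite ler0_norm; last by rewrite subr_le0 -expR0 ler_expR ltW.
  rewrite (ltr0_norm u0) opprB; apply: (@le_trans _ _ (- u)).
    by have := expR_ge1Dx u; lra.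
  by rewrite ler_peMr ?oppr_ge0 ?(ltW u0)// -expR0 ler_expR oppr_ge0 ltW.
have b1 : u * (expR u - 1) <= u ^+ 2 * expR `|u|.
  apply: le_trans (ler_norm _) _; rewrite normrM -real_normK ?num_real// expr2 -mulrA.
  by rewrite ler_wpM2l.
by have := e1 u; rewrite mulrBr mulr1 in b1; lra.
Qed.

Lemma sqr_le_expR z b : 0 <= z -> 0 < b -> z ^+ 2 <= 4 / b ^+ 2 * expR (b * z).
Proof.
move=> z0 b0; have h : b * z / 2 <= expR (b * z / 2).
  by apply: le_trans (expR_ge1Dx _); rewrite lerDr.
have -> : b * z = b * z / 2 + b * z / 2 by rewrite -splitr.
rewrite expRD -expr2 mulrAC ler_pdivlMr ?exprn_gt0//.
have -> : z ^+ 2 * b ^+ 2 = 4 * (b * z / 2) ^+ 2 by field.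
by rewrite ler_pM2l// ler_pXn2r ?nnegrE ?expR_ge0// divr_ge0// mulr_ge0// ltW.
Qed.

Lemma le_expR z b : 0 < b -> z <= b^-1 * expR (b * z).
Proof.
move=> b0; rewrite mulrC ler_pdivlMr// mulrC; apply: le_trans (expR_ge1Dx _).
by rewrite lerDr.
Qed.

Lemma bernoulli_le (t : R) n : 0 <= t -> t <= 1 -> 1 - n%:R * t <= (1 - t) ^+ n.
Proof.
move=> t0 t1; elim: n => [|n IH]; first by rewrite mul0r subr0 expr0.
rewrite exprS; have t1' : 0 <= 1 - t by rewrite subr_ge0.
apply: le_trans (ler_wpM2l t1' IH); rewrite -natr1.
have h : 0 <= n%:R * t * t by rewrite !mulr_ge0.
by move: (n%:R : R) h => N h; lra.
Qed.

Lemma contraction_arith (de u w v : R) : de * u <= de * - 1 -> de * (de * (w * v)) <= de * 2^-1 ->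
  1 + de * u + de ^+ 2 * w * v <= 1 - de / 2.
Proof.
move=> h1 h2; have -> : de ^+ 2 * w * v = de * (de * (w * v)) by ring.
lra.
Qed.

Lemma horner_step_arith (a p b r t : R) : a + p = b -> r * a + t + r * p = r * b + t.
Proof. by move=> <-; ring. Qed.

End ExponentialBounds.

(** * From the negative drift to a distance contracted on average at each step *)

Section Contraction.
Context {R : realType} {d : nat} (dot : {dot 'cV[R]_d.+1 for idfun}).
Local Notation G := (GL R d).
Local Notation X := (PV R d).
Local Notation ell := (ell dot).
Local Notation sd := (sd dot).
Local Notation Dl := (Dl dot).
Variables (mu : probability G R) (Q : probability (path G) R) (al : R).
Hypotheses (Q_cyl : iid_law mu Q)
  (al0 : 0 < al)
  (L1_exp : L1 mu (fun a => expR (al * ell a))).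
Local Notation EDl := (EDl dot Q).
Local Notation steps := (steps dot).

Lemma L1_exp_le (b : R) : b <= al -> L1 mu (fun a => expR (b * ell a)).
Proof.
move=> bal; apply: L1_le L1_exp _ => [|a].
  apply: mf_comp => //; apply: mfM => //; exact: mf_ell.
by rewrite ger0_norm ?expR_ge0// ler_expR ler_wpM2r// ell_ge0.
Qed.

Lemma exp_L1_ell : L1 mu ell.
Proof.
apply: (L1_le (mf_ell dot) (L1Z al^-1 L1_exp)) => a.
by rewrite ger0_norm ?ell_ge0//; exact: le_expR.
Qed.

Lemma exp_L1_ell4 : L1 mu (fun a => ell a ^+ 4).
Proof.
apply: (L1_le _ (L1Z ((4 / (al / 2) ^+ 2) ^+ 2) L1_exp)) => [|a].
  by apply: mfX; exact: mf_ell.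
rewrite ger0_norm ?exprn_ge0 ?ell_ge0// (exprM _ 2 2).
have a2 : 0 < al / 2 by rewrite divr_gt0.
have := sqr_le_expR (ell_ge0 dot a) a2 => h.
have E : expR (al * ell a) = expR (al / 2 * ell a) ^+ 2.
  by rewrite expr2 -expRD -mulrDl -splitr.
rewrite E -exprMn ler_pXn2r// nnegrE ?exprn_ge0 ?ell_ge0//.
by rewrite mulr_ge0 ?expR_ge0// divr_ge0// exprn_ge0// ltW.
Qed.

Lemma exp_tail (A : R) : \int[mu]_a Num.max (ell a - A) 0 <=
  al^-1 * (\int[mu]_a expR (al * ell a)) * expR (- (al * A)).
Proof.
have -> : al^-1 * (\int[mu]_a expR (al * ell a)) * expR (- (al * A)) =
    \int[mu]_a (al^-1 * expR (- (al * A)) * expR (al * ell a)).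
  by rewrite RintZ// mulrAC.
apply: Rint_le => [||a]; last 2 first.
- exact: L1Z.
- have p : 0 <= al^-1 * expR (- (al * A)) * expR (al * ell a).
    by rewrite !mulr_ge0 ?expR_ge0// invr_ge0 ltW.
  rewrite ge_max p andbT -mulrA -expRD [X in expR X]addrC -mulrBr; exact: le_expR.
apply: (L1_le _ (L1D exp_L1_ell (L1_cst mu `|A|))) => [|a].
  by apply: measurable_maxr => //; apply: mfB => //; exact: mf_ell.
rewrite ger0_norm ?le_max ?lexx ?orbT// ge_max addr_ge0 ?ell_ge0// andbT lerD2l.
by rewrite -normrN ler_norm.
Qed.

Lemma exp_tail_small (e : R) : 0 < e -> exists2 A, 0 <= A &
  \int[mu]_a Num.max (ell a - A) 0 <= e.
Proof.
move=> e0; set E := al^-1 * \int[mu]_a expR (al * ell a).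
have E0 : 0 <= E by rewrite mulr_ge0 ?invr_ge0 ?(ltW al0)// Rint_ge0// => a; rewrite expR_ge0.
exists (E / (al * e)) => [|]; first by rewrite divr_ge0// mulr_ge0// ltW.
apply: le_trans (exp_tail _) _; rewrite -/E.
have -> : al * (E / (al * e)) = E / e by field; rewrite !gt_eqF.
rewrite expRN ler_pdivrMr ?expR_gt0// mulrC -ler_pdivrMr//.
by apply: le_trans (expR_ge1Dx _); rewrite lerDr.
Qed.

(** A sum of [m] terms is at most [m] times the largest, so its exponential moments reduce to those
    of one increment, at a rate divided by [m]. *)
Lemma exp_steps_sum m (g : R) s : (0 < m)%N -> 0 <= g -> g * m%:R <= al ->
  expR (g * steps m s) <= \sum_(i < m) expR (al * ell (s i)).
Proof.
move=> m0 g0 gm; have [i im hi] := le_scaled_max (fun i => ell (s i)) m0.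
apply: (@le_trans _ _ (expR (al * ell (s i)))).
  rewrite ler_expR; apply: (@le_trans _ _ (g * (m%:R * ell (s i)))); first by rewrite ler_wpM2l.
  by rewrite mulrA ler_wpM2r// ell_ge0.
rewrite (bigD1 (Ordinal im))//= lerDl; apply: sumr_ge0 => j _; exact: expR_ge0.
Qed.

Lemma mf_steps m : mble (steps m).
Proof. exact: L1_measurable (L1_steps Q_cyl exp_L1_ell m). Qed.

Lemma L1_exp_steps m (g : R) : (0 < m)%N -> 0 <= g -> g * m%:R <= al ->
  L1 Q (fun s => expR (g * steps m s)).
Proof.
move=> m0 g0 gm; apply: (L1_le (g := fun s : path G => \sum_(i < m) expR (al * ell (s i)))) => [||s].
- by apply: mf_comp => //; apply: mfM => //; exact: mf_steps.
- apply: (L1_sum (f := fun i (s : path G) => expR (al * ell (s i)))) => i _.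
  exact: (Rint_coordinate Q_cyl i (L1_measurable L1_exp)).2.
- by rewrite ger0_norm ?expR_ge0//; exact: exp_steps_sum.
Qed.

Section Metric.
Variables (m : nat) (de : R).
Hypotheses (m0 : (0 < m)%N) (hm : forall x y, x != y -> EDl m x y <= - 1).
Hypotheses (de0 : 0 < de) (de1 : de <= 1) (dal : 16 * de * m%:R <= al).

(** A rate at which the sum of [m] increments has a finite exponential moment. In [Tphi_contr] one
    half of it, [be], absorbs the square of the sum and the other half the exponential remainder. *)
Let ga : R := al / m%:R.
Let be : R := ga / 2.

Hypothesis deB : de * (64 / be ^+ 2 * \int[Q]_s expR (ga * steps m s)) <= 2^-1.

Definition phi x y : R := powR (sd x y) de.

Lemma phi_ge0 x y : 0 <= phi x y. Proof. exact: powR_ge0. Qed.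

Lemma phi_le1 x y : phi x y <= 1.
Proof.
have -> : 1 = powR 1 de :> R by rewrite powR1.
rewrite /phi; by apply: ge0_ler_powR; rewrite ?nnegrE ?sd_ge0 ?sd_le1 ?ler01 ?(ltW de0).
Qed.

Lemma phi_xx x : phi x x = 0.
Proof. by rewrite /phi sd_xx powR0// gt_eqF. Qed.

Lemma phi_expR x y : x != y -> phi x y = expR (de * ln (sd x y)).
Proof. by move=> xy; rewrite /phi /powR gt_eqF// sd_gt0. Qed.

Lemma sd_phi x y : sd x y <= phi x y.
Proof.
have [->|xy] := eqVneq x y; first by rewrite sd_xx phi_ge0.
have s0 := sd_gt0 dot xy; rewrite phi_expR// -[leLHS]lnK ?posrE// ler_expR.
have : ln (sd x y) <= 0 by rewrite -ln1 ler_ln ?posrE// sd_le1.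
by have := de1; nra.
Qed.

Lemma phi_act g x y : phi (GL_act g x) (GL_act g y) = expR (de * Dl g x y) * phi x y.
Proof.
have [->|xy] := eqVneq x y; first by rewrite !phi_xx mulr0.
by rewrite !phi_expR// ?act_neq// -expRD -mulrDr !/(Dl _ _ _) subrK.
Qed.

Definition Tphi n x y : R := \int[Q]_s phi (GL_act (word n s) x) (GL_act (word n s) y).

Lemma mf_phi_word n :
  mble (fun w : path G * (X * X) =>
    phi (GL_act (word n w.1) w.2.1) (GL_act (word n w.1) w.2.2)).
Proof.
have mw (pj : X * X -> X) : mble pj ->
    mble (fun w : path G * (X * X) => GL_act (word n w.1) (pj w.2)).
  move=> mp; apply: (mf_app2 (F := GL_act)); [exact: mf_GL_act| |exact: (mf_comp mp mf_snd)].
  exact: (mf_comp (mf_word n) mf_fst).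
apply: (mf_comp (measurable_powR de)).
exact: (mf_comp (f := fun z : X * X => sd z.1 z.2) (mf_sd dot)
  (mf_pair (mw fst mf_fst) (mw snd mf_snd))).
Qed.

Lemma L1_phi_word n x y : L1 Q (fun s => phi (GL_act (word n s) x) (GL_act (word n s) y)).
Proof.
apply: (L1_bounded 1) => [|s]; last by rewrite ger0_norm ?phi_ge0 ?phi_le1.
exact: (mf_pair2 (f := fun w : path G * (X * X) =>
    phi (GL_act (word n w.1) w.2.1) (GL_act (word n w.1) w.2.2)) (x, y) (mf_phi_word n)).
Qed.

Lemma mf_Tphi n : mble2 (Tphi n).
Proof.
exact: (mf_Rint1 (f := fun w : path G * (X * X) =>
    phi (GL_act (word n w.1) w.2.1) (GL_act (word n w.1) w.2.2)) (mf_phi_word n)).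
Qed.

Lemma Tphi_ge0 n x y : 0 <= Tphi n x y. Proof. by apply: Rint_ge0 => s; exact: phi_ge0. Qed.

Lemma Tphi_le1 n x y : Tphi n x y <= 1.
Proof. by apply: Rint_lec => [|s]; [exact: L1_phi_word|exact: phi_le1]. Qed.

Lemma Tphi0 x y : Tphi 0 x y = phi x y.
Proof. by rewrite -[RHS](Rint_cst Q); apply: eq_Rint => s; rewrite !act1. Qed.

Lemma mf_act_pair x y :
  mble (fun a : G => (GL_act a x, GL_act a y)).
Proof.
have ma z : mble (fun a : G => GL_act a z).
  apply: (mf_app2 (F := GL_act)) => //; exact: mf_GL_act.
exact: mf_pair.
Qed.

Lemma L1_Tphi n x y : L1 mu (fun a => Tphi n (GL_act a x) (GL_act a y)).
Proof.
apply: (L1_bounded 1) => [|a]; last by rewrite ger0_norm ?Tphi_ge0 ?Tphi_le1.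
exact: (mf_comp (f := fun z : X * X => Tphi n z.1 z.2) (mf_Tphi n)
  (mf_act_pair x y)).
Qed.

Lemma Tphi_S n x y : \int[mu]_a Tphi n (GL_act a x) (GL_act a y) = Tphi n.+1 x y.
Proof.
rewrite [RHS](@Rint_cons_bounded _ _ _ mu Q Q_cyl
  (fun s => phi (GL_act (word n.+1 s) x) (GL_act (word n.+1 s) y)) 1).
- by apply: eq_Rint => a; apply: eq_Rint => s; rewrite word_cons !actM.
- exact: L1_measurable (L1_phi_word n.+1 x y).
- by move=> s; rewrite ger0_norm ?phi_ge0 ?phi_le1.
Qed.

Let m1 : 0 < m%:R :> R. Proof. by rewrite ltr0n. Qed.

Let ga0 : 0 < ga. Proof. exact: divr_gt0. Qed.

Let be0 : 0 < be. Proof. exact: divr_gt0. Qed.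

Let dega : 16 * de <= ga. Proof. by rewrite ler_pdivlMr. Qed.

Let L1_ga : L1 Q (fun s => expR (ga * steps m s)).
Proof. by apply: L1_exp_steps => //; [exact: ltW|rewrite mulfVK// gt_eqF]. Qed.

Definition Kst : R := \int[Q]_s expR (ga * steps m s).

Lemma Kst_ge0 : 0 <= Kst. Proof. by apply: Rint_ge0 => s; exact: expR_ge0. Qed.

Lemma Tphi_le n x y : (n <= m)%N -> Tphi n x y <= Kst * phi x y.
Proof.
move=> nm; rewrite mulrC /Kst -RintZ//; apply: Rint_le; [exact: L1_phi_word|exact: L1Z|].
move=> s; rewrite phi_act mulrC; apply: ler_wpM2l; first exact: phi_ge0.
rewrite ler_expR; apply: le_trans (ler_norm _) _; rewrite normrM (gtr0_norm de0).
apply: le_trans (ler_wpM2l (ltW de0) (Dl_steps dot n s x y)) _.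
rewrite mulrA; apply: ler_pM; rewrite ?mulr_ge0 ?(ltW de0) ?steps_ge0 ?le_steps//.
by have := dega; have := de0; lra.
Qed.

(** Expansion of [expR (de * Dl)] to second order: [hm] makes the first-order term at most [- de],
    and [deB] makes the remainder at most [de / 2]. *)
Lemma Tphi_contr x y : Tphi m x y <= (1 - de / 2) * phi x y.
Proof.
have [->|xy] := eqVneq x y.
  rewrite phi_xx mulr0 /Tphi -[leRHS](Rint_cst Q) le_eqVlt; apply/orP; left; apply/eqP.
  by apply: eq_Rint => s; exact: phi_xx.
have D1 := L1_Dlw Q_cyl exp_L1_ell m x y.
have Lc := L1_cst Q.
have LB : L1 Q (fun s => 1 + de * Dl (word m s) x y +
    de ^+ 2 * (64 / be ^+ 2) * expR (ga * steps m s)).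
  by apply: L1D; [apply: L1D; [exact: Lc|exact: L1Z]|exact: L1Z].
apply: (@le_trans _ _ (\int[Q]_s (phi x y * (1 + de * Dl (word m s) x y +
    de ^+ 2 * (64 / be ^+ 2) * expR (ga * steps m s))))).
  apply: Rint_le; [exact: L1_phi_word|exact: L1Z|] => s.
  rewrite phi_act mulrC; apply: ler_wpM2l; first exact: phi_ge0.
  apply: le_trans (expR_quad _) _; rewrite lerD2l exprMn -mulrA -mulrA.
  apply: ler_wpM2l; first by rewrite exprn_ge0// ltW.
  have h := Dl_steps dot m s x y; have st0 := steps_ge0 dot m s.
  have q1 : Dl (word m s) x y ^+ 2 <= 16 * (steps m s) ^+ 2.
    rewrite -real_normK ?num_real// (_ : 16 = 4 ^+ 2); last by ring.
    by rewrite -exprMn ler_pXn2r ?nnegrE ?mulr_ge0.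
  have q2 : expR `|de * Dl (word m s) x y| <= expR (be * steps m s).
    rewrite ler_expR normrM (gtr0_norm de0).
    apply: le_trans (ler_wpM2l (ltW de0) h) _; rewrite mulrA ler_wpM2r//.
    by rewrite /be; have := dega; have := de0; lra.
  have q3 := sqr_le_expR st0 be0.
  apply: le_trans (ler_pM (sqr_ge0 _) (expR_ge0 _) q1 q2) _.
  have -> : ga * steps m s = be * steps m s + be * steps m s.
    by rewrite -mulrDl /be -splitr.
  rewrite expRD mulrA; apply: ler_wpM2r; first exact: expR_ge0.
  apply: le_trans (ler_wpM2l _ q3) _ => //.
  by apply: le_of_eq; field; rewrite gt_eqF.
rewrite RintZ// mulrC; apply: ler_wpM2r; first exact: phi_ge0.
rewrite (RintD (L1D (Lc 1) (L1Z de D1)) (L1Z _ L1_ga)) (RintD (Lc 1) (L1Z de D1)) Rint_cst.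
rewrite (RintZ de D1) (RintZ _ L1_ga).
have h1 : de * \int[Q]_s Dl (word m s) x y <= de * - 1.
  by apply: ler_wpM2l; [exact: ltW|exact: hm].
have h2 := ler_wpM2l (ltW de0) deB.
exact: contraction_arith h1 h2.
Qed.

(** By Bernoulli's inequality its [m]-th power is at least [1 - de / 2], the contraction obtained
    over [m] steps. *)
Definition rate : R := 1 - de / (2 * m%:R).

Lemma rate_bounds : [/\ 0 < rate, rate < 1 & 1 - de / 2 <= rate ^+ m].
Proof.
have t0 : 0 < de / (2 * m%:R) by rewrite divr_gt0// mulr_gt0.
have t1 : de / (2 * m%:R) <= 2^-1.
  rewrite ler_pdivrMr ?mulr_gt0// mulrA mulVf ?mul1r ?pnatr_eq0//.
  by apply: le_trans de1 _; rewrite ler1n.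
split; first by rewrite /rate; lra.
  by rewrite /rate; lra.
apply: le_trans (bernoulli_le m (ltW t0) (_ : _ <= 1)); last by lra.
rewrite lerD2l lerN2; apply: le_of_eq; field.
by rewrite gt_eqF.
Qed.

(** Horner form of the sum over [k < n] of [rate ^ (n - 1 - k) * Tphi k], the averaging that turns a
    contraction over [m] steps into one at each step. *)
Fixpoint horn n x y : R := if n is k.+1 then rate * horn k x y + Tphi k x y else 0.

Lemma horn_bounds n x y : 0 <= horn n x y <= n%:R.
Proof.
have [r0 r1 _] := rate_bounds; elim: n => [|n /andP[h0 h1]] /=; first by rewrite lexx.
rewrite addr_ge0 ?mulr_ge0 ?Tphi_ge0 ?(ltW r0)//= -natr1 lerD ?Tphi_le1//.
by apply: le_trans h1; rewrite ler_piMl// ltW.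
Qed.

Lemma horn_le n x y : (n <= m)%N -> horn n x y <= n%:R * (Kst * phi x y).
Proof.
have [r0 r1 _] := rate_bounds; elim: n => [|n IH] nm /=; first by rewrite mul0r.
have -> : n.+1%:R = n%:R + 1 :> R by rewrite natr1.
rewrite [leRHS]mulrDl mul1r; apply: lerD; last by apply: Tphi_le; exact: ltnW.
apply: le_trans (IH (ltnW nm)); apply: ler_piMl; last exact: ltW.
by have /andP[] := horn_bounds n x y.
Qed.

Lemma horn_ge n x y : rate ^+ n * phi x y <= horn n.+1 x y.
Proof.
have [r0 r1 _] := rate_bounds; elim: n => [|n IH].
  by rewrite /= mulr0 add0r expr0 mul1r Tphi0.
rewrite -[horn n.+2 x y]/(rate * horn n.+1 x y + Tphi n.+1 x y) exprS -mulrA.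
apply: le_trans (ler_wpM2l (ltW r0) IH) _; by rewrite lerDl Tphi_ge0.
Qed.

Lemma mf_horn n : mble2 (horn n).
Proof.
elim: n => [|n IH] /=; first exact: measurable_cst.
by apply: mfD; [exact: mfM|exact: mf_Tphi].
Qed.

Lemma L1_horn n x y : L1 mu (fun a => horn n (GL_act a x) (GL_act a y)).
Proof.
apply: (L1_bounded (n%:R)) => [|a].
  exact: (mf_comp (f := fun z : X * X => horn n z.1 z.2) (mf_horn n)
    (mf_act_pair x y)).
by exact: norm_bounds (horn_bounds n (GL_act a x) (GL_act a y)).
Qed.

(** The operator shifts the index of [Tphi], so the sum is reproduced up to its two end terms; for
    [n = m] these are compared by [Tphi_contr]. *)
Lemma horn_act n x y :
  \int[mu]_a horn n (GL_act a x) (GL_act a y) + rate ^+ n * phi x y =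
  rate * horn n x y + Tphi n x y.
Proof.
elim: n => [|n IH] /=; first by rewrite Rint_cst add0r mulr0 add0r expr0 mul1r Tphi0.
rewrite RintD ?RintZ; [|exact: L1_horn|by apply: L1Z; exact: L1_horn|exact: L1_Tphi].
have -> : rate ^+ n.+1 * phi x y = rate * (rate ^+ n * phi x y) by rewrite exprS mulrA.
by rewrite Tphi_S; exact: horner_step_arith.
Qed.

Definition dist x y : R := m%:R^-1 * horn m x y.

Lemma dist_ge0 x y : 0 <= dist x y.
Proof. by rewrite mulr_ge0 ?invr_ge0//; have /andP[] := horn_bounds m x y. Qed.

Lemma dist_le1 x y : dist x y <= 1.
Proof. by rewrite /dist mulrC ler_pdivrMr// mul1r; have /andP[] := horn_bounds m x y. Qed.

Lemma mf_dist x y : mble (fun a : G => dist (GL_act a x) (GL_act a y)).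
Proof. by apply: mfM => //; exact: L1_measurable (L1_horn m x y). Qed.

Lemma dist_contr x y : \int[mu]_a dist (GL_act a x) (GL_act a y) <= rate * dist x y.
Proof.
have [r0 r1 r2] := rate_bounds.
rewrite RintZ; last exact: L1_horn.
rewrite /dist mulrCA; apply: ler_wpM2l; first by rewrite invr_ge0.
rewrite -(lerD2r (rate ^+ m * phi x y)) horn_act lerD2l.
apply: le_trans (Tphi_contr x y) _; apply: ler_wpM2r => //; exact: phi_ge0.
Qed.

Definition lowc : R := m%:R / rate ^+ m.-1.

Lemma lowc_gt0 : 0 < lowc.
Proof. by have [r0 _ _] := rate_bounds; rewrite divr_gt0// exprn_gt0. Qed.

Lemma phi_dist x y : phi x y <= lowc * dist x y.
Proof.
have [r0 _ _] := rate_bounds; have h := horn_ge m.-1 x y; rewrite prednK// in h.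
have -> : lowc * dist x y = horn m x y / rate ^+ m.-1.
  by rewrite /lowc /dist mulrACA divff ?gt_eqF// mul1r mulrC.
by rewrite ler_pdivlMr ?exprn_gt0// mulrC.
Qed.

(** A single constant for two purposes: the term [Kst] serves [dist_Lam], the other one
    [sigma_Lam]. *)
Definition lamc : R := lowc * (Kst + 2 * (1 + de^-1)).

Definition Lam (a : G) : R := lamc * expR (4 * de * ell a).

Let de4 : 0 <= 4 * de. Proof. by rewrite mulr_ge0// ltW. Qed.

Lemma lamc_ge0 : 0 <= lamc.
Proof.
rewrite mulr_ge0 ?(ltW lowc_gt0)// addr_ge0 ?Kst_ge0// mulr_ge0// addr_ge0// invr_ge0 ltW//.
Qed.

Lemma Lam_ge0 a : 0 <= Lam a. Proof. by rewrite mulr_ge0 ?lamc_ge0 ?expR_ge0. Qed.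

Let deal : 16 * de <= al.
Proof.
apply: le_trans dega _; by rewrite ler_pdivrMr// ler_peMr ?(ltW al0)// ler1n.
Qed.

Lemma L1_Lam : L1 mu Lam.
Proof.
by apply: L1Z; apply: L1_exp_le; apply: le_trans deal; rewrite ler_pM2r// ler_nat.
Qed.

Lemma L1_ell_Lam : L1 mu (fun a => ell a * Lam a).
Proof.
have c0 : 0 < 4 * de by rewrite mulr_gt0.
have le8 : 8 * de <= al by apply: le_trans deal; rewrite ler_pM2r// ler_nat.
apply: (L1_le (g := fun a => lamc * ((4 * de)^-1 * expR (8 * de * ell a)))) => [||a].
- by apply: mfM; [exact: mf_ell|exact: L1_measurable L1_Lam].
- by apply: L1Z; apply: L1Z; exact: L1_exp_le.
rewrite ger0_norm; last by apply: mulr_ge0; [exact: ell_ge0|exact: Lam_ge0].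
rewrite /Lam [leLHS]mulrCA; apply: ler_wpM2l; first exact: lamc_ge0.
have -> : 8 * de * ell a = 4 * de * ell a + 4 * de * ell a by ring.
by rewrite expRD mulrA; apply: ler_wpM2r; [exact: expR_ge0|exact: le_expR].
Qed.

Lemma phi_act_le a x y : phi (GL_act a x) (GL_act a y) <= expR (4 * de * ell a) * phi x y.
Proof.
rewrite phi_act; apply: ler_wpM2r; first exact: phi_ge0.
rewrite ler_expR; apply: le_trans (ler_norm _) _; rewrite normrM (gtr0_norm de0).
by apply: le_trans (ler_wpM2l (ltW de0) (Dl_ell dot a x y)) _; rewrite mulrCA mulrA.
Qed.

Lemma dist_phi x y : dist x y <= Kst * phi x y.
Proof.
by rewrite /dist mulrC ler_pdivrMr// mulrC; exact: horn_le.
Qed.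

Lemma dist_Lam a x y : dist (GL_act a x) (GL_act a y) <= Lam a * dist x y.
Proof.
apply: le_trans (dist_phi _ _) _.
apply: le_trans (ler_wpM2l Kst_ge0 (phi_act_le a x y)) _.
have -> : Lam a * dist x y = lamc * dist x y * expR (4 * de * ell a) by rewrite mulrAC.
rewrite [leLHS]mulrCA [leLHS]mulrC; apply: ler_wpM2r; first exact: expR_ge0.
apply: le_trans (ler_wpM2l Kst_ge0 (phi_dist x y)) _.
rewrite mulrA [Kst * _]mulrC; apply: ler_wpM2r; first exact: dist_ge0.
apply: ler_wpM2l; first exact: ltW lowc_gt0.
by rewrite lerDl mulr_ge0// addr_ge0// invr_ge0 ltW.
Qed.

(** Interpolation between the Lipschitz bound of [sigma_lip], equal to [expR w], and the bound
    [2 * ell a]: the result is of Holder type with the small exponent [de], with a constant that is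
    integrable. *)
Lemma sigma_phi a x y : `|sigma dot a x - sigma dot a y| <=
  2 * (1 + de^-1) * expR (4 * de * ell a) * phi x y.
Proof.
have l0 := ell_ge0 dot a.
have [->|xy] := eqVneq x y; first by rewrite subrr normr0 phi_xx mulr0.
have s0 := sd_gt0 dot xy; have ln2 : 0 <= ln 2 :> R by rewrite ln_ge0// ler1n.
set w := ln 2 + 2 * ell a + ln (sd x y).
have h1 : `|sigma dot a x - sigma dot a y| <= expR w.
  apply: le_trans (sigma_lip _ _ _ _) _; rewrite /w !expRD !lnK ?posrE//.
  by rewrite -expR_ell [expR _ ^+ 2]expr2 -expRD -mulr2n -[ell a *+ 2]mulr_natl.
have h2 : `|sigma dot a x - sigma dot a y| <= 2 * ell a.
  apply: le_trans (ler_normB _ _) _.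
  by have := sigma_ell dot a x; have := sigma_ell dot a y; lra.
have h3 : `|sigma dot a x - sigma dot a y| <= (1 + 2 * ell a) * expR (de * w).
  have [w0|w0] := leP w 0.
    apply: le_trans h1 _; apply: (@le_trans _ _ (expR (de * w))).
      by rewrite ler_expR -[leLHS]mul1r; exact: ler_wnM2r.
    by rewrite ler_peMl ?expR_ge0// lerDl mulr_ge0.
  apply: le_trans h2 _; apply: (@le_trans _ _ (1 + 2 * ell a)); first by rewrite lerDr.
  rewrite ler_peMr ?addr_ge0 ?mulr_ge0// -expR0 ler_expR mulr_ge0 ?(ltW w0)// ltW//.
apply: le_trans h3 _; rewrite phi_expR//.
have -> : de * w = de * ln 2 + 2 * de * ell a + de * ln (sd x y) by rewrite /w; ring.
rewrite expRD mulrA; apply: ler_wpM2r; first exact: expR_ge0.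
rewrite expRD mulrA.
have -> : 4 * de * ell a = 2 * de * ell a + 2 * de * ell a by ring.
rewrite expRD mulrA; apply: ler_wpM2r; first exact: expR_ge0.
rewrite mulrC -mulrA; apply: ler_pM; rewrite ?expR_ge0 ?addr_ge0 ?mulr_ge0//.
  rewrite -[leRHS]lnK ?posrE// ler_expR ler_piMl//.
rewrite [leRHS]mulrDl mul1r; apply: lerD; first by rewrite -expR0 ler_expR !mulr_ge0// ltW.
have h := le_expR (2 * ell a) de0.
by rewrite mulrA [de * 2]mulrC in h.
Qed.

Lemma sigma_Lam a x y : `|sigma dot a x - sigma dot a y| <= Lam a * dist x y.
Proof.
apply: le_trans (sigma_phi a x y) _.
have c0 : 0 <= 2 * (1 + de^-1) by rewrite mulr_ge0// addr_ge0// invr_ge0 ltW.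
apply: le_trans (ler_wpM2l (mulr_ge0 c0 (expR_ge0 _)) (phi_dist x y)) _.
rewrite mulrA; apply: ler_wpM2r; first exact: dist_ge0.
rewrite /Lam mulrAC; apply: ler_wpM2r; first exact: expR_ge0.
rewrite mulrC; apply: ler_wpM2l; first exact: ltW lowc_gt0.
by rewrite lerDr Kst_ge0.
Qed.

End Metric.

Theorem contraction_metric : (exists m, forall x y, x != y -> EDl m x y <= - 1) ->
  exists (D : X -> X -> R) (La : G -> R) (r c : R),
  [/\ 0 <= r < 1, (forall x y, 0 <= D x y <= 1) /\
      (forall x y, mble (fun a : G => D (GL_act a x) (GL_act a y))),
      (forall x y, \int[mu]_a D (GL_act a x) (GL_act a y) <= r * D x y) /\
      (forall a x y, D (GL_act a x) (GL_act a y) <= La a * D x y),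
      (forall a x y, `|sigma dot a x - sigma dot a y| <= La a * D x y) /\
      (0 <= c /\ forall x y, sd x y <= c * D x y) &
      (forall a, 0 <= La a) /\ (L1 mu La /\ L1 mu (fun a => ell a * La a))].
Proof.
move=> [m1 hm1].
have [m m0 hm] : exists2 m, (0 < m)%N & forall x y, x != y -> EDl m x y <= - 1.
  case: m1 hm1 => [|m1] hm1; last by exists m1.+1.
  exists 1%N => // x y xy; have := hm1 x y xy.
  have -> : EDl 0 x y = 0.
    by rewrite -[RHS](Rint_cst Q); apply: eq_Rint => s; exact: Dl1.
  by lra.
have mR : 0 < m%:R :> R by rewrite ltr0n.
set ga := al / m%:R; set be := ga / 2.
have ga0 : 0 < ga by exact: divr_gt0.
have be0 : 0 < be by exact: divr_gt0.
set B := 64 / be ^+ 2 * \int[Q]_s expR (ga * steps m s).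
have B0 : 0 <= B.
  by rewrite mulr_ge0// ?divr_ge0 ?exprn_ge0 ?(ltW be0)// Rint_ge0// => s; exact: expR_ge0.
(* The three requirements on the exponent: [sd] below its power, room in the exponential moment, and
   a small second-order remainder. *)
pose de := Num.min 1 (Num.min (al / (16 * m%:R)) (2 * (B + 1))^-1) : R.
have de0 : 0 < de.
  by rewrite !lt_min ltr01 divr_gt0 ?mulr_gt0//= invr_gt0 mulr_gt0// ltr_wpDl.
have de1 : de <= 1 by rewrite ge_min lexx.
have dal : 16 * de * m%:R <= al.
  have : de <= al / (16 * m%:R) by rewrite !ge_min lexx orbT.
  by rewrite ler_pdivlMr ?mulr_gt0// mulrCA mulrA.
have deB : de * B <= 2^-1.
  have : de <= (2 * (B + 1))^-1 by rewrite !ge_min lexx !orbT.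
  rewrite -[_^-1]mul1r ler_pdivlMr ?mulr_gt0 ?ltr_wpDl// => h.
  by move: h de0; move: (de) => z h z0; lra.
have [r0 r1 _] := rate_bounds m0 de0 de1.
exists (dist m de), (Lam m de), (rate m de), (lowc m de); split.
- by rewrite (ltW r0) r1.
- split=> [x y|x y]; first by rewrite dist_ge0// dist_le1.
  exact: mf_dist.
- split=> [x y|a x y]; first exact: dist_contr.
  exact: dist_Lam.
- split=> [a x y|]; first exact: sigma_Lam.
  split=> [|x y]; first by rewrite ltW// lowc_gt0.
  by apply: (@le_trans _ _ (phi de x y)); [exact: sd_phi|exact: phi_dist].
- split=> [a|]; first exact: Lam_ge0.
  by split; [exact: L1_Lam|exact: L1_ell_Lam].
Qed.

End Contraction.

Section LebesgueHelpers.
Context {R : realType}.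
Notation leb := (@lebesgue_measure R).

Lemma integral_half_line (f : R -> \bar R) (m : R) :
  (\int[leb]_(t in `[m, +oo[) f t = \int[leb]_t (((m <= t)%R%:R)%:E * f t))%E.
Proof.
rewrite integral_mkcond; apply: eq_integral => t _; rewrite patchE mem_setE in_itv/= andbT.
by case: (m <= t); rewrite ?mul1e ?mul0e.
Qed.

Lemma mf_le_ind {d} {Y : measurableType d} (f g : Y -> R) :
  mble f -> mble g ->
  mble (fun y => (f y <= g y)%R%:R : R).
Proof.
move=> mf mg; rewrite (_ : (fun y => _) = fun y => 1 - (0 < f y - g y)%R%:R); last first.
  by apply/funext => y; rewrite subr_gt0; case: ltP; rewrite ?subr0 ?subrr.
apply: mfB => //; apply: mf_ind; exact: mfB.
Qed.

End LebesgueHelpers.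

(** * The killed walk and its duality with the queue *)

Section KilledWalk.
Context {R : realType} {dG dX : measure_display}.
Context {G : measurableType dG} {X : measurableType dX}.
Variables (mu : probability G R) (act : G -> X -> X) (s : G -> X -> R).
Hypotheses (mact : mble2 act)
  (ms : mble2 s).
Notation leb := (@lebesgue_measure R).

(** The level is tested before each step and not after the last one, as in the event [tau > n - 1]
    with [0 <= t]; the final level may be negative. *)
Fixpoint killed (h : X -> R -> R) (n : nat) (x : X) (t : R) : R :=
  if n is k.+1 then (0 <= t)%R%:R * \int[mu]_a killed h k (act a x) (t + s a x) else h x t.

Section Bounded.
Variables (h : X -> R -> R) (K : R).
Hypotheses (mh : mble2 h)
  (h0 : forall x t, 0 <= h x t)
  (hK : forall x t, h x t <= K).

Lemma mf_killed n : mble2 (killed h n).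
Proof.
elim: n => [//|n IH] /=; apply: mfM.
  by apply: (mf_le_ind (f := fun=> 0) (g := fun z : X * R => z.2)) => //; exact: mf_snd.
apply: (mf_Rint1 (f := fun w : G * (X * R) =>
  killed h n (act w.1 w.2.1) (w.2.2 + s w.1 w.2.1))).
have m1 : mble (fun w : G * (X * R) => (w.1, w.2.1)).
  apply: mf_pair; first exact: mf_fst.
  exact: (mf_comp mf_fst mf_snd).
have m2 := mf_comp mact m1; have m3 := mf_comp ms m1.
have m4 : mble (fun w : G * (X * R) => w.2.2 + s w.1 w.2.1).
  by apply: mfD => //; exact: (mf_comp mf_snd mf_snd).
exact: (mf_comp (f := fun z : X * R => killed h n z.1 z.2) IH (mf_pair m2 m4)).
Qed.

Lemma killed_ge0 n x t : 0 <= killed h n x t.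
Proof. by elim: n x t => //= n IH x t; rewrite mulr_ge0// Rint_ge0. Qed.

Lemma mf_killed_step n x t :
  mble (fun a => killed h n (act a x) (t + s a x)).
Proof.
have m1 : mble (fun a : G => (a, x)) by exact: mf_pair.
apply: (mf_app2 (F := killed h n)); [exact: mf_killed|exact: (mf_comp mact m1)|].
by apply: mfD => //; exact: (mf_comp ms m1).
Qed.

Lemma killed_leK n x t : killed h n x t <= K.
Proof.
elim: n x t => //= n IH x t.
have i0 : 0 <= \int[mu]_a killed h n (act a x) (t + s a x).
  by apply: Rint_ge0 => a; exact: killed_ge0.
apply: (@le_trans _ _ (\int[mu]_a killed h n (act a x) (t + s a x))).
  by case: (0 <= t); rewrite ?mul1r ?mul0r.
apply: Rint_lec => //; apply: (L1_bounded K); first exact: mf_killed_step.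
by move=> a; rewrite ger0_norm ?killed_ge0.
Qed.

Lemma L1_killed_step n x t : L1 mu (fun a => killed h n (act a x) (t + s a x)).
Proof.
apply: (L1_bounded K); first exact: mf_killed_step.
by move=> a; rewrite ger0_norm ?killed_ge0 ?killed_leK.
Qed.

End Bounded.

Lemma killed_le (h h' : X -> R -> R) (K K' : R) :
  mble2 h ->
  mble2 h' ->
  (forall x t, 0 <= h x t) -> (forall x t, h x t <= h' x t) ->
  (forall x t, h x t <= K) -> (forall x t, h' x t <= K') ->
  forall n x t, killed h n x t <= killed h' n x t.
Proof.
move=> mh mh' h0 hh hK hK'; have h'0 x t : 0 <= h' x t by exact: le_trans (hh x t).
elim=> //= n IH x t; apply: ler_wpM2l; first exact: ler0n.
by apply: Rint_le => [||a]; [exact: (L1_killed_step mh h0 hK)|exact: (L1_killed_step mh' h'0 hK')|].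
Qed.

Definition killed_mass (h : X -> R -> R) n x : \bar R :=
  (\int[leb]_(t in `[0%R, +oo[) (t * killed h n x t)%:E)%E.

Lemma killed_mass_le (h h' : X -> R -> R) (K K' : R) :
  mble2 h ->
  mble2 h' ->
  (forall x t, 0 <= h x t) -> (forall x t, h x t <= h' x t) ->
  (forall x t, h x t <= K) -> (forall x t, h' x t <= K') ->
  forall n x, (killed_mass h n x <= killed_mass h' n x)%E.
Proof.
move=> mh mh' h0 hh hK hK' n x; have h'0 y t : 0 <= h' y t by exact: le_trans (hh y t).
have mk (f : X -> R -> R) : mble2 f ->
    measurable_fun (`[0%R, +oo[%classic : set R) (fun t : R => (t * killed f n x t)%:E).
  move=> mf; apply: measurable_funTS; apply/mf_EFin; apply: mfM => //.
  exact: (mf_pair1 x (mf_killed mf n)).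
apply: ge0_le_integral => //; try exact: (mk _ mh); try exact: (mk _ mh');
  move=> t /=; rewrite in_itv/= andbT => t0; rewrite lee_fin.
- by rewrite mulr_ge0// killed_ge0.
- apply: ler_wpM2l => //; exact: (killed_le mh mh' h0 hh hK hK').
Qed.

Section Duality.
Variables (h H : X -> R -> R) (K Kh T : R).
Hypotheses (mh : mble2 h)
  (h0 : forall x t, 0 <= h x t)
  (hK : forall x t, h x t <= Kh)
  (hH : forall x m, (\int[leb]_(t in `[m, +oo[) (h x t)%:E = (H x m)%:E)%E)
  (mH : mble2 H)
  (HK : forall x m, H x m <= K).

Let hT (x : X) (t : R) := h x (t - T).

Let mhT : mble2 hT.
Proof.
apply: (mf_app2 (F := h)) => //; exact: mfB.
Qed.

Let H0 x m : 0 <= H x m.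
Proof. by rewrite -lee_fin -hH; apply: integral_ge0 => t _; rewrite lee_fin. Qed.

Lemma queue_bounds n x m : 0 <= queue mu act s H T n x m <= K.
Proof.
elim: n x m => [|n IH] x m /=; first by rewrite H0 HK.
have L : L1 mu (fun a => queue mu act s H T n (act a x) (s a x + Num.max m 0)).
  apply: (L1_bounded K); first exact: mf_queue_step.
  by move=> a; exact: norm_bounds (IH (act a x) (s a x + Num.max m 0)).
apply/andP; split; first by apply: Rint_ge0 => a; have /andP[] := IH (act a x) (s a x + Num.max m 0).
by apply: Rint_lec => // a; have /andP[] := IH (act a x) (s a x + Num.max m 0).
Qed.

(** The indicators of [m <= t] and [0 <= t] combine into that of [Num.max m 0 <= t], and the
    translation by [s a x] moves this threshold to [s a x + Num.max m 0]: this is the recursion of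
    the queue. *)
Lemma killed_queue n x m :
  (\int[leb]_(t in `[m, +oo[) (killed hT n x t)%:E = (queue mu act s H T n x m)%:E)%E.
Proof.
elim: n x m => [|n IH] x m.
  rewrite /= -hH !integral_half_line.
  rewrite -[RHS](ge0_integral_translate (- T)).
  - by apply: eq_integral => t _; rewrite lerD2r.
  - apply/mf_EFin; apply: mfM; first exact: mf_le_ind.
    exact: (mf_pair1 x mh).
  - by move=> t; rewrite mule_ge0// lee_fin.
rewrite integral_half_line.
have mk := mf_killed mhT n; have hT0 y t : 0 <= hT y t by exact: h0.
have hTK y t : hT y t <= Kh by exact: hK.
transitivity (\int[leb]_t \int[mu]_a
    ((Num.max m 0 <= t)%R%:R * killed hT n (act a x) (t + s a x))%:E)%E.
  apply: eq_integral => t _; rewrite -EFinM /= mulrA.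
  have -> : (m <= t)%R%:R * (0 <= t)%R%:R = (Num.max m 0 <= t)%R%:R :> R.
    by rewrite ge_max; case: (m <= t); case: (0 <= t); rewrite ?mulr1 ?mulr0.
  have L := L1_killed_step mhT hT0 hTK n x t.
  by rewrite -RintZ// EFin_Rint//; exact: L1Z.
have mf : mble (fun z : R * G =>
    ((Num.max m 0 <= z.1)%R%:R * killed hT n (act z.2 x) (z.1 + s z.2 x))%:E).
  apply/mf_EFin; apply: mfM.
    by apply: (mf_le_ind (f := fun=> Num.max m 0) (g := fun z : R * G => z.1)) => //;
      exact: mf_fst.
  have m1 : mble (fun z : R * G => (z.2, x)) by exact: mf_pair.
  apply: (mf_app2 (F := killed hT n)) => //; first exact: (mf_comp mact m1).
  by apply: mfD => //; exact: (mf_comp ms m1).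
rewrite (fubini_tonelli (m1 := leb) (m2 := mu) (fun z : R * G =>
    ((Num.max m 0 <= z.1)%R%:R * killed hT n (act z.2 x) (z.1 + s z.2 x))%:E))//; last first.
  by move=> z; rewrite lee_fin mulr_ge0// killed_ge0.
transitivity (\int[mu]_a (queue mu act s H T n (act a x) (s a x + Num.max m 0))%:E)%E.
  apply: eq_integral => a _; rewrite -IH integral_half_line.
  rewrite -[RHS](ge0_integral_translate (s a x)).
  - by apply: eq_integral => t _; rewrite [s a x + _]addrC lerD2r EFinM.
  - apply/mf_EFin; apply: mfM; first exact: mf_le_ind.
    exact: (mf_pair1 (act a x) mk).
  - by move=> t; rewrite mule_ge0// lee_fin// killed_ge0.
rewrite -EFin_Rint//; apply: (L1_bounded K); first exact: mf_queue_step.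
by move=> a; exact: norm_bounds (queue_bounds n (act a x) (s a x + Num.max m 0)).
Qed.

(** Tonelli's theorem, the weight [t] being the integral over [m >= 0] of the indicator of
    [m <= t]. *)
Lemma killed_mass_queue n x : killed_mass hT n x =
  (\int[leb]_(m in `[0%R, +oo[) (queue mu act s H T n x m)%:E)%E.
Proof.
have hT0 y t : 0 <= hT y t by exact: h0.
have k0 t : 0 <= killed hT n x t by exact: killed_ge0.
have mk : mble (killed hT n x).
  exact: (mf_pair1 x (mf_killed mhT n)).
transitivity (\int[leb]_m \int[leb]_t
    ((0 <= m)%R%:R * (m <= t)%R%:R * killed hT n x t)%:E)%E; last first.
  rewrite integral_half_line; apply: eq_integral => m _; rewrite -killed_queue integral_half_line.
  rewrite -ge0_integralZl//.
  - by apply: eq_integral => t _; rewrite -!EFinM mulrA.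
  - by apply/mf_EFin; apply: mfM => //; exact: mf_le_ind.
  - by move=> t _; rewrite mule_ge0// lee_fin.
rewrite (fubini_tonelli (m1 := leb) (m2 := leb) (fun z : R * R =>
    ((0 <= z.1)%R%:R * (z.1 <= z.2)%R%:R * killed hT n x z.2)%:E)); last 2 first.
- apply/mf_EFin; apply: mfM; last exact: (mf_comp mk mf_snd).
  by apply: mfM; apply: mf_le_ind.
- by move=> z; rewrite lee_fin !mulr_ge0.
rewrite /killed_mass integral_half_line; apply: eq_integral => t _ /=.
under eq_integral do rewrite mulrC EFinM.
rewrite ge0_integralZl//; last 2 first.
- apply/mf_EFin; apply: mfM; exact: mf_le_ind.
- by rewrite lee_fin.
rewrite muleC [RHS]muleC EFinM.
have -> : (\int[leb]_m ((0 <= m)%R%:R * (m <= t)%R%:R)%:E = ((0 <= t)%R%:R * t)%:E)%E.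
  transitivity (\int[leb]_(m in `[0%R, t]) 1%:E)%E.
    rewrite [RHS]integral_mkcond; apply: eq_integral => m _.
    rewrite patchE mem_setE in_itv/=.
    by case: (0 <= m); case: (m <= t); rewrite ?mulr1 ?mulr0.
  rewrite integral_cst//= mul1e lebesgue_measure_itv/= lte_fin oppr0 adde0.
  case: ltgtP => [t0|t0|<-]; rewrite ?mul1r ?mul0r ?mulr0//.
by rewrite -!EFinM; congr EFin; ring.
Qed.

End Duality.
End KilledWalk.

(** * Transfer from the given probability space to the path space *)

Section PathLaw.
Context {R : realType} {d : nat} (dot : {dot 'cV[R]_d.+1 for idfun}) {disp : measure_display} {Omega : measurableType disp}.
Variables (P : probability Omega R) (g : nat -> {mfun Omega >-> GL R d}) (mu : probability (GL R d) R).
Local Notation G := (GL R d).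
Local Notation X := (PV R d).
Hypothesis g_iid : iid P g mu.

Definition trajectory (w : Omega) : path G := fun k => g k w.

Lemma mf_trajectory : mble trajectory.
Proof. by apply: mf_path => k; exact: measurable_funP. Qed.

Lemma path_law : exists Q : probability (path G) R,
  iid_law mu Q /\
  forall B, measurable B -> Q B = P (trajectory @^-1` B).
Proof.
pose tm : {mfun Omega >-> path G} := mfun_Sub (mem_set mf_trajectory).
exists (distribution P tm); split=> // n B mB.
have [g1 g2] := g_iid.
pose I := [fset k | k in iota 0 n]%fset.
have inI k : (k \in I) = (k < n)%N.
  apply/imfsetP/idP => [[j /= + ->]|kn]; first by rewrite mem_iota.
  by exists k => //=; rewrite mem_iota.
transitivity (P (trajectory @^-1` cylinder n B)); first by [].
have -> : trajectory @^-1` cylinder n B = \bigcap_(k in [set` I]) g k @^-1` B k.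
  apply/seteqP; split => w /= h k; first by move=> kI; apply: h; rewrite -inI.
  by move=> kn; apply: h => /=; rewrite inI.
rewrite g2// (eq_bigr (fun k => mu (B k))); last by move=> k _; exact: g1.
rewrite -(big_mkord xpredT (fun k => mu (B k))) /index_iota subn0.
apply: perm_big; apply: uniq_perm => [||k]; rewrite ?fset_uniq ?iota_uniq//.
by rewrite inI mem_iota.
Qed.

Lemma gprod_word n w : gprod g n w = word n (trajectory w).
Proof. by elim: n => //= n ->. Qed.

Section Killing.
Variables (s : G -> X -> R) (Q : probability (path G) R).
Hypotheses (ms : mble2 s)
  (sM : forall a b x, s (a * b)%g x = s a (GL_act b x) + s b x)
  (s1 : forall x, s 1%g x = 0)
  (Q_cyl : iid_law mu Q)
  (Q_traj : forall B, measurable B -> Q B = P (trajectory @^-1` B)).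

Lemma mf_act_word n x : mble (fun sp : path G => GL_act (word n sp) x).
Proof.
apply: (mf_app2 (F := GL_act)) => //; [exact: mf_GL_act|exact: mf_word].
Qed.

Lemma mf_s_word n x : mble (fun sp : path G => s (word n sp) x).
Proof.
apply: (mf_app2 (F := s)) => //; exact: mf_word.
Qed.

Lemma Rint_trajectory (f : path G -> R) : mble f ->
  \int[Q]_sp f sp = \int[P]_w f (trajectory w).
Proof. by move=> mf; exact: (Rint_pushforward mf_trajectory mf Q_traj).1. Qed.

Variables (h : X -> R -> R) (K : R).
Hypotheses (mh : mble2 h)
  (h0 : forall x t, 0 <= h x t)
  (hK : forall x t, h x t <= K).

Definition killed_path n x t (sp : path G) : R :=
  (\prod_(k < n) (0 <= t + s (word k sp) x)%R%:R) *
  h (GL_act (word n sp) x) (t + s (word n sp) x).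

Lemma killed_path_cons n x t a sp : killed_path n.+1 x t (scons a sp) =
  (0 <= t)%R%:R * killed_path n (GL_act a x) (t + s a x) sp.
Proof.
have wl (k : 'I_n) : word (lift ord0 k) (scons a sp) = (word k sp * a)%g by exact: word_cons.
have assoc v : t + (v + s a x) = t + s a x + v by rewrite [v + _]addrC addrA.
rewrite /killed_path big_ord_recl word_cons actM sM assoc [word ord0 _]/= s1 addr0 -mulrA.
congr (_ * (_ * h _ _)); apply: eq_bigr => k _.
by rewrite wl sM assoc.
Qed.

Lemma mf_killed_path n x t : mble (killed_path n x t).
Proof.
apply: mfM.
  apply: measurable_prod => k _; apply: mf_le_ind => //.
  by apply: mfD => //; exact: mf_s_word.
apply: (mf_app2 (F := h)) => //; first exact: mf_act_word.
by apply: mfD => //; exact: mf_s_word.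
Qed.

Lemma killed_path_bounds n x t sp : 0 <= killed_path n x t sp <= K.
Proof.
have p01 : 0 <= \prod_(k < n) ((0 <= t + s (word k sp) x)%R%:R : R) <= 1.
  apply/andP; split; first by apply: prodr_ge0 => k _; exact: ler0n.
  by apply: prodr_ile1 => k _; rewrite ler0n lern1 leq_b1.
have /andP[p0 p1] := p01; rewrite mulr_ge0//= /killed_path.
by apply: le_trans (hK (GL_act (word n sp) x) (t + s (word n sp) x)); rewrite ler_piMl.
Qed.

Lemma L1_killed_path n x t : L1 Q (killed_path n x t).
Proof.
apply: (L1_bounded K); first exact: mf_killed_path.
by move=> sp; exact: norm_bounds (killed_path_bounds n x t sp).
Qed.

Lemma Rint_killed_path n x t : \int[Q]_sp killed_path n x t sp = killed mu GL_act s h n x t.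
Proof.
elim: n x t => [|n IH] x t.
  rewrite -[RHS](Rint_cst Q); apply: eq_Rint => sp.
  by rewrite /killed_path big_ord0 mul1r /= act1 s1 addr0.
rewrite (@Rint_cons_bounded _ _ _ mu Q Q_cyl (killed_path n.+1 x t) K); last 2 first.
- exact: mf_killed_path.
- by move=> sp; exact: norm_bounds (killed_path_bounds n.+1 x t sp).
rewrite /= -RintZ; last exact: (L1_killed_step mu (mf_GL_act dot) ms mh h0 hK).
apply: eq_Rint => a; rewrite -IH -RintZ; last exact: L1_killed_path.
by apply: eq_Rint => sp; exact: killed_path_cons.
Qed.

(** [tau] looks at times from 1 on, whereas the product starts at [k = 0]; that factor is the
    indicator of [0 <= t], hence 1. The condition [n - 1 < tau] concerns exactly the times below
    [n]. *)
Lemma tau_gt n x t w : (0 < n)%N -> 0 <= t ->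
  (\1_[set w | ((n%:R - 1)%:E < tau g s x t w)%E] w : R) =
  \prod_(k < n) (0 <= t + s (word k (trajectory w)) x)%R%:R.
Proof.
move=> n0 t0.
have iff : ((n%:R - 1)%:E < tau g s x t w)%E <->
    forall k : 'I_n, 0 <= t + s (word k (trajectory w)) x.
  split=> [lt k|all].
    rewrite leNgt; apply/negP => neg.
    have k0 : (0 < k)%N.
      by rewrite lt0n; apply/negP => /eqP k0; move: neg; rewrite k0 /= s1 addr0 ltNge t0.
    have : (tau g s x t w <= k%:R%:E)%E.
      by apply: ereal_inf_lbound; exists k => //=; split=> //; rewrite gprod_word.
    move=> /(lt_le_trans lt); rewrite lte_fin ltrBlDr natr1 ltr_nat ltnS leqNgt ltn_ord.
    by [].
  apply: (@lt_le_trans _ _ (n%:R)%:E); first by rewrite lte_fin ltrBlDr ltrDl.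
  apply: le_ereal_inf_tmp => _ /= [k [k1 neg] <-]; rewrite lee_fin ler_nat leqNgt; apply/negP => kn.
  by have := all (Ordinal kn); rewrite -gprod_word /= leNgt neg.
rewrite indicE; have [A|A] := pselect ([set w | ((n%:R - 1)%:E < tau g s x t w)%E] w).
  rewrite mem_set// big1// => k _; move/iff: A => /(_ k) h'.
  by rewrite h'.
rewrite memNset//; apply/esym/eqP.
have [k nk] : exists k : 'I_n, ~~ (0 <= t + s (word k (trajectory w)) x).
  apply: contrapT => no; apply: A; apply/iff => k; apply: contrapT => /negP nk.
  by apply: no; exists k.
by rewrite prodf_seq_eq0; apply/hasP; exists k; rewrite ?mem_index_enum//= (negbTE nk).
Qed.

Lemma expectation_killed n x t : (0 < n)%N -> 0 <= t ->
  expectation_on P (fun w => h (GL_act (gprod g n w) x) (t + s (gprod g n w) x))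
    [set w | ((n%:R - 1)%:E < tau g s x t w)%E] = killed mu GL_act s h n x t.
Proof.
move=> n0 t0; rewrite -Rint_killed_path Rint_trajectory; last exact: mf_killed_path.
rewrite /expectation_on unlock /Rintegral; congr fine; apply: eq_integral => w _ /=.
by rewrite tau_gt// gprod_word mulrC.
Qed.

Lemma harmonic_integral n x : (0 < n)%N ->
  \int[lebesgue_measure]_(t in `[0%R, +oo[) (t * expectation_on P
    (fun w => h (GL_act (gprod g n w) x) (t + s (gprod g n w) x))
    [set w | ((n%:R - 1)%:E < tau g s x t w)%E]) =
  fine (killed_mass mu GL_act s h n x).
Proof.
move=> n0; rewrite /Rintegral; congr fine; apply: eq_integral => t.
rewrite mem_setE in_itv/= andbT => t0; by rewrite expectation_killed.
Qed.

End Killing.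
End PathLaw.

Lemma norm_tail_le (R : realType) (l A : R) : 0 <= l -> `|Num.max (l - A) 0| <= l + `|A|.
Proof.
move=> l0; have A1 := ler_norm A; have A2 := ler_norm (- A).
rewrite normrN in A2; have A3 := normr_ge0 A.
by rewrite ger0_norm ?le_max ?lexx ?orbT// ge_max; apply/andP; split; lra.
Qed.

Lemma sigma1 (R : realType) (d : nat) (dot : {dot 'cV[R]_d.+1 for idfun}) x : sigma dot 1%g x = 0.
Proof.
have := sigmaM dot 1%g 1%g x; rewrite mulg1 act1 => /eqP.
by rewrite -subr_eq subrr => /eqP.
Qed.

(** * The zero exponent centers the cocycle under the stationary measure *)

Section Centering.
Context {R : realType} {d : nat} (dot : {dot 'cV[R]_d.+1 for idfun})
  {disp : measure_display} {Omega : measurableType disp}.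
Variables (P : probability Omega R) (g : nat -> {mfun Omega >-> GL R d}).
Variables (mu : probability (GL R d) R) (nu : probability (PV R d) R) (Q : probability (path (GL R d)) R).
Local Notation G := (GL R d).
Local Notation X := (PV R d).
Local Notation ell := (ell dot).
Local Notation sigma := (sigma dot).
Hypotheses (Q_cyl : iid_law mu Q)
  (Q_traj : forall B, measurable B -> Q B = P (trajectory g @^-1` B))
  (nu_stationary : stationary mu nu)
  (L1_ell : L1 mu ell)
  (tail : forall e, 0 < e -> exists2 A, 0 <= A & \int[mu]_a Num.max (ell a - A) 0 <= e)
  (lam0 : lyapunov_exponent P g dot 0).

Let drift n x := \int[Q]_sp sigma (word n sp) x.

Lemma sigma_steps n sp x : `|sigma (word n sp) x| <= steps dot n sp.
Proof. by apply: le_trans (sigma_ell _ _ _) _; exact: ell_word. Qed.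

Lemma mf_sigma_word n : mble (fun z : path G * X => sigma (word n z.1) z.2).
Proof.
apply: (mf_app2 (F := sigma)) => //; [exact: mf_sigma|exact: (mf_comp (mf_word n) mf_fst)].
Qed.

Lemma L1_sigma_word n x : L1 Q (fun sp => sigma (word n sp) x).
Proof.
apply: (L1_le (g := steps dot n)) => [||sp]; [|exact: L1_steps Q_cyl L1_ell n|exact: sigma_steps].
exact: (mf_pair2 (f := fun z : path G * X => sigma (word n z.1) z.2) x
  (mf_sigma_word n)).
Qed.

Lemma Rint_cvg0 {dT} {T : measurableType dT} (p : probability T R) (f : nat -> T -> R) (b : T -> R) :
  (forall n, mble (f n)) -> (forall n x, `|f n x| <= b x) -> L1 p b ->
  {ae p, forall x, f n x @[n --> \oo] --> (0 : R)} ->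
  (\int[p]_x f n x) @[n --> \oo] --> (0 : R).
Proof.
move=> mf fb Lb f0.
have Lf n : L1 p (f n) by exact: L1_le Lb (fb n).
have f0' : {ae p, forall x, setT x -> (f n x)%:E @[n --> \oo] --> cst 0%E x}.
  by apply: filterS f0 => x fx _; apply: cvg_EFin; [exact: nearW|exact: fx].
have fb' : {ae p, forall x n, setT x -> (`|(f n x)%:E| <= (b x)%:E)%E}.
  by apply: aeW => x n _ /=; rewrite lee_fin.
have [_ _ cv] := @dominated_convergence _ _ _ p setT measurableT
  (fun n x => (f n x)%:E) (cst 0%E) (fun x => (b x)%:E) (fun n => proj2 (mf_EFin _ _) (mf n))
  (measurable_cst _) f0' Lb fb'.
have : (\int[p]_x f n x)%:E @[n --> \oo] --> (0 : R)%:E.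
  have -> : (0 : R)%:E = (\int[p]_x (cst 0%E x))%E by rewrite integral0.
  under eq_fun do rewrite EFin_Rint//.
  exact: cv.
by move/fine_cvg; apply.
Qed.

Lemma L1_tail A : L1 mu (fun a => Num.max (ell a - A) 0).
Proof.
apply: (L1_le (g := fun a => ell a + `|A|)) => [||a].
- by apply: measurable_maxr => //; apply: mfB => //; exact: mf_ell.
- by apply: L1D => //; exact: L1_cst.
by have /= l0 := ell_ge0 dot a; exact: norm_tail_le.
Qed.

(** The normalised cocycle is truncated at [A], and its excess over [A] is at most the average of
    the excesses of the [ell], of mean independent of [n]. The truncated part is bounded, so that
    dominated convergence applies to it. *)
Lemma drift_tail A n x : 0 <= A -> `|n%:R^-1 * drift n x| <=
  \int[Q]_sp Num.min `|n%:R^-1 * sigma (word n sp) x| A + \int[mu]_a Num.max (ell a - A) 0.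
Proof.
move=> A0; pose f k (sp : path G) := Num.max (ell (sp k) - A) 0.
have Lf k : L1 Q (f k).
  have m := L1_measurable (L1_tail A).
  exact: (Rint_coordinate Q_cyl k m).2 (L1_tail A).
have If k : \int[Q]_sp f k sp = \int[mu]_a Num.max (ell a - A) 0.
  exact: (Rint_coordinate Q_cyl k (L1_measurable (L1_tail A))).1.
have Lm : L1 Q (fun sp => Num.min `|n%:R^-1 * sigma (word n sp) x| A).
  apply: (L1_bounded A) => [|sp]; last by rewrite ger0_norm ?ge_min ?lexx ?orbT// le_min normr_ge0.
  by apply: measurable_minr => //; exact: L1_measurable (L1_norm (L1Z _ (L1_sigma_word n x))).
rewrite -RintZ; last exact: L1_sigma_word.
apply: le_trans (Rint_norm (L1Z _ (L1_sigma_word n x))) _.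
apply: (@le_trans _ _ (\int[Q]_sp (Num.min `|n%:R^-1 * sigma (word n sp) x| A +
   n%:R^-1 * \sum_(k < n) f k sp))).
  apply: Rint_le => [||sp].
  - exact: L1_norm (L1Z _ (L1_sigma_word n x)).
  - by apply: L1D => //; apply: L1Z; exact: L1_sum.
  have [n0|n0] := posnP n; first by subst n; rewrite invr0 !mul0r normr0 addr0 le_min lexx A0.
  have [le|lt] := leP `|n%:R^-1 * sigma (word n sp) x| A.
    by rewrite lerDl mulr_ge0 ?invr_ge0 ?sumr_ge0// => k _; rewrite le_max lexx orbT.
  rewrite normrM ger0_norm ?invr_ge0// -lerBlDl ler_pdivlMl ?ltr0n// mulrBr mulrA mulfV ?pnatr_eq0 -?lt0n// mul1r.
  apply: le_trans (lerB (sigma_steps n sp x) (lexx _)) _.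
  rewrite /steps -[n in n%:R]card_ord -sum1_card natr_sum mulr_suml -sumrB.
  by apply: ler_sum => k _; rewrite mul1r le_max lexx.
rewrite RintD//; last by apply: L1Z; exact: L1_sum.
rewrite lerD2l RintZ ?Rint_sum//; last exact: L1_sum.
under eq_bigr do rewrite If.
rewrite sumr_const card_ord -[X in _ * X]mulr_natl mulrA.
have [n0|n0] := posnP n; last by rewrite mulVf ?mul1r// pnatr_eq0 -lt0n.
by subst n; rewrite invr0 !mul0r Rint_ge0// => a; rewrite le_max lexx orbT.
Qed.

Lemma drift_cvg x : (n%:R^-1 * drift n x) @[n --> \oo] --> (0 : R).
Proof.
apply/cvgr0Pnorm_lt => e e0.
have [A A0 tA] : exists2 A, 0 <= A & \int[mu]_a Num.max (ell a - A) 0 <= e / 2.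
  by apply: tail; rewrite divr_gt0.
pose f n (w : Omega) := Num.min `|n%:R^-1 * sigma (gprod g n w) x| A.
have mz n : mble (fun sp : path G => Num.min `|n%:R^-1 * sigma (word n sp) x| A).
  by apply: measurable_minr => //; exact: L1_measurable (L1_norm (L1Z _ (L1_sigma_word n x))).
have fE n w : f n w = Num.min `|n%:R^-1 * sigma (word n (trajectory g w)) x| A.
  by rewrite /f gprod_word.
have mf n : mble (f n).
  apply: (eq_measurable_fun (fun w => Num.min `|n%:R^-1 * sigma (word n (trajectory g w)) x| A)).
    by move=> w _; rewrite fE.
  exact: mf_comp (mz n) (mf_trajectory g).
have f0A n w : 0 <= f n w <= A by rewrite /f le_min normr_ge0 A0 ge_min lexx orbT.
have cf : (\int[P]_w f n w) @[n --> \oo] --> (0 : R).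
  apply: (@Rint_cvg0 _ _ P f (cst A)) => //; last 2 first.
  - exact: L1_cst.
  - have := lam0 x; apply: filterS => w cw; apply: norm_cvg0.
    have cn : `|n%:R^-1 * sigma (gprod g n w) x| @[n --> \oo] --> (0 : R).
      by rewrite -(@normr0 _ R); exact: cvg_norm cw.
    apply: (@squeeze_cvgr _ _ _ _ (cst 0) (fun n => `|n%:R^-1 * sigma (gprod g n w) x|)) => //; last exact: cvg_cst.
    by apply: nearW => n; rewrite /= normr_ge0/= ger0_norm ?ge_min ?lexx//; have /andP[] := f0A n w.
  by move=> n w; rewrite ger0_norm; have /andP[] := f0A n w.
have e2 : 0 < e / 2 by rewrite divr_gt0.
have /cvgr0Pnorm_lt/(_ _ e2) := cf; apply: filterS => n lt.
apply: le_lt_trans (drift_tail n x A0) _.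
have -> : \int[Q]_sp Num.min `|n%:R^-1 * sigma (word n sp) x| A = \int[P]_w f n w.
  by rewrite (Rint_trajectory Q_traj (mz n)); apply: eq_Rint => w; rewrite fE.
rewrite [e]splitr; apply: ltr_leD => //.
by apply: le_lt_trans lt; exact: ler_norm.
Qed.

Lemma mf_drift n : mble (drift n).
Proof. exact: (mf_Rint1 (mf_sigma_word n)). Qed.

Lemma mf_sigma1 x : mble (fun a => sigma a x).
Proof. exact: (mf_pair2 x (mf_sigma dot)). Qed.

Lemma mf_drift_step n : mble (fun z : G * X => drift n (GL_act z.1 z.2) + sigma z.1 z.2).
Proof.
apply: mfD; last exact: mf_sigma.
exact: (mf_comp (mf_drift n) (mf_GL_act dot)).
Qed.

Lemma driftS n x : drift n.+1 x = \int[mu]_a (drift n (GL_act a x) + sigma a x).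
Proof.
have L := L1_sigma_word n.+1 x.
rewrite {1}/drift.
have [-> _ _] := @glue_dominated _ _ dot mu Q Q_cyl L1_ell 1 n _ (L1_measurable L) (fun s => le_trans (sigma_steps n.+1 s x) (ler_peMl (steps_ge0 _ _ _) (ler1n _ 4))).
have E s s' : sigma (word n.+1 (glue 1 s s')) x = sigma (word n s') (GL_act (s 0%N) x) + sigma (s 0%N) x.
  by rewrite -[n.+1]/(1 + n)%N word_glue sigmaM [word 1 s]/= mulg1.
transitivity (\int[Q]_s (drift n (GL_act (s 0%N) x) + sigma (s 0%N) x)).
  apply: eq_Rint => s; under eq_Rint do rewrite E.
  by rewrite RintD ?Rint_cst//; [exact: L1_sigma_word|exact: L1_cst].
apply: (Rint_coordinate Q_cyl 0%N (f := fun a => drift n (GL_act a x) + sigma a x) _).1.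
exact: (mf_pair2 x (mf_drift_step n)).
Qed.

Lemma drift_le n x : `|drift n x| <= n%:R * \int[mu]_a ell a.
Proof.
have L := L1_sigma_word n x.
apply: le_trans (Rint_norm L) _.
have -> : n%:R * \int[mu]_a ell a = \int[Q]_sp steps dot n sp.
  rewrite -[RHS]/(\int[Q]_sp \sum_(k < n) (fun k (sp : path G) => ell (sp k)) k sp).
  rewrite Rint_sum => [|k _]; last first.
    exact: (Rint_coordinate Q_cyl k (L1_measurable L1_ell)).2 L1_ell.
  under eq_bigr do rewrite (Rint_coordinate Q_cyl _ (L1_measurable L1_ell)).1.
  by rewrite sumr_const card_ord mulr_natl.
apply: Rint_le; [exact: L1_norm|exact: L1_steps Q_cyl L1_ell n|by move=> sp; exact: sigma_steps].
Qed.

Lemma mean_drift n : \int[nu]_x drift n x = n%:R * \int[prodP mu nu]_z sigma z.1 z.2.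
Proof.
elim: n => [|n IH].
  rewrite mul0r -[RHS](Rint_cst nu); apply: eq_Rint => x.
  rewrite -[RHS](Rint_cst Q); apply: eq_Rint => sp.
  exact: sigma1.
pose M := n%:R * \int[mu]_a ell a.
have mD1 : mble (fun z : G * X => drift n (GL_act z.1 z.2)).
  exact: (mf_comp (mf_drift n) (mf_GL_act dot)).
have Ld : L1 (prodP mu nu) (fun z => drift n (GL_act z.1 z.2)).
  by apply: (L1_bounded M) => // z; exact: drift_le.
have Ls : L1 (prodP mu nu) (fun z => sigma z.1 z.2).
  apply: (L1_le (g := fun z => ell z.1)) => [||z]; last exact: sigma_ell.
  - exact: mf_sigma.
  - exact: L1_fst.
have Lx x : L1 mu (fun a => drift n (GL_act a x) + sigma a x).
  apply: L1D.
    apply: (L1_bounded M) => [|a]; last exact: drift_le.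
    exact: (mf_pair2 x mD1).
  apply: (L1_le (g := ell)) => [||a]; last exact: sigma_ell.
  - exact: mf_sigma1.
  - exact: L1_ell.
transitivity (\int[prodP mu nu]_z (drift n (GL_act z.1 z.2) + sigma z.1 z.2)).
  rewrite Rint_prod21//; last exact: L1D.
  by apply: eq_Rint => x; exact: driftS.
rewrite RintD// -(integral_stationary (mf_GL_act dot) nu_stationary (mf_drift n)).
by rewrite IH -[in RHS]natr1 mulrDl mul1r.
Qed.

(** By stationarity the mean drift over [n] steps is exactly [n] times this integral, while divided
    by [n] it tends to 0 because the exponent is zero. *)
Lemma sigma_centered : \int[prodP mu nu]_z sigma z.1 z.2 = 0.
Proof.
set v := \int[_]_z _.
have m1 : \int[mu]_a ell a = \int[mu]_a ell a by [].
have cv : (\int[nu]_x (n%:R^-1 * drift n x)) @[n --> \oo] --> (0 : R).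
  apply: (@Rint_cvg0 _ _ nu _ (cst (\int[mu]_a ell a))) => [n|n x||].
  - by apply: mfM => //; exact: mf_drift.
  - rewrite normrM ger0_norm ?invr_ge0//.
    have [n0|n0] := posnP n; first by subst n; rewrite invr0 mul0r Rint_ge0// => a; exact: ell_ge0.
    by rewrite ler_pdivrMl ?ltr0n//; exact: drift_le.
  - exact: L1_cst.
  by apply: aeW => x; exact: drift_cvg.
have cst_v : (\int[nu]_x (n%:R^-1 * drift n x)) @[n --> \oo] --> v.
  apply: cvg_near_cst; exists 1%N => // n /= n0.
  rewrite RintZ ?mean_drift ?mulrA ?mulVf ?mul1r ?pnatr_eq0 -?lt0n//.
  apply: (L1_bounded (n%:R * \int[mu]_a ell a)); first exact: mf_drift.
  by move=> x; exact: drift_le.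
by apply: (cvg_unique _ cst_v cv); exact: Rhausdorff.
Qed.

End Centering.

(** * Approximation of continuous functions by functions Lipschitz in the line *)

Section LipschitzApproximation.
Context {R : realType} {d : nat} (dot : {dot 'cV[R]_d.+1 for idfun}).
Local Notation V := 'cV[R]_d.+1.
Local Notation N := (enorm dot).
Local Notation X := (PV R d).
Local Notation pc := (pc dot).

(** A distance with an immediate triangle inequality, which the envelope needs; [pdist_sd] compares
    it with the angle. *)
Definition pdist x y : R := \sum_i \sum_j `|pc i j x - pc i j y|.

Lemma pdist_ge0 x y : 0 <= pdist x y.
Proof. by apply: sumr_ge0 => i _; apply: sumr_ge0 => j _; exact: normr_ge0. Qed.

Lemma pdistC x y : pdist x y = pdist y x.
Proof. by apply: eq_bigr => i _; apply: eq_bigr => j _; rewrite distrC. Qed.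

Lemma pdist_xx x : pdist x x = 0.
Proof. by rewrite /pdist big1// => i _; rewrite big1// => j _; rewrite subrr normr0. Qed.

Lemma pdist_triangle y x z : pdist x z <= pdist x y + pdist y z.
Proof.
rewrite /pdist -big_split; apply: ler_sum => i _; rewrite -big_split; apply: ler_sum => j _.
exact: ler_distD.
Qed.

Lemma coord_le_pdist i j x y : `|pc i j x - pc i j y| <= pdist x y.
Proof.
rewrite /pdist (bigD1 i)//= (bigD1 j)//= -addrA lerDl addr_ge0// ?sumr_ge0// => k _.
by apply: sumr_ge0 => l _; exact: normr_ge0.
Qed.

Lemma continuous_pdist x : continuous (pdist x).
Proof.
apply: continuous_sum => i; apply: continuous_sum => j y.
apply: (@continuous_comp _ _ _ (fun y => pc i j x - pc i j y) (fun t : R => `|t|)); last exact: norm_continuous.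
by apply: continuousB; [exact: cst_continuous|exact: continuous_pc].
Qed.

Lemma mf_pdist y : mble (fun x => pdist x y).
Proof.
apply: continuous_measurable_PV; rewrite (_ : (fun x => _) = pdist y); first exact: continuous_pdist.
by apply/funext => x; exact: pdistC.
Qed.

Lemma pc_sd i j x y : `|pc i j x - pc i j y| <= 4 * Cco dot ^+ 2 * sd dot x y.
Proof.
have [c c0 [nE dE]] := chord dot x y.
set u := vec x in nE dE *; set v := c *: vec y in nE dE *.
have u0 : 0 < N u by rewrite enorm_gt0// vec_neq0.
have yE : pc i j y = v i 0 * v j 0 / dot v v.
  have -> : dot v v = c * (c * dot (vec y) (vec y)) by rewrite /v linearZl_LR linearZr_LR.
  rewrite /pc !/(pc _ _ _) /v !mxE.
  have d0 : dot (vec y) (vec y) != 0 by rewrite gt_eqF// dot_gt0// vec_neq0.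
  by field; rewrite c0 d0.
rewrite yE /pc !/(pc _ _ _) -/u -!sqr_enorm nE -mulrBl normrM normfV (ger0_norm (exprn_ge0 2 (ltW u0))).
rewrite ler_pdivrMr ?exprn_gt0//.
have C0 := ltW (Cco_gt0 dot).
have a1 := coord_le dot u i; have a2 := coord_le dot v j; rewrite nE in a2.
have vE k : c * vec y k 0 = v k 0 by rewrite mxE.
have b1 : `|(v - u) i 0| <= Cco dot * (2 * N u * sd dot x y).
  by apply: le_trans (coord_le dot _ i) _; rewrite ler_wpM2l.
have b2 : `|(v - u) j 0| <= Cco dot * (2 * N u * sd dot x y).
  by apply: le_trans (coord_le dot _ j) _; rewrite ler_wpM2l.
move: b1 b2; rewrite !mxE !vE => b1 b2.
have E (a b a' b' : R) : a * b - a' * b' = - (a * (b' - b) + b' * (a' - a)) by ring.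
rewrite E.
rewrite normrN; apply: le_trans (ler_normD _ _) _; rewrite !normrM.
have e1 := ler_pM (normr_ge0 _) (normr_ge0 _) a1 b2.
have e2 := ler_pM (normr_ge0 _) (normr_ge0 _) a2 b1.
apply: le_trans (lerD e1 e2) _.
by apply: le_of_eq; ring.
Qed.

Lemma pdist_sd : exists2 k : R, 0 <= k & forall x y, pdist x y <= k * sd dot x y.
Proof.
exists (d.+1%:R * (d.+1%:R * (4 * Cco dot ^+ 2))) => [|x y].
  by rewrite !mulr_ge0 ?exprn_ge0// ltW// Cco_gt0.
apply: (@le_trans _ _ (\sum_(i < d.+1) \sum_(j < d.+1) (4 * Cco dot ^+ 2 * sd dot x y))).
  by apply: ler_sum => i _; apply: ler_sum => j _; exact: pc_sd.
by rewrite !sumr_const card_ord -!mulrA !mulr_natl.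
Qed.

Lemma finite_net (e : R) : 0 < e -> exists s : seq X, forall x, exists2 y, y \in s & pdist x y < e.
Proof.
move=> e0; have := @compact_PV R d; rewrite compact_cover.
move=> /(_ X setT (fun y => [set x | pdist y x < e])) [y _|x _|s _ hs].
- rewrite -[X in open X]/(pdist y @^-1` [set t | t < e]).
  by apply: open_comp => [x _|]; [exact: continuous_pdist|exact: open_lt].
- by exists x => //=; rewrite pdist_xx.
exists (finmap.enum_fset s) => x; have [y ys /= h] := hs x Logic.I.
by exists y => //; rewrite pdistC.
Qed.

Section Compact.
Variables (h : X * R -> R).
Hypothesis ch : continuous h.

Lemma uniform_pdist (C e : R) : 0 < e -> exists2 a : R, 0 < a &
  forall x y t, `|t| <= C -> pdist x y < a -> `|h (x, t) - h (y, t)| <= e.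
Proof.
move=> e0.
pose P n (z : X * R) := forall y, pdist z.1 y < n.+1%:R^-1 -> `|h z - h (y, z.2)| <= e.
have [||[x0 t0] _|n hn] := @compact_uniform (X * R)%type (setT `*` `[- C, C]) P.
- by apply: compact_setX; [exact: compact_PV|exact: segment_compact].
- move=> n m z nm Pn y lt; apply: Pn; apply: lt_le_trans lt _.
  by rewrite lef_pV2 ?posrE// ler_nat.
- have e2 : 0 < e / 2 by rewrite divr_gt0.
  have /cvgrPdist_lt/(_ _ e2) [[U V] /= [nU nV] UV] := @ch (x0, t0).
  have [b b0 hb] : exists2 b : R, 0 < b & forall y, pdist x0 y < b -> U y.
    move: nU; rewrite nbhsE/= => -[U' [oU' Ux] UU'].
    have [b b0 hb] := PV_gen dot oU' Ux; exists b => // y lt.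
    apply: UU'; apply: hb => ij; rewrite distrC; apply: le_lt_trans lt.
    exact: coord_le_pdist.
  have [n nb] := upper_nat (2 / b); exists n.
  have nb' : n.+1%:R^-1 <= b / 2.
    rewrite -[leRHS]invrK lef_pV2 ?posrE ?invr_gt0 ?divr_gt0// invf_div.
    by apply: le_trans nb _; rewrite ler_nat.
  exists ([set x | pdist x0 x < b / 2], V) => /=.
    split=> //; have := @continuous_pdist x0 x0 [set t | t < b / 2]; apply.
    by rewrite pdist_xx; apply: open_nbhs_nbhs; split; [exact: open_lt|rewrite /= divr_gt0].
  move=> [x t] /= [lx Vt] y ly.
  have Ux : U x by apply: hb; apply: lt_trans lx _; rewrite ltr_pdivrMr// mulrC ltr_pMl// ltr1n.
  have Uy : U y.
    apply: hb; apply: le_lt_trans (pdist_triangle x _ _) _.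
    by rewrite [b]splitr; apply: ltrD => //; exact: lt_le_trans nb'.
  have h1 := UV (x, t) (conj Ux Vt); have h2 := UV (y, t) (conj Uy Vt).
  rewrite /= in h1 h2.
  have -> : h (x, t) - h (y, t) = (h (x0, t0) - h (y, t)) - (h (x0, t0) - h (x, t)) by ring.
  by apply: le_trans (ler_normB _ _) _; rewrite [e]splitr; apply: ltW; apply: ltrD.
exists n.+1%:R^-1 => // x y t tC lt; apply: (hn (x, t)) => //=.
by split=> //=; rewrite in_itv/= -ler_norml.
Qed.

(** Continuity refers to the product topology and measurability to the product sigma-algebra; they
    are related by the coordinates [pc] and the level, whose boxes form a countable base. *)
Lemma mf_continuous_prod : mble h.
Proof.
pose c (o : option ('I_d.+1 * 'I_d.+1)) (z : X * R) := if o is Some ij then pc ij.1 ij.2 z.1 else z.2.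
have c_gen U z : open U -> U z -> exists2 e : R, 0 < e &
    forall y, (forall o, `|c o y - c o z| < e) -> U y.
  move=> oU Uz; have [[A B] /= [nA nB] AB] : nbhs z U by exact: open_nbhs_nbhs.
  move: nA; rewrite nbhsE/= => -[A' [oA' Az] AA'].
  have [a a0 ha] := PV_gen dot oA' Az.
  move: nB => /nbhs_ballP[b /= b0 hb].
  exists (Num.min a b); first by rewrite lt_min a0.
  move=> y hy; apply: AB; split=> /=.
    apply: AA'; apply: ha => ij; have := hy (Some ij); rewrite lt_min => /andP[+ _].
    by [].
  apply: hb; rewrite /ball/= distrC.
  by have := hy None; rewrite lt_min => /andP[_ +].
rewrite -[h]/(h \o id); apply: mf_open_preimage => // U oU.
apply: (mf_coord_open c_gen) => // -[ij|] /=; last exact: mf_snd.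
exact: (mf_comp (mf_pc dot ij.1 ij.2) mf_fst).
Qed.

End Compact.

Lemma compact_support_bounds (h : X * R -> R) : continuous h -> compactly_supported h ->
  exists C M : R, [/\ 0 < C, 0 <= M, forall x t, C < `|t| -> h (x, t) = 0 & forall z, `|h z| <= M].
Proof.
move=> ch; rewrite /compactly_supported; set S := closure _ => cS.
have [C [Cr hC]] : bounded_set (snd @` S).
  apply: compact_bounded; apply: continuous_compact cS; apply: continuous_subspaceT => z; exact: cvg_snd.
have [M [Mr hM]] : bounded_set (h @` S).
  by apply: compact_bounded; apply: continuous_compact cS; exact: continuous_subspaceT.
exists (`|C| + 1), (`|M| + 1); split=> [||x t lt|z]; rewrite ?ltr_wpDl ?addr_ge0//.
  apply/eqP; apply: contrapT => /negP n0; have zS : S (x, t) by exact: subset_closure.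
  have : `|t| <= `|C| + 1.
    apply: hC => /=; first by rewrite (le_lt_trans (ler_norm C))// ltrDl.
    by exists (x, t).
  by rewrite leNgt lt.
have [->|n0] := eqVneq (h z) 0; first by rewrite normr0 addr_ge0.
have zS : S z by exact: subset_closure.
apply: hM => /=; first by rewrite (le_lt_trans (ler_norm M))// ltrDl.
by exists z.
Qed.

(* Pasch-Hausdorff envelope over a finite net. *)
Fixpoint envelope (h : X * R -> R) (M lam : R) (s : seq X) (x : X) (t : R) : R :=
  if s is y :: s' then Num.min (h (y, t) + lam * pdist x y) (envelope h M lam s' x t) else M.

Section Envelope.
Variables (h : X * R -> R) (M lam : R).
Hypotheses (ch : continuous h)
  (lam0 : 0 <= lam).

Lemma mf_envelope s : mble (fun z : X * R => envelope h M lam s z.1 z.2).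
Proof.
elim: s => [|y s IH] /=; first exact: measurable_cst.
apply: measurable_minr => //; apply: mfD.
  apply: (mf_comp (f := h) (g := fun z : X * R => (y, z.2))); first exact: mf_continuous_prod.
  by apply: mf_pair => //; exact: mf_snd.
apply: mfM => //.
exact: (mf_comp (mf_pdist y) mf_fst).
Qed.

Lemma envelope_lip s x y t : envelope h M lam s x t <= envelope h M lam s y t + lam * pdist x y.
Proof.
elim: s => [|z s IH] /=; first by rewrite lerDl mulr_ge0// pdist_ge0.
rewrite addr_minl le_min !ge_min; apply/andP; split; apply/orP; last by right.
by left; rewrite -addrA lerD2l -mulrDr ler_wpM2l// addrC pdist_triangle.
Qed.

Lemma envelope_le s x t y : y \in s -> envelope h M lam s x t <= h (y, t) + lam * pdist x y.
Proof.
elim: s => //= z s IH; rewrite inE => /orP[/eqP->|/IH]; rewrite ge_min; first by rewrite lexx.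
by move=> ->; rewrite orbT.
Qed.

Lemma envelope_ge s x t c : c <= M -> (forall y, c <= h (y, t) + lam * pdist x y) ->
  c <= envelope h M lam s x t.
Proof. by move=> cM hc; elim: s => //= z s IH; rewrite le_min hc. Qed.

Lemma envelope_leM s x t : envelope h M lam s x t <= M.
Proof. by elim: s => //= z s IH; rewrite ge_min IH orbT. Qed.

End Envelope.

(** In the level only measurability is asked, so the support may be cut off by an indicator:
    integration over the level provides the regularity of [H]. *)
Definition lipschitz_test (F : X -> R -> R) (C K lam : R) :=
  [/\ mble2 F,
      forall x t, 0 <= F x t <= K, forall x t, C < `|t| -> F x t = 0 &
      forall x y t, `|F x t - F y t| <= lam * pdist x y].

Lemma lip_cutoff (b : bool) (k a c e : R) : 0 <= k -> a <= c + k -> c <= a + k ->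
  `|Num.max (a + e) 0 * b%:R - Num.max (c + e) 0 * b%:R| <= k.
Proof.
move=> k0 h1 h2; case: b; rewrite ?mulr0 ?mulr1 ?subr0 ?normr0//.
by rewrite ler_norml; apply/andP; split; do 2! (case: (leP _ 0) => ?); lra.
Qed.

Lemma lipschitz_cutoff (f : X -> R -> R) (C M lam e : R) : 0 <= lam ->
  mble2 f -> (forall x t, 0 <= f x t <= M) ->
  (forall x y t, f x t <= f y t + lam * pdist x y) ->
  lipschitz_test (fun x t => Num.max (f x t + e) 0 * (`|t| <= C)%R%:R) C (M + `|e|) lam.
Proof.
move=> lam0 mf fM flip; split=> [|x t|x t lt|x y t].
- apply: mfM; first by apply: measurable_maxr => //; apply: mfD.
  apply: mf_le_ind => //; apply: mf_comp; first exact: normr_measurable.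
  exact: mf_snd.
- have /andP[f0 f1] := fM x t; have ee := ler_norm e; have e0 := normr_ge0 e.
  rewrite mulr_ge0 ?ler0n ?le_max ?lexx ?orbT//=.
  case: (`|t| <= C); rewrite ?mulr1 ?mulr0; last by lra.
  by rewrite ge_max; apply/andP; split; lra.
- by rewrite leNgt lt mulr0.
apply: lip_cutoff; [by rewrite mulr_ge0// pdist_ge0|exact: flip|].
by rewrite pdistC; exact: flip.
Qed.

(** With [lam * a = M], points of the net farther than [a] do not lower the envelope below [h], and
    closer ones change [h] by at most [e / 4]. The envelope thus lies between [h - e / 4] and
    [h + e / 2], and is shifted by these amounts. *)
Lemma lipschitz_sandwich (h : X * R -> R) (C M e : R) : continuous h -> 0 < e ->
    (forall z, 0 <= h z <= M) -> (forall x t, C < `|t| -> h (x, t) = 0) ->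
  exists (F1 F2 : X -> R -> R) (K lam : R), [/\ 0 <= lam,
    lipschitz_test F1 C K lam, lipschitz_test F2 C K lam,
    forall x t, F1 x t <= h (x, t) <= F2 x t &
    forall x t, F2 x t - F1 x t <= e].
Proof.
move=> ch e0 hM hC.
pose e' := e / 4.
have e'0 : 0 < e' by rewrite divr_gt0.
have [a a0 ha] := uniform_pdist ch C e'0.
have M0 : 0 <= M by have /andP[z0] := hM (point, 0); exact: le_trans.
pose lam := M / a.
have lam0 : 0 <= lam by rewrite divr_ge0// ltW.
pose b := Num.min a (e' / (lam + 1)).
have b0 : 0 < b by rewrite lt_min a0 divr_gt0// ltr_wpDl.
have [s hs] := finite_net b0.
pose f := envelope h M lam s.
have f_up x t : `|t| <= C -> f x t <= h (x, t) + 2 * e'.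
  move=> tC; have [y ys ly] := hs x.
  have la : pdist x y < a by apply: lt_le_trans ly _; rewrite ge_min lexx.
  have le : lam * pdist x y <= e'.
    have lb : pdist x y <= e' / (lam + 1) by apply: le_trans (ltW ly) _; rewrite ge_min lexx orbT.
    apply: (@le_trans _ _ ((lam + 1) * pdist x y)); first by rewrite ler_wpM2r ?pdist_ge0// lerDl.
    by rewrite mulrC -ler_pdivlMr// ltr_wpDl.
  have := ha x y t tC la; rewrite ler_norml => /andP[h1 h2].
  by have := envelope_le h M lam x t ys; rewrite -/(f x t) => h3; clear -h1 h2 h3 le; lra.
have f_lo x t : `|t| <= C -> h (x, t) - e' <= f x t.
  move=> tC; apply: envelope_ge => [|y].
    by have /andP[_ h1] := hM (x, t); clear -h1 e'0; lra.
  have [la|la] := ltP (pdist x y) a.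
    have := ha x y t tC la; rewrite ler_norml => /andP[h1 h2].
    have h3 : 0 <= lam * pdist x y by rewrite mulr_ge0// pdist_ge0.
    by clear -h1 h2 h3; lra.
  have h3 : M <= lam * pdist x y by rewrite /lam -mulrA ler_peMr// ler_pdivlMl// mulr1.
  have /andP[_ h1] := hM (x, t); have /andP[h2 _] := hM (y, t).
  by clear -h1 h2 h3 e'0; lra.
have f0M x t : 0 <= f x t <= M.
  rewrite envelope_leM andbT; apply: envelope_ge => // y.
  by have /andP[h0 _] := hM (y, t); rewrite addr_ge0// mulr_ge0// pdist_ge0.
have mf : mble2 f by exact: mf_envelope.
have lf x y t : f x t <= f y t + lam * pdist x y by exact: envelope_lip.
have test e1 := lipschitz_cutoff C e1 lam0 mf f0M lf.
exists (fun x t => Num.max (f x t + - (2 * e')) 0 * (`|t| <= C)%R%:R),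
  (fun x t => Num.max (f x t + e') 0 * (`|t| <= C)%R%:R), (M + `|2 * e'|), lam; split=> //.
- by have := test (- (2 * e')); rewrite normrN.
- have [m1 m2 m3 m4] := test e'; split=> // x t; have /andP[k1 k2] := m2 x t.
  rewrite k1/=; apply: le_trans k2 _; rewrite lerD2l [ `|2 * e'|]normrM normr_nat.
  by rewrite ler_peMl// ler1n.
- move=> x t; have /andP[h0 _] := hM (x, t).
  have [tC|tC] := leP `|t| C; last by rewrite hC// !mulr0 lexx.
  rewrite !mulr1 ge_max le_max h0 andbT lerBlDr f_up//=.
  by rewrite -lerBlDr f_lo.
move=> x t; have /andP[h0 _] := f0M x t.
have [tC|tC] := leP `|t| C; last by rewrite !mulr0 subrr ltW.
have -> : e = 4 * e' by rewrite /e' mulrC divfK.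
rewrite !mulr1; clear -h0 e'0; do 2! (case: (leP _ 0) => ?); lra.
Qed.

End LipschitzApproximation.

(** * Lebesgue measure on a bounded interval as a multiple of a probability measure *)

Section UniformMeasure.
Context {R : realType} (C : R).
Hypothesis C0 : 0 < C.
Let CC : - C < C. Proof. by rewrite gtrN. Qed.
Notation leb := (@lebesgue_measure R).
Let unif0 : probability (measurableTypeR R) R := uniform_prob CC.

Let borel (t : measurableTypeR R) : R := t.

Let mf_borel : mble borel.
Proof. by move=> _ B mB; rewrite setTI. Qed.

(* [uniform_prob] lives on another display of the Borel sets. *)
Let borelm : {mfun (measurableTypeR R) >-> R} := mfun_Sub (mem_set mf_borel).
Definition unif : probability R R := distribution unif0 borelm.

Lemma integral_unif (f : R -> R) : mble f -> (forall t, 0 <= f t) ->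
  (\int[leb]_(t in `[(- C)%R, C]) (f t)%:E = (2 * C)%:E * \int[unif]_t (f t)%:E)%E.
Proof.
move=> mf f0; have mE : mble (fun t => (f t)%:E) by exact/mf_EFin.
have f0E t : (0 <= (f t)%:E)%E by rewrite lee_fin.
rewrite ge0_integral_distribution//.
rewrite (_ : (\int[unif0]_x _)%E = (\int[uniform_prob CC]_x (f x)%:E)%E)// integral_uniform//.
rewrite muleA -EFinM opprK (_ : C + C = 2 * C); last by rewrite mulr2n mulrDl mul1r.
by rewrite mulfV ?mul1e// mulf_neq0// gt_eqF.
Qed.

Lemma integral_unif_support (f : R -> R) : mble f -> (forall t, 0 <= f t) ->
  (forall t, C < `|t| -> f t = 0) -> L1 unif f ->
  (\int[leb]_t (f t)%:E = (2 * C * \int[unif]_t f t)%:E)%E.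
Proof.
move=> mf f0 fC Lf; rewrite EFinM EFin_Rint// -integral_unif// [RHS]integral_mkcond.
apply: eq_integral => t _; rewrite patchE mem_setE in_itv/= -ler_norml.
by case: ifPn => //; rewrite -ltNge => /fC ->.
Qed.

Lemma unif_interval (a b : R) : a <= b ->
  2 * C * \int[unif]_t ((a <= t)%R%:R - (b <= t)%R%:R) <= b - a.
Proof.
move=> ab.
have mi c : mble (fun t : R => (c <= t)%R%:R : R) by exact: mf_le_ind.
have f0 t : 0 <= (a <= t)%R%:R - (b <= t)%R%:R :> R.
  have [bt|] := leP b t; last by rewrite subr0 ler0n.
  by rewrite (le_trans ab bt) subrr.
have mf : mble (fun t : R => (a <= t)%R%:R - (b <= t)%R%:R : R) by exact: mfB.
have Lf : L1 unif (fun t : R => (a <= t)%R%:R - (b <= t)%R%:R).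
  apply: (L1_bounded 1) => // t; rewrite ger0_norm//.
  by case: (a <= t); case: (b <= t); rewrite ?subr0 ?subrr ?sub0r// lerNl oppr0 ler01.
rewrite -lee_fin EFinM EFin_Rint// -integral_unif//.
apply: (@le_trans _ _ (\int[leb]_(t in `[a, b]) 1)%E); last first.
  rewrite integral_cst//= mul1e lebesgue_measure_itv/= lte_fin; case: ltP => // ba.
  by rewrite lee_fin subr_ge0.
rewrite [leRHS]integral_mkcond [leLHS]integral_mkcond; apply: ge0_le_integral => //.
- by move=> t _; rewrite patchE; case: ifP => // _; rewrite lee_fin.
- apply/(measurable_restrictT _ _).1 => //; apply: measurable_funTS; exact/mf_EFin.
- by apply/(measurable_restrictT _ _).1.
move=> t _; rewrite !patchE mem_setE [in leRHS]mem_setE !in_itv/=.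
case: ifP => _; last by case: ifP.
rewrite -[X in if _ then 1%E else X]/(0%E : \bar R).
case: (leP a t) => at' /=; last by rewrite (lt_geF (lt_le_trans at' ab)) subrr.
have [bt|bt] := leP b t; first by rewrite subrr; case: ifP.
by rewrite (ltW bt) subr0.
Qed.

End UniformMeasure.

(** * Masses of shifted Lipschitz test functions *)

Section TestFunctions.
Context {R : realType} {dG dX : measure_display}.
Context {G : measurableType dG} {X : measurableType dX}.
Notation leb := (@lebesgue_measure R).

Section Tails.
Variables (F : X -> R -> R) (D : X -> X -> R) (K C lam : R).
Hypotheses (mF : mble2 F)
  (F_ge0 : forall x t, 0 <= F x t)
  (F_leK : forall x t, F x t <= K)
  (F_out : forall x t, C <= `|t| -> F x t = 0)
  (F_lip : forall x y t, `|F x t - F y t| <= lam * D x y)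
  (D_ge0 : forall x y, 0 <= D x y)
  (lam0 : 0 <= lam)
  (C0 : 0 < C).
Local Notation U := (unif C0).

(** The function [H] of the queue attached to [F]: its integral over levels above [m], written
    against a probability measure so that [Rint_le] and its relatives apply. *)
Definition upper_tail x (m : R) : R := 2 * C * \int[U]_t ((m <= t)%R%:R * F x t).

Let K0 (x : X) : 0 <= K. Proof. exact: le_trans (F_ge0 x 0) (F_leK x 0). Qed.
Let CC0 : 0 <= 2 * C. Proof. by rewrite mulr_ge0// ltW. Qed.

Let mtail : mble (fun z : X * R * R => (z.1.2 <= z.2)%R%:R * F z.1.1 z.2).
Proof.
apply: mfM.
  apply: mf_le_ind; last exact: mf_snd.
  exact: mf_comp mf_snd mf_fst.
apply: (mf_app2 (F := F)) => //; exact: mf_comp mf_fst mf_fst.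
Qed.

Let bounds x m t : 0 <= (m <= t)%R%:R * F x t <= K.
Proof.
have h0 := F_ge0 x t; have hK := F_leK x t; have k0 := K0 x.
by case: (m <= t); rewrite ?mul1r ?mul0r ?lexx ?h0 ?hK ?k0.
Qed.

Let mtail1 x m : mble (fun t : R => (m <= t)%R%:R * F x t).
Proof. exact: (mf_pair1 (x, m) mtail). Qed.

Let Ltail x m : L1 U (fun t => (m <= t)%R%:R * F x t).
Proof. by apply: (L1_bounded K) => // t; exact: norm_bounds (bounds x m t). Qed.

Lemma integral_upper_tail x m :
  (\int[leb]_(t in `[m, +oo[) (F x t)%:E = (upper_tail x m)%:E)%E.
Proof.
rewrite integral_half_line /upper_tail -integral_unif_support//.
- by move=> t; have /andP[] := bounds x m t.
- by move=> t tC; rewrite F_out ?mulr0// ltW.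
Qed.

Lemma mf_upper_tail : mble2 upper_tail.
Proof.
apply: mfM => //.
exact: (mf_Rint2 (P2 := U) (f := fun z : X * R * R => (z.1.2 <= z.2)%R%:R * F z.1.1 z.2)).
Qed.

Lemma upper_tail_ge0 x m : 0 <= upper_tail x m.
Proof. by rewrite mulr_ge0// Rint_ge0// => t; have /andP[] := bounds x m t. Qed.

Lemma upper_tail_le x m : upper_tail x m <= 2 * C * K.
Proof. by rewrite ler_wpM2l//; apply: Rint_lec => // t; have /andP[] := bounds x m t. Qed.

Lemma upper_tail_noninc x m m' : m <= m' -> upper_tail x m' <= upper_tail x m.
Proof.
move=> mm; rewrite ler_wpM2l//; apply: Rint_le => // t.
rewrite ler_wpM2r// ler_nat; case: (leP m' t) => // /(le_trans mm) ->.
by [].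
Qed.

Lemma upper_tail_lip x m m' : `|upper_tail x m - upper_tail x m'| <= K * `|m - m'|.
Proof.
wlog mm : m m' / m <= m'.
  by move=> wl; case: (leP m m') => [|/ltW] /wl//; rewrite distrC [in X in _ <= X]distrC.
rewrite ger0_norm ?subr_ge0 ?upper_tail_noninc// distrC ger0_norm ?subr_ge0//.
rewrite /upper_tail -mulrBr -RintB//.
have mi c : mble (fun t : R => (c <= t)%R%:R : R) by exact: mf_le_ind.
have Li c : L1 U (fun t : R => (c <= t)%R%:R).
  by apply: (L1_bounded 1) => // t; rewrite ger0_norm ?ler0n// lern1 leq_b1.
apply: (@le_trans _ _ (2 * C * (K * \int[U]_t ((m <= t)%R%:R - (m' <= t)%R%:R)))).
  rewrite ler_wpM2l// -RintZ; last exact: L1B.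
  apply: Rint_le => [||t]; [exact: L1B|by apply: L1Z; exact: L1B|].
  rewrite -mulrBl mulrC ler_wpM2r// subr_ge0 ler_nat; case: (leP m' t) => // /(le_trans mm) ->.
  by [].
by rewrite mulrCA ler_wpM2l//; [exact: K0|exact: unif_interval].
Qed.

Lemma upper_tail_lipD x y m : `|upper_tail x m - upper_tail y m| <= 2 * C * lam * D x y.
Proof.
rewrite /upper_tail -mulrBr normrM ger0_norm// -RintB// -mulrA ler_wpM2l//.
apply: le_trans (Rint_norm _) _; first exact: L1B.
apply: Rint_lec; first by apply: L1_norm; exact: L1B.
move=> t; rewrite -mulrBr normrM ger0_norm ?ler0n//.
apply: le_trans (F_lip x y t); rewrite ler_piMl// lern1 leq_b1.
by [].
Qed.

Lemma upper_tail_out x m : C <= m -> upper_tail x m = 0.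
Proof.
move=> Cm; rewrite /upper_tail (_ : (\int[U]_t _) = 0) ?mulr0//.
rewrite -[RHS](Rint_cst U); apply: eq_Rint => t; case: (leP m t) => mt; rewrite ?mul0r// mul1r F_out//.
by rewrite (le_trans (le_trans Cm mt))// ler_norm.
Qed.

Lemma upper_tail_in x m : m <= - C -> upper_tail x m = upper_tail x (- C).
Proof.
move=> Cm; rewrite /upper_tail; congr (_ * _); apply: eq_Rint => t.
case: (leP (- C) t) => mt; first by rewrite (le_trans Cm mt).
by rewrite F_out ?mulr0// ler_normr lerNr (ltW mt) orbT.
Qed.

End Tails.

Variables (mu : probability G R) (nu : probability X R).
Variables (act : G -> X -> X) (s : G -> X -> R) (D : X -> X -> R).
(** All that the limit argument has to know of the dynamics. [c], [T0] and [u] may depend on the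
    test function, but not on [T] or [L]. *)
Definition mass_asymptotic := forall (F : X -> R -> R) (K C lam : R),
  mble2 F ->
  (forall x t, 0 <= F x t <= K) -> (forall x t, C <= `|t| -> F x t = 0) ->
  (forall x y t, `|F x t - F y t| <= lam * D x y) -> 0 <= lam -> 0 < C ->
  let FT T x t := F x (t - T) in
  exists c T0 I, [/\ forall T n x, T0 <= T -> killed_mass mu act s (FT T) n x \is a fin_num,
    forall T n, T0 <= T -> L1 nu (fun x => fine (killed_mass mu act s (FT T) n x)),
    (\int[nu]_x \int[leb]_t (F x t)%:E)%E = I%:E &
    exists2 u : nat -> nat, forall L, (L <= u L)%N & forall T L, T0 <= T ->
      `|\int[nu]_x fine (killed_mass mu act s (FT T) (u L) x) - T * I| <= c * (1 + Num.sqrt T)].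

Variables (ell Lam : G -> R) (r : R).
Hypotheses (mact : mble2 act)
  (ms : mble2 s)
  (nu_act : forall B, measurable B ->
  nu B = (\int[mu]_a nu (act a @^-1` B))%E)
  (mD : forall x y, mble (fun a => D (act a x) (act a y)))
  (D_ge0 : forall x y, 0 <= D x y)
  (D_le1 : forall x y, D x y <= 1)
  (D_contr : forall x y, \int[mu]_a D (act a x) (act a y) <= r * D x y)
  (D_Lam : forall a x y, D (act a x) (act a y) <= Lam a * D x y)
  (r_ge0 : 0 <= r)
  (r_lt1 : r < 1)
  (s_ell : forall a x, `|s a x| <= ell a)
  (s_Lam : forall a x y, `|s a x - s a y| <= Lam a * D x y)
  (L1ell : L1 mu ell)
  (L1Lam : L1 mu Lam)
  (Lam_ge0 : forall a, 0 <= Lam a)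
  (centered : \int[prodP mu nu]_z s z.1 z.2 = 0)
  (L1ell4 : L1 mu (fun a => ell a ^+ 4))
  (L1ellLam : L1 mu (fun a => ell a * Lam a)).
Variables (Ct q1 : R).
Hypotheses (Ct0 : 0 <= Ct) (q10 : 0 <= q1) (q11 : q1 < 1).
Hypothesis tails : forall n, tail_ell mu ell n%:R <= Ct * q1 ^+ n.

(** Duality identifies the masses with the integrated queue. The single constant [K'] serves as a
    bound of [H] and as its Lipschitz constant in both variables. *)
Lemma killed_mass_asymptotic : mass_asymptotic.
Proof.
move=> F K C lam mF FK F_out F_lip lam0 C0 FT.
have F_ge0 x t : 0 <= F x t by have /andP[] := FK x t.
have F_leK x t : F x t <= K by have /andP[] := FK x t.
have K0 : 0 <= K by exact: le_trans (F_ge0 point 0) (F_leK point 0).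
pose H := upper_tail F C0; pose K' := 2 * C * K + K + 2 * C * lam.
have k1 : 0 <= 2 * C * K by rewrite !mulr_ge0// ltW.
have k2 : 0 <= 2 * C * lam by rewrite !mulr_ge0// ltW.
have mH : mble2 H by exact: mf_upper_tail.
have H_ge0 x m : 0 <= H x m by exact: upper_tail_ge0.
have H_leK x m : H x m <= K'.
  by apply: le_trans (upper_tail_le mF F_ge0 F_leK C0 x m) _; rewrite /K' -addrA lerDl addr_ge0.
have H_noninc x m m' : m <= m' -> H x m' <= H x m by exact: (upper_tail_noninc mF F_ge0 F_leK).
have H_lip x m m' : `|H x m - H x m'| <= K' * `|m - m'|.
  apply: le_trans (upper_tail_lip mF F_ge0 F_leK C0 x m m') _.
  by rewrite ler_wpM2r// /K' addrAC lerDr addr_ge0.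
have H_lipD x y m : `|H x m - H y m| <= K' * D x y.
  apply: le_trans (upper_tail_lipD mF F_ge0 F_leK F_lip C0 x y m) _.
  by rewrite ler_wpM2r// /K' lerDr addr_ge0.
have H_out x m : C <= m -> H x m = 0 by exact: upper_tail_out.
have H_in x m : m <= - C -> H x m = H x (- C) by exact: upper_tail_in.
have hH x m : (\int[leb]_(t in `[m, +oo[) (F x t)%:E = (H x m)%:E)%E.
  exact: integral_upper_tail.
have C0' := ltW C0.
have km T n x : killed_mass mu act s (FT T) n x = tail (queue mu act s H T n x) 0.
  rewrite (killed_mass_queue mu mact ms T mF F_ge0 F_leK hH mH H_leK n x) /tail.
  by apply: eq_integral => m _; rewrite add0r.
have [c [u uL hu]] := mean_integrated_asymptotic mact ms nu_act mD D_ge0 D_le1 D_contr D_Lam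
  r_ge0 r_lt1 s_ell s_Lam L1ell L1Lam Lam_ge0 centered mH H_ge0 H_leK H_noninc H_lip H_lipD
  H_out H_in C0' L1ell4 L1ellLam Ct0 q10 q11 tails.
have LH : L1 nu (fun x => H x (- C)).
  apply: (L1_bounded K') => [|x]; last by rewrite ger0_norm.
  exact: (mf_pair2 (- C) mH).
exists c, (C + Theta mu Lam r *+ 2), (\int[nu]_x H x (- C)).
have T0C : C <= C + Theta mu Lam r *+ 2.
  by rewrite lerDl mulrn_wge0//; apply: Theta_ge0 => //.
split.
- move=> T n x T0; rewrite km.
  exact: (tailq_num mact ms s_ell L1ell mH H_ge0 H_leK H_noninc H_out H_in C0' (le_trans T0C T0)).
- move=> T n T0; rewrite (_ : (fun x => _) = integrated mu act s H T n); last first.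
    by apply/funext => x; rewrite km.
  exact: (L1_integrated nu mact ms s_ell L1ell mH H_ge0 H_leK H_noninc H_out H_in C0' (le_trans T0C T0)).
- rewrite EFin_Rint//; apply: eq_integral => x _; rewrite -hH integral_half_line.
  apply: eq_integral => t _; rewrite -EFinM; case: (leP (- C) t) => tC; rewrite ?mul1r// mul0r F_out//.
  by rewrite ler_normr lerNr (ltW tC) orbT.
have E T L : \int[nu]_x fine (killed_mass mu act s (FT T) (u L) x) = mean_integrated mu nu act s H T (u L).
  by apply: eq_Rint => x; rewrite km.
by exists u => [//|T L T0]; rewrite E; exact: hu.
Qed.

End TestFunctions.

(** * Functions supported in a box and their integrals against the product measure *)

Section BoxSupport.
Context {R : realType} {d : nat} (dot : {dot 'cV[R]_d.+1 for idfun}).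
Local Notation X := (PV R d).
Notation leb := (@lebesgue_measure R).

Definition box (a b : R) : set (X * R) := setT `*` [set` `[a, b]].

Lemma mf_box a b : measurable (box a b).
Proof. by apply: measurableX => //; exact: measurable_itv. Qed.

Lemma closed_box a b : closed (box a b).
Proof.
rewrite (_ : box a b = snd @^-1` `[a, b]); last first.
  by apply/seteqP; split => [z []|z zab]//.
by apply: closed_comp => [z _|]; [exact: cvg_snd|exact: interval_closed].
Qed.

Lemma compact_box a b : compact (box a b).
Proof. by apply: compact_setX; [exact: compact_PV|exact: segment_compact]. Qed.

Lemma box_compactly_supported (h : X * R -> R) a b :
  (forall z, ~ box a b z -> h z = 0) -> compactly_supported h.
Proof.
move=> h0; rewrite /compactly_supported.
apply: (@subclosed_compact _ _ (box a b)); [exact: closed_closure|exact: compact_box|].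
rewrite (closure_id (box a b)).1; last exact: closed_box.
apply: closure_subset => z /= hz; apply: contrapT => nb.
by move: hz; rewrite h0 ?eqxx.
Qed.

Lemma integrable_box (m : {measure set (X * R) -> \bar R}) (h : X * R -> R) a b M :
  mble h -> (forall z, `|h z| <= M) -> (forall z, ~ box a b z -> h z = 0) ->
  (m (box a b) < +oo)%E -> m.-integrable setT (EFin \o h).
Proof.
move=> mh hM h0 fin.
rewrite (_ : EFin \o h = (EFin \o h) \_ (box a b)); last first.
  apply/funext => z; rewrite patchE; case: ifPn => //.
  by rewrite notin_setE => /h0 /= ->.
apply/(integrable_mkcond _ (mf_box a b)).
apply: measurable_bounded_integrable => //.
- exact: mf_box.
- exact: measurable_funTS.
- exists M; split; first exact: num_real.
  by move=> y My z _ /=; exact: le_trans (hM z) (ltW My).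
Qed.

Variable nu : probability X R.

Section Mean.
Variables (F : X -> R -> R) (K C : R).
Hypotheses (mF : mble2 F)
  (FK : forall x t, 0 <= F x t <= K)
  (F_out : forall x t, C <= `|t| -> F x t = 0)
  (C0 : 0 < C).

Let F_ge0 x t : 0 <= F x t. Proof. by have /andP[] := FK x t. Qed.
Let mF1 x : mble (F x). Proof. exact: (mf_pair1 x mF). Qed.
Let LF x : L1 (unif C0) (F x).
Proof. by apply: (L1_bounded K) => // t; rewrite ger0_norm//; have /andP[] := FK x t. Qed.

Definition box_mean : R := 2 * C * \int[nu]_x \int[unif C0]_t F x t.

Lemma mf_unif_mean : mble (fun x => \int[unif C0]_t F x t).
Proof. exact: (mf_Rint2 (P2 := unif C0) (f := fun z : X * R => F z.1 z.2)). Qed.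

Lemma L1_unif_mean : L1 nu (fun x => \int[unif C0]_t F x t).
Proof.
apply: (L1_bounded K) => [|x]; first exact: mf_unif_mean.
rewrite ger0_norm ?Rint_ge0//; apply: Rint_lec => // t.
by have /andP[] := FK x t.
Qed.

Lemma integral_box_mean : (\int[nu]_x \int[leb]_t (F x t)%:E)%E = box_mean%:E.
Proof.
have L := L1_unif_mean; rewrite /box_mean -RintZ// EFin_Rint//; last exact: L1Z.
apply: eq_integral => x _; apply: integral_unif_support => // t tC.
by rewrite F_out// ltW.
Qed.

Lemma integral_product_box : (\int[(nu \x leb)%E]_z (F z.1 z.2)%:E)%E = box_mean%:E.
Proof.
rewrite -integral_box_mean (@fubini_tonelli1 _ _ _ _ _ nu leb (fun z : X * R => (F z.1 z.2)%:E))//.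
- exact/mf_EFin.
- by move=> z; rewrite lee_fin.
Qed.

Lemma Rintegral_box_mean : \int[(nu \x leb)%E]_z F z.1 z.2 = box_mean.
Proof. by rewrite /Rintegral integral_product_box. Qed.

Lemma integrable_product_box : (nu \x leb)%E.-integrable setT (EFin \o (fun z => F z.1 z.2)).
Proof.
apply/integrableP; split; first exact/mf_EFin.
under eq_integral do rewrite /= ger0_norm//.
by rewrite integral_product_box ltry.
Qed.

End Mean.

Lemma box_mean_le (F F' : X -> R -> R) (K K' C e : R) (C0 : 0 < C) :
  mble2 F -> (forall x t, 0 <= F x t <= K) ->
  mble2 F' -> (forall x t, 0 <= F' x t <= K') ->
  (forall x t, F x t <= F' x t + e) -> box_mean F C0 <= box_mean F' C0 + 2 * C * e.
Proof.
move=> mF FK mF' FK' le; rewrite /box_mean -mulrDr ler_wpM2l//; first by rewrite mulr_ge0// ltW.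
have L := L1_unif_mean mF FK C0; have L' := L1_unif_mean mF' FK' C0.
rewrite -[e in leRHS](Rint_cst nu) -RintD//; last exact: L1_cst.
apply: Rint_le => // [|x]; first by apply: L1D => //; exact: L1_cst.
have M x' : mble (F x') by exact: (mf_pair1 x' mF).
have M' x' : mble (F' x') by exact: (mf_pair1 x' mF').
have LF : L1 (unif C0) (F x).
  by apply: (L1_bounded K) => // t; exact: norm_bounds (FK x t).
have LF' : L1 (unif C0) (F' x).
  by apply: (L1_bounded K') => // t; exact: norm_bounds (FK' x t).
rewrite -[e in leRHS](Rint_cst (unif C0)) -RintD//; last exact: L1_cst.
by apply: Rint_le => //; apply: L1D => //; exact: L1_cst.
Qed.

End BoxSupport.

(** * Exponential moments of the increments *)

Section Moments.
Context {R : realType} {d : nat} (dot : {dot 'cV[R]_d.+1 for idfun}) (mu : probability (GL R d) R).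
Local Notation ell := (ell dot).

Lemma exponential_moment : finite_exponential_moment dot mu ->
  exists2 al : R, 0 < al & L1 mu (fun a => expR (al * ell a)).
Proof.
move=> [al al0 fin]; exists al => //; apply: L1_fin => [|a|].
- apply: mf_comp => //; apply: mfM => //; exact: mf_ell.
- exact: expR_ge0.
apply: le_lt_trans fin; apply: le_of_eq; apply: eq_integral => a _.
congr (_%:E); rewrite -[Num.max _ _]/(nm dot a) /powR gt_eqF ?nm_gt0//.
Qed.

Lemma geometric_tail (al : R) : 0 < al -> L1 mu (fun a => expR (al * ell a)) ->
  exists Ct q : R, [/\ 0 <= Ct, 0 <= q, q < 1 & forall n, tail_ell mu ell n%:R <= Ct * q ^+ n].
Proof.
move=> al0 L; exists (al^-1 * \int[mu]_a expR (al * ell a)), (expR (- al)).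
split; first by rewrite mulr_ge0 ?invr_ge0//; [exact: ltW|by apply: Rint_ge0 => a; exact: expR_ge0].
- exact: expR_ge0.
- by rewrite expR_lt1 oppr_lt0.
move=> n; apply: le_trans (exp_tail al0 L n%:R) _.
by rewrite -expRM_natl mulrN [n%:R * al]mulrC.
Qed.

End Moments.

Lemma ratio_squeeze {R : realType} (J : R -> R) (I I1 I2 c1 c2 e T0 : R) : 0 < e ->
    I1 <= I <= I2 -> I2 <= I1 + e / 2 ->
    (forall T, T0 <= T -> T * I1 - c1 * (1 + Num.sqrt T) - 1 <= J T <= T * I2 + c2 * (1 + Num.sqrt T) + 1) ->
  \forall T \near +oo, `|I - T^-1 * J T| <= e.
Proof.
move=> e0 /andP[hI1 hI2] h12 hJ.
(* For [T >= 1] the errors add up to at most [(2 * c + 1) * sqrt T], which is at most [e / 2 * T] as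
   soon as [T >= A ^ 2]. *)
pose c := `|c1| + `|c2|; pose A := (2 * c + 1) / (e / 2).
have c0 : 0 <= c by rewrite addr_ge0.
have A0 : 0 <= A by rewrite divr_ge0 ?divr_ge0 ?(ltW e0)// addr_ge0// mulr_ge0.
near=> T.
have T1 : 1 <= T by near: T; apply: nbhs_pinfty_ge; exact: num_real.
have TA : A ^+ 2 <= T by near: T; apply: nbhs_pinfty_ge; exact: num_real.
have TT : T0 <= T by near: T; apply: nbhs_pinfty_ge; exact: num_real.
have Tp : 0 < T by apply: lt_le_trans T1.
set q := Num.sqrt T; have qq : q * q = T by rewrite -expr2 sqr_sqrtr// ltW.
have q1 : 1 <= q by rewrite -[1]sqrtr1 ler_wsqrtr.
have qA : A <= q by rewrite -[A]ger0_norm// -sqrtr_sqr ler_wsqrtr.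
have bd : c * (1 + q) + 1 <= e / 2 * T.
  have h1 : (2 * c + 1) * q <= e / 2 * T.
    rewrite -qq mulrA ler_wpM2r ?(le_trans ler01 q1)//.
    by rewrite -ler_pdivrMl ?divr_gt0// mulrC.
  apply: le_trans h1.
  have h2 : c * 1 <= c * q by rewrite ler_wpM2l.
  by clear -h2 q1; lra.
have b1 : c1 * (1 + q) <= c * (1 + q).
  by rewrite ler_wpM2r ?addr_ge0 ?sqrtr_ge0// (le_trans (ler_norm _))// lerDl.
have b2 : c2 * (1 + q) <= c * (1 + q).
  by rewrite ler_wpM2r ?addr_ge0 ?sqrtr_ge0// (le_trans (ler_norm _))// lerDr.
have /andP[l1 l2] := hJ T TT; rewrite -/q in l1 l2.
have m1 : T * I1 <= T * I by rewrite ler_wpM2l// ltW.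
have m2 : T * I2 <= T * (I1 + e / 2) by rewrite ler_wpM2l// ltW.
have m3 : T * I <= T * I2 by rewrite ler_wpM2l// ltW.
rewrite distrC ler_distl ler_pdivlMl// ler_pdivrMl//.
by clear -l1 l2 m1 m2 m3 b1 b2 bd; apply/andP; split; lra.
Unshelve. all: by end_near.
Qed.

Lemma half_le {R : realType} (a b M : R) : a <= M -> b <= M -> 2^-1 * (a + b) <= M.
Proof. by lra. Qed.

Lemma lower_step {R : realType} (c m i J : R) : - c <= m - i -> m <= J + 1 -> i - c - 1 <= J.
Proof. by move=> ? ?; lra. Qed.

Lemma upper_step {R : realType} (c m i J : R) : m - i <= c -> J - 1 <= m -> J <= i + c + 1.
Proof. by move=> ? ?; lra. Qed.

Definition vague_limit {R : realType} {d : nat} (nu : probability (PV R d) R)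
    (rho : {measure set (PV R d * R) -> \bar R}) :=
  forall h : PV R d * R -> R, continuous h -> compactly_supported h ->
  (t^-1 * \int[rho]_z h (z.1, z.2 - t)) @[t --> +oo] -->
    \int[(nu \x lebesgue_measure)%E]_z h z.

(** * The limit of the shifted harmonic measure *)

Section HarmonicLimit.
Context {R : realType} {d : nat} (dot : {dot 'cV[R]_d.+1 for idfun})
  {disp : measure_display} {Omega : measurableType disp}.
Variables (P : probability Omega R) (g : nat -> {mfun Omega >-> GL R d}).
Variables (mu : probability (GL R d) R) (nu : probability (PV R d) R) (Q : probability (path (GL R d)) R).
Local Notation G := (GL R d).
Local Notation X := (PV R d).
Notation leb := (@lebesgue_measure R).
Hypotheses (Q_cyl : iid_law mu Q)
  (Q_traj : forall B, measurable B -> Q B = P (trajectory g @^-1` B)).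
Variables (s : G -> X -> R) (D : X -> X -> R) (c0 : R).
Hypotheses (ms : mble2 s)
  (sM : forall a b x, s (a * b)%g x = s a (GL_act b x) + s b x)
  (s1 : forall x, s 1%g x = 0)
  (c0_ge0 : 0 <= c0)
  (sd_D : forall x y, sd dot x y <= c0 * D x y)
  (asymp : mass_asymptotic mu nu (@GL_act R d) s D).
Variable rho : {measure set (X * R) -> \bar R}.
Hypothesis rho_harmonic : is_target_harmonic_measure P g s rho.

Lemma continuous_level_shift (h : X * R -> R) T : continuous h -> continuous (fun z : X * R => h (z.1, z.2 - T)).
Proof.
move=> ch z; apply: (@continuous_comp _ _ _ (fun z : X * R => (z.1, z.2 - T)) h); last exact: ch.
apply: (@cvg_pair _ _ _ _ (nbhs z.1) (nbhs (z.2 - T))); first exact: cvg_fst.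
by apply: cvgB; [exact: cvg_snd|exact: cvg_cst].
Qed.

Lemma shift_out (h : X * R -> R) C T : (forall x t, C < `|t| -> h (x, t) = 0) ->
  forall z : X * R, ~ box (T - C) (T + C) z -> h (z.1, z.2 - T) = 0.
Proof.
move=> hC z nb; apply: hC; rewrite ltNge; apply/negP => le; apply: nb.
by split=> //=; rewrite in_itv/= -ler_distl.
Qed.

(** The masses of the shifted [h] converge to its integral against [rho] uniformly in [x], so at a
    late time they may be integrated against [nu]. This time is taken of the form [u N], where they
    are squeezed between the masses of the Lipschitz bounds. An error of 1 in the mass is harmless
    after division by [T]. *)
Lemma harmonic_limit_ge0 (h : X * R -> R) : continuous h -> compactly_supported h ->
  (forall z, 0 <= h z) ->
  (t^-1 * \int[rho]_z h (z.1, z.2 - t)) @[t --> +oo] --> \int[(nu \x leb)%E]_z h z.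
Proof.
move=> ch cs h0; have [C [M [C0 M0 hC hM]]] := compact_support_bounds ch cs.
apply/cvgrPdist_le => e e0.
have hM' z : 0 <= h z <= M by rewrite h0/= (le_trans (ler_norm _)).
pose C1 := C + 1; have C1_gt0 : 0 < C1 by rewrite addr_gt0.
have CC1 : C < C1 by rewrite ltrDl.
pose e' := e / 2 / (2 * C1).
have e'0 : 0 < e' by rewrite !divr_gt0// mulr_gt0.
have [F1 [F2 [K [lam [lam0 [mF1 FK1 F1out F1lip] [mF2 FK2 F2out F2lip] F1h F12]]]]] :=
  lipschitz_sandwich dot ch e'0 hM' hC.
have [k k0 hk] := pdist_sd dot.
pose lam' := lam * (k * c0); have lam'0 : 0 <= lam' by rewrite !mulr_ge0.
have dle x y : lam * pdist dot x y <= lam' * D x y.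
  rewrite /lam' -mulrA ler_wpM2l//; apply: le_trans (hk x y) _.
  by rewrite -mulrA ler_wpM2l.
have F1out' x t : C1 <= `|t| -> F1 x t = 0 by move=> /(lt_le_trans CC1)/F1out.
have F2out' x t : C1 <= `|t| -> F2 x t = 0 by move=> /(lt_le_trans CC1)/F2out.
have F1lip' x y t : `|F1 x t - F1 y t| <= lam' * D x y by exact: le_trans (F1lip x y t) (dle x y).
have F2lip' x y t : `|F2 x t - F2 y t| <= lam' * D x y by exact: le_trans (F2lip x y t) (dle x y).
have [c1 [T1 [I1 [fin1 L11 E1 [u1 uL1 as1]]]]] := asymp mF1 FK1 F1out' F1lip' lam'0 C1_gt0.
have [c2 [T2 [I2 [fin2 L12 E2 [u2 uL2 as2]]]]] := asymp mF2 FK2 F2out' F2lip' lam'0 C1_gt0.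
have mh : mble h by exact: mf_continuous_prod.
have mhz : mble (fun z : X * R => h (z.1, z.2)).
  by rewrite (_ : (fun z => _) = h)//; apply/funext => -[].
have hM2 x t : 0 <= h (x, t) <= M by exact: hM'.
have hout x t : C1 <= `|t| -> h (x, t) = 0 by move=> /(lt_le_trans CC1)/hC.
have bE1 : I1 = box_mean nu F1 C1_gt0.
  by apply: EFin_inj; rewrite -E1 (integral_box_mean nu mF1 FK1 F1out' C1_gt0).
have bE2 : I2 = box_mean nu F2 C1_gt0.
  by apply: EFin_inj; rewrite -E2 (integral_box_mean nu mF2 FK2 F2out' C1_gt0).
have bE : \int[(nu \x leb)%E]_z h z = box_mean nu (fun x t => h (x, t)) C1_gt0.
  rewrite -(Rintegral_box_mean nu (F := fun x t => h (x, t)) mhz hM2 hout C1_gt0).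
  by apply: eq_Rintegral => -[].
apply: (@ratio_squeeze _ _ _ I1 I2 c1 c2 e (Num.max T1 T2)) => //.
- rewrite bE bE1 bE2; apply/andP; split.
    rewrite -[leRHS]addr0 -(mulr0 (2 * C1)); apply: (box_mean_le nu C1_gt0 mF1 FK1 mhz hM2) => x t.
    by rewrite addr0; have /andP[] := F1h x t.
  rewrite -[leRHS]addr0 -(mulr0 (2 * C1)); apply: (box_mean_le nu C1_gt0 mhz hM2 mF2 FK2) => x t.
  by rewrite addr0; have /andP[] := F1h x t.
- have -> : e / 2 = 2 * C1 * e' by rewrite /e' [RHS]mulrC divfK// mulf_neq0// gt_eqF.
  rewrite bE1 bE2; apply: (box_mean_le nu C1_gt0 mF2 FK2 mF1 FK1) => x t.
  by rewrite addrC -lerBlDr.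
move=> T; rewrite ge_max => /andP[TT1 TT2].
set J := \int[rho]_z _.
pose hT (x : X) (t : R) := h (x, t - T).
have mhT : mble2 hT.
  exact: (mf_continuous_prod dot (continuous_level_shift (T := T) ch)).
have shift_measurable (F : X -> R -> R) : mble2 F ->
    mble (fun z : X * R => F z.1 (z.2 - T)).
  move=> mF; apply: (mf_app2 (F := F)) => //; apply: mfB => //; exact: mf_snd.
have hT0 x t : 0 <= hT x t by exact: h0.
have hTM x t : hT x t <= M by have /andP[] := hM' (x, t - T).
have F10 x t : 0 <= F1 x (t - T) by have /andP[] := FK1 x (t - T).
have F1K x t : F1 x (t - T) <= K by have /andP[] := FK1 x (t - T).
have F20 x t : 0 <= F2 x (t - T) by have /andP[] := FK2 x (t - T).
have F2K x t : F2 x (t - T) <= K by have /andP[] := FK2 x (t - T).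
have F1hT x t : F1 x (t - T) <= hT x t by have /andP[] := F1h x (t - T).
have F2hT x t : hT x t <= F2 x (t - T) by have /andP[] := F1h x (t - T).
have lo n x := killed_mass_le mu (h := fun x t => F1 x (t - T)) (mf_GL_act dot) ms (shift_measurable _ mF1) mhT F10 F1hT F1K hTM n x.
have hi n x := killed_mass_le mu (h' := fun x t => F2 x (t - T)) (mf_GL_act dot) ms mhT (shift_measurable _ mF2) hT0 F2hT hTM F2K n x.
have hfin n x : killed_mass mu GL_act s hT n x \is a fin_num.
  rewrite ge0_fin_numE; last first.
    apply: integral_ge0 => t; rewrite /= in_itv/= andbT => t0; rewrite lee_fin mulr_ge0//.
    exact: killed_ge0.
  by apply: le_lt_trans (hi n x) _; rewrite ltey_eq fin2.
have [N _ hN] : \forall n \near \oo, forall x, `|fine (killed_mass mu GL_act s hT n x) - J| < 1.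
  have := rho_harmonic.2 _ (continuous_level_shift (T := T) ch) (box_compactly_supported (shift_out (T := T) hC)) 1 ltr01.
  move=> near1; near=> n => x.
  have n0 : (0 < n)%N by near: n; exists 1%N.
  rewrite -(harmonic_integral dot ms sM s1 Q_cyl Q_traj mhT hT0 hTM x n0).
  by move: x; near: n.
apply/andP; split.
  have uN : (N <= u1 N)%N by exact: uL1.
  have := as1 T N TT1; rewrite ler_norml => /andP[+ _].
  have le : \int[nu]_x fine (killed_mass mu GL_act s (fun x t => F1 x (t - T)) (u1 N) x) <= J + 1.
    apply: Rint_lec => [|x]; first exact: L11.
    apply: (@le_trans _ _ (fine (killed_mass mu GL_act s hT (u1 N) x))).
      by apply: fine_le; [exact: fin1|exact: hfin|exact: lo].
    by have := hN _ uN x; rewrite ltr_norml => /andP[_ +]; rewrite ltrBlDl => /ltW.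
  by move=> h1; exact: lower_step h1 le.
have uN : (N <= u2 N)%N by exact: uL2.
have := as2 T N TT2; rewrite ler_norml => /andP[_ +].
have le : J - 1 <= \int[nu]_x fine (killed_mass mu GL_act s (fun x t => F2 x (t - T)) (u2 N) x).
  apply: Rint_gec => [|x]; first exact: L12.
  apply: (@le_trans _ _ (fine (killed_mass mu GL_act s hT (u2 N) x))).
    by have := hN _ uN x; rewrite ltr_norml => /andP[+ _]; rewrite ltrBrDl => /ltW; rewrite addrC => /(le_trans _); apply; rewrite addrC.
  by apply: fine_le; [exact: hfin|exact: fin2|exact: hi].
by move=> h1; exact: upper_step h1 le.
Unshelve. all: by end_near.
Qed.

(** Killed masses compare monotonically for non-negative functions, so [h] is split into its
    positive and negative parts; their integrals are finite because [rho] is finite on boxes. *)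
Lemma harmonic_limit : vague_limit nu rho.
Proof.
move=> h ch cs; have [C [M [C0 M0 hC hM]]] := compact_support_bounds ch cs.
pose hp z := 2^-1 * (`|h z| + h z); pose hm z := 2^-1 * (`|h z| - h z).
have cn : continuous (fun z => `|h z|).
  by move=> z; apply: (@continuous_comp _ _ _ h (fun t : R => `|t|)); [exact: ch|exact: norm_continuous].
have cp : continuous hp by move=> z; apply: cvgMr; apply: cvgD; [exact: cn|exact: ch].
have cm : continuous hm by move=> z; apply: cvgMr; apply: cvgB; [exact: cn|exact: ch].
have hpC x t : C < `|t| -> hp (x, t) = 0 by move=> /hC h0; rewrite /hp h0 normr0 addr0 mulr0.
have hmC x t : C < `|t| -> hm (x, t) = 0 by move=> /hC h0; rewrite /hm h0 normr0 subr0 mulr0.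
have hp0 z : 0 <= hp z by rewrite mulr_ge0// -lerBlDr sub0r ler_normr lexx orbT.
have hm0 z : 0 <= hm z by rewrite mulr_ge0// subr_ge0 ler_norm.
have hpM z : `|hp z| <= M.
  by rewrite ger0_norm// half_le// (le_trans (ler_norm _)).
have hmM z : `|hm z| <= M.
  by rewrite ger0_norm// half_le// (le_trans (ler_norm _))// normrN.
have hE z : h z = hp z - hm z by rewrite /hp /hm; field.
have out (f : X * R -> R) (z : X * R) : (forall x t, C < `|t| -> f (x, t) = 0) -> ~ box (- C) C z -> f z = 0.
  by move=> fC nb; have := @shift_out f C 0 fC z; rewrite !sub0r add0r subr0 -surjective_pairing; apply.
have cutp : compactly_supported hp by apply: (@box_compactly_supported _ _ _ (- C) C) => z; exact: out.
have cutm : compactly_supported hm by apply: (@box_compactly_supported _ _ _ (- C) C) => z; exact: out.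
have split_int (m : {measure set (X * R) -> \bar R}) T : (m (box (T - C) (T + C)) < +oo)%E ->
    \int[m]_z h (z.1, z.2 - T) = \int[m]_z hp (z.1, z.2 - T) - \int[m]_z hm (z.1, z.2 - T).
  move=> fin; rewrite -RintegralB//.
  - by apply: eq_Rintegral => z _; exact: hE.
  - apply: (@integrable_box _ _ m (fun z => hp (z.1, z.2 - T)) (T - C) (T + C) M) => //.
      exact: (mf_continuous_prod dot (continuous_level_shift (T := T) cp)).
    exact: shift_out.
  - apply: (@integrable_box _ _ m (fun z => hm (z.1, z.2 - T)) (T - C) (T + C) M) => //.
      exact: (mf_continuous_prod dot (continuous_level_shift (T := T) cm)).
    exact: shift_out.
have -> : \int[(nu \x leb)%E]_z h z = \int[(nu \x leb)%E]_z hp z - \int[(nu \x leb)%E]_z hm z.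
  have int (f : X * R -> R) : continuous f -> (forall z, 0 <= f z) -> (forall z, `|f z| <= M) ->
      (forall x t, C < `|t| -> f (x, t) = 0) -> (nu \x leb)%E.-integrable setT (EFin \o f).
    move=> cf f0 fM fC; rewrite (_ : EFin \o f = EFin \o (fun z => f (z.1, z.2))); last first.
      by apply/funext => -[].
    apply: (@integrable_product_box _ _ nu (fun x t => f (x, t)) M (C + 1)) => //.
    - rewrite (_ : (fun z => _) = f); first exact: mf_continuous_prod.
      by apply/funext => -[].
    - by move=> x t; rewrite f0/= (le_trans (ler_norm _)).
    - by move=> x t lt; apply: fC; apply: lt_le_trans lt; rewrite ltrDl.
    - by rewrite addr_gt0.
  rewrite -RintegralB//; [|exact: int|exact: int].
  by apply: eq_Rintegral => z _; exact: hE.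
rewrite (_ : (fun t => _) = (fun t => t^-1 * \int[rho]_z hp (z.1, z.2 - t) - t^-1 * \int[rho]_z hm (z.1, z.2 - t))).
  by apply: cvgB; exact: harmonic_limit_ge0.
apply/funext => t; rewrite split_int ?mulrBr//.
by apply: rho_harmonic.1; exact: compact_box.
Qed.

End HarmonicLimit.

Lemma trapezoid {R : realType} (a b t : R) : 0 < a -> a < b ->
  let N := (`|t - b| + `|t + b|) - (`|t - a| + `|t + a|) in
  [/\ 0 <= N <= 2 * (b - a), `|t| <= a -> N = 2 * (b - a) & b <= `|t| -> N = 0].
Proof.
move=> a0 ab /=; split.
- by apply/andP; split; case: (ger0P (t - b)) => ?; case: (ger0P (t + b)) => ?;
    case: (ger0P (t - a)) => ?; case: (ger0P (t + a)) => ?; lra.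
- rewrite ler_norml => /andP[? ?]; rewrite (ler0_norm (_ : t - b <= 0)); last lra.
  rewrite (ger0_norm (_ : 0 <= t + b)); last lra.
  rewrite (ler0_norm (_ : t - a <= 0)); last lra.
  rewrite (ger0_norm (_ : 0 <= t + a)); last lra.
  lra.
- rewrite ler_normr => /orP[] ?.
    rewrite (ger0_norm (_ : 0 <= t - b)); last lra.
    rewrite (ger0_norm (_ : 0 <= t + b)); last lra.
    rewrite (ger0_norm (_ : 0 <= t - a)); last lra.
    rewrite (ger0_norm (_ : 0 <= t + a)); last lra.
    lra.
  rewrite (ler0_norm (_ : t - b <= 0)); last lra.
  rewrite (ler0_norm (_ : t + b <= 0)); last lra.
  rewrite (ler0_norm (_ : t - a <= 0)); last lra.
  rewrite (ler0_norm (_ : t + a <= 0)); last lra.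
  lra.
Qed.

Lemma density_ratio_upper {R : realType} (a b e t W J m : R) : 0 < a -> 0 < e -> 0 < t ->
  (b / a + e / 2) * a * 2 / e <= t -> 2 * a * W <= J -> m <= 2 * b ->
  (t + a)^-1 * J <= m + a * e -> W / t <= b / a + e.
Proof.
move=> a0 e0 t0 tge WJ mb Jm.
have ta : 0 < t + a by rewrite addr_gt0.
rewrite ler_pdivrMr//; rewrite ler_pdivrMl// in Jm; rewrite ler_pdivrMr// in tge.
have h : 2 * a * W <= 2 * a * ((b / a + e / 2) * (t + a)).
  apply: le_trans WJ _; apply: le_trans Jm _.
  have -> : 2 * a * ((b / a + e / 2) * (t + a)) = (t + a) * (2 * b + a * e).
    by field; rewrite gt_eqF.
  by apply: ler_wpM2l; [exact: ltW|rewrite lerD2r].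
rewrite ler_pM2l ?mulr_gt0// in h.
by apply: le_trans h _; clear -tge; nra.
Qed.

Lemma density_ratio_lower {R : realType} (a b e t W J m : R) : 0 < a -> 0 < b -> 0 < e -> 0 < t - b ->
  2 * a / e <= t -> J <= 2 * b * W -> 2 * a <= m ->
  m - b * e <= (t - b)^-1 * J -> a / b - e <= W / t.
Proof.
move=> a0 b0 e0 tb tge WJ ma Jm.
have t0 : 0 < t by apply: lt_le_trans tb _; rewrite lerBlDr lerDl ltW.
rewrite ler_pdivlMr//; rewrite ler_pdivlMl// in Jm; rewrite ler_pdivrMr// in tge.
have h : 2 * b * ((a / b - e / 2) * (t - b)) <= 2 * b * W.
  apply: le_trans _ WJ; apply: le_trans _ Jm.
  have -> : 2 * b * ((a / b - e / 2) * (t - b)) = (t - b) * (2 * a - b * e).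
    by field; rewrite gt_eqF.
  by apply: ler_wpM2l; [exact: ltW|rewrite lerD2r].
rewrite ler_pM2l ?mulr_gt0// in h.
apply: le_trans h.
have -> : (a / b - e / 2) * (t - b) = a / b * t - a - e / 2 * t + e / 2 * b by field; rewrite gt_eqF.
have eb : 0 < e * b by rewrite mulr_gt0.
by clear -tge eb; lra.
Qed.

(** * From the vague limit to the marginal density *)

Section Density.
Context {R : realType} {d : nat} (dot : {dot 'cV[R]_d.+1 for idfun}).
Local Notation X := (PV R d).
Notation leb := (@lebesgue_measure R).
Variables (nu : probability X R) (rho : {measure set (X * R) -> \bar R}) (W : R -> R).
Hypotheses (density : nondecreasing_marginal_density rho W)
  (limit : vague_limit nu rho).

Lemma density_integral_bounds (p q : R) : p <= q ->
  (((q - p) * W p)%:E <= rho (box p q) <= ((q - p) * W q)%:E)%E.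
Proof.
move=> pq; have [W_homo W_int] := density.
rewrite /box W_int//.
have mW : mble W by exact: nondecreasing_measurable.
have lebE : leb `[p, q]%classic = (q - p)%:E.
  rewrite lebesgue_measure_itv/= lte_fin; case: ltP => // qp.
  by rewrite (@le_anti _ _ p q) ?subrr// pq.
have fin : (leb `[p, q]%classic < +oo)%E by rewrite lebE ltry.
have intc (c : R) : leb.-integrable `[p, q] (EFin \o cst c).
  apply: measurable_bounded_integrable => //.
  by exists `|c|; split; [exact: num_real|move=> y cy x _ /=; exact: ltW].
have intW : leb.-integrable `[p, q] (EFin \o W).
  apply: measurable_bounded_integrable => //; first exact: measurable_funTS.
  exists (`|W p| + `|W q|); split; first exact: num_real.
  move=> y cy x /=; rewrite in_itv/= => /andP[px xq].
  have h1 := W_homo _ _ px; have h2 := W_homo _ _ xq.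
  apply: le_trans (ltW cy); rewrite ler_norml; apply/andP; split.
    rewrite lerNl (@le_trans _ _ (- W p)) ?lerN2// (le_trans (ler_norm _))// normrN.
    by rewrite lerDl.
  by rewrite (le_trans h2)// (le_trans (ler_norm _))// lerDr.
have cstE (c : R) : (\int[leb]_(x in `[p, q]) (c%:E) = ((q - p) * c)%:E)%E.
  by rewrite integral_cst// -[X in (_ * X)%E]/(leb `[p, q]%classic) lebE -EFinM mulrC.
rewrite -!cstE; apply/andP; split; apply: le_integral => //; [exact: intc| |exact: intc|].
- by move=> x; rewrite mem_setE in_itv/= lee_fin => /andP[px _]; exact: W_homo.
- by move=> x; rewrite mem_setE in_itv/= lee_fin => /andP[_ xq]; exact: W_homo.
Qed.

Section Trapezoid.
Variables (a b : R).
Hypotheses (a0 : 0 < a) (ab : a < b).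

(* 1 on [-a, a], 0 outside [-b, b], affine in between. *)
Let psi (t : R) : R := (2 * (b - a))^-1 * ((`|t - b| + `|t + b|) - (`|t - a| + `|t + a|)).

Let psi_bounds t : 0 <= psi t <= 1.
Proof.
have [/andP[n0 n1] _ _] := trapezoid t a0 ab.
have c0 : 0 < 2 * (b - a) by rewrite mulr_gt0// subr_gt0.
by rewrite /psi mulr_ge0 ?invr_ge0 ?(ltW c0)//= ler_pdivrMl// mulr1.
Qed.

Let psi_in t : `|t| <= a -> psi t = 1.
Proof.
have c0 : 0 < 2 * (b - a) by rewrite mulr_gt0// subr_gt0.
by move=> ta; have [_ h _] := trapezoid t a0 ab; rewrite /psi h// mulVf// gt_eqF.
Qed.

Let psi_out t : b <= `|t| -> psi t = 0.
Proof.
by move=> bt; have [_ _ h] := trapezoid t a0 ab; rewrite /psi h// mulr0.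
Qed.

Let h (z : X * R) : R := psi z.2.

Let ch : continuous h.
Proof.
have c (e : R) : continuous (fun z : X * R => `|z.2 + e|).
  move=> z; apply: (@continuous_comp _ _ _ (fun z : X * R => z.2 + e) (fun t : R => `|t|)); last exact: norm_continuous.
  by apply: cvgD; [exact: cvg_snd|exact: cvg_cst].
move=> z; apply: cvgMr; apply: cvgB; apply: cvgD; exact: c.
Qed.

Let b0 : 0 < b. Proof. exact: lt_trans ab. Qed.

Let mh : mble h. Proof. exact: (mf_continuous_prod dot ch). Qed.

Let mpsi : mble psi.
Proof. exact: (mf_pair1 (f := h) point mh). Qed.

Let mass := \int[(nu \x leb)%E]_z h z.

Let mass_bounds : 2 * a <= mass <= 2 * b.
Proof.
have FK (x : X) t : 0 <= psi t <= 1 by exact: psi_bounds.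
have F_out (x : X) t : b <= `|t| -> psi t = 0 by exact: psi_out.
have E : mass = box_mean nu (fun=> psi) b0.
  exact: (Rintegral_box_mean nu (F := fun=> psi) mh FK F_out b0).
apply/andP; split.
  rewrite E -lee_fin -(integral_box_mean nu (F := fun=> psi) mh FK F_out b0).
  have -> : (2 * a)%:E = (\int[nu]_x (2 * a)%:E)%E.
    by rewrite -EFin_Rint ?Rint_cst//; exact: L1_cst.
  have -> : (\int[nu]_x \int[leb]_t (psi t)%:E)%E = (\int[leb]_t (psi t)%:E)%E.
    have pE : (\int[leb]_t (psi t)%:E)%E = (2 * b * \int[unif b0]_t psi t)%:E.
      apply: integral_unif_support => //.
      - by move=> t; have /andP[] := psi_bounds t.
      - by move=> t bt; rewrite psi_out// ltW.
      - by apply: (L1_bounded 1) => // t; exact: norm_bounds (psi_bounds t).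
    rewrite pE -EFin_Rint ?Rint_cst//; exact: L1_cst.
  rewrite -EFin_Rint ?Rint_cst//; last exact: L1_cst.
  have -> : (2 * a)%:E = (\int[leb]_(t in `[(- a)%R, a]) 1%:E)%E.
    rewrite integral_cst//= mul1e lebesgue_measure_itv/= lte_fin gtrN// -EFinB opprK.
    by rewrite mulrDl mul1r.
  rewrite integral_mkcond; apply: ge0_le_integral => //.
  - by move=> t _; rewrite patchE; case: ifP => // _; rewrite lee_fin.
  - by apply/(measurable_restrictT _ _).1.
  - exact/mf_EFin.
  - move=> t _; rewrite patchE mem_setE in_itv/= -ler_norml; case: ifP => [ta|_]; first by rewrite psi_in.
    by rewrite lee_fin; have /andP[] := psi_bounds t.
rewrite E /box_mean -[leRHS]mulr1 ler_wpM2l ?mulr_ge0 ?(ltW b0)//.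
apply: Rint_lec => [|x]; first exact: (L1_unif_mean nu (F := fun=> psi) mh FK b0).
apply: Rint_lec => [|t]; last by have /andP[] := psi_bounds t.
by apply: (L1_bounded 1) => // t; exact: norm_bounds (psi_bounds t).
Qed.

(** The trapezoid lies between the indicators of its plateau and of its base, and [W], being
    non-decreasing, is at least its value at the left end of the plateau and at most its value at
    the right end of the base. *)
Let sandwich T : 2 * a * W (T - a) <= \int[rho]_z h (z.1, z.2 - T) <= 2 * b * W (T + b).
Proof.
have mT : mble (fun z : X * R => h (z.1, z.2 - T)).
  exact: (mf_continuous_prod dot (continuous_level_shift (T := T) ch)).
have ge0 z : 0 <= h (z.1, z.2 - T) by have /andP[] := psi_bounds (z.2 - T).
have le1 z : h (z.1, z.2 - T) <= 1 by have /andP[] := psi_bounds (z.2 - T).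
have Ta : T - a <= T + a by rewrite lerD2l ge0_cp// ltW.
have Tb : T - b <= T + b by rewrite lerD2l ge0_cp// ltW.
have /andP[lo _] := density_integral_bounds Ta.
have /andP[_ hi] := density_integral_bounds Tb.
have in_box z : (\1_(box (T - a) (T + a)) z : R) <= h (z.1, z.2 - T).
  rewrite indicE; case: (boolP (z \in _)) => [|_]; last exact: ge0.
  by rewrite inE => -[_] /=; rewrite in_itv/= -ler_distl => /psi_in; rewrite /h/= => ->.
have out_box z : h (z.1, z.2 - T) <= (\1_(box (T - b) (T + b)) z : R).
  rewrite indicE; case: (boolP (z \in _)) => [_|]; first exact: le1.
  rewrite notin_setE => nb; rewrite /h psi_out//= leNgt; apply/negP => /ltW le; apply: nb.
  by split=> //=; rewrite in_itv/= -ler_distl.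
have mb := fun c => mf_box (T - c) (T + c) : measurable (box (T - c) (T + c) : set (X * R)).
have indE c : (\int[rho]_z (\1_(box (T - c) (T + c)) z)%:E = rho (box (T - c) (T + c)))%E.
  by rewrite integral_indic ?setIT.
have I1 : (rho (box (T - a) (T + a)) <= \int[rho]_z (h (z.1, z.2 - T))%:E)%E.
  rewrite -indE.
  by apply: ge0_le_integral => //; try (exact/mf_EFin); move=> z _; rewrite lee_fin.
have I2 : (\int[rho]_z (h (z.1, z.2 - T))%:E <= rho (box (T - b) (T + b)))%E.
  rewrite -indE.
  by apply: ge0_le_integral => //; try (exact/mf_EFin); move=> z _; rewrite lee_fin.
have fin : (\int[rho]_z (h (z.1, z.2 - T))%:E)%E \is a fin_num.
  rewrite ge0_fin_numE; last by apply: integral_ge0 => z _; rewrite lee_fin.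
  by apply: le_lt_trans I2 _; apply: le_lt_trans hi _; rewrite ltry.
rewrite -!lee_fin /Rintegral fineK//; apply/andP; split.
  by apply: le_trans _ I1; rewrite (_ : 2 * a = T + a - (T - a))//; ring.
by apply: le_trans I2 _; rewrite (_ : 2 * b = T + b - (T - b))//; ring.
Qed.

Lemma density_near e : 0 < e -> \forall t \near +oo, a / b - e <= W t / t <= b / a + e.
Proof.
move=> e0; have := @limit h ch (@box_compactly_supported _ _ h (- b) b _).
have cut z : ~ box (- b) b z -> h z = 0.
  move=> nb; rewrite /h psi_out// leNgt; apply/negP => /ltW le; apply: nb.
  by split=> //=; rewrite in_itv/= -ler_norml.
move=> /(_ cut) /cvgrPdist_le lim.
have ae : 0 < a * e by rewrite mulr_gt0.
have be : 0 < b * e by rewrite mulr_gt0.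
have [M1 [_ h1]] := lim _ ae; have [M2 [_ h2]] := lim _ be.
have /andP[m1 m2] := mass_bounds.
near=> t.
have t0 : 0 < t by near: t; apply: nbhs_pinfty_gt; exact: num_real.
have tb : 0 < t - b.
  by rewrite subr_gt0; near: t; apply: nbhs_pinfty_gt; exact: num_real.
have tM1 : M1 < t + a.
  by rewrite -ltrBlDr; near: t; apply: nbhs_pinfty_gt; exact: num_real.
have tM2 : M2 < t - b.
  by rewrite ltrBrDr; near: t; apply: nbhs_pinfty_gt; exact: num_real.
have k1 : (b / a + e / 2) * a * 2 / e <= t by near: t; apply: nbhs_pinfty_ge; exact: num_real.
have k2 : 2 * a / e <= t by near: t; apply: nbhs_pinfty_ge; exact: num_real.
(* The centers [t + a] and [t - b] make both bounds bear on [W t] itself. *)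
have /andP[s1 _] := sandwich (t + a); rewrite addrK in s1.
have /andP[_ s2] := sandwich (t - b); rewrite subrK in s2.
have := h1 _ tM1; rewrite distrC ler_distl => /andP[_ u1].
have := h2 _ tM2; rewrite distrC ler_distl => /andP[u2 _].
apply/andP; split.
  exact: (density_ratio_lower a0 b0 e0 tb k2 s2 m1 u2).
exact: (density_ratio_upper a0 e0 t0 k1 s1 m2 u1).
Unshelve. all: by end_near.
Qed.

End Trapezoid.

Lemma density_limit : (W t / t) @[t --> +oo] --> (1 : R).
Proof.
apply/cvgrPdist_le => e e0; have e2 : 0 < e / 2 by rewrite divr_gt0.
(* With [a = 1] and [b = 1 + e / 2], the ratios [a / b] and [b / a] are both within [e / 2] of 1. *)
have ab : 1 < 1 + e / 2 by rewrite ltrDl.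
apply: filterS (density_near ltr01 ab e2) => t /andP[lo hi].
have b0 : 0 < 1 + e / 2 by rewrite addr_gt0.
have inv : 1 - e / 2 <= 1 / (1 + e / 2).
  by rewrite ler_pdivlMr// mulrDr mulr1 mulrBl mul1r addrA subrK gerBl mulr_ge0// ltW.
rewrite distrC ler_distl; apply/andP; split.
  apply: le_trans lo; apply: le_trans (lerB inv (lexx (e / 2))).
  by rewrite -addrA -opprD -splitr.
by apply: le_trans hi _; rewrite divr1 -addrA -splitr.
Qed.

End Density.

Theorem corollary1p5 (R : realType) (d : nat)
    (dot : {dot 'cV[R]_d.+1 for idfun})
    (mu : probability (GL R d) R) (nu : probability (PV R d) R)
    (disp : measure_display) (Omega : measurableType disp)
    (P : probability Omega R) (g : nat -> {mfun Omega >-> GL R d})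
    (rho rhoc : {measure set (PV R d * R) -> \bar R}) (W Wc : R -> R)
    (g_iid : iid P g mu)
    (nu_stationary : unique_stationary mu nu)
    (rho_harmonic : is_target_harmonic_measure P g (sigma dot) rho)
    (rhoc_harmonic : is_target_harmonic_measure P g
       (fun a x => - sigma dot a x) rhoc)
    (W_density : nondecreasing_marginal_density rho W)
    (Wc_density : nondecreasing_marginal_density rhoc Wc)
    (Gamma_proximal : proximal (Gamma mu))
    (Gamma_irreducible : strongly_irreducible (Gamma mu))
    (mu_moment : finite_exponential_moment dot mu)
    (lambda_mu_eq0 : lyapunov_exponent P g dot 0) :
  (forall h : PV R d * R -> R, continuous h -> compactly_supported h ->
     ((t^-1 * \int[rho]_z h (z.1, z.2 - t)) @[t --> +oo] -->
        \int[(nu \x lebesgue_measure)%E]_z h z) /\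
     ((t^-1 * \int[rhoc]_z h (z.1, z.2 - t)) @[t --> +oo] -->
        \int[(nu \x lebesgue_measure)%E]_z h z)) /\
  ((W t / t) @[t --> +oo] --> (1 : R)) /\ ((Wc t / t) @[t --> +oo] --> (1 : R)).
Proof.
have [Q [Q_cyl Q_traj]] := path_law g_iid.
have [al al0 L1_exp] := exponential_moment mu_moment.
have L1_ell := exp_L1_ell al0 L1_exp.
have L1_ell4 := exp_L1_ell4 al0 L1_exp.
have tail := exp_tail_small al0 L1_exp.
have [Ct [q [Ct0 q0 q1 tails]]] := geometric_tail al0 L1_exp.
have tight := pr_tight Q_cyl Gamma_proximal Gamma_irreducible L1_ell.
have decay (e eta : R) : 0 < e -> e <= 2^-1 -> 0 < eta ->
    exists n0, forall n x, (n0 <= n)%N -> mean Q n (fun a => (eta < e2 dot a x)%R%:R) <= 4 * e.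
  move=> e0 e1 eta0; apply: (e2_decay Q_cyl tight) => // eta' eta'0.
  exact: (good2_uniform dot Q_cyl Gamma_proximal Gamma_irreducible).
have [D [Lam [r [c [/andP[r0 r1] [D01 mD] [D_contr D_Lam] [s_Lam [c0 sd_D]] [Lam0 [L1Lam L1ellLam]]]]]]] :=
  contraction_metric Q_cyl al0 L1_exp (EDl_negative Q_cyl L1_ell tight decay tail).
have nu_act := nu_stationary.1.
have centered := sigma_centered Q_cyl Q_traj nu_act L1_ell tail lambda_mu_eq0.
have D_ge0 x y : 0 <= D x y by have /andP[] := D01 x y.
have D_le1 x y : D x y <= 1 by have /andP[] := D01 x y.
(* The cocycle is left arbitrary because [rhoc] is obtained from [- sigma], and all the conditions
   listed here are stable under a change of sign. *)
have limit (s : GL R d -> PV R d -> R) (rho' : {measure set (PV R d * R) -> \bar R}) : mble2 s ->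
    (forall a b x, s (a * b)%g x = s a (GL_act b x) + s b x) -> (forall x, s 1%g x = 0) ->
    (forall a x, `|s a x| <= ell dot a) ->
    (forall a x y, `|s a x - s a y| <= Lam a * D x y) ->
    \int[prodP mu nu]_z s z.1 z.2 = 0 -> is_target_harmonic_measure P g s rho' ->
    vague_limit nu rho'.
  move=> ms sM s1 s_ell s_Lam' s0 rho_s.
  apply: (harmonic_limit Q_cyl Q_traj ms sM s1 c0 sd_D _ rho_s).
  exact: (killed_mass_asymptotic (mf_GL_act dot) ms nu_act mD D_ge0 D_le1 D_contr D_Lam r0 r1
    s_ell s_Lam' L1_ell L1Lam Lam0 s0 L1_ell4 L1ellLam Ct0 q0 q1 tails).
have lim := limit _ _ (mf_sigma dot) (sigmaM dot) (sigma1 dot) (sigma_ell dot) s_Lam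
  centered rho_harmonic.
have limc : vague_limit nu rhoc.
  apply: (limit _ _ _ _ _ _ _ _ rhoc_harmonic) => [|a b x|x|a x|a x y|].
  - by apply: mf_comp => //; exact: mf_sigma.
  - by rewrite sigmaM opprD.
  - by rewrite sigma1 oppr0.
  - by rewrite normrN; exact: sigma_ell.
  - by rewrite -opprD normrN; exact: s_Lam.
  - rewrite -[RHS]oppr0 -centered -mulN1r -RintZ.
      by apply: eq_Rint => z; rewrite mulN1r.
    apply: (L1_le (g := fun z => ell dot z.1)) => [||z]; last exact: sigma_ell.
    - exact: mf_sigma.
    - exact: L1_fst.
split; first by move=> h ch cs; split; [exact: lim|exact: limc].
by split; [exact: (density_limit dot W_density lim)|exact: (density_limit dot Wc_density limc)].
Qed.
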